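(* Suppose $m,n$ are positive integers, $m\leq n$, $U$ is an open subset of $\mathbf{R}^n$, $V$ is an $m$ dimensional rectifiable varifold in $U$, $\|\delta V\|$ is a Radon measure, $Y$ is a finite dimensional normed vectorspace, and $f\in\mathbf{T}(V,Y)$. Then the following four statements hold: (1) If $A=\{x:f(x)=0\}$, then $V\mathbf{D}f(x)=0$ for $\|V\|$ almost all $x\in A$. (2) If $Z$ is a finite dimensional normed vectorspace, $g:U\to Z$ is locally Lipschitzian, and $h(x)=(f(x),g(x))$ for $x\in\operatorname{dmn}f$, then $h\in\mathbf{T}(V,Y\times Z)$ and $$V\mathbf{D}h(x)(u)=(V\mathbf{D}f(x)(u),V\mathbf{D}g(x)(u))\quad\text{whenever }u\in\mathbf{R}^n$$ for $\|V\|$ almost all $x$. (3) If $g:U\to Y$ is locally Lipschitzian, then $f+g\in\mathbf{T}(V,Y)$ and $V\mathbf{D}(f+g)(x)=V\mathbf{D}f(x)+V\mathbf{D}g(x)$ for $\|V\|$ almost all $x$. (4) If $f\in\mathbf{L}_1^{\mathrm{loc}}(\|V\|,Y)$, $V\mathbf{D}f\in\mathbf{L}_1^{\mathrm{loc}}(\|V\|,\operatorname{Hom}(\mathbf{R}^n,Y))$, and $g:U\to\mathbf{R}$ is locally Lipschitzian, then $gf\in\mathbf{T}(V,Y)$ and $$V\mathbf{D}(gf)(x)=V\mathbf{D}g(x)\,f(x)+g(x)\,V\mathbf{D}f(x)\quad\text{for }\|V\|\text{ almost all }x.$$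
   Context: Measures are outer measures. $\mathbf{G}(n,m)$ is the set of $m$ dimensional subspaces of $\mathbf{R}^n$; $P_\natural$ is the orthogonal projection onto $P$; $\sigma\bullet\tau=\operatorname{trace}(\sigma^\ast\circ\tau)$. $\mathscr{D}(U,Y)$, $\mathscr{E}(U,Y)$: smooth functions $U\to Y$ with compact, respectively arbitrary, support. $\langle v,\alpha\rangle=\alpha(v)$. $\mathbf{L}_1^{\mathrm{loc}}$: integrable on compact subsets. $\operatorname{dmn}f$ is the domain of $f$. $V\mathbf{D}g(x)\,f(x)$ in (4) denotes the linear map $u\mapsto V\mathbf{D}g(x)(u)\,f(x)$. $Y\times Z$ carries any product norm. An $m$ dimensional varifold in $U$ is a Radon measure $V$ over $U\times\mathbf{G}(n,m)$; $\|V\|(A)=V(A\times\mathbf{G}(n,m))$; it is rectifiable if it is given by integration over a countably $(\mathscr{H}^m,m)$ rectifiable, $\mathscr{H}^m$ measurable set with its approximate tangent planes and a positive multiplicity function. $\delta V(\theta)=\int P_\natural\bullet D\theta(x)\,dV(x,P)$ for $\theta\in\mathscr{D}(U,\mathbf{R}^n)$. $\|\delta V\|$ is the largest Borel regular measure over $U$ with $\|\delta V\|(G)=\sup\{\delta V(\theta):\operatorname{spt}\theta\subset G,|\theta|\leq1\}$ for open $G$; if it is Radon, $\delta V$ also denotes its continuous extension to $\mathbf{L}_1(\|\delta V\|,\mathbf{R}^n)$. $\mathbf{T}(V,Y)$ is the set of $Y$ valued $\|V\|+\|\delta V\|$ measurable functions $f$ with domain in $U$ (defined almost everywhere) such that for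 some $\|V\|$ measurable $\operatorname{Hom}(\mathbf{R}^n,Y)$ valued $F$: (i) $\int_{K\cap\{x:|f(x)|\leq s\}}\|F\|\,d\|V\|<\infty$ for compact $K\subset U$, $0\leq s<\infty$; (ii) $(\delta V)((\gamma\circ f)\theta)=\int\gamma(f(x))P_\natural\bullet D\theta(x)\,dV(x,P)+\int\langle\theta(x),D\gamma(f(x))\circ F(x)\rangle\,d\|V\|x$ for $\theta\in\mathscr{D}(U,\mathbf{R}^n)$, $\gamma\in\mathscr{E}(Y,\mathbf{R})$ with $\operatorname{spt}D\gamma$ compact. $F$ is $\|V\|$ almost unique and denoted $V\mathbf{D}f$. Locally Lipschitzian functions $U\to Y$ belong to $\mathbf{T}(V,Y)$. *)

(* Defs.v *)
From HB Require Import structures.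
From mathcomp Require Import all_boot all_order all_algebra.
From mathcomp Require Import all_classical all_reals all_analysis.

Set Implicit Arguments.
Unset Strict Implicit.
Unset Printing Implicit Defensive.

Import Order.TTheory GRing.Theory Num.Theory.
Import numFieldNormedType.Exports.

Local Open Scope classical_set_scope.
Local Open Scope ring_scope.

(** Measures are outer measures, integrated on their Caratheodory sigma-algebra.
    A measure over a subset [S] of a space [T] is an outer measure on [T]
    vanishing on [~` S]; topological conditions refer to the topology of [S].
    Likewise a function on [U] is a function on the ambient space of which only
    the values on [U] matter.  The space R^n is ['rV[R]_n], whose library norm
    is the sup norm (same topology, same Lipschitzian functions); the Euclidean
    norm is [enorm].  Linear maps act on row vectors by right multiplication. *)

(** ** Euclidean space *)

Definition enorm (R : realType) (n : nat) (u : 'rV[R]_n) : R :=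
  Num.sqrt ((u *m u^T) 0 0).

(* trace (sigma^* o tau); with row vectors sigma^* o tau is tau *m sigma^T *)
Definition mxbullet (R : realType) (n : nat) (sigma tau : 'M[R]_n) : R :=
  \tr (tau *m sigma^T).

Definition ecball (R : realType) (n : nat) (a : 'rV[R]_n) (r : R) :
  set 'rV[R]_n := [set x | enorm (x - a) <= r].

(** ** Subspaces of R^n and the Grassmannian *)

Definition subsp (R : realType) (n : nat) : Type := {vspace 'rV[R]_n}.

Section subspaces.
Variables (R : realType) (n : nat).

Definition basis_mx (P : {vspace 'rV[R]_n}) : 'M[R]_(\dim P, n) :=
  \matrix_(i < \dim P) tnth (vbasis P) i.

(* projection onto P parallel to its orthogonal complement
   {u | u *m (basis_mx P)^T = 0} *)
Definition orthproj (P : subsp R n) : 'M[R]_n :=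
  proj_mx <<basis_mx P>>%MS (kermx (basis_mx P)^T).

HB.instance Definition _ := Choice.copy (subsp R n) {vspace 'rV[R]_n}.
HB.instance Definition _ :=
  Topological.copy (subsp R n) (initial_topology orthproj).
HB.instance Definition _ := isPointed.Build (subsp R n) 0%VS.

Definition Grass (m : nat) : set (subsp R n) := [set P | \dim P = m].

End subspaces.
Arguments Grass : clear implicits.

(** ** Outer measures *)

Section outer_measures.
Variables (R : realType) (T : pointedType).
Implicit Types mu nu : {outer_measure set T -> \bar R}.

Definition oint mu (D : set T) (f : T -> \bar R) : \bar R :=
  (\int[(mu : set (caratheodory_type mu) -> \bar R)]_(x in D) f x)%E.

Definition oRint mu (D : set T) (f : T -> R) : R :=
  fine (oint mu D (EFin \o f)).

Definition oae mu (P : T -> Prop) : Prop := mu [set x | ~ P x] = 0%E.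

(* measurability of [f] with domain [D], relative to the family [op] of open
   subsets of the codomain *)
Definition measurable_on mu (S : Type) (op : set (set S)) (D : set T)
  (f : T -> S) : Prop :=
  forall W, op W -> mu.-caratheodory (D `&` f @^-1` W).

Definition outer_add mu nu (A : set T) : \bar R := (mu A + nu A)%E.

Lemma outer_add0 mu nu : outer_add mu nu set0 = 0%E.
Proof. by rewrite /outer_add !outer_measure0 adde0. Qed.

Lemma outer_add_ge0 mu nu A : (0 <= outer_add mu nu A)%E.
Proof. by rewrite /outer_add adde_ge0 ?outer_measure_ge0. Qed.

Lemma le_outer_add mu nu : {homo outer_add mu nu : A B / A `<=` B >-> (A <= B)%E}.
Proof. by move=> A B AB; rewrite /outer_add leeD ?le_outer_measure. Qed.

Lemma outer_add_sigma_subadditive mu nu : sigma_subadditive (outer_add mu nu).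
Proof.
move=> F; rewrite /outer_add nneseriesD => [|i _ _|i _ _];
  rewrite ?outer_measure_ge0//.
by rewrite leeD ?outer_measure_sigma_subadditive.
Qed.

HB.instance Definition _ mu nu := isOuterMeasure.Build R T (outer_add mu nu)
  (outer_add0 mu nu) (outer_add_ge0 mu nu) (@le_outer_add mu nu)
  (@outer_add_sigma_subadditive mu nu).

End outer_measures.

Section measures_over.
Variables (R : realType) (T : topologicalType).
Implicit Types mu : {outer_measure set T -> \bar R}.

Definition rel_open (S : set T) : set (set T) := [set S `&` O | O in open].

Definition radon_over (S : set T) mu : Prop :=
  [/\ mu (~` S) = 0%E,
      forall O, rel_open S O -> mu.-caratheodory O,
      forall K, compact K -> K `<=` S -> (mu K < +oo)%E,
      forall O, rel_open S O ->
        mu O = ereal_sup [set mu K | K in [set K | compact K /\ K `<=` O]]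
    & forall A, A `<=` S ->
        mu A = ereal_inf [set mu O | O in [set O | rel_open S O /\ A `<=` O]] ].

Definition borel_regular_over (S : set T) mu : Prop :=
  [/\ mu (~` S) = 0%E,
      forall O, rel_open S O -> mu.-caratheodory O
    & forall A, A `<=` S ->
        exists B, [/\ <<s S, rel_open S >> B, A `<=` B & mu B = mu A] ].

End measures_over.

(* [op] and [N]: open sets and norm of the codomain *)
Definition L1loc_on (R : realType) (T : ptopologicalType) (U : set T)
  (mu : {outer_measure set T -> \bar R}) (S : Type) (op : set (set S)) (N : S -> R)
  (D : set T) (f : T -> S) : Prop :=
  [/\ mu (~` D) = 0%E, measurable_on mu op D f
    & forall K, compact K -> K `<=` U ->
        (oint mu (K `&` D) (fun x => (N (f x))%:E) < +oo)%E].

(** ** Hausdorff measure and rectifiability *)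

Section hausdorff.
Variable (R : realType).

(* the volume of the unit ball of R^m *)
Fixpoint ball_volume (m : nat) : R :=
  match m with
  | 0%N => 1
  | 1%N => 2
  | (k.+1 as l).+1 => 2 * pi / l.+1%:R * ball_volume k
  end.

Variables (n : nat).
Implicit Types (A S : set 'rV[R]_n) (m : nat) (d : R).

(* meaningful for bounded S only *)
Definition ediam S : R := sup [set enorm (p.1 - p.2) | p in S `*` S].

Definition hausdorff_weight m S : R :=
  if S == set0 then 0 else ball_volume m * (ediam S / 2) ^+ m.

Definition fine_cover d A : set (nat -> set 'rV[R]_n) :=
  [set C | A `<=` \bigcup_k C k /\
           forall k x y, C k x -> C k y -> enorm (x - y) <= d].

Definition hausdorff_size m d A : \bar R :=
  ereal_inf [set (\sum_(k <oo) (hausdorff_weight m (C k))%:E)%E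
            | C in fine_cover d A].

Definition hausdorff m A : \bar R :=
  ereal_sup [set hausdorff_size m d A | d in [set d : R | 0 < d]].

Lemma ball_volume_ge0 m : 0 <= ball_volume m.
Proof.
suff : 0 <= ball_volume m /\ 0 <= ball_volume m.+1 by case.
elim: m => [|m [IH0 IH1]]; split=> //=.
by rewrite mulr_ge0// mulr_ge0 ?invr_ge0// mulr_ge0 ?pi_ge0.
Qed.

Lemma ediam_ge0 S : 0 <= ediam S.
Proof.
rewrite /ediam; set E := (X in sup X).
have [[[x [p Sp px]] E1]|/sup_out ->//] := pselect (has_sup E).
apply: (@le_trans _ _ x); first by rewrite -px sqrtr_ge0.
by apply: ub_le_sup => //; exists p.
Qed.

Lemma hausdorff_weight_ge0 m S : 0 <= hausdorff_weight m S.
Proof.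
rewrite /hausdorff_weight; case: ifP => // _.
by rewrite mulr_ge0 ?ball_volume_ge0// exprn_ge0// divr_ge0 ?ediam_ge0.
Qed.

Let allT := g_sigma_algebraType [set: set 'rV[R]_n].

Let weight m d (S : set allT) : \bar R :=
  if `[< forall x y, S x -> S y -> enorm (x - y) <= d >]
  then (hausdorff_weight m S)%:E else +oo%E.

Let weight0 m d : weight m d set0 = 0%E.
Proof.
rewrite /weight /hausdorff_weight eqxx; case: asboolP => // -[] x y.
by rewrite /set0 /mkset.
Qed.

Let weight_ge0 m d S : (0 <= weight m d S)%E.
Proof.
by rewrite /weight; case: asboolP => // _; rewrite lee_fin hausdorff_weight_ge0.
Qed.

Let hausdorff_sizeE m d A : hausdorff_size m d A = mu_ext (weight m d) A.
Proof.
apply/eqP; rewrite eq_le; apply/andP; split.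
- apply: le_ereal_inf_tmp => _ [C [_ AC] <-].
  have [fC|/existsNP[k nk]] := pselect (forall k,
      forall x y, C k x -> C k y -> enorm (x - y) <= d).
    apply: ereal_inf_lbound; exists C; first by split.
    by apply: eq_eseriesr => k _; rewrite /weight (asboolT (fC k)).
  rewrite (@eseries_pinfty _ _ _ k) ?leey//.
    by move=> i _; rewrite gt_eqF// (lt_le_trans _ (weight_ge0 _ _ _))// ltNyr.
  by rewrite /weight (asboolF nk).
- apply: le_ereal_inf_tmp => _ [C [AC fC] <-]; apply: ereal_inf_lbound.
  exists C.
    by split=> // k; exact: sub_gen_smallest.
  by apply: eq_eseriesr => k _; rewrite /weight (asboolT (fC k)).
Qed.

Let hausdorff_size_ge0 m d A : (0 <= hausdorff_size m d A)%E.
Proof. by rewrite hausdorff_sizeE; apply: mu_ext_ge0; exact: weight_ge0. Qed.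

Lemma hausdorff0 m : hausdorff m set0 = 0%E.
Proof.
rewrite /hausdorff (_ : [set _ | _ in _] = [set 0%E]) ?ereal_sup1//.
have E d : hausdorff_size m d set0 = 0%E.
  rewrite hausdorff_sizeE; apply: (mu_ext0 (weight0 m d)).
  exact: weight_ge0.
apply/seteqP; split=> [_ [d _ <-]|_ ->]; first exact: E.
by exists 1 => //=.
Qed.

Lemma hausdorff_ge0 m A : (0 <= hausdorff m A)%E.
Proof.
apply: (le_trans (hausdorff_size_ge0 m 1 A)).
by apply: ereal_sup_ubound; exists 1 => //=.
Qed.

Lemma le_hausdorff m : {homo hausdorff m : A B / A `<=` B >-> (A <= B)%E}.
Proof.
move=> A B AB; apply: ge_ereal_sup => _ [d d0 <-].
apply: (@le_trans _ _ (hausdorff_size m d B)).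
  by rewrite !hausdorff_sizeE; exact: le_mu_ext.
by apply: ereal_sup_ubound; exists d.
Qed.

Lemma hausdorff_sigma_subadditive m : sigma_subadditive (hausdorff m).
Proof.
move=> F; apply: ge_ereal_sup => _ [d d0 <-].
apply: (@le_trans _ _ (\sum_(i <oo) hausdorff_size m d (F i))%E).
  under eq_eseriesr do rewrite hausdorff_sizeE.
  rewrite hausdorff_sizeE; apply: mu_ext_sigma_subadditive.
  exact: weight_ge0.
apply: lee_nneseries => k *; first exact: hausdorff_size_ge0.
by apply: ereal_sup_ubound; exists d.
Qed.

HB.instance Definition _ m := isOuterMeasure.Build R 'rV[R]_n (hausdorff m)
  (hausdorff0 m) (@hausdorff_ge0 m) (@le_hausdorff m)
  (@hausdorff_sigma_subadditive m).

(* up to a set of H^m measure zero, M is covered by countably many Lipschitzian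
   images of bounded subsets of R^m *)
Definition countably_rectifiable m (M : set 'rV[R]_n) : Prop :=
  exists (B : nat -> set 'rV[R]_m) (phi : nat -> 'rV[R]_m -> 'rV[R]_n),
    (forall i, bounded_set (B i) /\ [lipschitz (phi i) z | z in B i]) /\
    hausdorff m (M `\` \bigcup_i (phi i @` B i)) = 0%E.

Definition tangent_cone S (a : 'rV[R]_n) : set 'rV[R]_n :=
  [set v | forall e : R, 0 < e -> exists x (r : R),
     [/\ S x, 0 < r, enorm (x - a) < e & enorm (r *: (x - a) - v) < e]].

Definition has_density m (mu : set 'rV[R]_n -> \bar R) (a : 'rV[R]_n)
  (l : \bar R) : Prop :=
  (fun r : R => mu (ecball a r) * ((ball_volume m * r ^+ m)^-1)%:E)%E @ 0^'+ --> l.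

(* Tan^m(mu, a), the cone of (mu, m) approximate tangent vectors at a *)
Definition approx_tangent_cone m (mu : set 'rV[R]_n -> \bar R) (a : 'rV[R]_n) :
  set 'rV[R]_n :=
  [set v | forall S, has_density m (fun B => mu (B `&` ~` S)) a 0%E ->
     tangent_cone S a v].

End hausdorff.

(** ** Smooth functions *)

(* The domain has finite dimension in all uses, hence Df is continuously
   differentiable k times iff all the functions x |-> Df(x)(v) are. *)
Fixpoint class_C (R : realType) (V W : normedModType R) (k : nat)
  (f : V -> W) : Prop :=
  match k with
  | 0%N => continuous f
  | l.+1 => (forall x, differentiable f x) /\
            forall v, class_C l (fun x => 'd f x v)
  end.

Definition smooth (R : realType) (V W : normedModType R) (f : V -> W) : Prop :=
  forall k, class_C k f.

Definition supp (T : topologicalType) (Y : zmodType) (f : T -> Y) : set T :=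
  closure [set x | f x != 0].

(* D(U, R^n), its members being extended by zero *)
Definition test_field (R : realType) (n : nat) (U : set 'rV[R]_n) :
  set ('rV[R]_n -> 'rV[R]_n) :=
  [set theta | [/\ smooth theta, compact (supp theta) & supp theta `<=` U]].

(* the members of E(Y, R) whose derivative has compact support *)
Definition test_scalar (R : realType) (Y : normedModType R) : set (Y -> R^o) :=
  [set gamma | smooth gamma /\
     compact (closure [set y | exists v, 'd gamma y v != 0])].

Definition finite_dim (R : realType) (Y : normedModType R) : Prop :=
  exists (k : nat) (e : 'I_k -> Y),
    forall y, exists c : 'I_k -> R, y = \sum_(i < k) c i *: e i.

Definition locally_lipschitz (R : realType) (V W : normedModType R) (U : set V)
  (g : V -> W) : Prop :=
  forall x, U x -> exists2 A, nbhs x A & [lipschitz g z | z in A].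

(** ** Hom(R^n, Y) *)

Section Hom.
Variables (R : realType) (n : nat) (Y : normedModType R).

Definition HomRn : Type := {linear 'rV[R]_n -> Y}.

(* operator norm, for linear maps between spaces of finite dimension *)
Definition opnorm (A : 'rV[R]_n -> Y) : R :=
  sup [set `|A u| | u in [set u | enorm u <= 1]].

Definition Hom_open : set (set HomRn) :=
  [set W | forall A : HomRn, W A -> exists2 e : R, 0 < e &
     forall B : HomRn, opnorm (fun u => B u - A u) < e -> W B].

End Hom.

(** ** Varifolds *)

Section varifolds.
Variables (R : realType) (n : nat).
Implicit Types (m : nat) (U : set 'rV[R]_n)
  (V : {outer_measure set ('rV[R]_n * subsp R n) -> \bar R}).

Definition varifold m U V : Prop := radon_over (U `*` Grass R n m) V.

Definition weight_measure m V (A : set 'rV[R]_n) : \bar R :=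
  V (A `*` Grass R n m).

Lemma weight_measure0 m V : weight_measure m V set0 = 0%E.
Proof. by rewrite /weight_measure set0X outer_measure0. Qed.

Lemma weight_measure_ge0 m V A : (0 <= weight_measure m V A)%E.
Proof. exact: outer_measure_ge0. Qed.

Lemma le_weight_measure m V :
  {homo weight_measure m V : A B / A `<=` B >-> (A <= B)%E}.
Proof. by move=> A B AB; apply: le_outer_measure => -[x P] [/AB]. Qed.

Lemma weight_measure_sigma_subadditive m V :
  sigma_subadditive (weight_measure m V).
Proof.
move=> F; rewrite /weight_measure.
apply: le_trans (outer_measure_sigma_subadditive V _).
by apply: le_outer_measure => -[x P] [[k _ Fx] GP]; exists k.
Qed.

HB.instance Definition _ m V := isOuterMeasure.Build R 'rV[R]_n
  (weight_measure m V) (weight_measure0 m V) (weight_measure_ge0 m V)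
  (@le_weight_measure m V) (@weight_measure_sigma_subadditive m V).

(* V is integration over M with multiplicity [mult] and tangent planes [tau].
   The weight ||V|| is the product of [mult] and H^m restricted to M; its
   approximate tangent cones are used because H^m restricted to M itself need
   not be locally finite, so that its cones could fail to be m dimensional. *)
Definition rectifiable_varifold m U V : Prop :=
  varifold m U V /\
  exists (M : set 'rV[R]_n) (mult : 'rV[R]_n -> R) (tau : 'rV[R]_n -> subsp R n),
    [/\ M `<=` U,
        (hausdorff m).-caratheodory M /\ countably_rectifiable m M,
        measurable_on (hausdorff m) open M mult /\
          forall x, M x -> 0 < mult x,
        oae (hausdorff m) (fun x => M x -> Grass R n m (tau x) /\
          approx_tangent_cone m (weight_measure m V) x =
            [set v : 'rV[R]_n | v \in (tau x : {vspace 'rV[R]_n})])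
      & forall k : 'rV[R]_n * subsp R n -> R,
          continuous k -> compact (supp k) ->
          supp k `<=` U `*` Grass R n m ->
          oint V setT (fun z => (k z)%:E) =
          oint (hausdorff m) M (fun x => (k (x, tau x) * mult x)%:E) ].

(* P_\natural \bullet D theta (x) *)
Definition divergence (theta : 'rV[R]_n -> 'rV[R]_n)
  (z : 'rV[R]_n * subsp R n) : R :=
  mxbullet (orthproj z.2) ('J theta z.1).

Definition first_variation V (theta : 'rV[R]_n -> 'rV[R]_n) : R :=
  oRint V setT (divergence theta).

Definition matches_variation U V (nu : {outer_measure set 'rV[R]_n -> \bar R}) :
  Prop :=
  borel_regular_over U nu /\
  forall G, rel_open U G ->
    nu G = ereal_sup [set (first_variation V theta)%:E | theta in
      [set theta | [/\ test_field U theta, supp theta `<=` G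
                     & forall x, enorm (theta x) <= 1]]].

(* dV is ||delta V|| *)
Definition is_variation_measure U V
  (dV : {outer_measure set 'rV[R]_n -> \bar R}) : Prop :=
  matches_variation U V dV /\
  forall nu : {outer_measure set 'rV[R]_n -> \bar R},
    matches_variation U V nu -> forall A, (nu A <= dV A)%E.

(* value at w of the continuous extension of delta V to L_1(dV, R^n), in which
   D(U, R^n) is dense when dV = ||delta V|| is a Radon measure *)
Definition first_variation_ext U V
  (dV : {outer_measure set 'rV[R]_n -> \bar R}) (w : 'rV[R]_n -> 'rV[R]_n) : R :=
  get [set c : R | exists theta : nat -> 'rV[R]_n -> 'rV[R]_n,
    [/\ forall k, test_field U (theta k),
        (fun k => oint dV setT (fun x => (enorm (theta k x - w x))%:E))
          @ \oo --> 0%E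
      & (fun k => first_variation V (theta k)) @ \oo --> c]].

End varifolds.

(** ** Generalised weakly differentiable functions *)

(* partial functions; the values of [pfun f] outside [dmn f] are irrelevant *)
Record partial_map (X Y : Type) := PartialMap { dmn : set X ; pfun :> X -> Y }.

Section weakly_differentiable.
Variables (R : realType) (n m : nat) (U : set 'rV[R]_n).
Variable V : {outer_measure set ('rV[R]_n * subsp R n) -> \bar R}.
Variable dV : {outer_measure set 'rV[R]_n -> \bar R}.
Variable Y : normedModType R.
Implicit Types (f : partial_map 'rV[R]_n Y) (F : 'rV[R]_n -> HomRn n Y).

Let wV : {outer_measure set 'rV[R]_n -> \bar R} := weight_measure m V.
Let wVdV : {outer_measure set 'rV[R]_n -> \bar R} := outer_add wV dV.

(* dV stands for ||delta V||.  Since F is defined ||V|| almost everywhere, it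
   may be assumed to be defined everywhere. *)
Definition is_weak_derivative f F : Prop :=
  [/\ [/\ dmn f `<=` U, wVdV (~` dmn f) = 0%E
        & measurable_on wVdV open (dmn f) f],
      measurable_on wV (@Hom_open R n Y) setT F,
      forall K (s : R), compact K -> K `<=` U -> 0 <= s ->
        (oint wV (K `&` [set x | dmn f x /\ (`|f x| <= s)%R])
                 (fun x => (opnorm (F x))%:E) < +oo)%E
    & forall theta gamma, test_field U theta -> @test_scalar R Y gamma ->
        first_variation_ext U V dV (fun x => gamma (f x) *: theta x) =
        oRint V (dmn f `*` setT) (fun z => gamma (f z.1) * divergence theta z) +
        oRint wV (dmn f) (fun x => 'd gamma (f x) (F x (theta x))) ].

(* T(V, Y) *)
Definition weakly_diff : set (partial_map 'rV[R]_n Y) :=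
  [set f | exists F, is_weak_derivative f F].

(* V D f, a representative of its ||V|| almost everywhere class *)
Definition VD f : 'rV[R]_n -> HomRn n Y := get (is_weak_derivative f).

End weakly_differentiable.

(* Main.v *)
Require Import Defs.
From HB Require Import structures.
From mathcomp Require Import all_boot all_order all_algebra.
From mathcomp Require Import all_classical all_reals all_analysis.
From mathcomp Require Import measurable_realfun ring lra.

Set Implicit Arguments.
Unset Strict Implicit.
Unset Printing Implicit Defensive.

Import Order.TTheory GRing.Theory Num.Theory.
Import numFieldNormedType.Exports.

Local Open Scope classical_set_scope.
Local Open Scope ring_scope.

(* By Radon-Nikodym, [delta V] has components with locally bounded densities
   [eta k] with respect to [||delta V||], so membership of [f] in T(V, Y) becomes,
   for each coordinate direction [k], an integral identity for the functions
   [gamma o f] tested with scalar functions.  It holds for smooth functions by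
   the product rule.  A locally Lipschitzian [g] is a locally uniform limit of
   smooth functions with bounded gradients (iterated Bernstein polynomials on a
   cube); hence the defect of the identity for [g] is bounded by [||V||], and its
   Radon-Nikodym density is the derivative of [g].  The same approximation gives
   the product rule of a bounded weakly differentiable and a Lipschitzian
   function.  Approximating a smooth [Phi (y, t)] by its Bernstein polynomials
   in [t] then yields the chain rule for [Phi (f, g)], with [g] Lipschitzian,
   hence (2), (3) and, after truncation of [f], (4).  For (1), the functions
   [e q (f / e)] with [q] a truncated coordinate tend to [0] as [e] tends to
   [0], whereas their derivatives tend to that of [q o f] on the zero set of
   [f] and to [0] elsewhere. *)

(** * Smooth functions *)

(** Membership of [f] in T(V, Y) speaks only of [gamma o f] with [D gamma] of compact support;
    neither [f] nor its coordinates need be integrable. Every operation on [f] is therefore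
    expressed through functions [Phi (f, g)] whose slices [Phi (., t)] are again such [gamma]; for a
    polynomial in [t] with slices as coefficients, sums and the product rule suffice. In the product
    rule the smooth approximations of [g] converge uniformly, but of their gradients only a bound
    survives. So the bounded factor is replaced by a smooth one close to it in L_1 of the weight,
    for which the identity defining the derivative of [g] applies; the gradient bound controls the
    replacement. In (4), the differential of [y |-> gamma (t y)] reaches arbitrarily far out as [t]
    tends to 0, whence the truncation; local integrability of [f] and of its derivative dominates
    its removal. The extension of [delta V] to L_1 is a limit along unspecified sequences; the
    densities [eta k] turn it into an integral. *)

Section smooth_calculus.
Variable R : realType.

Lemma bilin_scale (W : normedModType R) :
  bilinear_for (GRing.Scale.Law.clone _ _ *:%R _)
    (GRing.Scale.Law.clone _ _ *:%R _) (@GRing.scale R W : R^o -> W -> W).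
Proof.
split=> [u'|u] a x y /=.
- by rewrite scalerDl scalerA.
- by rewrite scalerDr !scalerA mulrC.
Qed.

HB.instance Definition _ (W : normedModType R) :=
  bilinear_isBilinear.Build R R^o W W _ _ (@GRing.scale R W : R^o -> W -> W)
  (@bilin_scale W).

Lemma scale_pair_continuous (W : normedModType R) :
  continuous (fun p : R^o * W => (p.1 : R) *: p.2).
Proof. exact: scale_continuous. Qed.

Lemma is_diff_scale (V W : normedModType R) (a da : V -> R^o) (f df : V -> W) x :
  is_diff x a da -> is_diff x f df ->
  is_diff x (fun y => (a y : R) *: f y)
    (fun v => (a x : R) *: df v + (da v : R) *: f x).
Proof.
move=> dax dfx.
have H : is_diff (a x, f x) (fun p : R^o * W => (p.1 : R) *: p.2)
   (fun q => (a x : R) *: q.2 + (q.1 : R) *: f x).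
  apply: DiffDef.
    exact: (@differentiable_bilin R R^o W W (@GRing.scale R W)
      (a x, f x) (@scale_pair_continuous W)).
  exact: (@diff_bilin R R^o W W (@GRing.scale R W)
    (a x, f x) (@scale_pair_continuous W)).
have -> : (fun y => (a y : R) *: f y) =
  (fun p : R^o * W => (p.1 : R) *: p.2) \o (fun y => (a y, f y)) by [].
by apply: is_diff_eq.
Qed.

Lemma is_diff_lin (V W : normedModType R) (L : {linear V -> W}) x :
  continuous L -> is_diff x L L.
Proof.
by move=> cL; apply: DiffDef; [exact: linear_differentiable|exact: diff_lin].
Qed.

Lemma is_diff_val (V W : normedModType R) (f df : V -> W) x :
  is_diff x f df -> forall v, 'd f x v = df v.
Proof. by move=> H v; rewrite diff_val. Qed.

Section maps.
Variables V W : normedModType R.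

Lemma eq_class_C k (f g : V -> W) : f =1 g -> class_C k f -> class_C k g.
Proof. by move=> /funext ->. Qed.

Lemma class_C_continuous k (f : V -> W) : class_C k f -> continuous f.
Proof.
case: k => // k [df _] x.
exact: differentiable_continuous.
Qed.

Lemma class_CW k (f : V -> W) : class_C k.+1 f -> class_C k f.
Proof.
elim: k f => [|k IH] f; first exact: class_C_continuous.
by case=> df H; split=> // v; apply: IH.
Qed.

(** With an explicit candidate [df], smoothness proofs become inductions on [k] in which the
    directional derivatives are combinations of maps already treated. *)
Lemma class_CS k (f : V -> W) (df : V -> V -> W) :
  (forall x, is_diff x f (df x)) -> (forall v, class_C k (df ^~ v)) ->
  class_C k.+1 f.
Proof.
move=> H1 H2; split=> [x|v]; first by have [] := H1 x.
by apply: eq_class_C (H2 v) => x; rewrite (is_diff_val (H1 x)).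
Qed.

Lemma class_C_cst k (c : W) : class_C k (fun _ : V => c).
Proof.
elim: k c => [|k IH] c; first exact: cst_continuous.
by apply: (@class_CS k _ (fun _ _ => 0)).
Qed.

Lemma class_C_lin k (L : {linear V -> W}) : continuous L -> class_C k L.
Proof.
move=> cL; case: k => // k.
apply: (@class_CS k _ (fun _ => L)) => [x|v]; first exact: is_diff_lin.
exact: class_C_cst.
Qed.

Lemma class_CD k (f g : V -> W) :
  class_C k f -> class_C k g -> class_C k (fun x => f x + g x).
Proof.
elim: k f g => [|k IH] f g.
  by move=> cf cg x; apply: continuousD; [exact: cf|exact: cg].
move=> [df Hf] [dg Hg].
apply: (@class_CS k _ (fun x v => 'd f x v + 'd g x v)) => [x|v].
  have H1 := differentiableP (df x); have H2 := differentiableP (dg x).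
  by apply: is_diff_eq.
exact: (IH (fun x => 'd f x v) (fun x => 'd g x v) (Hf v) (Hg v)).
Qed.

End maps.

Section scaled_maps.
Variables V W : normedModType R.

Lemma class_CZ k (a : V -> R^o) (f : V -> W) :
  class_C k a -> class_C k f -> class_C k (fun x => (a x : R) *: f x).
Proof.
elim: k a f => [|k IH] a f.
  move=> ca cf x; apply: (@cvgZ _ _ _ _ (nbhs_filter x) a f (a x) (f x)).
    exact: ca.
  exact: cf.
move=> Ha Hf; have [da Ha'] := Ha; have [df Hf'] := Hf.
apply: (@class_CS _ _ k _ (fun x v => (a x : R) *: 'd f x v + ('d a x v : R) *: f x)).
  by move=> x; apply: is_diff_scale; exact/differentiableP.
move=> v; apply: class_CD.
  exact: (IH a (fun x => 'd f x v) (class_CW Ha) (Hf' v)).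
exact: (IH (fun x => 'd a x v) f (Ha' v) (class_CW Hf)).
Qed.

Lemma class_CN k (f : V -> W) : class_C k f -> class_C k (fun x => - f x).
Proof.
move=> Hf; apply: (@eq_class_C _ _ k (fun x => (-1 : R) *: f x)).
  by move=> x; rewrite scaleN1r.
by apply: class_CZ => //; exact: class_C_cst.
Qed.

Lemma class_CB k (f g : V -> W) :
  class_C k f -> class_C k g -> class_C k (fun x => f x - g x).
Proof. by move=> Hf Hg; apply: class_CD => //; exact: class_CN. Qed.

Lemma class_C_sum k (I : Type) (r : seq I) (F : I -> V -> W) :
  (forall i, class_C k (F i)) -> class_C k (fun x => \sum_(i <- r) F i x).
Proof.
move=> HF; elim: r => [|i r IH].
  by apply: eq_class_C (@class_C_cst V W k 0) => x; rewrite big_nil.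
apply: (@eq_class_C _ _ k (fun x => F i x + \sum_(i <- r) F i x)).
  by move=> x; rewrite big_cons.
exact: class_CD.
Qed.

Lemma class_C_comp_affine (V' : normedModType R) k (L : {linear V' -> V}) (b : V)
  (f : V -> W) : continuous L -> class_C k f -> class_C k (fun x => f (L x + b)).
Proof.
move=> cL; elim: k f => [|k IH] f.
  move=> cf x; apply: (@continuous_comp _ _ _ (fun x => L x + b) f).
    by apply: continuousD; [exact: cL|exact: cst_continuous].
  exact: cf.
move=> [df Hf].
apply: (@class_CS _ _ k _ (fun x v => 'd f (L x + b) (L v))) => [x|v]; last
  exact: (IH (fun y => 'd f y (L v)) (Hf (L v))).
have dL := is_diff_lin x cL.
have H : is_diff x (fun x => L x + b) L.
  have -> : (fun x => L x + b) = (L : V' -> V) + cst b by [].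
  apply: is_diff_eq; by rewrite addr0.
have dfx := differentiableP (df (L x + b)).
have -> : (fun x => f (L x + b)) = f \o (fun x => L x + b) by [].
by apply: is_diff_eq.
Qed.

End scaled_maps.

Lemma class_CM (V : normedModType R) k (f g : V -> R^o) :
  class_C k f -> class_C k g -> class_C k (fun x => (f x : R) * g x : R^o).
Proof. by move=> Hf Hg; exact: (@class_CZ V R^o k f g). Qed.

Lemma class_C_prod (V : normedModType R) k (I : Type) (r : seq I)
  (F : I -> V -> R^o) :
  (forall i, class_C k (F i)) -> class_C k (fun x => \prod_(i <- r) F i x : R^o).
Proof.
move=> HF; elim: r => [|i r IH].
  by apply: eq_class_C (@class_C_cst V R^o k 1) => x; rewrite big_nil.
apply: (@eq_class_C _ _ k (fun x => (F i x : R) * \prod_(i <- r) F i x : R^o)).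
  by move=> x; rewrite big_cons.
exact: class_CM.
Qed.

Lemma is_diff_inv (V : normedModType R) (f df : V -> R^o) x :
  f x != 0 -> is_diff x f df ->
  is_diff x (fun y => (f y : R)^-1 : R^o) (fun v => - ((f x)^-1 ^+ 2 * df v)).
Proof.
move=> fx0 dfx; have dx : differentiable f x by case: dfx.
apply: DiffDef; first exact: (differentiableV dx fx0).
rewrite (diffV dx fx0) diff_val; apply/funext => v /=.
by rewrite /GRing.scale /= mulNr exprVn.
Qed.

Lemma class_CV (V : normedModType R) k (f : V -> R^o) :
  (forall x, f x != 0) -> class_C k f -> class_C k (fun x => (f x : R)^-1 : R^o).
Proof.
move=> f0; elim: k => [|k IH] Hf.
  by move=> x; apply: (@cvgV R _ (nbhs x) _ f (f x)) => //; exact: Hf.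
have [df Hf'] := Hf.
apply: (@class_CS _ _ k _ (fun x v => - ((f x)^-1 ^+ 2 * 'd f x v))).
  by move=> x; apply: is_diff_inv => //; exact/differentiableP.
have Hi := IH (class_CW Hf).
move=> v; apply: class_CN.
apply: (@class_CM _ k (fun x => (f x)^-1 ^+ 2) (fun x => 'd f x v)).
  exact: (@class_CM _ k (fun x => (f x)^-1) (fun x => (f x)^-1)).
exact: Hf'.
Qed.

Lemma smooth_class_CS (V W : normedModType R) (f : V -> W) :
  smooth f <-> (forall x, differentiable f x) /\ forall v, smooth (fun x => 'd f x v).
Proof.
split=> [Hf|[H1 H2] [|k]].
- split=> [x|v k]; first by have [+ _] := Hf 1%N; apply.
  by have [_] := Hf k.+1; apply.
- by move=> x; exact: differentiable_continuous (H1 x).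
- by split=> // v; exact: H2.
Qed.

Lemma smooth_differentiable (V W : normedModType R) (f : V -> W) x :
  smooth f -> differentiable f x.
Proof. by move=> /smooth_class_CS[]. Qed.

Lemma smooth_continuous (V W : normedModType R) (f : V -> W) :
  smooth f -> continuous f.
Proof. by move=> /(_ 0%N). Qed.

Lemma smooth_diff (V W : normedModType R) (f : V -> W) v :
  smooth f -> smooth (fun x => 'd f x v).
Proof. by move=> /smooth_class_CS[]. Qed.

Lemma diff_near_cst (V W : normedModType R) (f : V -> W) x (c : W) :
  differentiable f x -> (\forall y \near x, f y = c) -> forall v, 'd f x v = 0.
Proof.
by move=> df Hc v; rewrite -deriveE// (near_eq_derive v Hc) derive_cst.
Qed.

(** The outer function has one real variable, so the derivative factors as ['d q x v] times
    ['d f (q x) 1], and the induction closes with [class_CZ]. *)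
Lemma class_C_comp_real (V W : normedModType R) k (f : R^o -> W) (q : V -> R^o) :
  class_C k f -> class_C k q -> class_C k (fun x => f (q x)).
Proof.
elim: k f q => [|k IH] f q.
  by move=> cf cq x; apply: (@continuous_comp _ _ _ q f); [exact: cq|exact: cf].
move=> Hf Hq; have [df Hf'] := Hf; have [dq Hq'] := Hq.
apply: (@class_CS _ _ k _ (fun x v => ('d q x v : R) *: 'd f (q x) (1 : R^o))).
  move=> x.
  have H1 := differentiableP (df (q x)); have H2 := differentiableP (dq x).
  have -> : (fun x => f (q x)) = f \o q by [].
  apply: is_diff_eq; apply/funext => v /=.
  by rewrite -linearZ /GRing.scale /= mulr1.
move=> v; apply: (@class_CZ _ _ k (fun x => 'd q x v)
  (fun x => 'd f (q x) (1 : R^o))); first exact: Hq'.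
exact: (IH (fun y => 'd f y (1 : R^o)) q (Hf' 1) (class_CW Hq)).
Qed.

Lemma is_derive_is_diff (f : R^o -> R^o) (x : R) (l : R) :
  is_derive x 1 (f : R -> R) l -> is_diff (x : R^o) f (fun v => (v : R) * l : R^o).
Proof.
move=> [dv dE]; have df : differentiable f x by apply/derivable1_diffP.
apply: DiffDef => //; apply/funext => v.
rewrite -[v in LHS]mulr1 -[v * 1]/(v *: (1 : R^o)) linearZ /=.
by rewrite -deriveE// dE.
Qed.

Lemma class_C_derive k (f df : R^o -> R^o) :
  (forall x : R, is_derive x 1 (f : R -> R) (df x)) -> class_C k df ->
  class_C k.+1 f.
Proof.
move=> H1 H2.
pose d := (fun (x v : R^o) => (v : R) * df x : R^o).
have H3 x : is_diff (x : R^o) f (d x) by exact: is_derive_is_diff (H1 x).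
have H4 v : class_C k (d ^~ v).
  exact: (@class_CM R^o k (fun=> v) df (@class_C_cst R^o R^o k v) H2).
exact: (@class_CS R^o R^o k f d H3 H4).
Qed.

End smooth_calculus.

(** * Smooth cut-off functions on the line *)

Section cutoff.
Variable R : realType.

(** The function t^(-k) exp(-1/t), extended by zero. The powers are kept because the family is
    closed under differentiation: the derivative of flat_k is - k flat_(k+1) + flat_(k+2). *)
Definition flat (k : nat) (t : R) : R :=
  if 0 < t then t^-1 ^+ k * expR (- t^-1) else 0.

Lemma flat_ge0 k t : 0 <= flat k t.
Proof.
by rewrite /flat; case: ifP => // t0; rewrite mulr_ge0 ?expR_ge0 ?exprn_ge0 ?invr_ge0 ?ltW.
Qed.

Lemma flat_gt0 k t : 0 < t -> 0 < flat k t.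
Proof.
by move=> t0; rewrite /flat t0 mulr_gt0 ?expR_gt0// exprn_gt0// invr_gt0.
Qed.

Lemma flat_eq0 k t : t <= 0 -> flat k t = 0.
Proof. by rewrite /flat leNgt => /negbTE ->. Qed.

(** The exponential series gives exp(1/t) >= t^-(k+2) / (k+2)!. The quadratic bound makes the
    difference quotients at 0 tend to 0. *)
Lemma flat_le k t : flat k t <= (k.+2)`!%:R * t ^+ 2.
Proof.
have [t0|t0] := ltP 0 t; last first.
  by rewrite flat_eq0// mulr_ge0// sqr_ge0.
rewrite /flat t0.
have ti0 : 0 < t^-1 by rewrite invr_gt0.
have H : t^-1 ^+ k.+2 / k.+2`!%:R <= expR t^-1.
  by apply: le_trans (expR_ge1Dxn k.+1 (ltW ti0)); rewrite lerDr.
have f0 : 0 < (k.+2)`!%:R :> R by rewrite ltr0n fact_gt0.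
rewrite expRN ler_pdivrMr ?expR_gt0//.
rewrite ler_pdivrMr// in H.
apply: (@le_trans _ _ (t ^+ 2 * t^-1 ^+ k.+2)).
  by rewrite -[k.+2]addn2 exprD mulrCA -exprMn divff ?gt_eqF// expr1n mulr1.
apply: (le_trans (ler_wpM2l (sqr_ge0 t) H)).
by rewrite [leRHS]mulrAC [leLHS]mulrC [expR _ * _]mulrC.
Qed.

Lemma is_derive_flat k (t : R) :
  is_derive t 1 (flat k : R -> R) (- k%:R * flat k.+1 t + flat k.+2 t).
Proof.
have [t0|t0|<-] := ltgtP 0 t.
- have Ht : \forall y \near t, y^-1 ^+ k * expR (- y^-1) = flat k y.
    near=> y; rewrite /flat ifT//; near: y; exact: lt_nbhsr.
  apply: (near_eq_is_derive Ht).
  have tn0 : t != 0 by rewrite gt_eqF.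
  have -> : (fun y : R => y^-1 ^+ k * expR (- y^-1)) =
    ((fun y => y^-1) ^+ k) * (expR \o (- (fun y : R => y^-1))).
    by apply/funext => y /=; rewrite !fctE.
  have H1 : is_derive t 1 (fun y : R => y^-1) (- t ^- 2).
    have := @is_deriveV R id t 1 1 tn0 (is_derive_id t 1).
    by rewrite /GRing.scale/= mulr1.
  have H2 : is_derive t 1 (- (fun y : R => y^-1)) (t ^- 2).
    by apply: is_derive_eq; rewrite opprK.
  have H3 := @is_derive1_comp R expR (- (fun y : R => y^-1)) t _ _
    (is_derive_expR _) H2.
  apply: is_derive_eq.
  rewrite /flat t0 !fctE /GRing.scale/=.
  rewrite -[t ^- 2]exprVn !exprS expr0.
  case: k {Ht} => [|k]; first by rewrite !mulr0n !expr0; ring.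
  by rewrite /= -mulr_natl !exprS; ring.
- have Ht : \forall y \near t, cst 0 y = flat k y.
    near=> y; rewrite flat_eq0//; near: y.
    exact: lt_le_nbhsl.
  apply: (near_eq_is_derive Ht).
  by rewrite !flat_eq0 ?ltW// mulr0 addr0; exact: is_derive_cst.
- rewrite !(flat_eq0 _ (lexx 0)) mulr0 addr0.
  have H : (fun h : R => h^-1 *: ((flat k \o shift 0) (h *: (1 : R^o)) - flat k 0))
     @ 0^' --> (0 : R^o).
    apply/cvgrPdist_le => e e0.
    near=> h.
    rewrite sub0r normrN /= (flat_eq0 _ (lexx 0)) subr0 addr0.
    rewrite /GRing.scale /= mulr1 normrM normfV.
    have h0 : 0 < `|h| by rewrite normr_gt0; near: h; exact: nbhs_dnbhs_neq.
    rewrite mulrC ler_pdivrMr// (ger0_norm (flat_ge0 _ _)).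
    apply: (le_trans (flat_le k h)).
    rewrite -[h ^+ 2]real_normK ?num_real// expr2 mulrA ler_pM2r//.
    rewrite mulrC -ler_pdivlMr ?ltr0n ?fact_gt0//.
    near: h; apply: dnbhs0_le.
    by rewrite divr_gt0// ltr0n fact_gt0.
  apply: DeriveDef; first by apply/cvg_ex; exists (0 : R^o).
  exact/cvg_lim.
Unshelve. all: by end_near. Qed.

Lemma smooth_flat j : smooth (flat j : R^o -> R^o).
Proof.
move=> k; elim: k j => [|k IH] j.
  move=> x; apply: differentiable_continuous.
  by case: (is_derive_is_diff (is_derive_flat j x)).
apply: (class_C_derive (@is_derive_flat j)).
apply: class_CD; last exact: IH.
exact: (@class_CM R R^o k (fun=> - j%:R) (flat j.+1)
  (@class_C_cst R R^o R^o k _) (IH _)).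
Qed.

(** Equal to 1 on [-1, 1] and to 0 outside (-2, 2). The denominator never vanishes, since 4 - t^2
    and t^2 - 1 have sum 3 and cannot both be nonpositive. *)
Definition bump (t : R) : R :=
  flat 0 (4 - t ^+ 2) / (flat 0 (4 - t ^+ 2) + flat 0 (t ^+ 2 - 1)).

Lemma bump_den_gt0 t : 0 < flat 0 (4 - t ^+ 2) + flat 0 (t ^+ 2 - 1).
Proof.
have [h|h] := ltP 0 (4 - t ^+ 2).
  by rewrite ltr_pwDl ?flat_gt0 ?flat_ge0.
rewrite ltr_wpDl ?flat_ge0 ?flat_gt0//; lra.
Qed.

Lemma bump_ge0 t : 0 <= bump t.
Proof. by rewrite /bump divr_ge0 ?flat_ge0// ltW// bump_den_gt0. Qed.

Lemma bump_le1 t : bump t <= 1.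
Proof. by rewrite /bump ler_pdivrMr ?bump_den_gt0// mul1r lerDl flat_ge0. Qed.

Lemma bump1 t : `|t| <= 1 -> bump t = 1.
Proof.
move=> t1; rewrite /bump (@flat_eq0 0 (t ^+ 2 - 1)).
  rewrite addr0 divff// gt_eqF// flat_gt0//.
  have : t ^+ 2 <= 1 by rewrite -real_normK ?num_real// exprn_ile1.
  lra.
by rewrite subr_le0 -real_normK ?num_real// exprn_ile1.
Qed.

Lemma bump0 t : 2 <= `|t| -> bump t = 0.
Proof.
move=> t2; rewrite /bump flat_eq0 ?mul0r// subr_le0 -real_normK ?num_real//.
by rewrite (_ : 4 = 2 ^+ 2) ?lerXn2r ?nnegrE//; ring.
Qed.

Lemma smooth_bump : smooth (bump : R^o -> R^o).
Proof.
move=> k.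
have sq : class_C k (fun t : R^o => (t : R) ^+ 2 : R^o).
  have H : class_C k (fun t : R^o => t : R^o).
    by apply: (@class_C_lin R R^o R^o k idfun) => x; exact: cvg_id.
  exact: (@class_CM R R^o k (fun t => t) (fun t => t) H H).
have H1 : class_C k (fun t : R^o => flat 0 (4 - (t : R) ^+ 2) : R^o).
  apply: (@class_C_comp_real R R^o R^o k (flat 0 : R^o -> R^o)
    (fun t => 4 - (t : R) ^+ 2)); first exact: smooth_flat.
  exact: (@class_CB R R^o R^o k (fun=> 4) (fun t => (t : R) ^+ 2)
    (@class_C_cst R R^o R^o k _)).
have H2 : class_C k (fun t : R^o => flat 0 ((t : R) ^+ 2 - 1) : R^o).
  apply: (@class_C_comp_real R R^o R^o k (flat 0 : R^o -> R^o)
    (fun t => (t : R) ^+ 2 - 1)); first exact: smooth_flat.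
  exact: (@class_CB R R^o R^o k (fun t => (t : R) ^+ 2) (fun=> 1) sq
    (@class_C_cst R R^o R^o k _)).
have H3 : class_C k (fun t : R^o =>
    (flat 0 (4 - (t : R) ^+ 2) + flat 0 ((t : R) ^+ 2 - 1))^-1 : R^o).
  apply: (@class_CV R R^o k
    (fun t => flat 0 (4 - (t : R) ^+ 2) + flat 0 ((t : R) ^+ 2 - 1))).
    by move=> t; rewrite gt_eqF// bump_den_gt0.
  exact: class_CD.
exact: (@class_CM R R^o k _ _ H1 H3).
Qed.

End cutoff.

(** * Bernstein polynomials and smooth approximation of Lipschitzian functions *)

Section bernstein.
Variable R : realType.

(* The Bernstein operator of order [N] at [s], applied to the values [psi j] at
   the nodes: the mean of [psi j] for [j] binomial with parameters [N] and [s]. *)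
Fixpoint bern (N : nat) (s : R) (psi : nat -> R) : R :=
  if N is N'.+1 then (1 - s) * bern N' s psi + s * bern N' s (fun j => psi j.+1)
  else psi 0%N.

Lemma bernD N s psi phi :
  bern N s (fun j => psi j + phi j) = bern N s psi + bern N s phi.
Proof. by elim: N psi phi => //= N IH psi phi; rewrite !IH; ring. Qed.

Lemma bernZ N s c psi : bern N s (fun j => c * psi j) = c * bern N s psi.
Proof. by elim: N psi => //= N IH psi; rewrite !IH; ring. Qed.

Lemma bern_cst N s c : bern N s (fun=> c) = c.
Proof. by elim: N => //= N ->; ring. Qed.

Lemma bernB N s psi phi :
  bern N s (fun j => psi j - phi j) = bern N s psi - bern N s phi.
Proof. by elim: N psi phi => //= N IH psi phi; rewrite !IH; ring. Qed.

Lemma le_bern N s psi phi : 0 <= s <= 1 ->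
  (forall j, (j <= N)%N -> psi j <= phi j) -> bern N s psi <= bern N s phi.
Proof.
move=> /andP[s0 s1]; elim: N psi phi => [|N IH] psi phi H /=; first exact: H.
apply: lerD; apply: ler_wpM2l; rewrite ?subr_ge0//; apply: IH => j jN; apply: H.
  exact: leqW.
exact: jN.
Qed.

Lemma bern_norm_le N s psi phi : 0 <= s <= 1 ->
  (forall j, (j <= N)%N -> `|psi j| <= phi j) -> `|bern N s psi| <= bern N s phi.
Proof.
move=> s01 H; rewrite ler_norml; apply/andP; split.
  rewrite -mulN1r -bernZ; apply: le_bern => // j jN.
  by rewrite mulN1r; have := H j jN; rewrite ler_norml => /andP[].
by apply: le_bern => // j jN; exact: le_trans (ler_norm _) (H j jN).
Qed.

(** Second moment about [c] of [h] times a binomial variable: variance plus squared bias. The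
    induction needs [c] general, as shifting the index replaces [c] by [c - h]. *)
Lemma bern_sqr N s h c : bern N s (fun j => (j%:R * h - c) ^+ 2) =
  N%:R * h ^+ 2 * (s * (1 - s)) + (N%:R * h * s - c) ^+ 2.
Proof.
elim: N c => [|N IH] c /=; first by ring.
rewrite IH.
have -> : bern N s (fun j => (j.+1%:R * h - c) ^+ 2) =
    bern N s (fun j => (j%:R * h - (c - h)) ^+ 2).
  by congr bern; apply/funext => j; congr (_ ^+ 2); rewrite -natr1; ring.
by rewrite IH -natr1; ring.
Qed.

(** The first absolute moment is obtained from the second by a <= d/2 + a^2/(2d). The variance
    factor s(1 - s) is bounded by 1, and [d] is left free to be balanced against the order. *)
Lemma bern_dist N s h c d : 0 <= s <= 1 -> 0 < d ->
  bern N s (fun j => `|j%:R * h - c|) <=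
  (d + (N%:R * h ^+ 2 + (N%:R * h * s - c) ^+ 2) / d) / 2.
Proof.
move=> s01 d0; have /andP[s0 s1] := s01.
apply: (@le_trans _ _
    (bern N s (fun j => d / 2 + (2 * d)^-1 * (j%:R * h - c) ^+ 2))).
  apply: le_bern => // j _; rewrite -(real_normK (num_real (j%:R * h - c))).
  set a := `|_|.
  rewrite -subr_ge0 (_ : _ - a = (2 * d)^-1 * (a - d) ^+ 2); last first.
    by field; rewrite gt_eqF.
  by rewrite mulr_ge0 ?sqr_ge0// invr_ge0 mulr_ge0// ltW.
rewrite bernD bern_cst bernZ bern_sqr.
set Q := (_ - c) ^+ 2; set P := N%:R * h ^+ 2.
rewrite -subr_ge0 (_ : _ - _ = (2 * d)^-1 * (P * (1 - s * (1 - s)))); last first.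
  by field; rewrite gt_eqF.
have ps : 0 <= 1 - s * (1 - s).
  rewrite (_ : _ - _ = (1 - s) + s ^+ 2); last by ring.
  by rewrite addr_ge0 ?subr_ge0 ?sqr_ge0.
have d2 : 0 <= (2 * d)^-1 by rewrite invr_ge0 mulr_ge0// ltW.
have P0 : 0 <= P by rewrite mulr_ge0 ?sqr_ge0.
by apply: mulr_ge0 => //; apply: mulr_ge0.
Qed.

(** The derivative in [s] is N times a mean of consecutive differences, hence the constant N D. The
    induction splits off (s - s') times the mean of these differences. *)
Lemma bern_lipschitz N s s' psi D : 0 <= s <= 1 -> 0 <= s' <= 1 ->
  (forall j, (j < N)%N -> `|psi j.+1 - psi j| <= D) ->
  `|bern N s psi - bern N s' psi| <= N%:R * D * `|s - s'|.
Proof.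
move=> s01 s01'; elim: N psi => [|N IH] psi H /=; first by rewrite subrr normr0 !mul0r.
set psi' := fun j => _.
have -> : (1 - s) * bern N s psi + s * bern N s psi' -
    ((1 - s') * bern N s' psi + s' * bern N s' psi') =
  (1 - s) * (bern N s psi - bern N s' psi) +
  s * (bern N s psi' - bern N s' psi') +
  (s - s') * bern N s' (fun j => psi' j - psi j) by rewrite bernB; ring.
have /andP[s0 s1] := s01.
have H1 : `|bern N s psi - bern N s' psi| <= N%:R * D * `|s - s'|.
  by apply: IH => j jN; apply: H; exact: leqW.
have H2 : `|bern N s psi' - bern N s' psi'| <= N%:R * D * `|s - s'|.
  by apply: IH => j jN; apply: H.
have H3 : `|bern N s' (fun j => psi' j - psi j)| <= D.
  rewrite -[leRHS](bern_cst N s'); apply: bern_norm_le => // j jN; exact: H.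
apply: (le_trans (ler_normD _ _)); rewrite normrM.
rewrite (_ : N.+1%:R * D * _ = N%:R * D * `|s - s'| + `|s - s'| * D); last first.
  by rewrite -natr1; ring.
apply: lerD; last exact: ler_wpM2l.
apply: (le_trans (ler_normD _ _)); rewrite !normrM.
rewrite (ger0_norm s0) (@ger0_norm _ (1 - s)) ?subr_ge0//.
rewrite -[leRHS]mul1r -{2}(subrK s 1) [leRHS]mulrDl.
by apply: lerD; apply: ler_wpM2l; rewrite ?subr_ge0.
Qed.

Lemma class_C_bern (V : normedModType R) k N (s : V -> R^o)
  (psi : nat -> V -> R^o) : class_C k s -> (forall j, class_C k (psi j)) ->
  class_C k (fun x => bern N (s x) (fun j => psi j x) : R^o).
Proof.
move=> Hs; elim: N psi => [|N IH] psi Hpsi /=; first exact: (Hpsi 0%N).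
apply: class_CD; apply: class_CM => //.
- by apply: class_CB => //; exact: class_C_cst.
- exact: IH.
- by apply: (IH (fun j => psi j.+1)).
Qed.

End bernstein.

(** * Coordinatewise Bernstein approximation on a cube *)

Section lipschitz_approximation.
Variables (R : realType) (n : nat).
Implicit Types (x y : 'rV[R]_n) (u g : 'rV[R]_n -> R).

Definition upd x (i : 'I_n) (t : R) : 'rV[R]_n :=
  \row_k (if k == i then t else x 0 k).

Lemma updK x i : upd x i (x 0 i) = x.
Proof. by apply/rowP => k; rewrite !mxE; case: eqP => // ->. Qed.

Lemma upd_upd x i t t' : upd (upd x i t) i t' = upd x i t'.
Proof. by apply/rowP => k; rewrite !mxE; case: eqP. Qed.

Lemma updC x i k t t' : i != k -> upd (upd x k t) i t' = upd (upd x i t') k t.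
Proof.
move=> ik; apply/rowP => j; rewrite !mxE; case: eqP => // ->.
by rewrite (negbTE ik).
Qed.

Lemma upd_ii x i t : upd x i t 0 i = t.
Proof. by rewrite mxE eqxx. Qed.

Lemma upd_ki x i k t : k != i -> upd x i t 0 k = x 0 k.
Proof. by rewrite mxE => /negbTE ->. Qed.

Variables (M L : R).
Hypotheses (M0 : 0 < M) (L0 : 0 <= L).

Definition cube : set 'rV[R]_n := [set x | forall i, `|x 0 i| <= M].

Lemma cube_upd x i t : cube x -> `|t| <= M -> cube (upd x i t).
Proof. by move=> cx tM k; rewrite mxE; case: eqP. Qed.

(** Lipschitz bounds in each coordinate direction separately: in this form, with the same [L], they
    are preserved by [bern_coord] in any direction, and they bound the partial derivatives of the
    final approximation. *)
Definition coord_lip u := forall x k t t', cube x -> `|t| <= M -> `|t'| <= M ->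
  `|u (upd x k t) - u (upd x k t')| <= L * `|t - t'|.

Definition node N (j : nat) : R := j%:R * (2 * M / N%:R) - M.

Definition bern_coord N (i : 'I_n) u x : R :=
  bern N ((x 0 i + M) / (2 * M)) (fun j => u (upd x i (node N j))).

Lemma node_le N j : (j <= N)%N -> (0 < N)%N -> `|node N j| <= M.
Proof.
move=> jN N0; rewrite /node ler_norml.
have N0' : 0 < N%:R :> R by rewrite ltr0n.
have H : j%:R * (2 * M / N%:R) <= 2 * M.
  rewrite mulrCA ler_piMr ?mulr_ge0 ?(ltW M0)//.
  by rewrite ler_pdivrMr// mul1r ler_nat.
have H' : 0 <= j%:R * (2 * M / N%:R).
  by rewrite mulr_ge0// divr_ge0// ?mulr_ge0// ltW.
apply/andP; split; lra.
Qed.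

Lemma bern_coord_param x i : cube x -> 0 <= (x 0 i + M) / (2 * M) <= 1.
Proof.
move=> /(_ i); rewrite ler_norml => /andP[H1 H2].
have M2 : 0 < 2 * M by rewrite mulr_gt0.
rewrite ler_pdivrMr// ler_pdivlMr//; apply/andP; split; lra.
Qed.

Lemma coord_lip_bern N i u : (0 < N)%N -> coord_lip u ->
  coord_lip (bern_coord N i u).
Proof.
move=> N0 Hu x k t t' cx tM tM'; rewrite /bern_coord.
have [->|ki] := eqVneq k i.
  rewrite !upd_ii.
  under [X in bern _ _ X - _]eq_fun do rewrite upd_upd.
  under [X in _ - bern _ _ X]eq_fun do rewrite upd_upd.
  have N0' : 0 < N%:R :> R by rewrite ltr0n.
  have p1 := bern_coord_param i (cube_upd i cx tM).
  have p2 := bern_coord_param i (cube_upd i cx tM').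
  rewrite !upd_ii in p1 p2.
  apply: (le_trans (@bern_lipschitz R N _ _ _ (L * (2 * M / N%:R)) p1 p2 _)).
    move=> j jN; apply: (le_trans (Hu _ _ _ _ _ _ _)) => //; try exact: node_le.
      by apply: node_le => //; exact: ltnW.
    apply: ler_wpM2l => //; rewrite /node.
    have -> : j.+1%:R * (2 * M / N%:R) - M - (j%:R * (2 * M / N%:R) - M) =
      2 * M / N%:R by rewrite -natr1; ring.
    by rewrite ger0_norm// divr_ge0// mulr_ge0// ltW.
  rewrite (_ : _ - _ / _ = (t - t') / (2 * M)); last by field; rewrite gt_eqF.
  have M2 : 0 <= (2 * M)^-1 by rewrite invr_ge0 mulr_ge0// ltW.
  rewrite normrM (ger0_norm M2) le_eqVlt; apply/orP; left; apply/eqP; field.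
  by rewrite !gt_eqF.
rewrite !upd_ki 1?eq_sym// -bernB.
rewrite -[leRHS](bern_cst N ((x 0 i + M) / (2 * M))).
apply: bern_norm_le; first exact: bern_coord_param.
move=> j jN; rewrite !(@updC x i k) 1?eq_sym//; apply: Hu => //.
by apply: cube_upd => //; exact: node_le.
Qed.

(** Order K^2 and d = M/K in [bern_dist]: the step is h = 2M/K^2, the bias is zero and K^2 h^2 =
    4M^2/K^2, so the mean deviation is at most (M/K + 4M/K)/2. *)
Lemma bern_coord_approx K i u x : (0 < K)%N -> coord_lip u -> cube x ->
  `|bern_coord (K ^ 2) i u x - u x| <= L * (5 / 2 * M / K%:R).
Proof.
move=> K0 Hu cx; rewrite /bern_coord.
have K2 : (0 < K ^ 2)%N by rewrite expn_gt0 K0.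
have K0' : 0 < K%:R :> R by rewrite ltr0n.
set s := (x 0 i + M) / (2 * M).
have s01 : 0 <= s <= 1 by exact: bern_coord_param.
rewrite -(bern_cst (K ^ 2) s (u x)) -bernB.
apply: (@le_trans _ _ (bern (K ^ 2) s
    (fun j => L * `|j%:R * (2 * M / (K ^ 2)%:R) - (x 0 i + M)|))).
  apply: bern_norm_le => // j jN; rewrite -{2}(updK x i).
  apply: (le_trans (Hu _ _ _ _ _ _ _)) => //; first exact: node_le.
  by rewrite /node opprD addrA addrAC.
rewrite bernZ; apply: ler_wpM2l => //.
have d0 : 0 < M / K%:R by rewrite divr_gt0.
apply: (le_trans (bern_dist (K ^ 2) (2 * M / (K ^ 2)%:R) (x 0 i + M) s01 d0)).
rewrite natrX le_eqVlt; apply/orP; left; apply/eqP; rewrite /s.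
by field; rewrite !gt_eqF.
Qed.

(** Coordinates in [l] come from the variable [x], the others from the parameter [y]: after the
    directions in [l] have been treated, smoothness is known in these only, with the remaining ones
    frozen. *)
Definition merge (l : seq 'I_n) x y : 'rV[R]_n :=
  \row_k (if k \in l then x 0 k else y 0 k).

Lemma smooth_coord (i : 'I_n) : smooth (fun x : 'rV[R]_n => x 0 i : R^o).
Proof.
move=> k.
have lin : linear (fun x : 'rV[R]_n => x 0 i : R^o) by move=> a x y; rewrite !mxE.
pose f : {linear 'rV[R]_n -> R^o} := HB.pack (fun x : 'rV[R]_n => x 0 i : R^o)
  (GRing.isLinear.Build _ _ _ _ _ lin).
by apply: (@class_C_lin R _ _ k f) => x; exact: coord_continuous.
Qed.

Lemma bern_approx_iter (u : 'rV[R]_n -> R) (l : seq 'I_n) K : (0 < K)%N ->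
  coord_lip u -> uniq l ->
  exists p : 'rV[R]_n -> R, [/\ coord_lip p,
    forall x, cube x -> `|p x - u x| <= (size l)%:R * (L * (5 / 2 * M / K%:R)) &
    forall y, smooth (fun x => p (merge l x y) : R^o)].
Proof.
move=> K0 Hu; elim: l => [|i l IH] /=.
  move=> _; exists u; split=> //; first by move=> x _; rewrite subrr normr0 mul0r.
  move=> y; suff -> : (fun x => u (merge [::] x y)) = fun=> u y.
    by move=> k; exact: class_C_cst.
  by apply/funext => x; congr u; apply/rowP => k; rewrite mxE.
move=> /andP[il /IH [p [p1 p2 p3]]]; exists (bern_coord (K ^ 2) i p); split.
- by apply: coord_lip_bern => //; rewrite expn_gt0 K0.
- move=> x cx; rewrite -(subrKA (p x)) -natr1 mulrDl mul1r addrC.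
  apply: (le_trans (ler_normD _ _)); apply: lerD; first exact: p2.
  exact: bern_coord_approx.
- move=> y k.
  have -> : (fun x => bern_coord (K ^ 2) i p (merge (i :: l) x y) : R^o) =
    (fun x => bern (K ^ 2) ((2 * M)^-1 * (x 0 i + M))
      (fun j => p (merge l x (upd y i (node (K ^ 2) j))))).
    apply/funext => x; rewrite /bern_coord mxE mem_head mulrC; congr bern.
    apply/funext => j; congr p; apply/rowP => a; rewrite !mxE inE.
    by case: (eqVneq a i) => [->|] //=; rewrite (negbTE il).
  apply: (@class_C_bern R _ k (K ^ 2)
    (fun x : 'rV[R]_n => (2 * M)^-1 * (x 0 i + M) : R^o)
    (fun j x => p (merge l x (upd y i (node (K ^ 2) j))))); last by move=> j; exact: p3.
  apply: (@class_CM R _ k (fun=> (2 * M)^-1)); first exact: class_C_cst.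
  by apply: class_CD; [exact: smooth_coord|exact: class_C_cst].
Qed.

Lemma diff_le_lipschitz (p : 'rV[R]_n -> R^o) x (k : 'I_n) :
  differentiable p x -> coord_lip p -> (forall i, `|x 0 i| < M) ->
  `|'d p x (delta_mx 0 k)| <= L.
Proof.
move=> dp Hp xM; rewrite -deriveE//.
have /cvg_ex[l Hl] := @diff_derivable _ _ _ _ _ (delta_mx 0 k) dp.
rewrite /derive (cvg_lim _ Hl)//.
have Hn := cvg_norm Hl.
apply: (cvgr_to_le (Hn _)); near=> h.
have h0 : h != 0 by near: h; exact: nbhs_dnbhs_neq.
rewrite normrZ normfV mulrC ler_pdivrMr ?normr_gt0// /=.
have -> : h *: delta_mx 0 k + x = upd x k (x 0 k + h).
  apply/rowP => j; rewrite !mxE eqxx /=.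
  by case: eqP => [->|_]; rewrite ?mulr1 ?mulr0 ?add0r// addrC.
have cx : cube x by move=> i; exact: ltW.
have xh : `|x 0 k + h| <= M.
  near: h; apply: (@nbhs_dnbhs _ (0 : R)).
  have : \forall h \near (0 : R), `|x 0 k + h| < M.
    have c : (fun h : R => `|x 0 k + h|) @ (0 : R) --> `|x 0 k + 0|.
      by apply: cvg_norm; apply: cvgD; [exact: cvg_cst|exact: cvg_id].
    by apply: (cvgr_lt _ c); rewrite addr0.
  by apply: filterS => h /ltW.
have := Hp x k (x 0 k + h) (x 0 k) cx xh (ltW (xM k)).
by rewrite updK [x 0 k + h]addrC addrK.
Unshelve. all: by end_near. Qed.

End lipschitz_approximation.

Section rV_norm.
Variables (R : realType) (n : nat).

Lemma rV_coord_le (x : 'rV[R]_n) i : `|x 0 i| <= `|x|.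
Proof.
rewrite [leRHS]/Num.norm /= mx_normrE; apply/bigmax_geP; right => /=.
by exists (0, i).
Qed.

Lemma rV_norm_le (x : 'rV[R]_n) C : 0 <= C -> (forall i, `|x 0 i| <= C) -> `|x| <= C.
Proof.
move=> C0 H; rewrite [leLHS]/Num.norm /= mx_normrE; apply/bigmax_leP; split=> //.
by move=> [a b] _ /=; rewrite (ord1 a).
Qed.

End rV_norm.

(** The gradient bound is the Lipschitz constant itself, whatever [e] is. This uniformity later
    turns the defect of the identity for [g] into a functional dominated by the weight measure. *)
Lemma lipschitz_smooth_approx (R : realType) (n : nat) (M L e : R)
    (g : 'rV[R]_n -> R) : 0 < M -> 0 <= L -> 0 < e ->
    (forall x y, `|g x - g y| <= L * `|x - y|) ->
  exists p : 'rV[R]_n -> R^o, [/\ smooth p,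
    forall x : 'rV[R]_n, (forall i, `|x 0 i| <= M) -> `|p x - g x| <= e &
    forall (x : 'rV[R]_n) k, (forall i, `|x 0 i| < M) -> `|'d p x (delta_mx 0 k)| <= L].
Proof.
move=> M0 L0 e0 gL.
have Hg : coord_lip M L g.
  move=> x k t t' _ _ _; apply: (le_trans (gL _ _)); apply: ler_wpM2l => //.
  apply: rV_norm_le => // i; rewrite !mxE.
  by case: eqP => //; rewrite subrr normr0.
pose C := n%:R * (L * (5 / 2 * M)).
have C0 : 0 <= C by rewrite mulr_ge0// mulr_ge0// mulr_ge0// ltW.
have [K K0 HK] : exists2 K, (0 < K)%N & C / K%:R <= e.
  exists (Num.bound (C / e)).+1 => //.
  rewrite ler_pdivrMr ?ltr0n// mulrC -ler_pdivrMr//.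
  apply: (le_trans (ltW (archi_boundP _))); first by rewrite divr_ge0// ltW.
  by rewrite ler_nat.
have [p [p1 p2 p3]] := bern_approx_iter M0 L0 K0 Hg (enum_uniq 'I_n).
have sp : smooth (p : 'rV[R]_n -> R^o).
  move=> k; apply: eq_class_C (p3 0 k) => x; congr p.
  by apply/rowP => i; rewrite !mxE mem_enum.
exists p; split=> // [x cx|x k cx].
  apply: (le_trans (p2 x cx)); apply: le_trans HK.
  by rewrite size_enum_ord /C !mulrA.
apply: (diff_le_lipschitz (M := M) (L := L)) => //; exact: smooth_differentiable sp.
Qed.

(** * Lipschitz constants on compact sets and extension of Lipschitzian functions *)

Section lipschitz_extension.
Variables (R : realType) (V : normedModType R).

Lemma lipschitz_nbhs (W : normedModType R) (U : set V) (g : V -> W) x :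
  locally_lipschitz U g -> U x ->
  exists A k, [/\ nbhs x A, 0 <= k &
    forall y z, A y -> A z -> `|g y - g z| <= k * `|y - z|].
Proof.
move=> Hg Ux; have [A nA [M [Mr HM]]] := Hg x Ux.
exists A, (Num.max M 0 + 1); split=> //.
  by rewrite addr_ge0// le_max lexx orbT.
move=> y z Ay Az.
have H : M < Num.max M 0 + 1 by rewrite ltr_pwDr// le_max lexx.
exact: (HM _ H (y, z) (conj Ay Az)).
Qed.

Lemma locally_lipschitz_continuous (W : normedModType R) (U : set V) (g : V -> W) x :
  locally_lipschitz U g -> U x -> {for x, continuous g}.
Proof.
move=> Hg Ux; have [A [k [nA k0 H]]] := lipschitz_nbhs Hg Ux.
apply/cvgrPdist_le => e e0; near=> y.
apply: (le_trans (H x y (nbhs_singleton nA) _)); first by near: y.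
apply: (@le_trans _ _ ((k + 1) * `|x - y|)).
  by rewrite ler_wpM2r// lerDl.
rewrite mulrC -ler_pdivlMr ?ltr_wpDl//.
by near: y; apply: cvgr_dist_le; [exact: cvg_id|rewrite divr_gt0// ltr_wpDl].
Unshelve. all: by end_near. Qed.

(** [K] need not be convex, so local constants cannot be chained along segments; instead K x K is
    covered. Near a diagonal point a local constant works, and near other points the difference
    quotient is bounded by continuity. *)
Lemma compact_lipschitz (W : normedModType R) (U K : set V) (g : V -> W) :
  locally_lipschitz U g -> compact K -> K `<=` U ->
  exists2 L : R, 0 <= L &
    forall x y, K x -> K y -> `|g x - g y| <= L * `|x - y|.
Proof.
move=> Hg cK KU.
have /compact_near_coveringP Hn := compact_setX cK cK.
have Hcov : forall q, (K `*` K) q -> \forall p \near q & L \near (+oo : set_system R),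
    `|g p.1 - g p.2| <= L * `|p.1 - p.2|.
  move=> [x y] [/= Kx Ky].
  have [A [k [nA k0 HA]]] := lipschitz_nbhs Hg (KU _ Kx).
  have [xy|xy] := eqVneq x y.
    have nAA : \forall p \near (x, x), A p.1 /\ A p.2.
      by exists (A, A) => //=; move=> [a b] [].
    rewrite -xy; near=> p L => /=.
    apply: (@le_trans _ _ (k * `|p.1 - p.2|)).
      have [Ap1 Ap2] : A p.1 /\ A p.2 by near: p.
      exact: HA.
    apply: ler_wpM2r => //; near: L; exact: nbhs_pinfty_ge.
  have d0 : 0 < `|x - y| by rewrite normr_gt0 subr_eq0.
  pose C := `|g x - g y|.
  have cg : (fun p : V * V => `|g p.1 - g p.2|) @ (x, y) --> `|g x - g y|.
    apply: cvg_norm; apply: cvgB.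
      apply: (@cvg_comp _ _ _ fst g); first exact: cvg_fst.
      exact: (locally_lipschitz_continuous Hg (KU _ Kx)).
    apply: (@cvg_comp _ _ _ snd g); first exact: cvg_snd.
    exact: (locally_lipschitz_continuous Hg (KU _ Ky)).
  have cd : (fun p : V * V => `|p.1 - p.2|) @ (x, y) --> `|x - y|.
    by apply: cvg_norm; apply: cvgB; [exact: cvg_fst|exact: cvg_snd].
  near=> p L => /=.
  apply: (@le_trans _ _ (C + 1)).
    near: p; apply: (cvgr_le _ cg); rewrite /C; lra.
  (* Near a pair of distinct points the distance stays above half of |x - y|, while the difference
     of the values stays below C + 1. *)
  apply: (@le_trans _ _ (2 * (C + 1) / `|x - y| * `|p.1 - p.2|)).
    have : `|x - y| / 2 <= `|p.1 - p.2|.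
      near: p; apply: (cvgr_ge _ cd); lra.
    move=> H; apply: le_trans (ler_wpM2l _ H).
      rewrite le_eqVlt; apply/orP; left; apply/eqP; field; rewrite ?gt_eqF//.
    by rewrite divr_ge0// mulr_ge0// addr_ge0// /C.
  apply: ler_wpM2r => //; near: L; exact: nbhs_pinfty_ge.
have H := Hn R (+oo : set_system R)
  (fun L p => `|g p.1 - g p.2| <= L * `|p.1 - p.2|) _ Hcov.
have {}H : \forall L \near (+oo : set_system R),
  K `*` K `<=` (fun p => `|g p.1 - g p.2| <= L * `|p.1 - p.2|) by exact: H.
near (+oo : set_system R) => L.
exists L; first by near: L; exact: nbhs_pinfty_ge.
move=> x y Kx Ky.
suff HL : K `*` K `<=` (fun p => `|g p.1 - g p.2| <= L * `|p.1 - p.2|).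
  exact: (HL (x, y)).
by near: L.
Unshelve. all: by end_near. Qed.

(* McShane's extension formula *)
Lemma lipschitz_extend (K : set V) (g : V -> R) (L : R) : 0 <= L ->
    (forall x y, K x -> K y -> `|g x - g y| <= L * `|x - y|) ->
  exists2 h : V -> R, (forall x, K x -> h x = g x) &
    forall x y, `|h x - h y| <= L * `|x - y|.
Proof.
move=> L0 HL; have [->|/set0P[k0 Kk0]] := eqVneq K set0.
  exists (fun=> 0) => // x y; rewrite subrr normr0 mulr_ge0//.
pose E x := [set g k + L * `|x - k| | k in K].
have E0 x : E x !=set0 by exists (g k0 + L * `|x - k0|); exists k0.
have lbE x : has_lbound (E x).
  exists (g k0 - L * `|x - k0|) => _ [k Kk <-].
  have H1 := HL _ _ Kk0 Kk.
  have H2 : `|k0 - k| <= `|x - k0| + `|x - k|.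
    by rewrite (distrC x k0); apply: (le_trans _ (ler_normD _ _)); rewrite subrKA.
  have := ler_wpM2l L0 H2; rewrite mulrDr.
  have := ler_norm (g k0 - g k); lra.
exists (fun x => inf (E x)).
  move=> x Kx; apply/eqP; rewrite eq_le; apply/andP; split.
    by apply: ge_inf => //; exists x => //; rewrite subrr normr0 mulr0 addr0.
  apply: lb_le_inf => // _ [k Kk <-].
  have := HL _ _ Kx Kk; have := ler_norm (g x - g k); lra.
have half x y : inf (E x) <= inf (E y) + L * `|x - y|.
  rewrite -lerBlDr; apply: lb_le_inf => // _ [k Kk <-].
  rewrite lerBlDr; apply: (@le_trans _ _ (g k + L * `|x - k|)).
    by apply: ge_inf => //; exists k.
  rewrite -addrA lerD2l -mulrDr; apply: ler_wpM2l => //.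
  by rewrite [leRHS]addrC (_ : x - k = (x - y) + (y - k)) ?ler_normD// subrKA.
move=> x y; rewrite ler_norml; have := half x y; have := half y x.
by rewrite (distrC y x) => *; apply/andP; split; lra.
Qed.

End lipschitz_extension.

Lemma compact_image_continuous (S T : topologicalType) (f : S -> T) (A : set S) :
  continuous f -> compact A -> compact (f @` A).
Proof. by move=> cf cA; apply: continuous_compact => //; exact: continuous_subspaceT. Qed.

Lemma bounded_on_compact (R : realType) (T : topologicalType)
    (W : normedModType R) (f : T -> W) (K : set T) :
  continuous f -> compact K -> exists2 B : R, 0 <= B & forall x, K x -> `|f x| <= B.
Proof.
move=> cf cK; have [M [Mr HM]] := compact_bounded (compact_image_continuous cf cK).
exists (Num.max M 0 + 1); first by rewrite addr_ge0// le_max lexx orbT.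
move=> x Kx; apply: (HM (Num.max M 0 + 1)); last by exists x.
by rewrite ltr_pwDr// le_max lexx.
Qed.

Lemma continuous_linear_le (R : realType) (V W : normedModType R)
    (f : {linear V -> W}) : continuous f ->
  exists2 C : R, 0 <= C & forall x, `|f x| <= C * `|x|.
Proof.
move=> /linear_bounded_continuous/linear_boundedP H.
near (+oo : set_system R) => r; exists r; first by near: r; exact: nbhs_pinfty_ge.
by near: r.
Unshelve. all: by end_near. Qed.

Lemma le_continuous_linear (R : realType) (V W : normedModType R)
    (f : {linear V -> W}) (C : R) : (forall x, `|f x| <= C * `|x|) -> continuous f.
Proof.
move=> H; apply/linear_bounded_continuous/linear_boundedP; near=> r => x.
apply: (le_trans (H x)).
have Cr : C <= r by near: r; apply: nbhs_pinfty_ge; exact: num_real.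
exact: ler_wpM2r.
Unshelve. all: by end_near. Qed.

(** Plays the role of a basis: the reproducing formula and the continuity of the coordinates are
    what reduces boundedness, smoothness and measurability questions on [Y] to real functions. *)
Record frame (R : realType) (Y : normedModType R) := Frame {
  frk : nat;
  fvec : 'I_frk -> Y;
  fco : 'I_frk -> {linear Y -> R^o};
  fco_continuous : forall i, continuous (fco i);
  fcoE : forall y, y = \sum_i (fco i y : R) *: fvec i }.

Arguments fvec {R Y} f i.
Arguments fco {R Y} f i.

(** * Finite dimensional spaces *)

Section frame_existence.
Variables (R : realType) (Y : normedModType R).

Definition spans (k : nat) (e : 'I_k -> Y) : Prop :=
  forall y, exists c : 'I_k -> R, y = \sum_(i < k) c i *: e i.

(** If some c_j were nonzero, e_j would be a combination of the other vectors, which would then form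
    a smaller spanning family. *)
Lemma minimal_spans (k : nat) (e : 'I_k -> Y) : spans e ->
    (forall k' (e' : 'I_k' -> Y), spans e' -> (k <= k')%N) ->
  forall c : 'I_k -> R, \sum_(i < k) c i *: e i = 0 -> forall i, c i = 0.
Proof.
case: k e => [|k] e He Hmin c c0 j; first by case: j.
apply/eqP; apply/negP => /negP cj.
suff /Hmin : spans (fun i => e (lift j i)) by rewrite ltnn.
move=> y; have [d ->] := He y.
exists (fun i => d (lift j i) - d j * (c j)^-1 * c (lift j i)).
move: c0; rewrite !(bigD1_ord j)//= => c0.
have -> : e j = - (c j)^-1 *: \sum_(i < k) c (lift j i) *: e (lift j i).
  apply: (@scalerI _ _ (c j)) => //.
  rewrite scalerA mulrN divff// scaleN1r; apply/eqP.
  by rewrite -addr_eq0 c0.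
rewrite scalerA scaler_sumr -big_split /=; apply: eq_bigr => i _.
by rewrite scalerA -scalerDl; congr (_ *: _); ring.
Qed.

(** For a spanning family of minimal length, [T] is injective, so the norm of [T c] has a positive
    minimum [m] on the unit sphere of R^k. The coordinates are then bounded by 1/m times the
    norm. *)
Lemma finite_dim_frame : finite_dim Y -> exists b : frame Y, True.
Proof.
move=> [k0 [e0 He0]].
have : exists k, `[< exists e : 'I_k -> Y, spans e >].
  by exists k0; apply/asboolP; exists e0.
move=> /ex_minnP[k /asboolP[e He] Hmin'].
have Hmin k' (e' : 'I_k' -> Y) : spans e' -> (k <= k')%N.
  by move=> H; apply: Hmin'; apply/asboolP; exists e'.
have Hfree := minimal_spans He Hmin.
pose T (c : 'rV[R]_k) : Y := \sum_(i < k) c 0 i *: e i.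
have Tlin : linear T.
  move=> a x y; rewrite /T scaler_sumr -big_split /=; apply: eq_bigr => i _.
  by rewrite !mxE scalerDl scalerA.
have Tinj x : T x = 0 -> x = 0.
  by move=> Tx; apply/rowP => i; rewrite (Hfree _ Tx i) mxE.
have Tcont : continuous T.
  apply: (@class_C_sum R _ _ 0 _ _ (fun i (c : 'rV[R]_k) => c 0 i *: e i)) => i.
  apply: (@class_CZ R _ _ 0 (fun c : 'rV[R]_k => c 0 i)); first exact: smooth_coord.
  exact: class_C_cst.
have [m m0 Hm] : exists2 m : R, 0 < m & forall x, m * `|x| <= `|T x|.
  have [S0|S0] := eqVneq [set x : 'rV[R]_k | `|x| = 1] set0.
    exists 1 => // x; have [->|x0] := eqVneq x 0; first by rewrite normr0 mulr0.
    have : [set x : 'rV[R]_k | `|x| = 1] (`|x|^-1 *: x).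
      by rewrite /= normrZ normfV normr_id mulVf// normr_eq0.
    by rewrite S0.
  have cS : compact [set x : 'rV[R]_k | `|x| = 1].
    apply: bounded_closed_compact.
      by exists 1; split=> // M M1 x /= ->; exact: ltW.
    have -> : [set x : 'rV[R]_k | `|x| = 1] = Num.norm @^-1` [set 1 : R] by [].
    by apply: closed_comp; [move=> x _; exact: norm_continuous|exact: closed_eq].
  have cT : {within [set x : 'rV[R]_k | `|x| = 1], continuous (fun x => `|T x|)}.
    apply: continuous_subspaceT => x.
    by apply: (@continuous_comp _ _ _ T Num.norm); [exact: Tcont|exact: norm_continuous].
  have /set0P S0' := S0.
  have [c cS1 Hc] := @compact_EVT_min _ R (fun x => `|T x|) _ S0' cS cT.
  exists `|T c|.
    rewrite normr_gt0; apply/eqP => /Tinj c0; move: cS1.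
    by rewrite c0 inE /= normr0 => /esym/eqP; rewrite oner_eq0.
  move=> x; have [->|x0] := eqVneq x 0; first by rewrite normr0 mulr0 normr_ge0.
  have nx0 : 0 < `|x| by rewrite normr_gt0.
  have /Hc : `|x|^-1 *: x \in [set x : 'rV[R]_k | `|x| = 1].
    by rewrite inE /= normrZ normfV normr_id mulVf// gt_eqF.
  have -> : T (`|x|^-1 *: x) = `|x|^-1 *: T x.
    have := Tlin `|x|^-1 x 0.
    have -> : T 0 = 0 by rewrite /T big1// => i _; rewrite mxE scale0r.
    by rewrite !addr0.
  by rewrite normrZ normfV normr_id mulrC ler_pdivlMr.
have ex y : exists c : 'rV[R]_k, y = T c.
  have [c ->] := He y; exists (\row_i c i).
  by apply: eq_bigr => i _; rewrite mxE.
pose co y := sval (cid (ex y)).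
have coE y : y = T (co y) by rewrite /co; case: cid.
have Tinj2 c c' : T c = T c' -> c = c'.
  move=> H; apply/eqP; rewrite -subr_eq0; apply/eqP/Tinj.
  have := Tlin (-1) c' c; rewrite !scaleN1r H addNr => <-.
  by rewrite addrC.
have colin i : linear (fun y => co y 0 i : R^o).
  move=> a x y; suff -> : co (a *: x + y) = a *: co x + co y by rewrite !mxE.
  by apply: Tinj2; rewrite Tlin -!coE.
pose col i : {linear Y -> R^o} := HB.pack (fun y => co y 0 i : R^o)
  (GRing.isLinear.Build _ _ _ _ _ (colin i)).
have colc i : continuous (col i).
  apply: (@le_continuous_linear R _ _ (col i) m^-1) => y.
  rewrite mulrC ler_pdivlMr// mulrC {2}(coE y).
  apply: le_trans (Hm _); apply: ler_wpM2l; [exact: ltW|exact: rV_coord_le].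
by exists (@Frame R Y k e col colc coE).
Qed.

End frame_existence.

Lemma sum_pair (Y Z : zmodType) (I : Type) (r : seq I) (F : I -> Y) (G : I -> Z) :
  \sum_(i <- r) (F i, G i) = (\sum_(i <- r) F i, \sum_(i <- r) G i).
Proof. by elim: r => [|i r IH]; rewrite ?big_nil// !big_cons IH. Qed.

Lemma finite_dim_pair (R : realType) (Y Z : normedModType R) :
  finite_dim Y -> finite_dim Z -> finite_dim (Y * Z)%type.
Proof.
move=> [k [e He]] [l [f Hf]].
exists (k + l)%N, (fun i : 'I_(k + l) => match fintype.split i with inl a => (e a, 0) | inr b => (0, f b) end).
move=> [y z]; have [c cE] := He y; have [d dE] := Hf z.
exists (fun i : 'I_(k + l) => match fintype.split i with inl a => c a | inr b => d b end).
rewrite big_split_ord /=.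
under eq_bigr => i _ do rewrite (unsplitK (inl i : 'I_k + 'I_l)).
under [X in _ + X]eq_bigr => i _ do rewrite (unsplitK (inr i : 'I_k + 'I_l)).
have sc1 (a : R) (u : Y) : a *: (u, 0 : Z) = (a *: u, 0).
  exact: (congr1 (pair (a *: u)) (scaler0 _ a)).
have sc2 (a : R) (u : Z) : a *: (0 : Y, u) = (0, a *: u).
  exact: (congr1 (fun w => (w, a *: u)) (scaler0 _ a)).
under eq_bigr => i _ do rewrite sc1.
under [X in _ + X]eq_bigr => i _ do rewrite sc2.
rewrite !sum_pair -cE -dE !big1//.
exact/esym/(congr2 pair (addr0 y) (add0r z)).
Qed.

Lemma MVT_line (R : realType) (V : normedModType R) (f : V -> R^o) (a v : V) :
  (forall x, differentiable f x) ->
  exists2 t : R, 0 < t < 1 & f (a + v) - f a = 'd f (a + t *: v) v.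
Proof.
move=> df; pose phi (t : R) : R := f (a + t *: v).
have dphi (t : R) : is_derive t 1 phi ('d f (a + t *: v) v).
  have H1 : is_diff (t : R^o) (fun t : R^o => a + (t : R) *: v) (fun s => (s : R) *: v).
    have -> : (fun t : R^o => a + (t : R) *: v) = cst a + (fun t : R^o => (t : R) *: v) by [].
    by apply: is_diff_eq; rewrite add0r.
  have H2 := differentiableP (df (a + t *: v)).
  have H3 : is_diff (t : R^o) (f \o (fun t : R^o => a + (t : R) *: v))
      (fun s => 'd f (a + t *: v) ((s : R) *: v)).
    by apply: is_diff_eq.
  have H4 : differentiable (phi : R^o -> R^o) t by case: H3.
  apply: DeriveDef; first exact/derivable1_diffP.
  by rewrite deriveE// (is_diff_val H3) scale1r.
have [|t t01] := @MVT R phi _ 0 1 ltr01 (fun x _ => dphi x).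
  apply: continuous_subspaceT => x; apply: differentiable_continuous.
  by have [/derivable1_diffP] := dphi x.
rewrite /phi scale1r scale0r addr0 subr0 mulr1 => H.
by exists t => //; move: t01; rewrite in_itv.
Qed.

Section frame_theory.
Variables (R : realType) (Y : normedModType R) (b : frame Y).

(** Boxes are preferred to balls because the coordinates are smooth, whereas the norm of [Y] need
    not be. *)
Definition fbox (r : R) : set Y := [set y | forall i, `|fco b i y| <= r].

Lemma closed_fbox r : closed (fbox r).
Proof.
have -> : fbox r = \bigcap_(i in setT) (fun y => `|fco b i y|) @^-1` [set t : R | t <= r].
  by apply/seteqP; split=> y H i => [_|]; exact: H.
apply: closed_bigI => i _; apply: closed_comp; last exact: closed_le.
move=> y _; apply: (@continuous_comp _ _ _ (fco b i) Num.norm).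
  exact: fco_continuous.
exact: norm_continuous.
Qed.

Lemma compact_fbox r : compact (fbox r).
Proof.
pose T (c : 'rV[R]_(frk b)) : Y := \sum_i c 0 i *: fvec b i.
have Tcont : continuous T.
  apply: (@class_C_sum R _ _ 0 _ _ (fun i (c : 'rV[R]_(frk b)) => c 0 i *: fvec b i)) => i.
  apply: (@class_CZ R _ _ 0 (fun c : 'rV[R]_(frk b) => c 0 i)); first exact: smooth_coord.
  exact: class_C_cst.
have cB : compact [set c : 'rV[R]_(frk b) | forall i, `[- r, r]%classic (c ord0 i)].
  by apply: (@rV_compact _ _ (fun=> `[- r, r]%classic)) => i; exact: segment_compact.
apply: (subclosed_compact (@closed_fbox r) (compact_image_continuous Tcont cB)).
move=> y Hy; exists (\row_i fco b i y).
  by move=> i /=; rewrite mxE in_itv /= -ler_norml.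
by rewrite {2}(fcoE b y); apply: eq_bigr => i _; rewrite mxE.
Qed.

Lemma fco_le : exists2 C : R, 0 < C & forall i y, `|fco b i y| <= C * `|y|.
Proof.
have H i : exists C : R, 0 <= C /\ forall y, `|fco b i y| <= C * `|y|.
  by have [C] := continuous_linear_le (@fco_continuous _ _ b i); exists C.
have [C HC] := choice H.
exists (1 + \sum_i C i).
  by apply: ltr_pwDl => //; apply: sumr_ge0 => i _; case: (HC i).
move=> i y; apply: (le_trans ((HC i).2 y)); apply: ler_wpM2r => //.
rewrite (bigD1 i)//= addrCA lerDl addr_ge0//.
by apply: sumr_ge0 => j _; case: (HC j).
Qed.

Lemma norm_le_fco : exists2 C : R, 0 <= C & forall y, `|y| <= C * \sum_i `|fco b i y|.
Proof.
exists (\sum_(i < frk b) `|fvec b i|); first exact: sumr_ge0.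
move=> y; rewrite {1}(fcoE b y); apply: (le_trans (ler_norm_sum _ _ _)).
rewrite mulr_sumr; apply: ler_sum => i _; rewrite normrZ mulrC.
apply: ler_wpM2r => //; rewrite (bigD1 i)//= lerDl; exact: sumr_ge0.
Qed.

Lemma compact_fbox_sub (K : set Y) : compact K ->
  exists2 r : R, 0 < r & K `<=` fbox r.
Proof.
move=> cK; have [C C0 HC] := fco_le.
have [B B0 HB] := @bounded_on_compact R Y Y id K (fun x => cvg_id) cK.
exists (C * B + 1); first by rewrite ltr_wpDl// mulr_ge0// ltW.
move=> y Ky i; apply: (le_trans (HC i y)).
by apply: (@le_trans _ _ (C * B)); rewrite ?lerDl// ler_wpM2l ?HB// ltW.
Qed.

Lemma fco_scale_norm r i y : 0 < r -> `|r^-1 * (fco b i y : R)| = `|fco b i y| / r.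
Proof. by move=> r0; rewrite normrM normfV (gtr0_norm r0) mulrC. Qed.

Definition fcut (r : R) (y : Y) : R := \prod_i bump (r^-1 * fco b i y).

Lemma smooth_fco i : smooth (fco b i).
Proof. by move=> k; apply: class_C_lin; exact: fco_continuous. Qed.

Lemma smooth_fcut r : smooth (fcut r : Y -> R^o).
Proof.
move=> k; apply: (@class_C_prod R Y k _ _
  (fun i y => bump (r^-1 * fco b i y) : R^o)) => i.
apply: (@class_C_comp_real R Y R^o k (@bump R : R^o -> R^o)
  (fun y => r^-1 * fco b i y : R^o)); first exact: smooth_bump.
apply: (@class_CM R Y k (fun=> r^-1) (fco b i)); last exact: smooth_fco.
exact: class_C_cst.
Qed.

Lemma fcut_ge0 r y : 0 <= fcut r y.
Proof. by apply: prodr_ge0 => i _; exact: bump_ge0. Qed.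

Lemma fcut_le1 r y : fcut r y <= 1.
Proof. by apply: prodr_ile1 => i _; rewrite bump_ge0 bump_le1. Qed.

Lemma fcut1 r y : 0 < r -> fbox r y -> fcut r y = 1.
Proof.
move=> r0 Hy; rewrite /fcut big1// => i _; apply: bump1.
by rewrite fco_scale_norm// ler_pdivrMr// mul1r.
Qed.

Lemma fcut0 r y : 0 < r -> ~ fbox (2 * r) y -> fcut r y = 0.
Proof.
move=> r0 /existsNP[i /negP]; rewrite -ltNge => Hi.
rewrite /fcut (bigD1 i)//= bump0 ?mul0r//.
by rewrite fco_scale_norm// ler_pdivlMr// ltW.
Qed.

Lemma near_not_fbox r y : ~ fbox r y -> \forall z \near y, ~ fbox r z.
Proof.
move=> H; have /open_nbhs_nbhs : open_nbhs y (~` fbox r).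
  by split=> //; rewrite openC; exact: closed_fbox.
by [].
Qed.

Lemma diff_fcut_out r y v : 0 < r -> ~ fbox (2 * r) y -> 'd (fcut r : Y -> R^o) y v = 0.
Proof.
move=> r0 Hy; apply: (@diff_near_cst _ _ _ _ _ 0).
  exact: smooth_differentiable (smooth_fcut r).
by apply: filterS (near_not_fbox Hy) => z; exact: fcut0.
Qed.

(* [g] is constant on rays outside of a box, so its values are taken in the box. *)
Lemma test_scalar_bounded (g : Y -> R^o) : test_scalar g ->
  exists2 B : R, 0 <= B & forall y, `|g y| <= B.
Proof.
move=> [sg /compact_fbox_sub[r r0 Kr]].
have dg y v : ~ fbox r y -> 'd g y v = 0.
  move=> H; apply/eqP/negP => /negP Hd; apply: H; apply: Kr.
  by apply: subset_closure; exists v.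
have [B B0 HB] := bounded_on_compact (smooth_continuous sg) (@compact_fbox r).
exists B => // y; have [/HB//|Hy] := pselect (fbox r y).
pose S := [set s : R | 0 <= s <= 1 /\ fbox r (s *: y)].
have S1 s : S s -> s <= 1 by case=> /andP[].
have S0 : S 0.
  split; first by rewrite lexx ler01.
  by move=> i; rewrite scale0r linear0 normr0 ltW.
have cS : compact S.
  have E : S = `[0, 1]%classic `&` (fun s : R => s *: y) @^-1` (fbox r).
    by apply/seteqP; split=> t /=; rewrite in_itv.
  apply: (@subclosed_compact R S `[0, 1]%classic); last by rewrite E => t [].
    rewrite E; apply: closedI; first exact: interval_closed.
    apply: closed_comp; last exact: closed_fbox.
    by move=> t _; exact: scalel_continuous.
  exact: segment_compact.
have [s Ss smax] := @compact_EVT_max R R id S (ex_intro _ 0 S0) cS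
  (continuous_subspaceT (fun x => cvg_id)).
rewrite inE in Ss.
have [/andP[s0 s1] Hs] := Ss.
have := MVT_line (s *: y) ((1 - s) *: y) (fun x => smooth_differentiable x sg).
move=> [t /andP[t0 t1]].
have -> : s *: y + (1 - s) *: y = y by rewrite -scalerDl addrC subrK scale1r.
rewrite scalerA -scalerDl dg.
  by move/eqP; rewrite subr_eq0 => /eqP ->; exact: HB.
move=> Hbox.
have slt1 : s < 1.
  by rewrite lt_neqAle s1 andbT; apply/eqP => s1'; apply: Hy; move: Hs; rewrite s1' scale1r.
have : S (s + t * (1 - s)).
  split=> //; apply/andP; split.
    by rewrite addr_ge0// mulr_ge0 ?subr_ge0// ltW.
  have : t * (1 - s) <= 1 * (1 - s) by apply: ler_wpM2r; rewrite ?subr_ge0// ltW.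
  lra.
move=> /mem_set/smax; rewrite /= gerDl leNgt => /negP; apply.
by rewrite mulr_gt0// subr_gt0.
Qed.

End frame_theory.

(** * Integration with respect to outer measures *)

Section outer_integral.
Variables (R : realType) (T : pointedType).
Variable mu : {outer_measure set T -> \bar R}.
Local Notation cT := (caratheodory_type mu).
Local Notation muM := (mu : set cT -> \bar R).
Implicit Types f g : T -> R.

Definition omeas f : Prop := measurable_fun [set: cT] (f : cT -> R).

Definition ointeg f : Prop := muM.-integrable setT (EFin \o f).

Definition oI f : R := oRint mu setT f.

Lemma null_caratheodory N : mu N = 0%E -> mu.-caratheodory N.
Proof.
move=> N0; apply: le_caratheodory_measurable => X /=.
rewrite (_ : mu (X `&` N) = 0%E) ?add0e; last first.
  by apply/eqP; rewrite eq_le outer_measure_ge0 andbT -N0 le_outer_measure.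
by rewrite le_outer_measure.
Qed.

Lemma null_sub N N' : N `<=` N' -> mu N' = 0%E -> mu N = 0%E.
Proof.
by move=> NN' N0; apply/eqP; rewrite eq_le outer_measure_ge0 andbT -N0 le_outer_measure.
Qed.

(** Completeness of the Caratheodory sigma-algebra. This is the means of passing from partial
    functions and relatively open sets to total functions and open sets. *)
Lemma caratheodory_null_eq A B N : mu N = 0%E -> A `\` N = B `\` N ->
  mu.-caratheodory A -> mu.-caratheodory B.
Proof.
move=> N0 AB mA.
have -> : B = (A `\` N) `|` (B `&` N).
  by rewrite AB setUC; apply/seteqP; split=> x /=; [case: (pselect (N x)); tauto|tauto].
apply: caratheodory_measurable_setU.
  by apply: caratheodory_measurable_setD => //; exact: null_caratheodory.
by apply: null_caratheodory; apply: null_sub N0 => x [].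
Qed.

Lemma null_bigcup (N : nat -> set T) : (forall k, mu (N k) = 0%E) ->
  mu (\bigcup_k N k) = 0%E.
Proof.
move=> N0; apply/eqP; rewrite eq_le outer_measure_ge0 andbT.
apply: le_trans (outer_measure_sigma_subadditive mu N) _.
by rewrite eseries0// => i _ _; rewrite N0.
Qed.

Lemma null_setU (N N' : set T) : mu N = 0%E -> mu N' = 0%E -> mu (N `|` N') = 0%E.
Proof.
move=> H H'; apply/eqP; rewrite eq_le outer_measure_ge0 andbT.
by have := outer_measureU2 mu N N'; rewrite H H' adde0.
Qed.

Lemma omeasP f : omeas f <->
  forall O : set R, open O -> mu.-caratheodory (f @^-1` O).
Proof.
split=> [mf O oO|H].
  by rewrite -[_ @^-1` _]setTI; apply: mf => //; exact: open_measurable.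
apply: (measurability (@RGenOInfty.G R)); first exact: RGenOInfty.measurableE.
move=> _ [_ [x ->] <-]; rewrite setTI; apply: H.
exact: interval_open.
Qed.

Lemma omeas_null f g N : mu N = 0%E -> (forall x, ~ N x -> f x = g x) ->
  omeas f -> omeas g.
Proof.
move=> N0 fg /omeasP mf; apply/omeasP => O oO.
apply: (@caratheodory_null_eq (f @^-1` O) _ N) => //; last exact: mf.
by apply/seteqP; split=> x [Hx Nx]; split=> //; move: Hx; rewrite /= fg.
Qed.

Lemma omeas_cst c : omeas (fun=> c).
Proof. exact: measurable_cst. Qed.

Lemma omeasD f g : omeas f -> omeas g -> omeas (fun x => f x + g x).
Proof. exact: measurable_funD. Qed.

Lemma omeasM f g : omeas f -> omeas g -> omeas (fun x => f x * g x).
Proof. exact: measurable_funM. Qed.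

Lemma omeasB f g : omeas f -> omeas g -> omeas (fun x => f x - g x).
Proof. exact: measurable_funB. Qed.

Lemma omeas_norm f : omeas f -> omeas (fun x => `|f x|).
Proof. by move=> mf; apply: (measurableT_comp (@normr_measurable R setT) mf). Qed.

Lemma omeas_comp f (h : R -> R) : continuous h -> omeas f -> omeas (fun x => h (f x)).
Proof.
move=> ch /omeasP mf; apply/omeasP => O oO.
rewrite (_ : _ @^-1` O = f @^-1` (h @^-1` O))//; apply: mf.
by apply: open_comp => // x _; exact: ch.
Qed.

Lemma omeas_sum (I : Type) (s : seq I) (F : I -> T -> R) :
  (forall i, omeas (F i)) -> omeas (fun x => \sum_(i <- s) F i x).
Proof. by move=> H; exact: (measurable_sum s H). Qed.

Lemma omeas_indic A : mu.-caratheodory A -> omeas (\1_A : T -> R).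
Proof. by move=> mA; exact: (@measurable_indic _ cT R setT A). Qed.

Lemma omeas_cvg (F : nat -> T -> R) f : (forall k, omeas (F k)) ->
  (forall x, (F ^~ x) @ \oo --> f x) -> omeas f.
Proof. by move=> mF H; apply: (@measurable_fun_cvg _ cT R setT F) => // x _; exact: H. Qed.

Lemma ointeg_meas f : ointeg f -> omeas f.
Proof. by move=> /integrableP[/measurable_EFinP]. Qed.

Lemma ointegP f : ointeg f <->
  omeas f /\ (oint mu setT (fun x => `|f x|%:E) < +oo)%E.
Proof.
split=> [/integrableP[/measurable_EFinP mf H]|[mf H]]; first by split.
by apply/integrableP; split=> //; exact/measurable_EFinP.
Qed.

Lemma le_ointeg f g : omeas f -> ointeg g -> (forall x, `|f x| <= g x) -> ointeg f.
Proof.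
move=> mf ig fg; apply: (le_integrable measurableT _ _ ig).
  exact/measurable_EFinP.
by move=> x _ /=; rewrite lee_fin; apply: (le_trans (fg x)); exact: ler_norm.
Qed.

Lemma ointegD f g : ointeg f -> ointeg g -> ointeg (fun x => f x + g x).
Proof. by move=> H1 H2; exact: (integrableD measurableT H1 H2). Qed.

Lemma ointegB f g : ointeg f -> ointeg g -> ointeg (fun x => f x - g x).
Proof. by move=> H1 H2; exact: (integrableB measurableT H1 H2). Qed.

Lemma ointegZ c f : ointeg f -> ointeg (fun x => c * f x).
Proof. by move=> H; exact: (integrableZl measurableT c H). Qed.

Lemma ointeg_norm f : ointeg f -> ointeg (fun x => `|f x|).
Proof. by move=> H; exact: (integrable_abse H). Qed.

Lemma ointeg0 : ointeg (fun=> 0).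
Proof. exact: (integrable0 muM setT). Qed.

Lemma ointeg_sum (I : Type) (s : seq I) (F : I -> T -> R) :
  (forall i, ointeg (F i)) -> ointeg (fun x => \sum_(i <- s) F i x).
Proof.
move=> H; elim: s => [|i s IH].
  by rewrite (_ : (fun _ => _) = fun=> 0); [exact: ointeg0|apply/funext => x; rewrite big_nil].
rewrite (_ : (fun _ => _) = fun x => F i x + \sum_(i <- s) F i x).
  exact: ointegD.
by apply/funext => x; rewrite big_cons.
Qed.

Lemma ointeg_indic A : mu.-caratheodory A -> (mu A < +oo)%E -> ointeg (\1_A : T -> R).
Proof.
move=> mA Aoo; apply/ointegP; split; first exact: omeas_indic.
rewrite /oint (eq_integral (fun x : cT => (\1_A x)%:E)); last first.
  by move=> x _; rewrite ger0_norm.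
by rewrite integral_indic// setIT.
Qed.

Lemma ointeg_bounded f A B : omeas f -> mu.-caratheodory A -> (mu A < +oo)%E ->
  (forall x, A x -> `|f x| <= B) -> (forall x, ~ A x -> f x = 0) -> ointeg f.
Proof.
move=> mf mA Aoo fB f0.
apply: (@le_ointeg f (fun x => B * \1_A x)) => //.
  exact: (ointegZ B (ointeg_indic mA Aoo)).
move=> x; rewrite indicE; case: (asboolP (A x)) => Ax.
  by rewrite mem_set// mulr1; exact: fB.
by rewrite memNset// mulr0 f0// normr0.
Qed.

Lemma eq_oI f g : f =1 g -> oI f = oI g.
Proof. by move=> /funext ->. Qed.

Lemma oI0 : oI (fun=> 0) = 0.
Proof. by rewrite /oI /oRint /oint integral0. Qed.

Lemma oID f g : ointeg f -> ointeg g -> oI (fun x => f x + g x) = oI f + oI g.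
Proof. by move=> H1 H2; exact: (RintegralD measurableT H1 H2). Qed.

Lemma oIB f g : ointeg f -> ointeg g -> oI (fun x => f x - g x) = oI f - oI g.
Proof. by move=> H1 H2; exact: (RintegralB measurableT H1 H2). Qed.

Lemma oIZ c f : ointeg f -> oI (fun x => c * f x) = c * oI f.
Proof. by move=> H; exact: (@RintegralZl _ cT R muM setT f c measurableT H). Qed.

Lemma oI_sum (I : Type) (s : seq I) (F : I -> T -> R) : (forall i, ointeg (F i)) ->
  oI (fun x => \sum_(i <- s) F i x) = \sum_(i <- s) oI (F i).
Proof.
move=> H; elim: s => [|i s IH].
  rewrite big_nil -[RHS]oI0; apply: eq_oI => x; exact: big_nil.
rewrite big_cons -IH -oID//; last exact: ointeg_sum.
by apply: eq_oI => x; rewrite big_cons.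
Qed.

Lemma le_oI f g : ointeg f -> ointeg g -> (forall x, f x <= g x) -> oI f <= oI g.
Proof. by move=> H1 H2 H; exact: (le_Rintegral measurableT H1 H2 (fun x _ => H x)). Qed.

Lemma oI_ge0 f : (forall x, 0 <= f x) -> 0 <= oI f.
Proof. by move=> H; exact: (@Rintegral_ge0 _ cT R muM setT f). Qed.

Lemma le_norm_oI f : ointeg f -> `|oI f| <= oI (fun x => `|f x|).
Proof. by move=> H; exact: (le_normr_Rintegral measurableT H). Qed.

Lemma norm_oI_le f g : omeas f -> ointeg g -> (forall x, `|f x| <= g x) ->
  `|oI f| <= oI g.
Proof.
move=> mf ig H; have iF := le_ointeg mf ig H.
apply: (le_trans (le_norm_oI iF)); apply: le_oI => //; exact: ointeg_norm.
Qed.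

Lemma ointE f : ointeg f -> oint mu setT (EFin \o f) = (oI f)%:E.
Proof. by move=> H; rewrite /oI /oRint fineK//; exact: integrable_fin_num. Qed.

Lemma oI_indic A : mu.-caratheodory A -> (mu A < +oo)%E ->
  (oI (\1_A : T -> R))%:E = mu A.
Proof.
move=> mA Aoo; rewrite -ointE; last exact: ointeg_indic.
by rewrite /oint integral_indic// setIT.
Qed.

Lemma ointeg_null f g N : mu N = 0%E -> (forall x, ~ N x -> f x = g x) ->
  ointeg f -> ointeg g.
Proof.
move=> N0 fg iF; have mg := omeas_null N0 fg (ointeg_meas iF).
have mN : measurable (N : set cT) by exact: null_caratheodory.
apply: (@integrableS _ cT R muM setT) => //.
have H : muM.-integrable (setT `\` N) (EFin \o g).
  apply: (@eq_integrable _ cT R muM _ _ (EFin \o f)).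
  - exact: measurableD.
  - by move=> x; rewrite inE => -[_ Nx] /=; rewrite fg.
  - by apply: integrableS iF => //; exact: measurableD.
apply/(@negligible_integrable _ cT R muM setT N (EFin \o g)) => //.
exact/measurable_EFinP.
Qed.

Lemma oI_null f g N : mu N = 0%E -> (forall x, ~ N x -> f x = g x) ->
  omeas f -> oI f = oI g.
Proof.
move=> N0 fg mf; have mg := omeas_null N0 fg mf.
congr fine; apply: (@ae_eq_integral _ cT R muM (setT : set cT)) => //.
- exact/measurable_EFinP.
- exact/measurable_EFinP.
exists N; split => //; first exact: null_caratheodory.
by move=> x /= /not_implyP[_ H]; apply: contrapT => Nx; apply: H; rewrite /= fg.
Qed.

Lemma oRint_null f D : mu (~` D) = 0%E -> omeas f -> oRint mu D f = oI f.
Proof.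
move=> D0 mf; rewrite /oRint /oint integral_mkcond.
transitivity (oI (f \_ D)).
  by congr fine; apply: eq_integral => x _; rewrite restrict_EFin.
apply: (@oI_null _ _ (~` D)) => // [x /contrapT Dx|].
  by rewrite patchE mem_set.
apply: (omeas_null D0) mf => x /contrapT Dx.
by rewrite patchE mem_set.
Qed.

Lemma oI_dominated (F : nat -> T -> R) f g N : mu N = 0%E ->
    (forall k, omeas (F k)) -> omeas f -> ointeg g ->
    (forall x, ~ N x -> (F ^~ x) @ \oo --> f x) ->
    (forall k x, ~ N x -> `|F k x| <= g x) ->
  [/\ ointeg f, (fun k => oI (F k)) @ \oo --> oI f &
    (fun k => oI (fun x => `|F k x - f x|)) @ \oo --> (0 : R)].
Proof.
move=> N0 mF mf ig Ff Fg.
have mN : measurable (N : set cT) by exact: null_caratheodory.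
have H1 : {ae muM, forall x, setT x -> (EFin \o F ^~ x) @ \oo --> (EFin \o f) x}.
  exists N; split=> // x /= /not_implyP[_ H]; apply: contrapT => Nx; apply: H.
  by apply/fine_cvgP; split; [near=> k|exact: Ff].
have H2 : {ae muM, forall x n, setT x -> (`|(EFin \o F n) x| <= (EFin \o g) x)%E}.
  exists N; split=> // x /= H; apply: contrapT => Nx; apply: H => k _.
  by rewrite lee_fin; exact: Fg.
have [iF c1 c2] := @dominated_convergence _ cT R muM setT measurableT
  (fun k => EFin \o F k) (EFin \o f) (EFin \o g)
  (fun k => (measurable_EFinP _ _).2 (mF k)) ((measurable_EFinP _ _).2 mf) H1 ig H2.
have iFk k : ointeg (F k).
  pose g' x := if `[< N x >] then `|F k x| else g x.
  apply: (@ointeg_null (fun x => if `[< N x >] then 0 else F k x) _ N) => //.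
    by move=> x Nx; case: asboolP.
  apply: (@le_ointeg _ (fun x => `|g x|)); last first.
  - by move=> x; case: asboolP => Nx; rewrite ?normr0//; apply: le_trans (Fg k x Nx) (ler_norm _).
  - exact: ointeg_norm.
  - by apply: (@omeas_null (F k) _ N) => // x Nx; case: asboolP.
have c2' : (fun k => oint mu setT (EFin \o F k)) @ \oo --> (oI f)%:E.
  by rewrite -(ointE iF); exact: c2.
have c1' : (fun k => oint mu setT (EFin \o (fun x => `|F k x - f x|))) @ \oo --> 0%:E.
  exact: c1.
by split=> //; [exact: fine_cvg c2'|exact: fine_cvg c1'].
Unshelve. all: by end_near. Qed.

Lemma oI_norm_eq0 f : ointeg f -> oI (fun x => `|f x|) = 0 -> mu [set x | f x <> 0] = 0%E.
Proof.
move=> iF H.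
have H0 : (\int[muM]_x `|(EFin \o f) x| = 0)%E.
  exact: etrans (ointE (ointeg_norm iF)) (congr1 EFin H).
have mf : measurable_fun [set: cT] (EFin \o f).
  by apply/measurable_EFinP; exact: ointeg_meas.
have [A [mA A0 HA]] := (@ae_eq_integral_abs _ cT R muM setT measurableT _ mf).1 H0.
apply: (null_sub _ A0) => x Hx; apply: HA => /= H2; apply: Hx.
by have [] := H2 I.
Qed.

End outer_integral.

Section lipschitz_functional.
Variables (R : realType) (W : Type) (D : set W) (T : W -> R) (d : W -> W -> R).

(* McShane's formula *)
Lemma extend_functional (a w0 : W) : D w0 ->
    (forall v w, D v -> D w -> T v - T w <= d a v + d a w) ->
  exists t : R, forall w, D w -> `|t - T w| <= d a w.
Proof.
move=> Dw0 H; pose E := [set T w - d a w | w in D].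
have E0 : E !=set0 by exists (T w0 - d a w0); exists w0.
have ubE v : D v -> ubound E (T v + d a v).
  by move=> Dv _ [w Dw <-]; have := H w v Dw Dv; lra.
have supE : has_sup E by split=> //; exists (T w0 + d a w0); exact: ubE.
exists (sup E) => w Dw; rewrite ler_norml; apply/andP; split.
  rewrite lerBrDr addrC; apply: (sup_upper_bound supE); by exists w.
by rewrite lerBlDl; apply: ge_sup => //; exact: ubE.
Qed.

End lipschitz_functional.

(** * Measurability with respect to Radon measures *)

Section radon_measurability.
Variables (R : realType) (T : ptopologicalType) (S : set T).
Variable mu : {outer_measure set T -> \bar R}.
Hypothesis radon_mu : radon_over S mu.

(** Measurability is given for relatively open sets; what an open set of the ambient space has
    outside of [S] is null. *)
Lemma radon_open O : open O -> mu.-caratheodory O.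
Proof.
move=> oO; have [N0 H _ _ _] := radon_mu.
apply: (@caratheodory_null_eq R T mu (S `&` O) O (~` S)) => //; last first.
  by apply: H; exists O.
by apply/seteqP; split=> x [] => [[Sx Ox] nSx|Ox /contrapT Sx]; split=> //; apply.
Qed.

Lemma radon_closed C : closed C -> mu.-caratheodory C.
Proof.
move=> cC; rewrite -(setCK C); apply: caratheodory_measurable_setC.
by apply: radon_open; rewrite openC.
Qed.

Lemma radon_continuous (f : T -> R) : continuous f -> omeas mu f.
Proof.
move=> cf; apply/omeasP => O oO; apply: radon_open.
by apply: open_comp => // x _; exact: cf.
Qed.

Lemma radon_compact K : compact K -> K `<=` S -> (mu K < +oo)%E.
Proof. by have [_ _ H _ _] := radon_mu; exact: H. Qed.

End radon_measurability.

(** * Test functions and densities of functionals *)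

Section euclidean_cutoff.
Variables (R : realType) (n : nat).
Implicit Types (U K C O : set 'rV[R]_n) (phi : 'rV[R]_n -> R).

Definition test_fun U : set ('rV[R]_n -> R) :=
  [set phi | [/\ smooth (phi : 'rV[R]_n -> R^o), compact (supp phi) & supp phi `<=` U]].

Definition cube_bump (a : 'rV[R]_n) (r : R) (x : 'rV[R]_n) : R :=
  \prod_i bump (r^-1 * (x 0 i - a 0 i)).

Lemma smooth_cube_bump a r : smooth (cube_bump a r : 'rV[R]_n -> R^o).
Proof.
move=> k; apply: (@class_C_prod R _ k _ _
  (fun i (x : 'rV[R]_n) => bump (r^-1 * (x 0 i - a 0 i)) : R^o)) => i.
apply: (@class_C_comp_real R _ R^o k (@bump R : R^o -> R^o)
  (fun x : 'rV[R]_n => r^-1 * (x 0 i - a 0 i) : R^o)); first exact: smooth_bump.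
apply: (@class_CM R _ k (fun=> r^-1) (fun x : 'rV[R]_n => x 0 i - a 0 i : R^o)).
  exact: class_C_cst.
by apply: class_CB; [exact: smooth_coord|exact: class_C_cst].
Qed.

Lemma cube_bump_ge0 a r x : 0 <= cube_bump a r x.
Proof. by apply: prodr_ge0 => i _; exact: bump_ge0. Qed.

Lemma cube_bump_le1 a r x : cube_bump a r x <= 1.
Proof. by apply: prodr_ile1 => i _; rewrite bump_ge0 bump_le1. Qed.

Lemma scaled_coord_norm r (t : R) : 0 < r -> `|r^-1 * t| = `|t| / r.
Proof. by move=> r0; rewrite normrM normfV (gtr0_norm r0) mulrC. Qed.

Lemma cube_bump1 a r x : 0 < r -> `|x - a| <= r -> cube_bump a r x = 1.
Proof.
move=> r0 Hx; rewrite /cube_bump big1// => i _; apply: bump1.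
rewrite scaled_coord_norm// ler_pdivrMr// mul1r.
by have := rV_coord_le (x - a) i; rewrite !mxE => /le_trans; apply.
Qed.

Lemma cube_bump0 a r x : 0 < r -> 2 * r < `|x - a| -> cube_bump a r x = 0.
Proof.
move=> r0 Hx; have [i Hi] : exists i, 2 * r < `|(x - a) 0 i|.
  apply: contrapT => /forallNP H; move: Hx; rewrite ltNge => /negP; apply.
  apply: rV_norm_le; first by rewrite mulr_ge0// ltW.
  by move=> i; have /negP := H i; rewrite -leNgt.
rewrite /cube_bump (bigD1 i)//= bump0 ?mul0r// scaled_coord_norm// ler_pdivlMr//.
by move: Hi; rewrite !mxE => /ltW.
Qed.

Lemma closed_ball_norm (a : 'rV[R]_n) r : closed [set x | `|x - a| <= r].
Proof.
have -> : [set x : 'rV[R]_n | `|x - a| <= r] = (fun x => `|x - a|) @^-1` [set t : R | t <= r].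
  by [].
apply: closed_comp; last exact: closed_le.
have c : continuous (fun x : 'rV[R]_n => x - a).
  by move=> x; apply: (@continuousB R 'rV[R]_n 'rV[R]_n); [exact: cvg_id|exact: cst_continuous].
move=> x _; apply: (@continuous_comp _ _ _ (fun x : 'rV[R]_n => x - a) Num.norm).
  exact: c.
exact: norm_continuous.
Qed.

Lemma compact_ball_norm (a : 'rV[R]_n) r : compact [set x | `|x - a| <= r].
Proof.
apply: bounded_closed_compact; last exact: closed_ball_norm.
exists (r + `|a|); split; first exact: num_real.
move=> M HM x /= Hx; rewrite -(subrK a x).
by apply: (le_trans (ler_normD _ _)); apply: le_trans (ltW HM); rewrite lerD2r.
Qed.

Lemma supp_subset (T : topologicalType) (Y : zmodType) (f : T -> Y) (A : set T) :
  closed A -> (forall x, ~ A x -> f x = 0) -> supp f `<=` A.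
Proof.
move=> cA H; rewrite /supp closureE => x; apply; split=> // y /eqP fy.
by apply: contrapT => /H.
Qed.

Lemma supp_out (T : topologicalType) (Y : zmodType) (f : T -> Y) x :
  ~ supp f x -> f x = 0.
Proof.
by move=> H; apply/eqP/negP => /negP fx; apply: H; exact: subset_closure.
Qed.

Lemma closed_supp (T : topologicalType) (Y : zmodType) (f : T -> Y) : closed (supp f).
Proof. exact: closed_closure. Qed.

Lemma supp_subset_closed_compact (Y : zmodType) (f : 'rV[R]_n -> Y) K :
  compact K -> (forall x, ~ K x -> f x = 0) -> compact (supp f) /\ supp f `<=` K.
Proof.
move=> cK H; have cl : closed K by apply: compact_closed => //; exact: norm_hausdorff.
have sK := supp_subset cl H; split=> //.
exact: (subclosed_compact (@closed_supp _ _ f) cK).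
Qed.

(** Finitely many bumps cover [C]. One minus the product of the factors 1 - bump is 1 wherever some
    bump is 1 and vanishes wherever all of them do. *)
Lemma smooth_urysohn C O : compact C -> open O -> C `<=` O ->
  exists phi, [/\ test_fun O phi, forall x, 0 <= phi x <= 1 &
    forall x, C x -> phi x = 1].
Proof.
move=> cC oO CO.
have Hr a : exists r : R, 0 < r /\ (C a -> [set x | `|x - a| <= 2 * r] `<=` O).
  have [Ca|Ca] := pselect (C a); last by exists 1.
  have /nbhs_ballP[e /= e0 He] : nbhs a O by apply: open_nbhs_nbhs; split=> //; exact: CO.
  exists (e / 3); split=> [|_ x /= Hx]; first by rewrite divr_gt0.
  apply: He; rewrite -ball_normE /= distrC; apply: (le_lt_trans Hx); lra.
have [r rP] := choice Hr.
have := cC; rewrite compact_cover.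
move=> /(_ _ C (fun a => ball a (r a)) (fun a _ => ball_open a (r a))).
move=> [x Cx|D DC Dcov].
  by exists x => //; exact: ballxx (rP x).1.
pose s : seq 'rV[R]_n := finmap.enum_fset D.
have sC a : a \in s -> C a by move=> aD; exact: set_mem (DC a aD).
have scov x : C x -> exists2 a, a \in s & ball a (r a) x.
  by move=> /Dcov[a /= aD Hx]; exists a.
pose phi x : R := 1 - \prod_(a <- s) (1 - cube_bump a (r a) x).
pose K := \bigcup_(a in [set` s]) [set x | `|x - a| <= 2 * r a].
have cK : compact K.
  rewrite /K bigcup_seq; elim/big_ind : _ => //.
  - exact: compact0.
  - exact: compactU.
  - by move=> a _; exact: compact_ball_norm.
have KO : K `<=` O.
  by move=> x [a /= aD Hx]; apply: (rP a).2 => //; exact: sC.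
have out x : ~ K x -> phi x = 0.
  move=> Hx; rewrite /phi big_seq big1 ?subrr// => a aD.
  rewrite cube_bump0 ?subr0//; first exact: (rP a).1.
  by rewrite ltNge; apply/negP => Hle; apply: Hx; exists a.
have [cs sK] := supp_subset_closed_compact cK out.
exists phi; split.
- split=> //; last exact: subset_trans KO.
  move=> k; apply: class_CB; first exact: class_C_cst.
  apply: (@class_C_prod R _ k _ _ (fun a x => 1 - cube_bump a (r a) x : R^o)) => a.
  by apply: class_CB; [exact: class_C_cst|exact: smooth_cube_bump].
- move=> x; have p0 : 0 <= \prod_(a <- s) (1 - cube_bump a (r a) x).
    by apply: prodr_ge0 => a _; rewrite subr_ge0 cube_bump_le1.
  have p1 : \prod_(a <- s) (1 - cube_bump a (r a) x) <= 1.
    apply: prodr_ile1 => a _; rewrite subr_ge0 cube_bump_le1/=.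
    by rewrite lerBlDr lerDl cube_bump_ge0.
  by rewrite /phi; apply/andP; split; lra.
- move=> x /scov [a aD Hx].
  rewrite /phi (big_rem a)//= cube_bump1 ?subrr ?mul0r ?subr0//; first exact: (rP a).1.
  by move: Hx; rewrite -ball_normE /= distrC => /ltW.
Qed.

End euclidean_cutoff.

Section test_functions.
Variables (R : realType) (n : nat) (U : set 'rV[R]_n).
Implicit Types (phi psi : 'rV[R]_n -> R).

Lemma test_fun_of_out phi K : smooth (phi : 'rV[R]_n -> R^o) -> compact K ->
  K `<=` U -> (forall x, ~ K x -> phi x = 0) -> test_fun U phi.
Proof.
move=> sphi cK KU H; have [cs sK] := supp_subset_closed_compact cK H.
by split=> //; exact: subset_trans KU.
Qed.

Lemma test_fun_smooth phi : test_fun U phi -> smooth (phi : 'rV[R]_n -> R^o).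
Proof. by case. Qed.

Lemma test_fun0 : test_fun U (fun=> 0).
Proof.
apply: (@test_fun_of_out _ set0) => //; last exact: compact0.
by move=> k; exact: class_C_cst.
Qed.

Lemma test_funM phi psi : smooth (phi : 'rV[R]_n -> R^o) -> test_fun U psi ->
  test_fun U (fun x => phi x * psi x).
Proof.
move=> sphi [spsi cpsi Upsi]; apply: (@test_fun_of_out _ (supp psi)) => //.
  by move=> k; apply: (@class_CM R _ k phi psi).
by move=> x /supp_out ->; rewrite mulr0.
Qed.

Lemma test_funZ c psi : test_fun U psi -> test_fun U (fun x => c * psi x).
Proof. by apply: (@test_funM (fun=> c)) => k; exact: class_C_cst. Qed.

Lemma test_funD phi psi : test_fun U phi -> test_fun U psi ->
  test_fun U (fun x => phi x + psi x).
Proof.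
move=> [s1 c1 U1] [s2 c2 U2].
apply: (@test_fun_of_out _ (supp phi `|` supp psi)).
- by move=> k; apply: (@class_CD R _ _ k phi psi).
- exact: compactU.
- by move=> x [/U1|/U2].
- by move=> x /not_orP[/supp_out -> /supp_out ->]; rewrite addr0.
Qed.

Lemma test_funB phi psi : test_fun U phi -> test_fun U psi ->
  test_fun U (fun x => phi x - psi x).
Proof.
move=> H1 H2; have := test_funD H1 (test_funZ (-1) H2).
by congr test_fun; apply/funext => x; rewrite mulN1r.
Qed.

Lemma test_fun_bounded phi : test_fun U phi ->
  exists2 B : R, 0 <= B & forall x, `|phi x| <= B.
Proof.
move=> [sp cp _].
have [B B0 HB] := @bounded_on_compact R _ R^o phi _ (smooth_continuous sp) cp.
exists B => // x; have [/HB//|/supp_out ->] := pselect (supp phi x).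
by rewrite normr0.
Qed.

End test_functions.

(** * Exhaustion of an open set by compact sets *)

Section exhaustion.
Variables (R : realType) (n : nat) (U : set 'rV[R]_n).

Definition cpt_exh (j : nat) : set 'rV[R]_n :=
  [set x | `|x| <= j%:R /\ forall y, `|y - x| < j.+1%:R^-1 -> U y].

Lemma cpt_exh_sub j : cpt_exh j `<=` U.
Proof. by move=> x [_]; apply; rewrite subrr normr0 invr_gt0 ltr0n. Qed.

Lemma compact_cpt_exh j : compact (cpt_exh j).
Proof.
apply: (@subclosed_compact _ _ [set x : 'rV[R]_n | `|x - 0| <= j%:R]).
- have -> : cpt_exh j = [set x : 'rV[R]_n | `|x - 0| <= j%:R] `&`
      \bigcap_(y in ~` U) ~` [set x : 'rV[R]_n | `|x - y| < j.+1%:R^-1].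
    apply/seteqP; split=> [x [H1 H2]|x [H1 H2]]; split; rewrite /= ?subr0// in H1 *.
      by move=> y Uy Hxy; apply: Uy; apply: H2; rewrite distrC.
    by move=> y Hy; apply: contrapT => Uy; apply: (H2 y Uy); rewrite /= distrC.
  apply: closedI; first exact: closed_ball_norm.
  apply: closed_bigI => y _; apply: open_closedC.
  have -> : [set x : 'rV[R]_n | `|x - y| < j.+1%:R^-1] = ball y j.+1%:R^-1.
    by apply/seteqP; split=> x; rewrite -ball_normE /= distrC.
  exact: ball_open.
- exact: compact_ball_norm.
- by move=> x [H _]; rewrite /= subr0.
Qed.

Lemma cpt_exh_cover K : open U -> compact K -> K `<=` U -> exists j, K `<=` cpt_exh j.
Proof.
move=> oU /compact_near_coveringP cK KU.
have H : forall x, K x -> \forall x' \near x & j \near \oo, cpt_exh j x'.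
  move=> x Kx.
  have /nbhs_ballP[e /= e0 He] : nbhs x U by apply: open_nbhs_nbhs; split=> //; exact: KU.
  near=> x' j => /=; split.
    apply: (@le_trans _ _ (`|x| + 1)).
      rewrite -lerBlDl; apply: (le_trans (lerB_dist _ _)).
      by rewrite distrC; near: x'; apply: cvgr_dist_le => //; exact: cvg_id.
    near: j; exact: nbhs_infty_ger.
  move=> y Hy; apply: He; rewrite -ball_normE /=.
  apply: (le_lt_trans (ler_distD x' _ _)).
  rewrite [ltRHS](splitr e); apply: ltr_leD.
    by near: x'; apply: cvgr_dist_lt; [exact: cvg_id|rewrite divr_gt0].
  rewrite distrC; apply: (le_trans (ltW Hy)).
  near: j; exists (Num.bound (2 / e)) => // j /= Hj.
  rewrite -[e / 2]invrK lef_pV2 ?posrE ?ltr0n ?invr_gt0 ?divr_gt0//.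
  rewrite invf_div; apply: (le_trans (ltW (archi_boundP _))).
    by rewrite divr_ge0// ltW.
  by rewrite ler_nat; exact: leqW.
have {H}[j _ Hj] := cK _ _ (fun j x => cpt_exh j x) _ H.
by exists j; apply: Hj => /=.
Unshelve. all: by end_near. Qed.

Lemma cpt_exh_bigcup : open U -> U = \bigcup_j cpt_exh j.
Proof.
move=> oU; apply/seteqP; split=> [x Ux|x [j _ /cpt_exh_sub]//].
have xU : [set x] `<=` U by move=> y ->.
have [j Hj] := cpt_exh_cover oU (@compact_set1 _ x) xU.
by exists j => //; exact: Hj.
Qed.

End exhaustion.

Section bounded_measurable_induction.
Variables (R : realType) (T : pointedType).
Variable mu : {outer_measure set T -> \bar R}.

(** A sum over unit layers: counting the levels below [t] gives a staircase with error at most 1. *)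
Lemma count_lt_approx (N : nat) (t : R) : 0 <= t <= N%:R ->
  t - 1 <= \sum_(j < N) (if j.+1%:R < t then 1 else 0) <= t.
Proof.
move=> /andP[t0 tN].
have H1 M : \sum_(j < M) (if j.+1%:R < t then 1 else 0 : R) <= t.
  elim: M => [|M IH]; first by rewrite big_ord0.
  rewrite big_ord_recr /=; case: ifP => [Ht|_]; last by rewrite addr0.
  rewrite -natr1 in Ht; apply: le_trans (ltW Ht); rewrite lerD2r.
  rewrite -[leRHS]mul1r mulr_natr -[M in leRHS]card_ord -sumr_const.
  by apply: ler_sum => j _; case: ifP.
have H2 M : Num.min (t - 1) M%:R <= \sum_(j < M) (if j.+1%:R < t then 1 else 0 : R).
  elim: M => [|M IH]; first by rewrite big_ord0 ge_min lexx orbT.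
  rewrite big_ord_recr /= -natr1; case: (ltP (M%:R + 1) t) => Ht.
    have : Num.min (t - 1) M%:R = M%:R by rewrite min_r//; lra.
    move=> E; rewrite E in IH; rewrite ge_min; apply/orP; right.
    by rewrite lerD2r.
  have : Num.min (t - 1) M%:R = t - 1 by rewrite min_l//; lra.
  by move=> E; rewrite E in IH; rewrite addr0 ge_min IH.
rewrite H1 andbT; apply: le_trans (H2 N).
by rewrite le_min lexx/=; lra.
Qed.

(** The range of [f] is rescaled to [0, N], where [count_lt_approx] supplies a combination of
    indicators; so indicators, linear combinations and limits uniform on [K] reach every bounded
    measurable function vanishing off [K]. *)
Lemma bounded_measurable_ind (K : set T) (P : (T -> R) -> Prop) :
  mu.-caratheodory K ->
  (forall A, mu.-caratheodory A -> A `<=` K -> P \1_A) ->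
  (forall f g, P f -> P g -> P (fun x => f x + g x)) ->
  (forall c f, P f -> P (fun x => c * f x)) ->
  (forall f, omeas mu f -> (forall e : R, 0 < e ->
     exists2 g, P g & forall x, `|f x - g x| <= e * \1_K x) -> P f) ->
  forall f (B : R), omeas mu f -> (forall x, `|f x| <= B) ->
    (forall x, ~ K x -> f x = 0) -> P f.
Proof.
move=> mK P1 PD PZ Plim f B0 mf fB0 f0.
pose B := `|B0| + 1; have Bp : 0 < B by rewrite ltr_wpDl.
have fB x : `|f x| <= B.
  by apply: (le_trans (fB0 x)); rewrite /B; have := ler_norm B0; lra.
apply: Plim => // e e0.
pose N := (Num.bound (2 * B / e)).+1.
have N0 : 0 < N%:R :> R by rewrite ltr0n.
have Ne : 2 * B / N%:R <= e.
  rewrite ler_pdivrMr// [leRHS]mulrC -ler_pdivrMr//.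
  apply: (le_trans (ltW (archi_boundP _))); first by rewrite divr_ge0// ?mulr_ge0// ltW.
  by rewrite ler_nat.
(* The affine map from [-B, B] onto [0, N]; a unit layer for [t] has height 2B/N <= e for [f]. *)
pose t x := (f x + B) * (N%:R / (2 * B)).
pose A j := K `&` [set x | j.+1%:R < t x].
have mA j : mu.-caratheodory (A j).
  apply: caratheodory_measurable_setI => //.
  have /omeasP mt : omeas mu t.
    by apply: omeasM; [apply: omeasD => //|]; exact: omeas_cst.
  by have := mt _ (@open_gt R j.+1%:R).
exists (fun x => - B * \1_K x + 2 * B / N%:R * \sum_(j < N) \1_(A j) x).
  apply: (PD _ _); first exact/PZ/P1.
  apply: (PZ _ _); suff HS M : P (fun x => \sum_(j < M) \1_(A j) x) by exact: HS.
  elim: M => [|M IH].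
    rewrite (_ : (fun _ => _) = fun x => 0 * \1_K x); first exact/PZ/P1.
    by apply/funext => x; rewrite big_ord0 mul0r.
  rewrite (_ : (fun _ => _) = fun x => \sum_(j < M) \1_(A j) x + \1_(A M) x).
    by apply: (PD _ _) => //; apply: P1 => //; exact: subIsetl.
  by apply/funext => x; rewrite big_ord_recr.
move=> x; have [Kx|Kx] := pselect (K x); last first.
  rewrite f0// sub0r indicE memNset// !mulr0 add0r big1 ?mulr0 ?oppr0 ?normr0//.
  by move=> j _; rewrite indicE memNset// => -[].
rewrite indicE mem_set// !mulr1.
have -> : \sum_(j < N) \1_(A j) x = \sum_(j < N) (if j.+1%:R < t x then 1 else 0 : R).
  apply: eq_bigr => j _; rewrite indicE; case: ifP => H.
    by rewrite mem_set//; split.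
  by rewrite memNset// => -[_] /=; rewrite H.
have := fB x; rewrite ler_norml => /andP[fx1 fx2].
have t01 : 0 <= t x <= N%:R.
  rewrite /t mulr_ge0 ?divr_ge0 ?mulr_ge0 ?(ltW Bp)//=; last by lra.
  rewrite mulrA ler_pdivrMr ?mulr_gt0// mulrC ler_wpM2l ?(ltW N0)//; lra.
have /andP[s1 s2] := count_lt_approx t01.
set s := \sum_(j < N) _ in s1 s2 *.
have -> : f x - (- B + 2 * B / N%:R * s) = 2 * B / N%:R * (t x - s).
  by rewrite /t; field; rewrite !gt_eqF.
rewrite normrM ger0_norm; last by rewrite divr_ge0// ?mulr_ge0// ltW.
apply: le_trans Ne; rewrite ler_piMr//.
  by rewrite divr_ge0// ?mulr_ge0// ltW.
rewrite ler_norml; apply/andP; split; lra.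
Qed.

End bounded_measurable_induction.

(** * Density of test functions in L_1 of a Radon measure *)

Section radon_density.
Variables (R : realType) (n : nat) (U : set 'rV[R]_n).
Variable mu : {outer_measure set 'rV[R]_n -> \bar R}.
Hypotheses (oU : open U) (radon_mu : radon_over U mu).

(** Inner regularity is available for open sets: an open [G] containing [A] is chosen first, then a
    compact [C] inside [G] rather than inside [A]. A cut-off between [C] and [G] differs from the
    indicator of [A] at most on [G] minus [C] and [G] minus [A]. *)
Lemma radon_indic_approx A K (e : R) : compact K -> K `<=` U -> A `<=` K ->
    mu.-caratheodory A -> 0 < e ->
  exists phi E, [/\ test_fun U phi, forall x, 0 <= phi x <= 1,
    mu.-caratheodory E, (mu E < e%:E)%E & forall x, ~ E x -> phi x = \1_A x].
Proof.
move=> cK KU AK mA e0; have [_ _ _ Hin Hout] := radon_mu.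
have Kfin := radon_compact radon_mu cK KU.
have Afin : mu A \is a fin_num.
  rewrite ge0_fin_numE ?outer_measure_ge0//.
  by apply: le_lt_trans Kfin; exact: le_outer_measure.
have e2 : 0 < e / 2 by rewrite divr_gt0.
have [_ [G [oO AO] <-] muO] : exists2 y,
    [set mu G | G in [set G | rel_open U G /\ A `<=` G]] y & (y < mu A + (e / 2)%:E)%E.
  apply: ereal_inf_lt; rewrite -Hout; last exact: subset_trans KU.
  by rewrite lteDl// lte_fin.
have Ofin : mu G \is a fin_num.
  rewrite ge0_fin_numE ?outer_measure_ge0//; apply: (lt_le_trans muO).
  by rewrite leey.
have [_ [C [cC CO] <-] muC] : exists2 y,
    [set mu K | K in [set K | compact K /\ K `<=` G]] y & (mu G - (e / 2)%:E < y)%E.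
  apply: ereal_sup_gt; rewrite -Hin//.
  by rewrite lteBlDr// lteDl// lte_fin.
have Cfin : mu C \is a fin_num.
  rewrite ge0_fin_numE ?outer_measure_ge0//.
  apply: le_lt_trans (le_outer_measure mu _ _ CO) _.
  by rewrite -ge0_fin_numE ?outer_measure_ge0.
have [G' oO' OE] := oO.
have oO2 : open G by rewrite -OE; exact: openI.
have mO := radon_open radon_mu oO2.
have mC : mu.-caratheodory C.
  by apply: (radon_closed radon_mu); apply: compact_closed => //; exact: norm_hausdorff.
have [phi [tphi phi01 phi1]] := smooth_urysohn cC oO2 CO.
exists phi, ((G `\` C) `|` (G `\` A)); split=> //.
- have [s1 s2 s3] := tphi; split=> //; apply: subset_trans s3 _.
  by rewrite -OE; exact: subIsetl.
- by apply: caratheodory_measurable_setU; apply: caratheodory_measurable_setD.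
- have h1 : (mu (G `\` C) < (e / 2)%:E)%E.
    have := mC G; rewrite (setIidr CO) -setDE => E.
    rewrite E in muC Ofin; move: muC Ofin Cfin.
    have := outer_measure_ge0 mu (G `\` C).
    case: (mu C) => [c||]//; case: (mu (G `\` C)) => [d||]// d0.
    by rewrite -EFinN -!EFinD !lte_fin => + _ _; lra.
  have h2 : (mu (G `\` A) < (e / 2)%:E)%E.
    have := mA G; rewrite (setIidr AO) -setDE => E.
    rewrite E in muO Ofin; move: muO Ofin Afin.
    have := outer_measure_ge0 mu (G `\` A).
    case: (mu A) => [c||]//; case: (mu (G `\` A)) => [d||]// d0.
    by rewrite -!EFinD !lte_fin => + _ _; lra.
  apply: le_lt_trans (outer_measureU2 mu _ _) _.
  by rewrite [e]splitr EFinD; exact: lteD.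
move=> x /not_orP[H1 H2]; rewrite indicE.
have [Ox|Ox] := pselect (G x).
  have Cx : C x by apply: contrapT => nC; apply: H1.
  have Ax : A x by apply: contrapT => nA; apply: H2.
  by rewrite phi1// mem_set.
rewrite memNset; last by move=> /AO.
by apply: supp_out => Hs; apply: Ox; case: tphi => _ _; apply.
Qed.

Lemma test_fun_ointeg phi : test_fun U phi -> ointeg mu phi.
Proof.
move=> tphi; have [sp cp Up] := tphi; have [B B0 HB] := test_fun_bounded tphi.
apply: (@ointeg_bounded _ _ mu _ (supp phi) B).
- exact: (radon_continuous radon_mu (smooth_continuous sp)).
- apply: (radon_closed radon_mu); exact: closed_supp.
- exact: (radon_compact radon_mu).
- by move=> x _; exact: HB.
- by move=> x /supp_out.
Qed.

Lemma cpt_caratheodory K : compact K -> mu.-caratheodory K.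
Proof.
by move=> cK; apply: (radon_closed radon_mu); apply: compact_closed => //; exact: norm_hausdorff.
Qed.

Lemma bounded_ointeg K a (B : R) : compact K -> K `<=` U -> omeas mu a ->
  (forall x, K x -> `|a x| <= B) -> (forall x, ~ K x -> a x = 0) -> ointeg mu a.
Proof.
move=> cK KU ma aB a0; apply: (@ointeg_bounded _ _ mu _ K B) => //.
  exact: cpt_caratheodory.
exact: (radon_compact radon_mu).
Qed.

Lemma radon_L1_approx K a (B e : R) : compact K -> K `<=` U -> omeas mu a ->
    (forall x, `|a x| <= B) -> (forall x, ~ K x -> a x = 0) -> 0 < e ->
  exists2 phi, test_fun U phi & oI mu (fun x => `|phi x - a x|) < e.
Proof.
move=> cK KU ma aB a0.
pose P (a : 'rV[R]_n -> R) := ointeg mu a /\ forall e : R, 0 < e ->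
    exists2 phi, test_fun U phi & oI mu (fun x => `|phi x - a x|) < e.
suff [_ H] : P a by exact: H.
have mK := cpt_caratheodory cK.
have Kfin := radon_compact radon_mu cK KU.
apply: (@bounded_measurable_ind R _ mu K P mK _ _ _ _ a B ma aB a0) => {a B e ma aB a0}.
- move=> A mA AK; have Afin : (mu A < +oo)%E.
    by apply: le_lt_trans Kfin; exact: le_outer_measure.
  split; first exact: ointeg_indic.
  move=> e e0; have [phi [E [tphi phi01 mE muE H]]] := radon_indic_approx cK KU AK mA e0.
  exists phi => //.
  have Efin : (mu E < +oo)%E by apply: (lt_trans muE); rewrite ltry.
  have : oI mu (\1_E : _ -> R) < e by rewrite -lte_fin oI_indic.
  apply: le_lt_trans; apply: le_oI.
  - apply: ointeg_norm; apply: ointegB; [exact: test_fun_ointeg|exact: ointeg_indic].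
  - exact: ointeg_indic.
  - move=> x; rewrite [\1_E x]indicE; case: (asboolP (E x)) => Ex.
      rewrite mem_set// ler_norml; have := phi01 x; rewrite indicE.
      by case: (x \in A) => /= /andP[]; lra.
    by rewrite memNset// H// subrr normr0.
- move=> f g [if_ Hf] [ig Hg]; split; first exact: ointegD.
  move=> e e0; have e2 : 0 < e / 2 by rewrite divr_gt0.
  have [p tp Hp] := Hf _ e2; have [q tq Hq] := Hg _ e2.
  exists (fun x => p x + q x); first exact: test_funD.
  have ip := test_fun_ointeg tp; have iq := test_fun_ointeg tq.
  apply: (@le_lt_trans _ _ (oI mu (fun x => `|p x - f x| + `|q x - g x|))).
    apply: le_oI; first by apply: ointeg_norm; apply: ointegB; exact: ointegD.
      by apply: ointegD; apply: ointeg_norm; exact: ointegB.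
    by move=> x; rewrite opprD addrACA; exact: ler_normD.
  rewrite oID; try by apply: ointeg_norm; exact: ointegB.
  by rewrite (splitr e); exact: ltrD.
- move=> c f [if_ Hf]; split; first exact: ointegZ.
  move=> e e0; have c0 : 0 < `|c| + 1 by rewrite ltr_wpDl.
  have [p tp Hp] := Hf _ (divr_gt0 e0 c0).
  exists (fun x => c * p x); first exact: test_funZ.
  have ip := test_fun_ointeg tp.
  have iN : ointeg mu (fun x => `|p x - f x|) by apply: ointeg_norm; exact: ointegB.
  rewrite (@eq_oI _ _ mu _ (fun x => `|c| * `|p x - f x|)); last first.
    by move=> x; rewrite -mulrBr normrM.
  rewrite oIZ//; move: Hp; rewrite ltr_pdivlMr//; apply: le_lt_trans.
  by rewrite mulrC ler_wpM2l ?oI_ge0// lerDl.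
- move=> f mf Hf.
  have iK : ointeg mu (\1_K : _ -> R) by exact: ointeg_indic.
  have if_ : ointeg mu f.
    have [g [ig _] Hg] := Hf _ ltr01.
    apply: (@le_ointeg _ _ mu _ (fun x => `|g x| + \1_K x)) => //.
      by apply: ointegD => //; exact: ointeg_norm.
    move=> x; rewrite -[f x](subrK (g x)) addrC.
    apply: (le_trans (ler_normD _ _)); rewrite lerD2l; have := Hg x.
    by rewrite mul1r.
  split=> // e e0.
  pose k := oI mu (\1_K : _ -> R) + 1.
  have k0 : 0 < k by rewrite ltr_wpDl// oI_ge0.
  have [|g [ig Hg1] Hg] := Hf (e / 2 / k); first by rewrite !divr_gt0.
  have [|p tp Hp] := Hg1 (e / 2); first by rewrite divr_gt0.
  have ip := test_fun_ointeg tp.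
  exists p => //.
  apply: (@le_lt_trans _ _ (oI mu (fun x => `|p x - g x| + e / 2 / k * \1_K x))).
    apply: le_oI; first by apply: ointeg_norm; exact: ointegB.
      by apply: ointegD; [apply: ointeg_norm; exact: ointegB|exact: ointegZ].
    move=> x; rewrite -(subrKA (g x)); apply: (le_trans (ler_normD _ _)).
    by rewrite lerD2l distrC.
  rewrite oID//; [|by apply: ointeg_norm; exact: ointegB|exact: ointegZ].
  rewrite oIZ// [ltRHS](splitr e); apply: ltr_leD => //.
  rewrite -mulrA ler_piMr ?divr_ge0 ?(ltW e0)//.
  by rewrite mulrC ler_pdivrMr// mul1r /k lerDl.
Qed.

End radon_density.

(** The outer measure and [nu] are packed as a measure and a charge on the Caratheodory
    sigma-algebra. The density obtained is finite everywhere, so a real function represents it. *)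
Lemma radon_nikodym_cara (R : realType) (T : pointedType)
    (mu : {outer_measure set T -> \bar R})
    (nu : set (caratheodory_type mu) -> \bar R) :
    sigma_finite [set: caratheodory_type mu] (mu : set (caratheodory_type mu) -> \bar R) ->
    nu set0 = 0%E -> (forall A, measurable A -> nu A \is a fin_num) ->
    semi_sigma_additive nu -> nu `<< (mu : set (caratheodory_type mu) -> \bar R) ->
  exists g : T -> R, ointeg mu g /\ forall A, mu.-caratheodory A ->
    nu A = (oI mu (fun x => \1_A x * g x))%:E.
Proof.
move=> sf nu0 nu_fin nu_sigma nu_dom.
pose cT := caratheodory_type mu; pose muM := (mu : set cT -> \bar R).
pose smu : {sigma_finite_measure set cT -> \bar R} :=
  HB.pack muM (isMeasure.Build _ cT R muM (@caratheodory_measure0 R _ mu)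
    (@caratheodory_measure_ge0 R _ mu) (@caratheodory_measure_sigma_additive R _ mu))
    (@Measure_isSigmaFinite.Build _ cT R muM sf).
pose cnu : {charge set cT -> \bar R} :=
  HB.pack nu (isCharge.Build _ cT R nu nu0 nu_fin nu_sigma).
have iG0 := @Radon_Nikodym_integrable _ cT R cnu smu nu_dom.
have G0fin x := @Radon_Nikodym_fin_num _ cT R cnu smu x nu_dom.
have G0E A := @Radon_Nikodym_integral _ cT R cnu smu A nu_dom.
move: iG0 G0fin G0E; set G0 := Radon_Nikodym _ _ => iG0 G0fin G0E.
pose g : T -> R := fun x => fine (G0 x).
have gE : G0 = EFin \o g.
  by apply/funext => x; rewrite /g /= fineK.
have ig : ointeg mu g by move: iG0; rewrite gE.
exists g; split=> // A mA.
transitivity (\int[muM]_(x in A) G0 x)%E; first exact: G0E.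
rewrite -ointE; last first.
  apply: (@le_ointeg _ _ mu _ (fun x => `|g x|)).
  - by apply: omeasM; [exact: omeas_indic|exact: ointeg_meas].
  - exact: ointeg_norm.
  - by move=> x; rewrite normrM ler_piMl// indicE; case: (_ \in _); rewrite ?normr0 ?normr1.
rewrite /oint integral_mkcond; apply: eq_integral => x _.
by rewrite patchE /= indicE gE /=; case: (x \in A) => /=; rewrite ?mul1r ?mul0r.
Qed.

(** * Densities of functionals dominated by an integral over a compact set *)

Section integral_density.
Variables (R : realType) (n : nat) (U : set 'rV[R]_n).
Variable mu : {outer_measure set 'rV[R]_n -> \bar R}.
Hypotheses (oU : open U) (radon_mu : radon_over U mu).
Local Notation cT := (caratheodory_type mu).
Local Notation muM := (mu : set cT -> \bar R).

Lemma radon_sigma_finite : sigma_finite [set: cT] muM.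
Proof.
exists (fun j => cpt_exh U j `|` ~` U).
  apply/seteqP; split=> // x _; have [Ux|Ux] := pselect (U x); last by exists 0%N => //; right.
  have [j _ Hj] : (\bigcup_j cpt_exh U j) x by rewrite -(cpt_exh_bigcup oU).
  by exists j => //; left.
have [N0 _ _ _ _] := radon_mu.
move=> j; split.
  apply: measurableU; first exact: (cpt_caratheodory radon_mu (@compact_cpt_exh _ _ _ j)).
  exact: null_caratheodory.
apply: le_lt_trans (outer_measureU2 mu _ _) _; rewrite N0 adde0.
exact: (radon_compact radon_mu (@compact_cpt_exh _ _ _ j) (@cpt_exh_sub _ _ _ j)).
Qed.

Definition bmeas (a : 'rV[R]_n -> R) : Prop :=
  omeas mu a /\ exists B : R, forall x, `|a x| <= B.

Lemma bmeasD a b : bmeas a -> bmeas b -> bmeas (fun x => a x + b x).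
Proof.
move=> [ma [A HA]] [mb [B HB]]; split; first exact: omeasD.
by exists (A + B) => x; apply: (le_trans (ler_normD _ _)); exact: lerD.
Qed.

Lemma bmeasM a b : bmeas a -> bmeas b -> bmeas (fun x => a x * b x).
Proof.
move=> [ma [A HA]] [mb [B HB]]; split; first exact: omeasM.
by exists (A * B) => x; rewrite normrM; apply: ler_pM.
Qed.

Lemma bmeas_cst c : bmeas (fun=> c).
Proof. by split; [exact: omeas_cst|exists `|c|]. Qed.

Lemma bmeasB a b : bmeas a -> bmeas b -> bmeas (fun x => a x - b x).
Proof.
move=> Ha Hb; have := bmeasD Ha (bmeasM (bmeas_cst (-1)) Hb).
by congr bmeas; apply/funext => x; rewrite mulN1r.
Qed.

Lemma bmeas_norm a : bmeas a -> bmeas (fun x => `|a x|).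
Proof.
by move=> [ma [A HA]]; split; [exact: omeas_norm|exists A => x; rewrite normr_id].
Qed.

Lemma bmeas_indic A : mu.-caratheodory A -> bmeas \1_A.
Proof.
move=> mA; split; first exact: omeas_indic.
by exists 1 => x; rewrite indicE; case: (x \in A); rewrite ?normr0 ?normr1.
Qed.

Lemma bmeas_test phi : test_fun U phi -> bmeas phi.
Proof.
move=> tphi; have [B _ HB] := test_fun_bounded tphi; split; last by exists B.
exact: (radon_continuous radon_mu (smooth_continuous (test_fun_smooth tphi))).
Qed.

Variables (K : set 'rV[R]_n) (T : ('rV[R]_n -> R) -> R) (C : R).
Hypotheses (cK : compact K) (KU : K `<=` U) (C0 : 0 <= C).
Hypothesis TD : forall phi psi, test_fun U phi -> test_fun U psi ->
  T (fun x => phi x + psi x) = T phi + T psi.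
Hypothesis TZ : forall c phi, test_fun U phi -> T (fun x => c * phi x) = c * T phi.
Hypothesis Tle : forall phi, test_fun U phi ->
  `|T phi| <= C * oI mu (fun x => \1_K x * `|phi x|).

Let mK := cpt_caratheodory radon_mu cK.
(** A pseudo-distance with respect to which [T] has Lipschitz constant 1 on test functions, by
    [Tle]. *)
Let d (a b : 'rV[R]_n -> R) := C * oI mu (fun x => \1_K x * `|a x - b x|).

Let integ a : bmeas a -> ointeg mu (fun x => \1_K x * a x).
Proof.
move=> [ma [B HB]]; apply: (@bounded_ointeg _ _ U _ radon_mu K _ B) => //.
- by apply: omeasM => //; exact: omeas_indic.
- by move=> x Kx; rewrite indicE mem_set// mul1r.
- by move=> x Kx; rewrite indicE memNset// mul0r.
Qed.

Let integd a b : bmeas a -> bmeas b -> ointeg mu (fun x => \1_K x * `|a x - b x|).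
Proof. by move=> Ha Hb; apply/integ/bmeas_norm/bmeasB. Qed.

Let d_tri a b c : bmeas a -> bmeas b -> bmeas c -> d a b <= d a c + d c b.
Proof.
move=> Ha Hb Hc; rewrite /d -mulrDr; apply: ler_wpM2l => //.
rewrite -oID; try exact: integd.
apply: le_oI => [||x]; [exact: integd|by apply: ointegD; exact: integd|].
rewrite -mulrDr; apply: ler_wpM2l; first by rewrite indicE.
by rewrite -(subrKA (c x)); exact: ler_normD.
Qed.

Let d_sym a b : d a b = d b a.
Proof. by rewrite /d; congr (_ * _); apply: eq_oI => x; rewrite distrC. Qed.

Let TB phi psi : test_fun U phi -> test_fun U psi ->
  T phi - T psi = T (fun x => phi x - psi x).
Proof.
move=> H1 H2; rewrite -mulN1r -TZ// -TD//; last exact: test_funZ.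
by congr T; apply/funext => x; rewrite mulN1r.
Qed.

(** McShane's formula extends [T] to the single function [a]. As test functions are dense for [d],
    the value is determined, so linearity need not be built in: it follows by approximation. *)
Let ext_ex a : exists t : R, bmeas a -> forall phi, test_fun U phi ->
  `|t - T phi| <= d a phi.
Proof.
have [Ha|Ha] := pselect (bmeas a); last by exists 0.
have [|t Ht] := @extend_functional R _ (test_fun U) T d a (fun=> 0) (@test_fun0 _ _ U).
  move=> v w Hv Hw; rewrite TB//; apply: (le_trans (ler_norm _)).
  apply: (le_trans (Tle (test_funB Hv Hw))); rewrite -/(d v w) [d a v]d_sym.
  by apply: d_tri => //; exact: bmeas_test.
by exists t => _.
Qed.

Let That a := sval (cid (ext_ex a)).

Let ThatP a phi : bmeas a -> test_fun U phi -> `|That a - T phi| <= d a phi.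
Proof. by rewrite /That; case: cid => t Ht /= Ha; exact: Ht. Qed.

Let T0 : T (fun=> 0) = 0.
Proof.
have H := TZ 0 (@test_fun0 _ _ U).
transitivity (0 * T (fun=> 0)); last by rewrite mul0r.
by rewrite -H; congr T; apply/funext => x; rewrite mulr0.
Qed.

Let That_le a : bmeas a -> `|That a| <= C * oI mu (fun x => \1_K x * `|a x|).
Proof.
move=> Ha; have := ThatP Ha (@test_fun0 _ _ U).
rewrite T0 subr0 /d; congr (_ <= _ * _).
by apply: eq_oI => x; rewrite subr0.
Qed.

Let approx a e : bmeas a -> 0 < e -> exists2 phi, test_fun U phi & d a phi < e.
Proof.
move=> Ha e0; have C1 : 0 < C + 1 by rewrite ltr_wpDl.
have [mKa [B HB]] := bmeasM (bmeas_indic mK) Ha.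
have [|phi tphi Hphi] := radon_L1_approx oU radon_mu cK KU mKa HB _ (divr_gt0 e0 C1).
  by move=> x Kx; rewrite indicE memNset// mul0r.
exists phi => //; apply: (@le_lt_trans _ _ ((C + 1) *
    oI mu (fun x => `|phi x - \1_K x * a x|))); last by rewrite mulrC -ltr_pdivlMr.
have tb := bmeas_test tphi.
apply: ler_pM => //; [|by rewrite lerDl|].
  by apply: oI_ge0 => x; rewrite mulr_ge0// indicE.
apply: le_oI; first exact: integd.
  apply: ointeg_norm; apply: ointegB; last exact: integ.
  exact: (test_fun_ointeg radon_mu tphi).
move=> x; rewrite indicE; case: (x \in K); last by rewrite mul0r.
by rewrite !mul1r distrC.
Qed.

Let small_eq0 (t : R) : (forall e, 0 < e -> `|t| <= e) -> t = 0.
Proof.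
move=> H; apply/eqP; rewrite -normr_le0; apply/ler_addgt0Pr => e e0.
by rewrite add0r; exact: H.
Qed.

Let ThatD a b : bmeas a -> bmeas b -> That (fun x => a x + b x) = That a + That b.
Proof.
move=> Ha Hb; apply/eqP; rewrite -subr_eq0; apply/eqP/small_eq0 => e e0.
have [phi tphi Hphi] := approx Ha (divr_gt0 e0 (@ltr0n R 4)).
have [psi tpsi Hpsi] := approx Hb (divr_gt0 e0 (@ltr0n R 4)).
have h1 := ThatP Ha tphi; have h2 := ThatP Hb tpsi.
have h3 := ThatP (bmeasD Ha Hb) (test_funD tphi tpsi).
have h4 : d (fun x => a x + b x) (fun x => phi x + psi x) <= d a phi + d b psi.
  have tp := bmeas_test tphi; have tq := bmeas_test tpsi.
  rewrite /d -mulrDr; apply: ler_wpM2l => //; rewrite -oID; try exact: integd.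
  apply: le_oI => [||x]; [by apply: integd; exact: bmeasD|by apply: ointegD; exact: integd|].
  rewrite -mulrDr; apply: ler_wpM2l; first by rewrite indicE.
  by rewrite opprD addrACA; exact: ler_normD.
rewrite TD// in h3; move: h1 h2 h3; rewrite !ler_norml => /andP[? ?] /andP[? ?] /andP[? ?].
apply/andP; split; lra.
Qed.

Let ThatZ c a : bmeas a -> That (fun x => c * a x) = c * That a.
Proof.
move=> Ha; apply/eqP; rewrite -subr_eq0; apply/eqP/small_eq0 => e e0.
have c1 : 0 < 2 * (`|c| + 1) by rewrite mulr_gt0// ltr_wpDl.
have [phi tphi Hphi] := approx Ha (divr_gt0 e0 c1).
have h1 := ThatP Ha tphi.
have h3 := ThatP (bmeasM (bmeas_cst c) Ha) (test_funZ c tphi).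
rewrite TZ// in h3.
have h4 : d (fun x => c * a x) (fun x => c * phi x) = `|c| * d a phi.
  have tp := bmeas_test tphi.
  rewrite /d mulrCA; congr (_ * _); rewrite -oIZ; last exact: integd.
  by apply: eq_oI => x; rewrite -mulrBr normrM mulrCA.
rewrite -(subrKA (c * T phi)); apply: (le_trans (ler_normD _ _)).
have -> : c * T phi - c * That a = - c * (That a - T phi) by ring.
rewrite h4 in h3; rewrite normrM normrN.
have h5 := ler_wpM2l (normr_ge0 c) h1.
have h6 : 2 * (`|c| + 1) * d a phi <= e by rewrite mulrC -ler_pdivlMr// ltW.
have d0 : 0 <= d a phi.
  by rewrite /d mulr_ge0//; apply: oI_ge0 => x; rewrite mulr_ge0// indicE.
lra.
Qed.

Let ThatB a b : bmeas a -> bmeas b -> That (fun x => a x - b x) = That a - That b.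
Proof.
move=> Ha Hb; rewrite -mulN1r -ThatZ// -ThatD//; last exact: bmeasM (bmeas_cst _) Hb.
by congr That; apply/funext => x; rewrite mulN1r.
Qed.

Let That_test phi : test_fun U phi -> That phi = T phi.
Proof.
move=> tphi; apply/eqP; rewrite -subr_eq0 -normr_le0.
apply: (le_trans (ThatP (bmeas_test tphi) tphi)).
rewrite /d (@eq_oI _ _ mu _ (fun=> 0)) ?oI0 ?mulr0// => x.
by rewrite subrr normr0 mulr0.
Qed.

(** The extension evaluated on indicators. Continuity for [d] makes it a signed measure, and it
    vanishes on null sets because its value at [A] is at most [C] times the measure of the part of
    [A] in [K]. *)
Let nu (A : set cT) : \bar R := (That \1_A)%:E.

Let That_indic_bigU (A : nat -> set 'rV[R]_n) k :
  (forall i, mu.-caratheodory (A i)) -> trivIset setT A ->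
  That \1_(\big[setU/set0]_(i < k) A i) = \sum_(i < k) That \1_(A i).
Proof.
move=> mA tA; elim: k => [|k IH].
  rewrite !big_ord0; apply/eqP; rewrite -normr_le0.
  apply: (le_trans (That_le (bmeas_indic (caratheodory_measurable_set0 mu)))).
  rewrite (@eq_oI _ _ mu _ (fun=> 0)) ?oI0 ?mulr0// => x.
  by rewrite [X in `|X|]indicE in_set0 normr0 mulr0.
rewrite !big_ord_recr /= -IH -ThatD//; last 2 first.
- apply: bmeas_indic; exact: caratheodory_measurable_bigsetU.
- exact: bmeas_indic.
congr That; apply/funext => x; rewrite !indicE in_setU.
case: (asboolP (A k x)) => Ak; last by rewrite [x \in A k]memNset// orbF addr0.
rewrite [x \in A k]mem_set// orbT [x \in \big[_/_]_(i < k) _]memNset ?add0r//.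
rewrite -bigcup_mkord => -[i /= ik Ai].
have := tA i k I I (ex_intro _ x (conj Ai Ak)) => ikE.
by rewrite ikE ltnn in ik.
Qed.

Let nu0 : nu set0 = 0%E.
Proof.
rewrite /nu; have := @That_indic_bigU (fun=> set0) 0 (fun=> caratheodory_measurable_set0 mu).
by rewrite !big_ord0 => -> //; apply/trivIsetP => i j _ _ _; rewrite setI0.
Qed.

Let nu_fin A : measurable A -> nu A \is a fin_num. Proof. by []. Qed.

Let nu_sigma : semi_sigma_additive nu.
Proof.
move=> A mA tA mUA.
rewrite (_ : (fun k => _) = (fun k => (That \1_(\big[setU/set0]_(i < k) A i))%:E)).
  apply: cvg_EFin; first by near=> k.
  pose F k x : R := \1_K x * `|\1_(\big[setU/set0]_(i < k) A i) x - \1_(\bigcup_i A i) x|.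
  have mB k : mu.-caratheodory (\big[setU/set0]_(i < k) A i).
    exact: caratheodory_measurable_bigsetU.
  have bF k : bmeas (F k).
    apply: bmeasM; first exact: bmeas_indic.
    by apply/bmeas_norm/bmeasB; apply: bmeas_indic.
  have KF : ointeg mu (\1_K : _ -> R).
    by apply: ointeg_indic => //; exact: (radon_compact radon_mu).
  have [||_ HF _] := @oI_dominated _ _ mu F (fun=> 0) \1_K set0 (outer_measure0 mu)
    (fun k => (bF k).1) (@omeas_cst _ _ mu 0) KF.
  - move=> x _; apply: cvg_near_cst.
    have [[i _ Ai]|HN] := pselect ((\bigcup_i A i) x).
      near=> k; rewrite /F !indicE [x \in \bigcup_i _]mem_set; last by exists i.
      rewrite [x \in \big[_/_]_(_ < _) _]mem_set ?subrr ?normr0 ?mulr0//.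
      rewrite -bigcup_mkord; exists i => //=; near: k; exact: nbhs_infty_gt.
    near=> k; rewrite /F !indicE [x \in \bigcup_i _]memNset//.
    rewrite [x \in \big[_/_]_(_ < _) _]memNset ?subrr ?normr0 ?mulr0//.
    by rewrite -bigcup_mkord => -[i _ Ai]; apply: HN; exists i.
  - move=> k x _; rewrite /F normrM normr_id ger0_norm ?ler_piMr// ?indicE//.
    rewrite ler_norml; do 2 case: (_ \in _) => /=; rewrite ?subrr ?subr0 ?sub0r;
      apply/andP; split; lra.
  rewrite oI0 in HF.
  apply/cvgrPdist_le => e e0.
  have C1 : 0 < C + 1 by rewrite ltr_wpDl.
  have /cvgrPdist_le/(_ _ (divr_gt0 e0 C1)) := HF.
  apply: filterS => k; rewrite sub0r normrN ger0_norm; last first.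
    by apply: oI_ge0 => x; rewrite /F mulr_ge0// indicE.
  move=> H; rewrite distrC -ThatB; try exact: bmeas_indic.
  apply: (le_trans (That_le _)); first by apply: bmeasB; apply: bmeas_indic.
  apply: (@le_trans _ _ ((C + 1) * oI mu (F k))).
    by apply: ler_wpM2r; [apply: oI_ge0 => x; rewrite /F mulr_ge0// indicE|rewrite lerDl].
  by rewrite mulrC -ler_pdivlMr.
by apply/funext => k; rewrite That_indic_bigU// big_mkord -sumEFin.
Unshelve. all: by end_near. Qed.

Let nu_dom : nu `<< muM.
Proof.
apply/null_content_dominatesP => A mA A0; rewrite /nu; congr EFin.
apply/eqP; rewrite -normr_le0; apply: (le_trans (That_le (bmeas_indic mA))).
rewrite (@oI_null _ _ mu _ (fun=> 0) A) ?oI0 ?mulr0//.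
- by move=> x Ax; rewrite [X in `|X|]indicE memNset// normr0 mulr0.
- by apply: omeasM; [exact: omeas_indic|apply: omeas_norm; exact: omeas_indic].
Qed.

(** The Radon-Nikodym density represents the extension on indicators. The bounds on the density are
    recovered from [That_le], and test functions are reached by [bounded_measurable_ind]. *)
Lemma test_functional_density : exists G : 'rV[R]_n -> R,
  [/\ omeas mu G, forall x, `|G x| <= C, forall x, ~ K x -> G x = 0 &
    forall phi, test_fun U phi -> T phi = oI mu (fun x => phi x * G x)].
Proof.
have [g [ig nuE0]] := radon_nikodym_cara radon_sigma_finite nu0 nu_fin nu_sigma nu_dom.
have igA A : mu.-caratheodory A -> ointeg mu (fun x => \1_A x * g x).
  move=> mA; apply: (@le_ointeg _ _ mu _ (fun x => `|g x|)).
  - by apply: omeasM; [exact: omeas_indic|exact: ointeg_meas].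
  - exact: ointeg_norm.
  - by move=> x; rewrite normrM ler_piMl// indicE; case: (_ \in _); rewrite ?normr0 ?normr1.
have nuE A : mu.-caratheodory A -> That \1_A = oI mu (fun x => \1_A x * g x).
  by move=> mA; apply: EFin_inj; exact: nuE0.
have iK : ointeg mu (\1_K : _ -> R).
  by apply: ointeg_indic => //; exact: (radon_compact radon_mu).
have mg := ointeg_meas ig.
(* On the set [A] where s g exceeds C 1_K, the difference s g - C 1_K is positive, but its integral
   is at most 0 by [That_le]; hence [A] is null. The signs s = 1 and s = -1 bound |g|. *)
have key (s : R) : `|s| = 1 -> mu [set x | C * \1_K x < s * g x] = 0%E.
  move=> s1; set A := [set x | _].
  have mA : mu.-caratheodory A.
    have /omeasP H : omeas mu (fun x => s * g x - C * \1_K x).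
      apply: omeasB; apply: omeasM => //; try exact: omeas_cst.
      exact: omeas_indic.
    have := H _ (@open_gt R 0); congr (mu.-caratheodory _).
    by apply/seteqP; split=> x; rewrite /A /= subr_gt0.
  pose h x : R := s * (\1_A x * g x) - C * (\1_K x * \1_A x).
  have h0 x : 0 <= h x.
    rewrite /h indicE; case: (asboolP (A x)) => Ax.
      by rewrite mem_set// mul1r mulr1 subr_ge0 ltW.
    by rewrite memNset// mul0r !mulr0 subr0.
  have i1 : ointeg mu (fun x => \1_K x * \1_A x : R) by exact: integ (bmeas_indic mA).
  have ih : ointeg mu h.
    by apply: ointegB; apply: ointegZ => //; exact: igA.
  have hle : oI mu h <= 0.
    rewrite /h oIB; [|by apply/ointegZ/igA|exact: ointegZ].
    rewrite !oIZ//; last exact: igA.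
    rewrite -nuE// subr_le0; apply: (le_trans (ler_norm _)).
    rewrite normrM s1 mul1r; apply: (le_trans (That_le (bmeas_indic mA))).
    by apply: ler_wpM2l => //; apply: le_oI => // [|x];
      [apply/integ/bmeas_norm/bmeas_indic|rewrite [`|_|]ger0_norm// indicE].
  apply: null_sub (oI_norm_eq0 ih _).
    move=> x Ax /= hx; move: Ax; rewrite /A /= => Ax.
    by move: hx; rewrite /h indicE mem_set// mul1r mulr1 => /eqP; rewrite gt_eqF// subr_gt0.
  rewrite (@eq_oI _ _ mu _ h); last by move=> x; rewrite ger0_norm.
  by apply/eqP; rewrite eq_le hle oI_ge0.
pose N := [set x | C * \1_K x < 1 * g x] `|` [set x | C * \1_K x < -1 * g x].
have N0 : mu N = 0%E by apply: null_setU; apply: key; rewrite ?normrN normr1.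
(* A change on a null set makes the bounds hold at every point. *)
pose G x := if `|g x| <= C * \1_K x then g x else 0.
have GN x : ~ N x -> g x = G x.
  move=> /not_orP[/negP H1 /negP H2]; rewrite /G ifT// ler_norml.
  by rewrite -!leNgt mul1r mulN1r in H1 H2 *; apply/andP; split => //; lra.
have mG : omeas mu G by exact: omeas_null N0 GN mg.
have GC x : `|G x| <= C * \1_K x.
  rewrite /G; case: ifP => // _; rewrite normr0 mulr_ge0// indicE//.
have GC' x : `|G x| <= C.
  by apply: (le_trans (GC x)); rewrite ler_piMr// indicE; case: (_ \in _).
have GK x : ~ K x -> G x = 0.
  by move=> Kx; apply/eqP; rewrite -normr_le0; apply: (le_trans (GC x)); rewrite indicE memNset// mulr0.
have iaG a : bmeas a -> ointeg mu (fun x => a x * G x).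
  move=> [ma [B HB]]; apply: (@bounded_ointeg _ _ U _ radon_mu K _ (B * C)) => //.
  - exact: omeasM.
  - by move=> x _; rewrite normrM; apply: ler_pM.
  - by move=> x Kx; rewrite GK// mulr0.
exists G; split=> // phi tphi.
have tb := bmeas_test tphi.
have [_ [B HB]] := bmeasM tb (bmeas_indic mK).
pose P a := bmeas a /\ That a = oI mu (fun x => a x * G x).
have [_ H] : P (fun x => phi x * \1_K x).
  apply: (@bounded_measurable_ind R _ mu K P mK _ _ _ _ _ B) => //.
  - move=> A mA AK; split; first exact: bmeas_indic.
    rewrite nuE//; apply: (@oI_null _ _ mu _ _ N) => //.
      by move=> x Nx; rewrite GN.
    exact: ointeg_meas (igA A mA).
  - move=> a b [ba Ha] [bb Hb]; split; first exact: bmeasD.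
    rewrite ThatD// Ha Hb -oID; try exact: iaG.
    by apply: eq_oI => x; rewrite mulrDl.
  - move=> c a [ba Ha]; split; first exact: bmeasM (bmeas_cst c) ba.
    rewrite ThatZ// Ha -oIZ; last exact: iaG.
    by apply: eq_oI => x; rewrite mulrA.
  - move=> f mf Hf.
    have bf : bmeas f.
      split=> //; have [b [[_ [B' HB']] _] Hb] := Hf _ ltr01.
      exists (1 + B') => x; rewrite -(subrK (b x) (f x)).
      apply: (le_trans (ler_normD _ _)); apply: lerD => //.
      by apply: (le_trans (Hb x)); rewrite mul1r indicE; case: (_ \in _).
    split=> //; apply/eqP; rewrite -subr_eq0; apply/eqP/small_eq0 => e e0.
    pose k := 2 * (C * oI mu (\1_K : _ -> R) + 1).
    have IK0 : 0 <= oI mu (\1_K : _ -> R) by apply: oI_ge0 => x; rewrite indicE.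
    have k0 : 0 < k by rewrite mulr_gt0// ltr_wpDl// mulr_ge0.
    have [b [bb Hb] Hfb] := Hf _ (divr_gt0 e0 k0).
    rewrite -(subrKA (That b)) {2}Hb -ThatB// -oIB; try exact: iaG.
    apply: (le_trans (ler_normD _ _)).
    have h1 : `|That (fun x => f x - b x)| <= C * (e / k * oI mu (\1_K : _ -> R)).
      apply: (le_trans (That_le (bmeasB bf bb))); apply: ler_wpM2l => //.
      rewrite -oIZ//; apply: le_oI => [||x]; [exact: integd|exact: ointegZ|].
      apply: le_trans (Hfb x); rewrite ler_piMl// indicE.
    have h2 : `|oI mu (fun x => b x * G x - f x * G x)| <= C * (e / k * oI mu (\1_K : _ -> R)).
      rewrite -!oIZ//; last exact: ointegZ.
      apply: norm_oI_le; [|by do 2 apply: ointegZ|].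
        by apply: omeasB; apply: omeasM => //; case: bb.
      move=> x; rewrite -mulrBl normrM mulrC distrC; apply: ler_pM => //.
    apply: (le_trans (lerD h1 h2)).
    have -> : C * (e / k * oI mu (\1_K : _ -> R)) + C * (e / k * oI mu (\1_K : _ -> R))
       = e * (2 * (C * oI mu (\1_K : _ -> R))) / k by ring.
    rewrite ler_pdivrMr//; apply: ler_wpM2l; first exact: ltW.
    by rewrite /k mulrDr lerDl mulr1.
  - by apply: omeasM; [case: tb|exact: omeas_indic].
  - by move=> x Kx; rewrite indicE memNset// mulr0.
(* By [That_le] the functional sees only the values on [K], so the indicator of [K] may be
   inserted. *)
rewrite -That_test//; transitivity (That (fun x => phi x * \1_K x)).
  apply/eqP; rewrite -subr_eq0 -ThatB//; last exact: bmeasM tb (bmeas_indic mK).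
  rewrite -normr_le0; apply: (le_trans (That_le _)).
    by apply: bmeasB => //; exact: bmeasM tb (bmeas_indic mK).
  rewrite (@eq_oI _ _ mu _ (fun=> 0)) ?oI0 ?mulr0// => x.
  by rewrite !indicE; case: (_ \in _); rewrite ?mul0r// mul1r mulr1 subrr normr0.
rewrite H; apply: eq_oI => x; rewrite indicE.
have [Kx|Kx] := pselect (K x); first by rewrite mem_set// mulr1.
by rewrite GK// !mulr0.
Qed.

End integral_density.

(** * The Grassmannian and the weight measure *)

Section orthogonal_projections.
Variables (R : realType) (n : nat).
Implicit Types (P : subsp R n) (Q : 'M[R]_n).

Lemma mem_basis_mx (P : {vspace 'rV[R]_n}) (u : 'rV[R]_n) :
  (u \in P) = (u <= basis_mx P)%MS.
Proof.
apply/idP/idP => [uP|/submxP[c ->]].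
  apply/submxP; exists (\row_i coord (vbasis P) i u).
  rewrite {1}(coord_vbasis uP) mulmx_sum_row; apply: eq_bigr => i _.
  by rewrite mxE rowK (tnth_nth 0).
rewrite mulmx_sum_row; apply: memv_suml => i _; apply: memvZ.
by rewrite rowK; apply: vbasis_mem; exact: mem_tnth.
Qed.

Lemma rank_basis_mx (P : {vspace 'rV[R]_n}) : \rank (basis_mx P) = \dim P.
Proof.
apply/eqP; rewrite -/(row_free _) -kermx_eq0 -submx0; apply/rV_subP => c.
move=> /sub_kermxP cB.
have /freeP Hf : free (vbasis P) by apply: basis_free; exact: vbasisP.
suff -> : c = 0 by exact: sub0mx.
apply/rowP => i; rewrite [RHS]mxE; apply: (Hf (fun i => c 0 i)).
rewrite -[RHS]cB mulmx_sum_row; apply: eq_bigr => j _.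
by rewrite rowK (tnth_nth 0).
Qed.

Lemma mulmx_tr_eq0 (u : 'rV[R]_n) : u *m u^T = 0 -> u = 0.
Proof.
move=> /matrixP /(_ 0 0); rewrite !mxE => /eqP.
rewrite psumr_eq0 => [/allP H|j _]; last by rewrite mxE -expr2 sqr_ge0.
apply/rowP => i; rewrite [RHS]mxE; have := H i (mem_index_enum i).
by rewrite mxE mulf_eq0 orbb => /eqP.
Qed.

Lemma orthproj_dx P : (<<basis_mx P>> :&: kermx (basis_mx P)^T = 0)%MS.
Proof.
apply/eqP; rewrite -submx0; apply/rV_subP => u; rewrite sub_capmx => /andP[].
rewrite genmxE => /submxP[c uE] /sub_kermxP uk.
suff -> : u = 0 by exact: sub0mx.
by apply: mulmx_tr_eq0; rewrite {2}uE trmx_mul mulmxA uk mul0mx.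
Qed.

Lemma orthproj_full P : (1%:M <= <<basis_mx P>> + kermx (basis_mx P)^T)%MS.
Proof.
rewrite sub1mx /row_full -(eqn_add2r (\rank (<<basis_mx P>> :&: kermx (basis_mx P)^T)%MS)).
rewrite mxrank_sum_cap orthproj_dx mxrank0 addn0 mxrank_ker mxrank_tr genmxE.
by rewrite subnKC// rank_leq_col.
Qed.

Lemma orthproj_sub P : (orthproj P <= basis_mx P)%MS.
Proof. by rewrite -[orthproj P]mul1mx -(genmxE (basis_mx P)) proj_mx_sub. Qed.

Lemma orthproj_id P m (A : 'M[R]_(m, n)) : (A <= basis_mx P)%MS -> A *m orthproj P = A.
Proof. by move=> H; rewrite proj_mx_id ?orthproj_dx// genmxE. Qed.

Lemma orthproj_compl P : (1%:M - orthproj P) *m (basis_mx P)^T = 0.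
Proof.
apply/sub_kermxP.
have := add_proj_mx (orthproj_dx P) (orthproj_full P).
rewrite !mul1mx => E; rewrite -{1}E [_ + proj_mx (kermx _) _]addrC addrK.
by rewrite -[X in (X <= _)%MS]mul1mx proj_mx_sub.
Qed.

(** The projection P has its rows in the span of the basis, which is orthogonal to the rows of 1 -
    P; thus P (1 - P)^T = 0, that is P = P P^T, and the right side is symmetric. *)
Lemma orthproj_tr P : (orthproj P)^T = orthproj P.
Proof.
have E : orthproj P = orthproj P *m (orthproj P)^T.
  have [D DE] := submxP (orthproj_sub P).
  have Z : orthproj P *m (1%:M - orthproj P)^T = 0.
    by rewrite {1}DE -mulmxA -{1}[basis_mx P]trmxK -trmx_mul orthproj_compl trmx0 mulmx0.
  by move: Z; rewrite linearB /= trmx1 mulmxBr mulmx1 => /eqP; rewrite subr_eq0 => /eqP.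
by rewrite E trmx_mul trmxK -E.
Qed.

Lemma orthproj_idem P : orthproj P *m orthproj P = orthproj P.
Proof. exact: orthproj_id (orthproj_sub P). Qed.

Lemma rank_orthproj P : \rank (orthproj P) = \dim P.
Proof.
rewrite -rank_basis_mx; apply/eqP; rewrite eqn_leq mxrankS ?orthproj_sub//=.
by rewrite -{1}(orthproj_id (submx_refl (basis_mx P))) mxrankM_maxr.
Qed.

Lemma idem_factor r (A : 'M[R]_(n, r)) (B : 'M[R]_(r, n)) L S :
  L *m A = 1%:M -> B *m S = 1%:M -> (A *m B) *m (A *m B) = A *m B -> B *m A = 1%:M.
Proof.
move=> LA BS /(congr1 (fun X => L *m X *m S)).
by rewrite !mulmxA !LA !mul1mx -!mulmxA !BS !mulmx1.
Qed.

(** In a full rank factorisation Q = A B of an idempotent, B A is the identity of size rank Q, and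
    tr (A B) = tr (B A). *)
Lemma mxtrace_idem Q : Q *m Q = Q -> \tr Q = (\rank Q)%:R.
Proof.
move=> QQ; have [L HL] := row_fullP (col_base_full Q).
have [B HB] := row_freeP (row_base_free Q).
have E : row_base Q *m col_base Q = 1%:M.
  by apply: (idem_factor HL HB); rewrite !mulmx_base.
by rewrite -{1}(mulmx_base Q) mxtrace_mulC E mxtrace1.
Qed.

(** The orthogonal projections of rank [m]. The rank is expressed by the trace, so that all three
    conditions are closed. *)
Definition grass_mx m : set 'M[R]_n :=
  [set Q | [/\ Q *m Q = Q, Q^T = Q & \tr Q = m%:R]].

Lemma grass_mxE m : @orthproj R n @` Grass R n m = grass_mx m.
Proof.
apply/seteqP; split=> [_ [P HP <-]|Q [QQ QT Qm]].
  split; [exact: orthproj_idem|exact: orthproj_tr|].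
  by rewrite mxtrace_idem ?orthproj_idem// rank_orthproj HP.
pose f : 'End('rV[R]_n) := linfun (mulmxr Q).
pose P : {vspace 'rV[R]_n} := limg f.
have PQ (u : 'rV[R]_n) : (u \in P) = (u <= Q)%MS.
  apply/memv_imgP/submxP => [[v _ ->]|[v ->]]; exists v; rewrite ?lfunE ?memvf//=.
have BQ : (basis_mx P <= Q)%MS.
  by apply/row_subP => i; rewrite -PQ mem_basis_mx row_sub.
have QB : (Q <= basis_mx P)%MS.
  by apply/row_subP => i; rewrite -mem_basis_mx PQ row_sub.
have E1 : Q *m orthproj P = Q by exact: orthproj_id.
have E2 : orthproj P *m Q = orthproj P.
  have /submxP[D ->] : (orthproj P <= Q)%MS := submx_trans (orthproj_sub P) BQ.
  by rewrite -mulmxA QQ.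
have E : orthproj P = Q.
  by rewrite -[RHS]QT -E1 trmx_mul QT orthproj_tr E2.
exists P => //; rewrite /Grass /=.
have : \tr (orthproj P) = (\dim P)%:R by rewrite mxtrace_idem ?orthproj_idem// rank_orthproj.
by rewrite E Qm => /eqP; rewrite eqr_nat => /eqP.
Qed.

(** Q_kk is the sum over l of Q_kl^2. Hence Q_kl^2 <= Q_kk; for l = k this gives Q_kk <= 1. *)
Lemma idem_entry_le1 Q i j : Q *m Q = Q -> Q^T = Q -> `|Q i j| <= 1.
Proof.
move=> QQ QT.
have E k : Q k k = \sum_l Q k l ^+ 2.
  rewrite -{1}QQ mxE; apply: eq_bigr => l _.
  by rewrite -{2}QT mxE.
have H k l : Q k l ^+ 2 <= Q k k.
  by rewrite [leRHS]E (bigD1 l)//= lerDl sumr_ge0// => *; exact: sqr_ge0.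
have Hk k : Q k k <= 1.
  have := H k k; have [//|H1] := leP (Q k k) 1.
  have : Q k k * 1 < Q k k * Q k k by rewrite ltr_pM2l// (lt_trans ltr01).
  by rewrite mulr1 expr2; lra.
rewrite -(@ler_pXn2r _ 2 isT) ?nnegrE// expr1n real_normK ?num_real//.
exact: le_trans (H i j) (Hk i).
Qed.

Lemma orthproj_entry_le1 P i j : `|orthproj P i j| <= 1.
Proof. apply: idem_entry_le1; [exact: orthproj_idem|exact: orthproj_tr]. Qed.

Lemma mx_norm_le m p (A : 'M[R]_(m, p)) C : 0 <= C -> (forall i j, `|A i j| <= C) -> `|A| <= C.
Proof.
move=> C0 H; rewrite [leLHS]/Num.norm /= mx_normrE; by apply/bigmax_leP; split=> // -[].
Qed.

Lemma compact_grass_mx m : compact (grass_mx m).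
Proof.
pose A : set 'rV[R]_(n * n) := vec_mx @^-1` grass_mx m.
have cvec : continuous (@vec_mx R n n).
  apply: (@le_continuous_linear R _ _ (@vec_mx R n n) 1) => v; rewrite mul1r.
  by apply: mx_norm_le => // i j; rewrite mxE; exact: rV_coord_le.
have -> : grass_mx m = vec_mx @` A.
  apply/seteqP; split=> [Q HQ|_ [v HA <-]//].
  by exists (mxvec Q); rewrite /A/= mxvecK.
apply: compact_image_continuous => //.
have ce i j : class_C 0 (fun v : 'rV[R]_(n * n) => vec_mx v i j : R^o).
  by move=> v; apply: (@continuous_comp _ _ _ vec_mx (fun M => M i j));
    [exact: cvec|exact: coord_continuous].
have cl0 (f : 'rV[R]_(n * n) -> R^o) c : continuous f -> closed (f @^-1` [set c]).
  move=> cf; apply: closed_comp; [by move=> x _; exact: cf|exact: closed_eq].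
apply: bounded_closed_compact.
  exists 1; split; first exact: num_real.
  move=> M M1 v [H1 H2 _]; apply: (le_trans _ (ltW M1)).
  rewrite -[v]vec_mxK; apply: rV_norm_le => // k.
  case/mxvec_indexP: k => i j; rewrite mxvecE; exact: idem_entry_le1.
have -> : A = (\bigcap_(ij in setT) (fun v : 'rV[R]_(n * n) =>
      \sum_k vec_mx v ij.1 k * vec_mx v k ij.2 - vec_mx v ij.1 ij.2 : R^o) @^-1` [set 0]) `&`
    (\bigcap_(ij in setT) (fun v : 'rV[R]_(n * n) =>
      vec_mx v ij.2 ij.1 - vec_mx v ij.1 ij.2 : R^o) @^-1` [set 0]) `&`
    ((fun v : 'rV[R]_(n * n) => \sum_i vec_mx v i i : R^o) @^-1` [set m%:R]).
  apply/seteqP; split=> v.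
    move=> [H1 H2 H3]; do !split => //.
      by move=> [i j] _ /=; apply/eqP; rewrite subr_eq0 -{3}H1 [in X in _ == X]mxE.
    by move=> [i j] _ /=; apply/eqP; rewrite subr_eq0 -{2}H2 [in X in _ == X]mxE.
  move=> [[H1 H2] H3]; split=> //.
    apply/matrixP => i j; apply/eqP; rewrite [in X in X == _]mxE -subr_eq0.
    by apply/eqP; exact: (H1 (i, j)).
  apply/matrixP => i j; apply/eqP; rewrite [in X in X == _]mxE -subr_eq0.
  by apply/eqP; exact: (H2 (i, j)).
apply: closedI; first apply: closedI.
- apply: closed_bigI => -[i j] _ /=; apply: (cl0 (fun v => _)).
  have cs : class_C 0 (fun v : 'rV[R]_(n * n) => \sum_k vec_mx v i k * vec_mx v k j : R^o).
    apply: (@class_C_sum R _ R^o 0 _ _ (fun k v => vec_mx v i k * vec_mx v k j)) => k.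
    exact: (@class_CM R _ 0 _ _ (ce i k) (ce k j)).
  exact: (@class_CB R _ R^o 0 _ _ cs (ce i j)).
- apply: closed_bigI => -[i j] _ /=; apply: (cl0 (fun v => _)).
  exact: (@class_CB R _ R^o 0 _ _ (ce j i) (ce i j)).
- apply: (cl0 (fun v => _)).
  by apply: (@class_C_sum R _ R^o 0 _ _ (fun k v => vec_mx v k k)) => k; exact: ce.
Qed.

Lemma orthproj_continuous : continuous (@orthproj R n).
Proof. exact: initial_continuous. Qed.

(** The topology is induced by [orthproj], so a cluster point of the image filter in the compact set
    [grass_mx m] lifts to a cluster point of the filter. *)
Lemma compact_Grass m : compact (Grass R n m).
Proof.
move=> F PF FG.
have cG : compact (@orthproj R n @` Grass R n m) by rewrite grass_mxE; exact: compact_grass_mx.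
have FI : F (@orthproj R n @^-1` (@orthproj R n @` Grass R n m)).
  by apply: filterS FG => P GP; exists P.
have [_ [[P GP <-] clP]] := cG (@orthproj R n @ F) _ FI.
exists P; split=> // A B FA.
rewrite nbhsE => -[_ [[W oW <-] WP] WB].
have FA' : F (@orthproj R n @^-1` (@orthproj R n @` A)).
  by apply: filterS FA => P' AP'; exists P'.
have [_ [[P' AP' <-] WP']] := clP _ W FA' (open_nbhs_nbhs (conj oW WP)).
by exists P'; split=> //; exact: WB.
Qed.

End orthogonal_projections.

Lemma open_setXT (T S : topologicalType) (A : set T) : open A -> open (A `*` [set: S]).
Proof.
move=> oA; have -> : A `*` [set: S] = fst @^-1` A.
  by apply/seteqP; split=> [[x P] []|[x P]].
by apply: open_comp => // z _; exact: cvg_fst.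
Qed.

(** * The weight measure as the image of the varifold *)

Section weight_measure_theory.
Variables (R : realType) (n m : nat) (U : set 'rV[R]_n).
Variable V : {outer_measure set ('rV[R]_n * subsp R n) -> \bar R}.
Hypotheses (oU : open U) (vV : varifold m U V).

Definition wgt : {outer_measure set 'rV[R]_n -> \bar R} := weight_measure m V.

Lemma wgtE A : wgt A = V (A `*` Grass R n m). Proof. by []. Qed.

Let G := Grass R n m.

Let radonV : radon_over (U `*` G) V := vV.

Lemma radon_open_over W : open W -> V.-caratheodory W.
Proof.
move=> oW; have [N0 H _ _ _] := radonV.
apply: (@caratheodory_null_eq _ _ V (U `*` G `&` W) W (~` (U `*` G))) => //; last first.
  by apply: H; exists W.
by apply/seteqP; split=> x [] => [[Sx Ox] nSx|Ox /contrapT Sx]; split=> //; apply.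
Qed.

Lemma radon_continuous_over (c : 'rV[R]_n * subsp R n -> R) : continuous c -> omeas V c.
Proof.
move=> cc; apply/omeasP => W oW; apply: radon_open_over.
by apply: open_comp => // z _; exact: cc.
Qed.

Lemma null_over N : wgt N = 0%E -> V (N `*` setT) = 0%E.
Proof.
move=> N0; have [V0 _ _ _ _] := radonV.
apply: (@null_sub _ _ V _ ((N `*` G) `|` ~` (U `*` G))); last exact: null_setU.
move=> [x P] [/= Nx _]; have [GP|GP] := pselect (G P); first by left.
by right => -[].
Qed.

(** Compactness of the Grassmannian makes products with it compact and permits the tube lemma for
    outer regularity; inner regularity follows by projecting compact sets to the first factor. *)
Lemma radon_wgt : radon_over U wgt.
Proof.
have [V0 VO Vfin Vin Vout] := radonV.
have relG W : rel_open U W -> rel_open (U `*` G) (W `*` G).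
  move=> [W' oW' <-]; exists (W' `*` setT); first exact: open_setXT.
  by apply/seteqP; split=> [[x P] [[? ?] [? ?]]|[x P] [[? ?] ?]].
split.
- by apply: null_sub V0 => -[x P] [/= H _] [].
- move=> W oW X; have := VO _ (relG _ oW) (X `*` G).
  rewrite !wgtE; have -> : X `*` G `&` W `*` G = (X `&` W) `*` G.
    by apply/seteqP; split=> [[x P] [[? ?] [? ?]]|[x P] [[? ?] ?]].
  have -> : X `*` G `&` ~` (W `*` G) = (X `&` ~` W) `*` G.
    apply/seteqP; split=> [[x P] [[/= ? ?] H]|[x P] [[/= ? H] ?]]; split=> //.
      by split=> // Wx; apply: H.
    by case.
  by [].
- move=> K cK KU; rewrite wgtE; apply: Vfin.
    by apply: compact_setX => //; exact: compact_Grass.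
  by move=> [x P] [/= /KU].
- move=> W oW; apply/eqP; rewrite eq_le; apply/andP; split; last first.
    by apply: ge_ereal_sup => _ [K [cK KW] <-]; exact: le_outer_measure.
  rewrite wgtE (Vin _ (relG _ oW)); apply: ge_ereal_sup => _ [K [cK KW] <-].
  apply: (@le_trans _ _ (wgt (fst @` K))).
    rewrite wgtE; apply: le_outer_measure => -[x P] Kx; split; first by exists (x, P).
    by have [] := KW _ Kx.
  apply: ereal_sup_ubound; exists (fst @` K) => //; split.
    by apply: continuous_compact => //; apply: continuous_subspaceT => z; exact: cvg_fst.
  by move=> _ [[x P] /KW[/= Wx _] <-].
- move=> A AU; apply/eqP; rewrite eq_le; apply/andP; split.
    by apply: le_ereal_inf_tmp => _ [W [_ AW] <-]; exact: le_outer_measure.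
  have AGU : A `*` G `<=` U `*` G by move=> [x P] [/= /AU].
  rewrite wgtE (Vout _ AGU); apply: le_ereal_inf_tmp => _ [W [[W' oW' WE] AW] <-].
  (* Tube lemma: the points whose whole fibre lies in W' form an open set containing [A]. *)
  pose S := [set x | U x /\ forall P, G P -> W' (x, P)].
  have oS : open S.
    rewrite openE => x [Ux Hx].
    have /compact_near_coveringP cG := @compact_Grass R n m.
    have H1 : \forall y \near x, G `<=` (fun P => W' (y, P)).
      apply: (cG _ (nbhs x) (fun y P => W' (y, P))) => P GP.
      have : nbhs (x, P) W' by apply: open_nbhs_nbhs; split=> //; exact: Hx.
      case=> -[A1 A2] /= [nA1 nA2] HA; exists (A2, A1) => //=.
      by move=> [P' y] [/= H2 H1]; apply: (HA (y, P')).
    have H2 : nbhs x U by apply: open_nbhs_nbhs.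
    by apply: filterS2 H2 H1 => y Uy Hy; split.
  apply: (@le_trans _ _ (wgt S)); last first.
    rewrite wgtE; apply: le_outer_measure => -[x P] [[/= Ux Hx] GP].
    by rewrite -WE; split=> //; exact: Hx.
  apply: ereal_inf_lbound; exists S => //; split.
    by exists S => //; apply/setIidr => x [].
  move=> x Ax; split; first exact: AU.
  by move=> P GP; have := AW (x, P) (conj Ax GP); rewrite -WE => -[].
Qed.

(** By outer regularity, [A] is a countable intersection of relatively open sets up to a null set,
    and both relatively open sets and null sets lift to measurable subsets of the product. *)
Let cara_over_bounded A K : compact K -> K `<=` U -> A `<=` K ->
  wgt.-caratheodory A -> V.-caratheodory (A `*` setT).
Proof.
move=> cK KU AK mA; have [_ _ _ _ Hout] := radon_wgt.
have AU := subset_trans AK KU.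
have Kfin := radon_compact radon_wgt cK KU.
have Afin : wgt A \is a fin_num.
  rewrite ge0_fin_numE ?outer_measure_ge0//.
  by apply: le_lt_trans Kfin; exact: le_outer_measure.
have Hk k : exists W, [/\ rel_open U W, A `<=` W & (wgt W < wgt A + (k.+1%:R^-1)%:E)%E].
  have [_ [W [oW AW] <-] H] : exists2 y,
      [set wgt W | W in [set W | rel_open U W /\ A `<=` W]] y & (y < wgt A + (k.+1%:R^-1)%:E)%E.
    apply: ereal_inf_lt; rewrite -Hout//.
    by rewrite lteDl// lte_fin invr_gt0.
  by exists W.
have [W HW] := choice Hk.
pose B := \bigcap_k W k.
have AB : A `<=` B by move=> x Ax k _; have [_ + _] := HW k; exact.
have B0 : wgt (B `\` A) = 0%E.
  apply/eqP; rewrite eq_le outer_measure_ge0 andbT; apply/lee_addgt0Pr => e e0.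
  rewrite add0e.
  have [k ke] : exists k, k.+1%:R^-1 <= e.
    exists (Num.bound e^-1); rewrite -[leRHS]invrK lef_pV2 ?posrE ?invr_gt0//.
    apply: (le_trans (ltW (archi_boundP _))); first by rewrite invr_ge0 ltW.
    by rewrite ler_nat.
  have [_ AW HWk] := HW k.
  apply: (@le_trans _ _ (wgt (W k `\` A))).
    by apply: le_outer_measure => x [Bx nA]; split=> //; exact: Bx.
  apply: (@le_trans _ _ (k.+1%:R^-1)%:E); last by rewrite lee_fin.
  have := mA (W k); rewrite (setIidr AW) -setDE => E.
  by move: HWk; rewrite E lteD2lE// => /ltW.
apply: (@caratheodory_null_eq _ _ V (B `*` setT) _ ((B `\` A) `*` setT)).
- exact: null_over.
- apply/seteqP; split=> -[x P] [[/= H1 _] H2]; split=> //; split=> //=.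
    by apply: contrapT => nA; apply: H2.
  exact: AB.
- have -> : B `*` [set: subsp R n] = \bigcap_k (W k `*` setT).
    by apply/seteqP; split=> [[x P] [/= Bx _] k _|[x P] H]; split=> //;
      [exact: Bx|move=> k _; have [] := H k I].
  rewrite -[X in _ X]setCK setC_bigcap; apply: caratheodory_measurable_setC.
  apply: caratheodory_measurable_bigcup => k; apply: caratheodory_measurable_setC.
  apply: radon_open_over; apply: open_setXT.
  by have [[W' oW' <-] _ _] := HW k; exact: openI.
Qed.

Lemma caratheodory_over A : wgt.-caratheodory A -> V.-caratheodory (A `*` setT).
Proof.
move=> mA.
apply: (@caratheodory_null_eq _ _ V ((\bigcup_j (A `&` cpt_exh U j)) `*` setT) _
  (~` U `*` setT)).
- by apply: null_over; have [] := radon_wgt.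
- apply/seteqP; split=> -[x P] [[/= H1 _] H2]; split=> //; split=> //=.
    by case: H1 => j _ [].
  have Ux : U x by apply: contrapT => nU; apply: H2.
  have [j _ Hj] : (\bigcup_j cpt_exh U j) x by rewrite -(cpt_exh_bigcup oU).
  by exists j.
- have -> : (\bigcup_j (A `&` cpt_exh U j)) `*` [set: subsp R n] =
      \bigcup_j ((A `&` cpt_exh U j) `*` setT).
    by apply/seteqP; split=> [[x P] [[j _ Hj] _]|[x P] [j _ [Hj _]]];
      [exists j|split=> //; exists j].
  apply: caratheodory_measurable_bigcup => j.
  apply: (@cara_over_bounded _ (cpt_exh U j)).
  + exact: compact_cpt_exh.
  + exact: cpt_exh_sub.
  + exact: subIsetr.
  + apply: caratheodory_measurable_setI => //.
    exact: (cpt_caratheodory radon_wgt (@compact_cpt_exh _ _ _ j)).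
Qed.

Lemma omeas_over (b : 'rV[R]_n -> R) : omeas wgt b -> omeas V (fun z => b z.1).
Proof.
move=> /omeasP mb; apply/omeasP => W oW.
have -> : (fun z : 'rV[R]_n * subsp R n => b z.1) @^-1` W = (b @^-1` W) `*` setT.
  by apply/seteqP; split=> [[x P]|[x P] []].
exact/caratheodory_over/mb.
Qed.

(** The image of [V] under the first projection is the weight measure, because [V] vanishes off U x
    G. *)
Lemma oint_over (b : 'rV[R]_n -> R) : omeas wgt b ->
  oint V setT (fun z => `|b z.1|%:E) = oint wgt setT (fun x => `|b x|%:E).
Proof.
move=> mb.
have mfst : measurable_fun [set: caratheodory_type V] (fst : caratheodory_type V -> caratheodory_type wgt).
  move=> _ A mA; rewrite setTI.
  have -> : fst @^-1` A = A `*` [set: subsp R n].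
    by apply/seteqP; split=> [[x P]|[x P] []].
  exact: caratheodory_over.
have mb' : measurable_fun [set: caratheodory_type wgt] (fun x => `|b x|%:E).
  by apply/measurable_EFinP; exact: omeas_norm.
have := @ge0_integral_pushforward _ _ (caratheodory_type V) (caratheodory_type wgt) R
  fst mfst V setT (fun x => `|b x|%:E) measurableT mb' (fun x _ => lee_tofin (normr_ge0 (b x))).
rewrite /oint => <-; apply: eq_measure_integral => A mA _.
rewrite /pushforward /= wgtE; have [V0 _ _ _ _] := radonV.
apply/eqP; rewrite eq_le; apply/andP; split; last first.
  by apply: le_outer_measure => -[x P] [].
have : V (A `*` G `|` ~` (U `*` G)) = V (A `*` G).
  apply/eqP; rewrite eq_le; apply/andP; split; last by apply: le_outer_measure; exact: subsetUl.
  by apply: le_trans (outer_measureU2 V _ _) _; rewrite V0 adde0.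
move=> <-; apply: le_outer_measure => -[x P] /= Ax.
have [GP|GP] := pselect (G P); first by left.
by right => -[].
Qed.

Lemma ointeg_over (b : 'rV[R]_n -> R) : ointeg wgt b -> ointeg V (fun z => b z.1).
Proof.
move=> /ointegP[mb H]; apply/ointegP; split; first exact: omeas_over.
by rewrite oint_over.
Qed.

Lemma oI_over (b : 'rV[R]_n -> R) : omeas wgt b ->
  oI V (fun z => `|b z.1|) = oI wgt (fun x => `|b x|).
Proof. by move=> mb; rewrite /oI /oRint; congr fine; exact: oint_over. Qed.

Lemma norm_oI_over (c : 'rV[R]_n * subsp R n -> R) (b : 'rV[R]_n -> R) :
  omeas V c -> ointeg wgt b -> (forall z, `|c z| <= `|b z.1|) ->
  ointeg V c /\ `|oI V c| <= oI wgt (fun x => `|b x|).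
Proof.
move=> mc ib H; have iV := ointeg_norm (ointeg_over ib).
split; first exact: le_ointeg mc iV H.
by rewrite -oI_over; [exact: norm_oI_le mc iV H|exact: ointeg_meas].
Qed.

End weight_measure_theory.

Definition locally_bounded (R : realType) (n : nat) (U : set 'rV[R]_n) (a : 'rV[R]_n -> R) :=
  forall K, compact K -> K `<=` U -> exists B : R, forall x, K x -> `|a x| <= B.

(** * Gluing of local densities *)

Section local_density.
Variables (R : realType) (n : nat) (U : set 'rV[R]_n).
Variable mu : {outer_measure set 'rV[R]_n -> \bar R}.
Hypotheses (oU : open U) (radon_mu : radon_over U mu).

Lemma locally_bounded_ointeg K a b : compact K -> K `<=` U -> omeas mu a ->
  locally_bounded U a -> omeas mu b -> (exists B : R, forall x, `|b x| <= B) ->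
  (forall x, ~ K x -> b x = 0) -> ointeg mu (fun x => b x * a x).
Proof.
move=> cK KU ma la mb [B HB] b0; have [C HC] := la _ cK KU.
apply: (@bounded_ointeg _ _ U mu radon_mu K _ (B * C)) => //.
- exact: omeasM.
- by move=> x Kx; rewrite normrM; apply: ler_pM => //; exact: HC.
- by move=> x Kx; rewrite b0// mul0r.
Qed.

Lemma test_locally_bounded_ointeg phi a : test_fun U phi -> omeas mu a ->
  locally_bounded U a -> ointeg mu (fun x => phi x * a x).
Proof.
move=> tphi ma la; have [_ cs sU] := tphi.
apply: (@locally_bounded_ointeg (supp phi)) => //.
- exact: (radon_continuous radon_mu (smooth_continuous (test_fun_smooth tphi))).
- by have [B _ HB] := test_fun_bounded tphi; exists B.
- by move=> x; exact: supp_out.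
Qed.

Lemma exhaustion_cutoffs : exists chi : nat -> 'rV[R]_n -> R, forall j,
  [/\ test_fun U (chi j), forall x, 0 <= chi j x <= 1 &
      forall x, cpt_exh U j x -> chi j x = 1].
Proof.
have H j := @smooth_urysohn R n _ _ (@compact_cpt_exh _ _ U j) oU (@cpt_exh_sub _ _ U j).
by have [chi Hchi] := choice H; exists chi.
Qed.

Variable T : ('rV[R]_n -> R) -> R.
Hypothesis TD : forall phi psi, test_fun U phi -> test_fun U psi ->
  T (fun x => phi x + psi x) = T phi + T psi.
Hypothesis TZ : forall c phi, test_fun U phi -> T (fun x => c * phi x) = c * T phi.
Hypothesis Tle : forall K, compact K -> K `<=` U -> exists C : R, forall phi,
  test_fun U phi -> (forall x, ~ K x -> phi x = 0) ->
  `|T phi| <= C * oI mu (fun x => `|phi x|).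

(* The local densities [G j] of [phi |-> T (chi j * phi)] are glued with the
   weights [PI j = \prod_(l < j) (1 - chi l)]: the sum of the [chi j * PI j]
   telescopes to [1] locally in [U]. *)
Lemma test_functional_local_density : exists G : 'rV[R]_n -> R,
  [/\ omeas mu G, locally_bounded U G &
    forall phi, test_fun U phi -> T phi = oI mu (fun x => phi x * G x)].
Proof.
have [chi Hchi] := exhaustion_cutoffs.
have tchi j : test_fun U (chi j) by have [] := Hchi j.
have chi1 j x : cpt_exh U j x -> chi j x = 1 by have [_ _] := Hchi j; exact.
have chib j x : `|chi j x| <= 1.
  by have [_ /(_ x)/andP[h0 h1] _] := Hchi j; rewrite ger0_norm.
have Gex j : exists GC : ('rV[R]_n -> R) * R, [/\ omeas mu GC.1,
    forall x, `|GC.1 x| <= GC.2, forall x, ~ U x -> GC.1 x = 0 &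
    forall phi, test_fun U phi -> T (fun x => chi j x * phi x) = oI mu (fun x => phi x * GC.1 x)].
  have [_ cs sU] := tchi j; have [C HC] := Tle cs sU.
  have [|||G [mG GC G0 HG]] := @test_functional_density R n U mu oU radon_mu (supp (chi j))
      (fun phi => T (fun x => chi j x * phi x)) `|C| cs sU (normr_ge0 _).
  - move=> phi psi tp tq /=; rewrite -TD; [|exact: test_funM (test_fun_smooth (tchi j)) _..].
    by congr T; apply/funext => x; rewrite mulrDr.
  - move=> c phi tp /=; rewrite -TZ; last exact: test_funM (test_fun_smooth (tchi j)) _.
    by congr T; apply/funext => x; rewrite mulrCA.
  - move=> phi tp /=.
    have tcp := test_funM (test_fun_smooth (tchi j)) tp.
    apply: (le_trans (HC _ tcp _)); first by move=> x /supp_out ->; rewrite mul0r.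
    apply: (@le_trans _ _ (`|C| * oI mu (fun x => `|chi j x * phi x|))).
      by apply: ler_wpM2r; [exact: oI_ge0|exact: ler_norm].
    apply: ler_wpM2l => //; apply: le_oI.
    + exact/ointeg_norm/(test_fun_ointeg radon_mu).
    + apply: (@le_ointeg _ _ mu _ (fun x => `|phi x|)).
      * apply: omeasM; first exact/omeas_indic/(cpt_caratheodory radon_mu).
        exact/omeas_norm/ointeg_meas/(test_fun_ointeg radon_mu).
      * exact/ointeg_norm/(test_fun_ointeg radon_mu).
      * by move=> x; rewrite normrM normr_id indicE; case: (_ \in _); rewrite ?normr1 ?mul1r// normr0 mul0r.
    + move=> x; rewrite indicE; case: (asboolP (supp (chi j) x)) => Hx.
        by rewrite mem_set// mul1r normrM ler_piMl.
      by rewrite memNset// (supp_out Hx) !mul0r normr0.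
  by exists (G, `|C|); split=> // x Ux; apply: G0 => /sU.
have [GC HGC] := choice Gex; pose G j := (GC j).1.
have mG j : omeas mu (G j) by have [] := HGC j.
pose PI N x := \prod_(l < N) (1 - chi l x).
have PI1 N x : 0 <= PI N x <= 1.
  rewrite /PI; elim: N => [|N /andP[IH0 IH1]]; first by rewrite big_ord0 ler01 lexx.
  have [_ /(_ x)/andP[h0 h1] _] := Hchi N.
  rewrite big_ord_recr/= mulr_ge0 ?subr_ge0//=.
  by rewrite -[leRHS]mul1r ler_pM ?subr_ge0// gerBl.
have PI0 J N x : cpt_exh U J x -> (J < N)%N -> PI N x = 0.
  by move=> Jx JN; rewrite /PI (bigD1 (Ordinal JN))//= chi1// subrr mul0r.
have sPI N : smooth (PI N : 'rV[R]_n -> R^o).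
  move=> k; apply: (@class_C_prod R _ k _ _ (fun l : 'I_N => (fun x => 1 - chi l x) : 'rV[R]_n -> R^o)) => l.
  by apply: class_CB; [exact: class_C_cst|exact: (test_fun_smooth (tchi l))].
pose S N x := \sum_(j < N) PI j x * G j x.
have mPI N : omeas mu (PI N) by exact: (radon_continuous radon_mu (smooth_continuous (sPI N))).
have mS N : omeas mu (S N) by apply: omeas_sum => j; exact: omeasM.
have SJ J x : cpt_exh U J x -> forall N, (J < N)%N -> S N x = S J.+1 x.
  move=> Jx; elim=> // N IH; rewrite ltnS leq_eqVlt => /predU1P[->//|JN].
  by rewrite /S big_ord_recr/= -/(S N x) IH// (PI0 J)// mul0r addr0.
have SU x : ~ U x -> forall N, S N x = 0.
  by move=> Ux N; rewrite /S big1// => j _; have [_ _ H _] := HGC j; rewrite /G H// mulr0.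
have Hex x : exists t : R, \forall N \near \oo, S N x = t.
  have [Ux|Ux] := pselect (U x); last by exists 0; near=> N; exact: SU.
  have [J _ Jx] : (\bigcup_j cpt_exh U j) x by rewrite -(cpt_exh_bigcup oU).
  by exists (S J.+1 x); exists J.+1 => // N /= JN; exact: SJ.
have [H HH] := choice Hex.
have HJ J x : cpt_exh U J x -> H x = S J.+1 x.
  move=> Jx; have [N0 _ HN] := HH x.
  rewrite -(HN (maxn N0 J.+1)) /= ?leq_maxl//.
  by apply: SJ => //; rewrite leq_maxr.
exists H; split.
- apply: (@omeas_cvg _ _ mu S) => // x.
  apply: cvg_near_cst; exact: HH.
- move=> K cK KU; have [J KJ] := cpt_exh_cover oU cK KU.
  exists (\sum_(j < J.+1) (GC j).2) => x /KJ Jx; rewrite (HJ J)//.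
  apply: (le_trans (ler_norm_sum _ _ _)); apply: ler_sum => j _.
  have [_ h _ _] := HGC j; have /andP[p0 p1] := PI1 j x.
  by rewrite normrM (ger0_norm p0) -[leRHS]mul1r ler_pM ?h.
move=> phi tphi; have [_ cs sU] := tphi.
have [J KJ] := cpt_exh_cover oU cs sU.
have tPI N : test_fun U (fun x => PI N x * phi x) by exact: test_funM.
have T0 : T (fun=> 0) = 0.
  rewrite -[RHS](mul0r (T (fun=> 0))) -(TZ 0 (@test_fun0 _ _ U)).
  by congr T; apply/funext => x; rewrite mul0r.
have key N : T phi = \sum_(j < N) oI mu (fun x => (PI j x * phi x) * G j x) + T (fun x => PI N x * phi x).
  elim: N => [|N IH].
    by rewrite big_ord0 add0r; congr T; apply/funext => x; rewrite /PI big_ord0 mul1r.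
  rewrite IH big_ord_recr/= -addrA; congr (_ + _).
  have [_ _ _ h] := HGC N; rewrite /G -h// -TD; last exact: tPI.
    congr T; apply/funext => x; rewrite /PI big_ord_recr/=; ring.
  exact: test_funM (test_fun_smooth (tchi N)) _.
rewrite (key J.+1).
have -> : T (fun x => PI J.+1 x * phi x) = 0.
  rewrite -[RHS]T0; congr T; apply/funext => x.
  have [/KJ Jx|/supp_out ->] := pselect (supp phi x); last by rewrite mulr0.
  by rewrite (PI0 J)// mul0r.
have iG j : ointeg mu (fun x => (PI j x * phi x) * G j x).
  apply: test_locally_bounded_ointeg => // K _ _.
  by have [_ h _ _] := HGC j; exists (GC j).2 => x _; exact: h.
rewrite addr0 -oI_sum//; apply: eq_oI => x.
have [/KJ Jx|/supp_out ->] := pselect (supp phi x).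
  by rewrite (HJ J)// /S mulr_sumr; apply: eq_bigr => j _; rewrite mulrA [phi x * _]mulrC.
by rewrite mul0r big1// => j _; rewrite mulr0 mul0r.
Unshelve. all: by end_near. Qed.

End local_density.

(** * The first variation *)

Section tangential_gradient.
Variables (R : realType) (n : nat).
Implicit Types (phi p : 'rV[R]_n -> R) (k : 'I_n) (U : set 'rV[R]_n).

Local Notation dd p x i := ('d (p : 'rV[R]_n -> R^o) x (delta_mx 0 i) : R).

(* the [k]-th component of [P_\natural (D p (x))] at [z = (x, P)] *)
Definition tgrad p k (z : 'rV[R]_n * subsp R n) : R :=
  \sum_i dd p z.1 i * orthproj z.2 i k.

Lemma tgrad_le p k z : `|tgrad p k z| <= \sum_i `|dd p z.1 i|.
Proof.
apply: (le_trans (ler_norm_sum _ _ _)); apply: ler_sum => i _.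
by rewrite normrM ler_piMr// orthproj_entry_le1.
Qed.

Lemma tgradD p q k z : smooth (p : 'rV[R]_n -> R^o) -> smooth (q : 'rV[R]_n -> R^o) ->
  tgrad (fun x => p x + q x) k z = tgrad p k z + tgrad q k z.
Proof.
move=> sp sq; rewrite /tgrad -big_split; apply: eq_bigr => i _ /=; rewrite -mulrDl.
congr (_ * _).
have dp := differentiableP (smooth_differentiable z.1 sp).
have dq := differentiableP (smooth_differentiable z.1 sq).
exact: (is_diff_val (is_diffD dp dq)).
Qed.

Lemma tgrad_mul p q k z : smooth (p : 'rV[R]_n -> R^o) -> smooth (q : 'rV[R]_n -> R^o) ->
  tgrad (fun x => p x * q x) k z = p z.1 * tgrad q k z + q z.1 * tgrad p k z.
Proof.
move=> sp sq; rewrite /tgrad !mulr_sumr -big_split; apply: eq_bigr => i _ /=.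
have dp := differentiableP (smooth_differentiable z.1 sp).
have dq := differentiableP (smooth_differentiable z.1 sq).
have E : dd (fun y => p y * q y) z.1 i = p z.1 * dd q z.1 i + dd p z.1 i * q z.1.
  exact: (is_diff_val (is_diff_scale dp dq) (delta_mx 0 i)).
by rewrite E mulrDl mulrA [q z.1 * _]mulrCA mulrA.
Qed.

Lemma smooth_cst (V W : normedModType R) (c : W) : smooth (fun _ : V => c).
Proof. by move=> j; exact: class_C_cst. Qed.

Lemma diff_cst0 (V W : normedModType R) (c : W) (x v : V) : 'd (fun _ : V => c) x v = 0.
Proof. exact: (is_diff_val (is_diff_cst c x)). Qed.

Lemma tgrad_cst (c : R) k z : tgrad (fun=> c) k z = 0.
Proof. by rewrite /tgrad big1// => i _; rewrite (@diff_cst0 _ R^o) mul0r. Qed.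

Lemma tgradZ (c : R) p k z : smooth (p : 'rV[R]_n -> R^o) ->
  tgrad (fun x => c * p x) k z = c * tgrad p k z.
Proof.
move=> sp; rewrite (@tgrad_mul (fun=> c) p)//; last exact: (@smooth_cst _ R^o).
by rewrite tgrad_cst mulr0 addr0.
Qed.

Lemma tgrad_continuous p k : smooth (p : 'rV[R]_n -> R^o) -> continuous (tgrad p k).
Proof.
move=> sp; apply: (@continuous_big R) => [x|i _ z].
  exact: (@add_continuous R^o x).
apply: cvgM.
  apply: (@continuous_comp _ _ _ fst (fun x => dd p x i)); first exact: cvg_fst.
  exact: (smooth_continuous (smooth_diff (delta_mx 0 i) sp)).
apply: (@continuous_comp _ _ _ (fun z : 'rV[R]_n * subsp R n => orthproj z.2) (fun M : 'M[R]_n => M i k)).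
  apply: (@continuous_comp _ _ _ snd (@orthproj R n)); first exact: cvg_snd.
  exact: orthproj_continuous.
exact: coord_continuous.
Qed.

Lemma diff_out (W : normedModType R) (p : 'rV[R]_n -> W) x v :
  differentiable p x -> ~ supp p x -> 'd p x v = 0.
Proof.
move=> dp px; apply: (diff_near_cst dp (c := 0)).
have : nbhs x (~` supp p).
  by apply: open_nbhs_nbhs; split=> //; apply: closed_openC; exact: closed_supp.
by apply: filterS => y /supp_out.
Qed.

Lemma test_fun_diff U phi v : test_fun U phi ->
  test_fun U (fun x => 'd (phi : 'rV[R]_n -> R^o) x v).
Proof.
move=> tphi; have [sp cs sU] := tphi.
apply: (@test_fun_of_out _ _ U _ (supp phi)) => //; first exact: smooth_diff.
by move=> x Hx; apply: diff_out => //; exact: smooth_differentiable.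
Qed.

Definition coordl k : 'rV[R]_n -> R^o := fun x => x 0 k.

Fact coordl_linear k : linear (coordl k).
Proof. by move=> a x y; rewrite /coordl !mxE. Qed.

HB.instance Definition _ k := GRing.isLinear.Build R 'rV[R]_n R^o _ (coordl k) (coordl_linear k).

Lemma coordl_continuous k : continuous (coordl k).
Proof. by move=> x; exact: coord_continuous. Qed.

Lemma diff_coord (theta : 'rV[R]_n -> 'rV[R]_n) k x v : differentiable theta x ->
  ('d theta x v) 0 k = 'd ((fun y => theta y 0 k) : 'rV[R]_n -> R^o) x v.
Proof.
move=> dt; have dL := is_diff_lin (theta x) (@coordl_continuous k).
have dth := differentiableP dt.
by rewrite (is_diff_val (is_diff_comp dth dL)).
Qed.

Lemma smooth_coord_comp (theta : 'rV[R]_n -> 'rV[R]_n) k : smooth theta ->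
  smooth ((fun y => theta y 0 k) : 'rV[R]_n -> R^o).
Proof.
move=> st j; elim: j theta st => [|j IH] theta st.
  move=> x; apply: (@continuous_comp _ _ _ theta (coordl k)).
    exact: (smooth_continuous st).
  exact: coordl_continuous.
apply: (@class_CS _ _ _ j _ (fun x v => ('d theta x v) 0 k)).
  move=> x; have dth := differentiableP (smooth_differentiable x st).
  exact: (is_diff_comp dth (is_diff_lin (theta x) (@coordl_continuous k))).
by move=> v; apply: IH; exact: smooth_diff.
Qed.

Lemma divergenceE (theta : 'rV[R]_n -> 'rV[R]_n) z : smooth theta ->
  divergence theta z = \sum_k tgrad (fun x => theta x 0 k) k z.
Proof.
move=> st; rewrite /divergence /mxbullet mxtrace_mulC /mxtrace /tgrad.
under eq_bigr do rewrite mxE.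
apply: eq_bigr => k _; apply: eq_bigr => i _.
have dt := smooth_differentiable z.1 st.
rewrite !mxE -diff_coord// mulrC; congr (_ * _).
Qed.

Definition vfield phi k (x : 'rV[R]_n) : 'rV[R]_n := phi x *: delta_mx 0 k.

Lemma test_field_vfield U phi k : test_fun U phi -> test_field U (vfield phi k).
Proof.
move=> [sp cs sU].
have [cs' s'] := @supp_subset_closed_compact R n 'rV[R]_n (vfield phi k) (supp phi) cs
  (fun x Hx => etrans (congr1 (fun t => t *: _) (supp_out Hx)) (scale0r _)).
split=> //; last exact: subset_trans s' sU.
by move=> j; apply: class_CZ; [exact: sp|exact: class_C_cst].
Qed.

Lemma test_field_coord U theta k : test_field U theta -> test_fun U (fun x => theta x 0 k).
Proof.
move=> [st cs sU]; apply: (@test_fun_of_out _ _ U _ (supp theta)) => //.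
  exact: smooth_coord_comp.
by move=> x /supp_out ->; rewrite mxE.
Qed.

Lemma vfield_coord phi k l x : vfield phi k x 0 l = if l == k then phi x else 0.
Proof. by rewrite /vfield !mxE eqxx/=; case: eqP => _; rewrite ?mulr1 ?mulr0. Qed.

Lemma divergence_vfield phi k z : smooth (phi : 'rV[R]_n -> R^o) ->
  divergence (vfield phi k) z = tgrad phi k z.
Proof.
move=> sp; rewrite divergenceE; last by move=> j; apply: class_CZ; [exact: sp|exact: class_C_cst].
rewrite (bigD1 k)//= big1 ?addr0 => [|l lk].
  by congr tgrad; apply/funext => x; rewrite vfield_coord eqxx.
rewrite (_ : (fun x => _) = fun=> 0) ?tgrad_cst//.
by apply/funext => x; rewrite vfield_coord (negbTE lk).
Qed.

End tangential_gradient.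

Section euclidean_norm.
Variables (R : realType) (n : nat).
Implicit Types u : 'rV[R]_n.

Lemma enormE u : enorm u = Num.sqrt (\sum_i u 0 i ^+ 2).
Proof. by rewrite /enorm mxE; congr Num.sqrt; apply: eq_bigr => i _; rewrite !mxE expr2. Qed.

Lemma coord_le_enorm u i : `|u 0 i| <= enorm u.
Proof.
rewrite enormE -sqrtr_sqr ler_sqrt; last by apply: sumr_ge0 => j _; exact: sqr_ge0.
by rewrite (bigD1 i)//= lerDl; apply: sumr_ge0 => j _; exact: sqr_ge0.
Qed.

Lemma enorm_le_sum u : enorm u <= \sum_i `|u 0 i|.
Proof.
have S0 : 0 <= \sum_i `|u 0 i| by exact: sumr_ge0.
rewrite enormE -[leRHS]ger0_norm// -sqrtr_sqr ler_sqrt ?sqr_ge0//.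
rewrite expr2 mulr_suml; apply: ler_sum => i _.
rewrite -real_normK ?num_real// expr2; apply: ler_wpM2l => //.
by rewrite (bigD1 i)//= lerDl sumr_ge0.
Qed.

Lemma enorm_scale_delta (t : R) k : enorm (t *: (delta_mx 0 k : 'rV[R]_n)) = `|t|.
Proof.
rewrite enormE (bigD1 k)//= big1 ?addr0 => [|i ik].
  by rewrite !mxE !eqxx mulr1 sqrtr_sqr.
by rewrite !mxE eqxx (negbTE ik) mulr0 expr0n.
Qed.

End euclidean_norm.

(** The powers of 2 below [a] form a geometric sum, less than twice its largest term. *)
Lemma geometric_level_sum (R : realType) N (a : R) : 0 <= a ->
  \sum_(j < N) 2 ^+ j * (if 2 ^+ j < a then 1 else 0) <= 2 * a.
Proof.
move=> a0.
have H M : \sum_(j < M) 2 ^+ j * (if 2 ^+ j < a then 1 else 0 : R) <= 2 ^+ M.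
  elim: M => [|M IH]; first by rewrite big_ord0.
  rewrite big_ord_recr/= exprS mulr_natl mulr2n lerD//.
  by case: ifP => _; rewrite ?mulr1// mulr0 exprn_ge0.
elim: N => [|N IH]; first by rewrite big_ord0 mulr_ge0.
rewrite big_ord_recr/=; case: ifP => [Na|_]; last by rewrite mulr0 addr0.
have := H N; lra.
Qed.

Section first_variation_theory.
Variables (R : realType) (n m : nat) (U : set 'rV[R]_n).
Variable V : {outer_measure set ('rV[R]_n * subsp R n) -> \bar R}.
Variable dV : {outer_measure set 'rV[R]_n -> \bar R}.
Hypotheses (oU : open U) (vV : varifold m U V).
Hypotheses (dVm : matches_variation U V dV) (radon_dV : radon_over U dV).
Local Notation wV := (wgt m V).
Let radon_wV : radon_over U wV := radon_wgt oU vV.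

Lemma weighted_tgrad_ointeg b phi k : omeas wV b -> locally_bounded U b ->
  test_fun U phi ->
  ointeg V (fun z => b z.1 * tgrad phi k z) /\
  `|oI V (fun z => b z.1 * tgrad phi k z)| <=
    oI wV (fun x => `|b x| * \sum_i `|'d (phi : 'rV[R]_n -> R^o) x (delta_mx 0 i)|).
Proof.
move=> mb lb tphi; have sphi := test_fun_smooth tphi.
pose S x := \sum_i `|'d (phi : 'rV[R]_n -> R^o) x (delta_mx 0 i)| : R.
have S0 x : 0 <= S x by exact: sumr_ge0.
have iS : ointeg wV (fun x => `|b x| * S x).
  rewrite /S; under eq_fun do rewrite mulr_sumr.
  apply: ointeg_sum => i; under eq_fun do rewrite -normrM mulrC.
  apply: ointeg_norm; apply: (test_locally_bounded_ointeg radon_wV) => //.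
  exact: test_fun_diff.
have mt : omeas V (tgrad phi k) by apply: (radon_continuous_over vV); exact: tgrad_continuous.
have [|H1 H2] := norm_oI_over oU vV (omeasM (omeas_over oU vV mb) mt) iS.
- by move=> z; rewrite [leRHS]normrM normr_id normrM ler_wpM2l// (ger0_norm (S0 _)) tgrad_le.
- split=> //; apply: (le_trans H2).
  by rewrite le_eqVlt; apply/orP; left; apply/eqP/eq_oI => x; rewrite ger0_norm// mulr_ge0.
Qed.

Let locally_bounded_cst c : locally_bounded U (fun=> c).
Proof. by move=> K _ _; exists `|c|. Qed.

Lemma tgrad_ointeg phi k : test_fun U phi -> ointeg V (tgrad phi k).
Proof.
move=> tphi.
have [H _] := @weighted_tgrad_ointeg (fun=> 1) phi k (@omeas_cst _ _ wV 1) (@locally_bounded_cst 1) tphi.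
by move: H; congr (ointeg V _); apply/funext => z; rewrite mul1r.
Qed.

(** The k-th component of the first variation: [delta V] at the field [phi e_k]. *)
Definition fvar k phi : R := oI V (tgrad phi k).

Lemma fvarD k phi psi : test_fun U phi -> test_fun U psi ->
  fvar k (fun x => phi x + psi x) = fvar k phi + fvar k psi.
Proof.
move=> tp tq; rewrite /fvar -oID; try exact: tgrad_ointeg.
by apply: eq_oI => z; exact: (tgradD k z (test_fun_smooth tp) (test_fun_smooth tq)).
Qed.

Lemma fvarZ k c phi : test_fun U phi -> fvar k (fun x => c * phi x) = c * fvar k phi.
Proof.
move=> tp; rewrite /fvar -oIZ; last exact: tgrad_ointeg.
by apply: eq_oI => z; exact: (tgradZ c k z (test_fun_smooth tp)).
Qed.

Lemma fvarB k phi psi : test_fun U phi -> test_fun U psi ->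
  fvar k (fun x => phi x - psi x) = fvar k phi - fvar k psi.
Proof.
move=> tp tq; have E := fvarD k tp (test_funZ (-1) tq).
rewrite fvarZ// mulN1r in E; rewrite -E.
by congr fvar; apply/funext => x; rewrite mulN1r.
Qed.

Lemma first_variation_vfield k phi : test_fun U phi ->
  first_variation V (vfield phi k) = fvar k phi.
Proof.
move=> tp; apply: eq_oI => z; exact: (divergence_vfield k z (test_fun_smooth tp)).
Qed.

Lemma first_variationE theta : test_field U theta ->
  first_variation V theta = \sum_k fvar k (fun x => theta x 0 k).
Proof.
move=> tt; rewrite /fvar -oI_sum => [|k]; last exact/tgrad_ointeg/test_field_coord.
by apply: eq_oI => z; apply: divergenceE; case: tt.
Qed.

(** After division by [M] and a choice of sign, the field [phi e_k] competes in the supremum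
    defining the variation measure of [W]. *)
Lemma fvar_level k phi W (M : R) : test_fun U phi -> open W -> W `<=` U ->
  supp phi `<=` W -> (dV W < +oo)%E -> 0 < M -> (forall x, `|phi x| <= M) ->
  `|fvar k phi| <= M * fine (dV W).
Proof.
move=> tp oW WU sW Woo M0 HM.
have Wfin : dV W \is a fin_num by rewrite ge0_fin_numE ?outer_measure_ge0.
have relW : rel_open U W by exists W => //; exact/setIidr.
have [_ /(_ _ relW) HW] := dVm.
have key (s : R) : `|s| = 1 -> s * fvar k phi <= M * fine (dV W).
  move=> s1; rewrite -ler_pdivrMl// mulrA -lee_fin fineK// HW -fvarZ//.
  have tq : test_fun U (fun x => M^-1 * s * phi x) by exact: test_funZ.
  apply: ereal_sup_ubound; exists (vfield (fun x => M^-1 * s * phi x) k); last first.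
    by congr EFin; rewrite first_variation_vfield.
  split; first exact: test_field_vfield.
    apply: subset_trans sW; apply: supp_subset; first exact: closed_supp.
    by move=> x Hx; rewrite /vfield (supp_out Hx) mulr0 scale0r.
  move=> x; rewrite /vfield enorm_scale_delta !normrM s1 mulr1 gtr0_norm ?invr_gt0//.
  by rewrite ler_pdivrMl// mulr1.
rewrite ler_norml; apply/andP; split.
  by have := key (-1); rewrite normrN normr1 mulN1r => /(_ erefl); lra.
by have := key 1; rewrite normr1 mul1r; apply.
Qed.

(* Dyadic decomposition of [phi] according to the size of [|phi|]: the piece
   where [|phi|] is about [2^j b] is estimated by [fvar_level]. *)
Lemma fvar_le k phi : test_fun U phi ->
  `|fvar k phi| <= 16 * oI dV (fun x => `|phi x|).
Proof.
(* Determines the lowest level [b] for the end of the proof, where its contribution 2 b ||delta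
   V||(W0) has to be at most e. *)
have aux (e q : R) : 0 < e -> 0 <= q -> 0 < e / (2 * (q + 1)) /\ 2 * (e / (2 * (q + 1))) * q <= e.
  move=> e0 q0; have q1 : 0 < 2 * (q + 1) by lra.
  split; first exact: divr_gt0.
  have -> : 2 * (e / (2 * (q + 1))) * q = e * (q / (q + 1)) by field; lra.
  by rewrite ler_piMr ?(ltW e0)// ler_pdivrMr; lra.
move=> tphi; have [sphi cphi sU] := tphi.
have [chi [[schi cchi sUchi] chi01 chi1]] := smooth_urysohn cphi oU sU.
(* A neighbourhood of the support of finite measure, to which the values of size at most 2b are
   charged. *)
pose W0 := [set x | 1 / 2 < chi x].
have copen (h : 'rV[R]_n -> R) (c : R) : continuous h -> open [set x | c < h x].
  by move=> ch; apply: (@open_comp _ _ h [set t | c < t]) => // x _; exact: ch.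
have cnorm : continuous (fun x => `|phi x|).
  move=> x; apply: (@continuous_comp _ _ _ phi (fun t : R^o => `|t|)); last exact: norm_continuous.
  exact: (smooth_continuous sphi).
have oW0 : open W0 by apply: copen; exact: (smooth_continuous schi).
have W0s : W0 `<=` supp chi.
  move=> x; rewrite /W0/= => H; apply: contrapT => /supp_out E; move: H; rewrite E; lra.
have finsub K W : compact K -> K `<=` U -> W `<=` K -> (dV W < +oo)%E.
  move=> cK KU WK; apply: le_lt_trans (radon_compact radon_dV cK KU); exact: le_outer_measure.
have W0oo := finsub _ _ cchi sUchi W0s.
have sW0 : supp phi `<=` W0 by move=> x /chi1 E; rewrite /W0/= E; lra.
have [B B0 HB] := test_fun_bounded tphi.
(* Smooth truncation: [P c] agrees with [phi] where |phi| <= c and vanishes where |phi| >= 2c. *)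
pose P c x := bump (c^-1 * phi x) * phi x.
have tP c : test_fun U (P c).
  apply: test_funM => // j.
  apply: (@class_C_comp_real R _ R^o j (@bump R : R^o -> R^o) (fun x => c^-1 * phi x : R^o)).
    exact: smooth_bump.
  by apply: (@class_CM R _ j (fun=> c^-1) phi); [exact: (@class_C_cst R _ R^o)|exact: sphi].
have sc c t : 0 < c -> `|c^-1 * t| = `|t| / c.
  by move=> c0; rewrite normrM gtr0_norm ?invr_gt0// mulrC.
have P1 c x : 0 < c -> `|phi x| <= c -> P c x = phi x.
  by move=> c0 H; rewrite /P bump1 ?mul1r// sc// ler_pdivrMr// mul1r.
have P0 c x : 0 < c -> 2 * c <= `|phi x| -> P c x = 0.
  by move=> c0 H; rewrite /P bump0 ?mul0r// sc// ler_pdivlMr.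
have Ple c x : `|P c x| <= `|phi x|.
  by rewrite normrM ler_piMl// ger0_norm ?bump_ge0// bump_le1.
have Ple2 c x : 0 < c -> `|P c x| <= 2 * c.
  move=> c0; have [H|H] := leP (2 * c) `|phi x|.
    by rewrite P0// normr0; lra.
  by apply: (le_trans (Ple c x)); exact: ltW.
have key b : 0 < b -> `|fvar k phi| <= 2 * b * fine (dV W0) + 16 * oI dV (fun x => `|phi x|).
  move=> b0.
  pose c j := 2 ^+ j * b : R.
  have c0 j : 0 < c j by rewrite mulr_gt0// exprn_gt0.
  have cS j : c j.+1 = 2 * c j by rewrite /c exprS mulrA.
  pose W j := [set x | c j / 2 < `|phi x|].
  have oW j : open (W j).
    by apply: copen; exact: cnorm.
  have Ws j : W j `<=` supp phi.
    move=> x; rewrite /W/= => H; apply: contrapT => /supp_out E; move: H; rewrite E normr0.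
    by have := c0 j; lra.
  have Woo j := finsub _ _ cphi sU (Ws j).
  have mW j : dV.-caratheodory (W j) by exact: (radon_open radon_dV).
  (* The piece at level c_j vanishes unless c_j <= |phi| <= 4 c_j. Its support lies in [W j], and
     its values are at most 4 c_j. *)
  pose Q j x := P (c j.+1) x - P (c j) x.
  have tQ j : test_fun U (Q j) by exact: test_funB.
  have Qle j : `|fvar k (Q j)| <= 4 * c j * oI dV \1_(W j).
    have -> : oI dV \1_(W j) = fine (dV (W j)) by rewrite -oI_indic.
    apply: fvar_level => //.
    - exact: subset_trans (Ws j) sU.
    - apply: (@subset_trans _ [set x | c j <= `|phi x|]).
        apply: supp_subset.
          apply: (@closed_comp _ _ (fun x => `|phi x|) [set t | c j <= t]); last exact: closed_ge.
          by move=> x _; exact: cnorm.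
        move=> x /negP; rewrite -ltNge => H; rewrite /Q !P1 ?subrr//; first exact: ltW.
        by apply: ltW; apply: (lt_trans H); rewrite cS; have := c0 j; lra.
      by move=> x /= H; rewrite /W/=; have := c0 j; lra.
    - by rewrite mulr_gt0.
    - move=> x; rewrite /Q; have [H|H] := leP (4 * c j) `|phi x|.
        rewrite !P0 ?subrr ?normr0 ?mulr_ge0 ?(ltW (c0 j))//; rewrite ?cS; have := c0 j; lra.
      have cj : 0 < (c j)^-1 by rewrite invr_gt0.
      apply: (@le_trans _ _ `|phi x|); last exact: ltW.
      rewrite /P -mulrBl normrM ler_piMl// ler_norml.
      have := bump_ge0 ((c j)^-1 * phi x); have := bump_le1 ((c j)^-1 * phi x).
      have := bump_ge0 ((c j.+1)^-1 * phi x); have := bump_le1 ((c j.+1)^-1 * phi x).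
      by move=> *; apply/andP; split; lra.
  have tele N : fvar k (P (c N)) = fvar k (P (c 0%N)) + \sum_(j < N) fvar k (Q j).
    elim: N => [|N IH]; first by rewrite big_ord0 addr0.
    by rewrite big_ord_recr/= addrA -IH /Q fvarB// addrC subrK.
  have [N HN] : exists N, B <= c N.
    exists (Num.bound (B / b)); rewrite /c -ler_pdivrMr//.
    apply: (le_trans (ltW (archi_boundP _))); first by rewrite divr_ge0// ltW.
    by rewrite -natrX ler_nat ltnW// ltn_expl.
  have -> : fvar k phi = fvar k (P (c N)).
    by congr fvar; apply/funext => x; rewrite P1//; exact: le_trans (HB x) HN.
  rewrite tele; apply: (le_trans (ler_normD _ _)); apply: lerD.
    apply: fvar_level => //.
    - by move=> x /W0s /sUchi.
    - apply: subset_trans sW0; apply: supp_subset; first exact: closed_supp.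
      by move=> x Hx; rewrite /P (supp_out Hx) mulr0.
    - by rewrite mulr_gt0.
    - by move=> x; have := Ple2 (c 0%N) x (c0 _); rewrite /c expr0 mul1r.
  apply: (le_trans (ler_norm_sum _ _ _)).
  apply: (@le_trans _ _ (\sum_(j < N) oI dV (fun x => 4 * c j * \1_(W j) x))).
    by apply: ler_sum => j _; rewrite oIZ ?Qle//; exact: ointeg_indic.
  rewrite -oI_sum => [|j]; last exact/ointegZ/ointeg_indic.
  rewrite -oIZ; last exact/ointeg_norm/(test_fun_ointeg radon_dV).
  apply: le_oI.
  - by apply: ointeg_sum => j; exact/ointegZ/ointeg_indic.
  - exact/ointegZ/ointeg_norm/(test_fun_ointeg radon_dV).
  (* Membership of x in [W j] means 2^j < 2 |phi x| / b. The sum of these 2^j is at most 4 |phi x| /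
     b, and the factor 4 b from the bound on the pieces yields the constant 16. *)
  - move=> x; have a0 : 0 <= 2 * `|phi x| / b by rewrite divr_ge0 ?mulr_ge0// ltW.
    have := geometric_level_sum N a0.
    rewrite -(ler_pM2l (mulr_gt0 (@ltr0n R 4) b0)) mulr_sumr => H.
    apply: (le_trans _ (le_trans H _)).
      apply: ler_sum => j _; rewrite /c indicE /W mulrA [X in X * _]mulrAC mulrA.
      case: (asboolP (2 ^+ j * b / 2 < `|phi x|)) => Hj.
        rewrite mem_set// ifT// ltr_pdivlMr// ; move: Hj; rewrite /c; lra.
      by rewrite memNset// mulr0 mulr_ge0 ?mulr_ge0 ?exprn_ge0 ?(ltW b0)//; case: ifP.
    by rewrite le_eqVlt; apply/orP; left; apply/eqP; field; rewrite gt_eqF.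
apply/ler_addgt0Pl => e e0.
have F0 : 0 <= fine (dV W0) by rewrite fine_ge0// outer_measure_ge0.
have [d0 Hd] := aux _ _ e0 F0.
by apply: (le_trans (key _ d0)); rewrite lerD2r.
Qed.

Lemma variation_density k : exists eta : 'rV[R]_n -> R,
  [/\ omeas dV eta, locally_bounded U eta &
    forall phi, test_fun U phi -> fvar k phi = oI dV (fun x => phi x * eta x)].
Proof.
apply: (test_functional_local_density oU radon_dV).
- exact: fvarD.
- exact: fvarZ.
- by move=> K _ _; exists 16 => phi tphi _; exact: fvar_le.
Qed.

End first_variation_theory.

Lemma archi_inv (R : realType) (e : R) : 0 < e -> exists k : nat, k.+1%:R^-1 < e.
Proof.
move=> e0; exists (Num.bound e^-1); rewrite -[ltRHS]invrK ltf_pV2 ?posrE ?invr_gt0//.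
apply: (lt_trans (archi_boundP _)); first by rewrite invr_ge0 ltW.
by rewrite ltr_nat.
Qed.

Lemma test_field_sum (R : realType) (n : nat) (U : set 'rV[R]_n) (I : Type) (s : seq I)
    (F : I -> 'rV[R]_n -> 'rV[R]_n) :
  (forall i, test_field U (F i)) -> test_field U (fun x => \sum_(i <- s) F i x).
Proof.
move=> HF; elim: s => [|i s [IH1 IH2 IH3]].
  have [|c0 s0] := @supp_subset_closed_compact R n 'rV[R]_n (fun x => \sum_(i <- [::]) F i x) set0 (@compact0 _).
    by move=> x _; rewrite big_nil.
  split=> //; last by move=> x /s0.
  by move=> k; apply: class_C_sum => i; have [] := HF i.
have [h1 h2 h3] := HF i.
have [|c0 s0] := @supp_subset_closed_compact R n 'rV[R]_n (fun x => \sum_(i <- i :: s) F i x)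
    (supp (F i) `|` supp (fun x => \sum_(i <- s) F i x)) (compactU h2 IH2).
  by move=> x /not_orP[/supp_out H1 /supp_out H2]; rewrite big_cons H1 H2 addr0.
split=> //; last by move=> x /s0[/h3|/IH3].
by move=> k; apply: class_C_sum => j; have [] := HF j.
Qed.

(** * The continuous extension of the first variation to L_1 *)

Section variation_extension.
Variables (R : realType) (n m : nat) (U : set 'rV[R]_n).
Variable V : {outer_measure set ('rV[R]_n * subsp R n) -> \bar R}.
Variable dV : {outer_measure set 'rV[R]_n -> \bar R}.
Hypotheses (oU : open U) (vV : varifold m U V).
Hypotheses (dVm : matches_variation U V dV) (radon_dV : radon_over U dV).
Variable eta : 'I_n -> 'rV[R]_n -> R.
Hypotheses (meta : forall k, omeas dV (eta k)) (leta : forall k, locally_bounded U (eta k)).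
Hypothesis fvar_eta : forall k phi, test_fun U phi ->
  fvar V k phi = oI dV (fun x => phi x * eta k x).

Variable K : set 'rV[R]_n.
Hypotheses (cK : compact K) (KU : K `<=` U).

(** All approximations vanish off one compact set [S] that does not depend on [e]; this is needed
    because the densities [eta k] are bounded on compact sets only. *)
Lemma test_approx_supp a (B : R) : omeas dV a -> (forall x, `|a x| <= B) ->
    (forall x, ~ K x -> a x = 0) ->
  exists2 S, [/\ compact S, S `<=` U & K `<=` S] & forall e : R, 0 < e ->
    exists phi, [/\ test_fun U phi, forall x, ~ S x -> phi x = 0 &
      oI dV (fun x => `|phi x - a x|) < e].
Proof.
move=> ma aB a0; have [chi [tchi chi01 chi1]] := smooth_urysohn cK oU KU.
have [_ cs sU] := tchi; exists (supp chi) => [|e e0].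
  by split=> // x /chi1 E; apply: subset_closure; rewrite /= E oner_eq0.
have [phi tphi Hphi] := radon_L1_approx oU radon_dV cK KU ma aB a0 e0.
have tcp := test_funM (test_fun_smooth tchi) tphi.
exists (fun x => chi x * phi x); split=> //.
  by move=> x /supp_out ->; rewrite mul0r.
have ia : ointeg dV a by apply: (@bounded_ointeg _ _ U dV radon_dV K a B).
apply: le_lt_trans Hphi; apply: le_oI => [||x].
- exact/ointeg_norm/ointegB/ia/(test_fun_ointeg radon_dV).
- exact/ointeg_norm/ointegB/ia/(test_fun_ointeg radon_dV).
- have /andP[h0 h1] := chi01 x.
  have -> : chi x * phi x - a x = chi x * (phi x - a x).
    rewrite mulrBr; have [/chi1 ->|/a0 ->] := pselect (K x); first by rewrite !mul1r.
    by rewrite mulr0.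
  by rewrite normrM ger0_norm// ler_piMl.
Qed.

(** The bound [fvar_le] is carried from test functions to [a] by an intermediate [phi] close to [a].
    Its error enters with the factor 16 from [fvar_le] and with the bound [C] for [eta k] on [S],
    whence the choice of |C| + 17. *)
Lemma fvar_approx k a (B : R) psi : omeas dV a -> (forall x, `|a x| <= B) ->
    (forall x, ~ K x -> a x = 0) -> test_fun U psi ->
  `|fvar V k psi - oI dV (fun x => a x * eta k x)| <= 16 * oI dV (fun x => `|psi x - a x|).
Proof.
move=> ma aB a0 tpsi; have [S [cS SU KS] HS] := test_approx_supp ma aB a0.
have [C HC] := leta k cS SU.
have ia : ointeg dV a by apply: (@bounded_ointeg _ _ U dV radon_dV K a B).
have iae : ointeg dV (fun x => a x * eta k x).
  by apply: (locally_bounded_ointeg radon_dV cK KU) => //; exists B.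
have C1 : 0 < `|C| + 17 by rewrite ltr_wpDl.
apply/ler_addgt0Pl => e e0.
have [phi [tphi phiS Hphi]] := HS _ (divr_gt0 e0 C1).
have ip := test_fun_ointeg radon_dV tphi; have iq := test_fun_ointeg radon_dV tpsi.
set d := oI dV _ in Hphi.
have H1 : `|fvar V k psi - fvar V k phi| <= 16 * (oI dV (fun x => `|psi x - a x|) + d).
  rewrite -(fvarB oU vV)//; apply: (le_trans (fvar_le oU vV dVm radon_dV _ _)); first exact: test_funB.
  apply: ler_wpM2l => //; rewrite -oID; try exact/ointeg_norm/ointegB.
  apply: le_oI => [||x]; first exact/ointeg_norm/ointegB.
    by apply: ointegD; apply: ointeg_norm; exact: ointegB.
  by rewrite [X in _ <= _ + X]distrC; apply: le_trans (ler_normD _ _); rewrite subrKA.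
have H2 : `|fvar V k phi - oI dV (fun x => a x * eta k x)| <= `|C| * d.
  rewrite fvar_eta// -oIB//; last exact: (test_locally_bounded_ointeg radon_dV).
  rewrite -oIZ; last exact/ointeg_norm/ointegB.
  apply: norm_oI_le.
  - apply: omeasB; apply: omeasM => //; exact: ointeg_meas.
  - exact/ointegZ/ointeg_norm/ointegB.
  - move=> x; rewrite -mulrBl normrM mulrC.
    have [Sx|Sx] := pselect (S x).
      by apply: ler_wpM2r => //; apply: le_trans (ler_norm C); exact: HC.
    have Kx : ~ K x by move=> /KS.
    by rewrite phiS// a0// subrr normr0 !mulr0.
rewrite -(subrKA (fvar V k phi)); apply: (le_trans (ler_normD _ _)); apply: (le_trans (lerD H1 H2)).
have d0 : 0 <= d by exact: oI_ge0.
have : (16 + `|C|) * d <= e.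
  apply: (@le_trans _ _ ((`|C| + 17) * (e / (`|C| + 17)))).
    by apply: ler_pM => //; [rewrite addrC lerD2l ler_nat|exact: ltW].
  by rewrite mulrC divfK// gt_eqF.
by rewrite mulrDl mulrDr; lra.
Qed.

(** The extension is a [get], so its value must be forced: along every sequence of test fields
    converging to [w] in L_1 the first variations converge to [X], and such a sequence exists. *)
Lemma first_variation_extE (a : 'I_n -> 'rV[R]_n -> R) (B : R) :
    (forall k, omeas dV (a k)) -> (forall k x, `|a k x| <= B) ->
    (forall k x, ~ K x -> a k x = 0) ->
  first_variation_ext U V dV (fun x => \row_k a k x) =
  \sum_k oI dV (fun x => a k x * eta k x).
Proof.
move=> ma aB a0; set w := fun x => _; set X := \sum_k _.
have ia k : ointeg dV (a k).
  exact: (@bounded_ointeg _ _ U dV radon_dV K (a k) B cK KU (ma k) (fun x _ => aB k x) (a0 k)).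
have ith theta k : test_field U theta -> ointeg dV (fun x => theta x 0 k - a k x).
  by move=> tt; apply/ointegB/ia/(test_fun_ointeg radon_dV); exact: test_field_coord.
have men theta : test_field U theta -> omeas dV (fun x => enorm (theta x - w x)).
  move=> tt; under eq_fun do rewrite enormE.
  apply: (@omeas_comp _ _ dV (fun x => \sum_i (theta x - w x) 0 i ^+ 2) Num.sqrt).
    exact: sqrt_continuous.
  apply: omeas_sum => k.
  have := ointeg_meas (ith theta k tt) => H.
  have H2 := omeasM H H.
  by move: H2; congr (omeas dV _); apply/funext => x; rewrite !mxE expr2.
have ien theta : test_field U theta -> ointeg dV (fun x => enorm (theta x - w x)).
  move=> tt; apply: (@le_ointeg _ _ dV _ (fun x => \sum_k `|theta x 0 k - a k x|)).
  - exact: men.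
  - by apply: ointeg_sum => k; exact/ointeg_norm/ith.
  - move=> x; rewrite ger0_norm ?sqrtr_ge0//; apply: (le_trans (enorm_le_sum _)).
    by apply: ler_sum => k _; rewrite !mxE.
have bound theta : test_field U theta ->
    `|first_variation V theta - X| <= n%:R * 16 * oI dV (fun x => enorm (theta x - w x)).
  move=> tt; rewrite (first_variationE oU vV)// -sumrB.
  apply: (le_trans (ler_norm_sum _ _ _)).
  rewrite -mulrA mulr_natl -[X in _ *+ X]card_ord -sumr_const; apply: ler_sum => k _.
  apply: (le_trans (@fvar_approx k (a k) B _ (ma k) (aB k) (a0 k) _)).
    exact: test_field_coord.
  apply: ler_wpM2l => //; apply: le_oI => [||x].
  - exact/ointeg_norm/ith.
  - exact: ien.
  - by have := coord_le_enorm (theta x - w x) k; rewrite !mxE.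
have oiE theta : test_field U theta ->
    oint dV setT (fun x => (enorm (theta x - w x))%:E) = (oI dV (fun x => enorm (theta x - w x)))%:E.
  by move=> tt; rewrite -ointE//; exact: ien.
have conv (theta : nat -> 'rV[R]_n -> 'rV[R]_n) : (forall i, test_field U (theta i)) ->
    (fun i => oint dV setT (fun x => (enorm (theta i x - w x))%:E)) @ \oo --> 0%E ->
    (fun i => first_variation V (theta i)) @ \oo --> X.
  move=> tt H.
  have H' : (fun i => oI dV (fun x => enorm (theta i x - w x))) @ \oo --> (0 : R).
    exact: (fine_cvg H).
  apply/subr_cvg0/norm_cvg0P.
  apply: (@squeeze_cvgr _ _ _ _ (fun=> 0) (fun i => n%:R * 16 * oI dV (fun x => enorm (theta i x - w x)))).
  - by near=> i; rewrite normr_ge0/= bound.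
  - exact: cvg_cst.
  - by rewrite -(mulr0 (n%:R * 16 : R)); apply: cvgMr.
have [theta [tt H]] : exists theta : nat -> 'rV[R]_n -> 'rV[R]_n, (forall i, test_field U (theta i)) /\
    (fun i => oint dV setT (fun x => (enorm (theta i x - w x))%:E)) @ \oo --> 0%E.
  have Hk i k : exists phi S, [/\ test_fun U phi, [/\ compact S, S `<=` U & forall x, ~ S x -> phi x = 0] &
      oI dV (fun x => `|phi x - a k x|) < i.+1%:R^-1].
    have [S [cS SU _] HS] := test_approx_supp (ma k) (aB k) (a0 k).
    have [|phi [tphi phiS Hphi]] := HS i.+1%:R^-1; first by rewrite invr_gt0.
    by exists phi, S.
  have Hi i : exists theta, test_field U theta /\
      oI dV (fun x => enorm (theta x - w x)) <= n%:R * i.+1%:R^-1.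
    have [phi Hphi] := choice (Hk i).
    have tf : test_field U (fun x => \sum_k vfield (phi k) k x).
      apply: test_field_sum => k; apply: test_field_vfield.
      by have [S []] := Hphi k.
    exists (fun x => \sum_k vfield (phi k) k x); split=> //.
    have E x k : (\sum_l vfield (phi l) l x) 0 k = phi k x.
      rewrite summxE (bigD1 k)//= vfield_coord eqxx big1 ?addr0// => l lk.
      by rewrite vfield_coord eq_sym (negbTE lk).
    apply: (@le_trans _ _ (oI dV (fun x => \sum_k `|phi k x - a k x|))).
      apply: le_oI => [||x].
      - exact: ien.
      - apply: ointeg_sum => k; apply/ointeg_norm; apply/ointegB/ia/(test_fun_ointeg radon_dV).
        by have [S []] := Hphi k.
      - apply: (le_trans (enorm_le_sum _)); apply: ler_sum => k _.
        by rewrite !mxE E.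
    rewrite oI_sum => [|k]; last first.
      apply/ointeg_norm; apply/ointegB/ia/(test_fun_ointeg radon_dV).
      by have [S []] := Hphi k.
    rewrite mulr_natl -[X in _ *+ X]card_ord -sumr_const; apply: ler_sum => k _.
    by have [S [_ _ /ltW]] := Hphi k.
  have [theta Ht] := choice Hi.
  exists theta; split=> [i|]; first by have [] := Ht i.
  apply: cvg_EFin; first by near=> i; rewrite oiE//; have [] := Ht i.
  apply: (@squeeze_cvgr _ _ _ _ (fun=> 0) (fun i : nat => n%:R * i.+1%:R^-1)).
  - near=> i; have [tti Hti] := Ht i; rewrite /= oiE//= Hti andbT.
    by apply: oI_ge0 => x; exact: sqrtr_ge0.
  - exact: cvg_cst.
  - rewrite -(mulr0 (n%:R : R)); apply: cvgMr; exact: cvg_harmonic.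
rewrite /first_variation_ext; set E := [set c | _].
have EX : E X by exists theta; split=> //; exact: conv.
have [th [tth Hth Hc]] := @getPex _ E (ex_intro _ X EX).
have Hx := conv th tth Hth.
by rewrite -(cvg_lim (@Rhausdorff R) Hc) -[RHS](cvg_lim (@Rhausdorff R) Hx).
Unshelve. all: by end_near. Qed.

End variation_extension.

(** * Scalar weak derivatives *)

Section local_lipschitz_approximation.
Variables (R : realType) (n : nat) (U : set 'rV[R]_n) (g : 'rV[R]_n -> R^o).
Hypotheses (oU : open U) (lg : locally_lipschitz U g).

Lemma locally_lipschitz_smooth_approx K : compact K -> K `<=` U ->
  exists2 L : R, 0 <= L & forall e : R, 0 < e -> exists p : 'rV[R]_n -> R^o,
    [/\ smooth p, forall x, K x -> `|p x - g x| <= e &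
      forall x i, K x -> `|'d p x (delta_mx 0 i)| <= L].
Proof.
move=> cK KU; have [L L0 HL] := compact_lipschitz lg cK KU.
exists L => // e e0; have [h hK hL] := lipschitz_extend L0 HL.
have [M M0 HM] := @bounded_on_compact R 'rV[R]_n 'rV[R]_n idfun K (fun x => cvg_id) cK.
have [|p [sp p1 p2]] := lipschitz_smooth_approx (M := M + 1) _ L0 e0 hL; first by rewrite ltr_wpDl.
have cM x i : K x -> `|x 0 i| < M + 1.
  by move=> Kx; apply: (le_lt_trans (rV_coord_le _ _)); apply: (le_lt_trans (HM x Kx)); rewrite ltrDl.
exists p; split=> // [x Kx|x i Kx]; last by apply: p2 => j; exact: cM.
by rewrite -hK//; apply: p1 => i; apply/ltW/cM.
Qed.

Lemma locally_lipschitz_locally_bounded : locally_bounded U g.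
Proof.
move=> K cK KU; have [L L0 HL] := compact_lipschitz lg cK KU.
have [h hK hL] := lipschitz_extend L0 HL.
have [M M0 HM] := @bounded_on_compact R 'rV[R]_n 'rV[R]_n idfun K (fun x => cvg_id) cK.
exists (`|h 0| + L * M) => x Kx; rewrite -hK// -(subrK (h 0) (h x)) addrC.
apply: (le_trans (ler_normD _ _)); rewrite lerD2l; apply: (le_trans (hL _ _)).
by rewrite subr0; apply: ler_wpM2l => //; exact: HM.
Qed.

Lemma locally_lipschitz_omeas (mu : {outer_measure set 'rV[R]_n -> \bar R}) :
  radon_over U mu -> omeas mu g.
Proof.
move=> radon_mu; have [N0 _ _ _ _] := radon_mu.
apply/omeasP => W oW; apply: (@caratheodory_null_eq _ _ mu (U `&` g @^-1` W) _ (~` U)) => //.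
  by apply/seteqP; split=> x [] => [[Ux gx] nU|gx /contrapT Ux]; split=> //; apply.
apply: (radon_open radon_mu); rewrite openE => x [Ux Wx].
have H1 : nbhs x U by apply: open_nbhs_nbhs.
have H2 : nbhs x (g @^-1` W).
  by apply: (locally_lipschitz_continuous lg Ux); apply: open_nbhs_nbhs.
exact: filterI.
Qed.

End local_lipschitz_approximation.

Section weak_derivative_calculus.
Variables (R : realType) (n m : nat) (U : set 'rV[R]_n).
Variable V : {outer_measure set ('rV[R]_n * subsp R n) -> \bar R}.
Variable dV : {outer_measure set 'rV[R]_n -> \bar R}.
Hypotheses (oU : open U) (vV : varifold m U V) (radon_dV : radon_over U dV).
Variables (k : 'I_n) (eta : 'rV[R]_n -> R).
Hypotheses (meta : omeas dV eta) (leta : locally_bounded U eta).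
Hypothesis fvar_eta : forall phi, test_fun U phi ->
  fvar V k phi = oI dV (fun x => phi x * eta x).
Local Notation wV := (wgt m V).
Let radon_wV : radon_over U wV := radon_wgt oU vV.
Implicit Types (a b g A G : 'rV[R]_n -> R).

(** Measurability is asked for both measures, as the identity integrates [a] with respect to ||delta
    V|| and to V. Local boundedness makes the products with test functions integrable. *)
Definition admissible a := [/\ omeas dV a, omeas wV a & locally_bounded U a].

Definition locally_integrable A :=
  omeas wV A /\ forall K, compact K -> K `<=` U -> ointeg wV (fun x => \1_K x * A x).

Definition wd_dV a phi := oI dV (fun x => phi x * (a x * eta x)).
Definition wd_V a phi := oI V (fun z => a z.1 * tgrad phi k z).
Definition wd_wV A phi := oI wV (fun x => phi x * A x).

(* condition (ii) of the definition of T(V, R) for [theta = phi e_k] and [gamma]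
   the identity: [A] is the [k]-th component of the derivative of [a] *)
Definition wd a A := forall phi, test_fun U phi ->
  wd_dV a phi = wd_V a phi + wd_wV A phi.

Lemma admissible_cst c : admissible (fun=> c).
Proof. by split; [exact: omeas_cst|exact: omeas_cst|move=> K _ _; exists `|c|]. Qed.

Lemma admissible_lipschitz g : locally_lipschitz U (g : _ -> R^o) -> admissible g.
Proof.
move=> lg; split; last exact: locally_lipschitz_locally_bounded.
  exact: (locally_lipschitz_omeas oU lg radon_dV).
exact: (locally_lipschitz_omeas oU lg radon_wV).
Qed.

Lemma admissibleD a b : admissible a -> admissible b -> admissible (fun x => a x + b x).
Proof.
move=> [a1 a2 a3] [b1 b2 b3]; split; [exact: omeasD|exact: omeasD|].
move=> K cK KU; have [A HA] := a3 K cK KU; have [B HB] := b3 K cK KU.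
by exists (A + B) => x Kx; apply: (le_trans (ler_normD _ _)); apply: lerD; [exact: HA|exact: HB].
Qed.

Lemma admissibleM a b : admissible a -> admissible b -> admissible (fun x => a x * b x).
Proof.
move=> [a1 a2 a3] [b1 b2 b3]; split; [exact: omeasM|exact: omeasM|].
move=> K cK KU; have [A HA] := a3 K cK KU; have [B HB] := b3 K cK KU.
by exists (A * B) => x Kx; rewrite normrM; apply: ler_pM => //; [exact: HA|exact: HB].
Qed.

Lemma locally_integrableD A B : locally_integrable A -> locally_integrable B ->
  locally_integrable (fun x => A x + B x).
Proof.
move=> [A1 A2] [B1 B2]; split; first exact: omeasD.
move=> K cK KU; under eq_fun do rewrite mulrDr.
by apply: ointegD; [exact: A2|exact: B2].
Qed.

Lemma locally_integrable_le A B : omeas wV A -> locally_integrable B ->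
  (forall x, `|A x| <= B x) -> locally_integrable A.
Proof.
move=> mA [mB iB] H; split=> // K cK KU.
apply: (@le_ointeg _ _ wV _ (fun x => \1_K x * B x)).
- by apply: omeasM => //; apply: omeas_indic; exact: (cpt_caratheodory radon_wV).
- exact: iB.
- by move=> x; rewrite normrM ger0_norm ?ler_wpM2l// indicE.
Qed.

Lemma locally_integrable_bounded A : omeas wV A -> locally_bounded U A -> locally_integrable A.
Proof.
move=> mA lA; split=> // K cK KU.
apply: (locally_bounded_ointeg radon_wV cK KU) => //.
- by apply: omeas_indic; exact: (cpt_caratheodory radon_wV).
- by exists 1 => x; rewrite indicE; case: (_ \in _); rewrite ?normr1 ?normr0.
- by move=> x Kx; rewrite indicE memNset.
Qed.

Lemma locally_integrable_mul_bounded a A : omeas wV a -> locally_bounded U a ->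
  locally_integrable A -> locally_integrable (fun x => a x * A x).
Proof.
move=> ma la [mA iA]; split; first exact: omeasM.
move=> K cK KU; have [B HB] := la K cK KU; have mK := cpt_caratheodory radon_wV cK.
apply: (@le_ointeg _ _ wV _ (fun x => `|B| * `|\1_K x * A x|)).
- by apply: omeasM; [exact: omeas_indic|exact: omeasM].
- exact/ointegZ/ointeg_norm/iA.
- move=> x; rewrite [\1_K x]indicE; case: (asboolP (K x)) => Kx.
    rewrite mem_set// !mul1r normrM ler_wpM2r//.
    by apply: le_trans (ler_norm B); exact: HB.
  by rewrite memNset// !mul0r normr0 mulr0.
Qed.

Lemma locally_integrableM a A : admissible a -> locally_integrable A ->
  locally_integrable (fun x => a x * A x).
Proof. by move=> [_ ma la]; exact: locally_integrable_mul_bounded. Qed.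

Lemma ointeg_dV a phi : admissible a -> test_fun U phi ->
  ointeg dV (fun x => phi x * (a x * eta x)).
Proof.
move=> [ma _ la] tphi; apply: (test_locally_bounded_ointeg radon_dV tphi); first exact: omeasM.
move=> K cK KU; have [A HA] := la K cK KU; have [B HB] := leta cK KU.
by exists (A * B) => x Kx; rewrite normrM; apply: ler_pM => //; [exact: HA|exact: HB].
Qed.

Lemma ointeg_V a phi : admissible a -> test_fun U phi ->
  ointeg V (fun z => a z.1 * tgrad phi k z).
Proof. by move=> [_ ma la] tphi; have [] := weighted_tgrad_ointeg oU vV k ma la tphi. Qed.

Lemma ointeg_wV A phi : locally_integrable A -> test_fun U phi ->
  ointeg wV (fun x => phi x * A x).
Proof.
move=> [mA iA] tphi; have [_ cs sU] := tphi.
have [B B0 HB] := test_fun_bounded tphi.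
apply: (@le_ointeg _ _ wV _ (fun x => B * `|\1_(supp phi) x * A x|)).
- by apply: omeasM => //; apply: ointeg_meas; exact: (test_fun_ointeg radon_wV).
- by apply: ointegZ; apply: ointeg_norm; exact: iA.
- move=> x; rewrite normrM indicE; case: (asboolP (supp phi x)) => Sx.
    by rewrite mem_set// mul1r ler_wpM2r.
  by rewrite (supp_out Sx) normr0 mul0r mulr_ge0.
Qed.

Lemma wd_cst c : wd (fun=> c) (fun=> 0).
Proof.
move=> phi tphi; rewrite /wd_dV /wd_V /wd_wV.
under [X in oI wV X]eq_fun do rewrite mulr0.
rewrite oI0 addr0 oIZ; last exact: (tgrad_ointeg oU vV k tphi).
rewrite -[oI V _]/(fvar V k phi) fvar_eta// -oIZ; last exact: (test_locally_bounded_ointeg radon_dV).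
by apply: eq_oI => x; rewrite mulrCA.
Qed.

Lemma wdD a A b B : admissible a -> locally_integrable A -> wd a A ->
    admissible b -> locally_integrable B -> wd b B ->
  wd (fun x => a x + b x) (fun x => A x + B x).
Proof.
move=> aa iA wa ab iB wb phi tphi; have := wa _ tphi; have := wb _ tphi.
have -> : wd_dV (fun x => a x + b x) phi = wd_dV a phi + wd_dV b phi.
  rewrite /wd_dV -oID; try exact: ointeg_dV.
  by apply: eq_oI => x; rewrite mulrDl mulrDr.
have -> : wd_V (fun x => a x + b x) phi = wd_V a phi + wd_V b phi.
  rewrite /wd_V -oID; try exact: ointeg_V.
  by apply: eq_oI => x; rewrite mulrDl.
have -> : wd_wV (fun x => A x + B x) phi = wd_wV A phi + wd_wV B phi.
  rewrite /wd_wV -oID; try exact: ointeg_wV.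
  by apply: eq_oI => x; rewrite mulrDr.
by move=> -> ->; rewrite addrACA.
Qed.

Lemma tgrad_out phi z : test_fun U phi -> ~ supp phi z.1 -> tgrad phi k z = 0.
Proof.
move=> tphi Hz; rewrite /tgrad big1// => i _; rewrite diff_out ?mul0r//.
exact/smooth_differentiable/(test_fun_smooth tphi).
Qed.

(** Dominated convergence in each of the three integrals. Bounds and convergence matter only on the
    support of [phi], since [phi] and its gradient vanish elsewhere. The limits in the chain rule,
    in (1) and in (4) are instances. *)
Lemma wd_lim (a_ A_ : nat -> 'rV[R]_n -> R) a A H (B : R) phi : test_fun U phi ->
    (forall i, omeas dV (a_ i)) -> (forall i, omeas wV (a_ i)) ->
    omeas dV a -> omeas wV a -> (forall i, omeas wV (A_ i)) -> omeas wV A ->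
    (forall i x, supp phi x -> `|a_ i x| <= B) ->
    (forall x, supp phi x -> (a_ ^~ x) @ \oo --> a x) ->
    locally_integrable H -> (forall i x, supp phi x -> `|A_ i x| <= H x) ->
    (forall x, supp phi x -> (A_ ^~ x) @ \oo --> A x) ->
    (forall i, wd_dV (a_ i) phi = wd_V (a_ i) phi + wd_wV (A_ i) phi) ->
  wd_dV a phi = wd_V a phi + wd_wV A phi.
Proof.
move=> tphi mda mwa mda' mwa' mA mA' aB acvg iH AH Acvg E.
have mphi mu : radon_over U mu -> omeas mu phi.
  by move=> rmu; apply: ointeg_meas; exact: (test_fun_ointeg rmu).
have [_ c1 _] := @oI_dominated _ _ dV (fun i x => phi x * (a_ i x * eta x))
  (fun x => phi x * (a x * eta x)) (fun x => B * `|phi x * eta x|) set0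
  (outer_measure0 dV)
  (fun i => omeasM (mphi _ radon_dV) (omeasM (mda i) meta)) (omeasM (mphi _ radon_dV) (omeasM mda' meta))
  (ointegZ B (ointeg_norm (test_locally_bounded_ointeg radon_dV tphi meta leta)))
  ltac:(move=> x _; have [Sx|/supp_out ->] := pselect (supp phi x);
     [by apply: cvgMr; apply: cvgMl; exact: acvg|by under eq_fun do rewrite mul0r; rewrite mul0r; exact: cvg_cst])
  ltac:(move=> i x _; have [Sx|/supp_out ->] := pselect (supp phi x);
     [by rewrite mulrCA normrM ler_wpM2r//; exact: aB|by rewrite !mul0r normr0 mulr0]).
have mt : omeas V (tgrad phi k) by apply: ointeg_meas; exact: (tgrad_ointeg oU vV k tphi).
have [_ c2 _] := @oI_dominated _ _ V (fun i z => a_ i z.1 * tgrad phi k z)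
  (fun z => a z.1 * tgrad phi k z) (fun z => B * `|tgrad phi k z|) set0
  (outer_measure0 V)
  (fun i => omeasM (omeas_over oU vV (mwa i)) mt) (omeasM (omeas_over oU vV mwa') mt)
  (ointegZ B (ointeg_norm (tgrad_ointeg oU vV k tphi)))
  ltac:(move=> x _; have [Sx|Sx] := pselect (supp phi x.1);
     [by apply: cvgMl; exact: acvg
     |by rewrite (tgrad_out tphi Sx) mulr0; under eq_fun do rewrite mulr0; exact: cvg_cst])
  ltac:(move=> i x _; have [Sx|Sx] := pselect (supp phi x.1);
     [by rewrite normrM ler_wpM2r//; exact: aB|by rewrite (tgrad_out tphi Sx) !mulr0 normr0 mulr0]).
have [_ c3 _] := @oI_dominated _ _ wV (fun i x => phi x * A_ i x)
  (fun x => phi x * A x) (fun x => `|phi x * H x|) set0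
  (outer_measure0 wV)
  (fun i => omeasM (mphi _ radon_wV) (mA i)) (omeasM (mphi _ radon_wV) mA')
  (ointeg_norm (ointeg_wV iH tphi))
  ltac:(move=> x _; have [Sx|/supp_out ->] := pselect (supp phi x);
     [by apply: cvgMr; exact: Acvg|by under eq_fun do rewrite mul0r; rewrite mul0r; exact: cvg_cst])
  ltac:(move=> i x _; have [Sx|/supp_out ->] := pselect (supp phi x);
     [by rewrite !normrM ler_wpM2l//; apply: le_trans (ler_norm _); exact: AH|by rewrite !mul0r normr0]).
have c4 : (fun i => wd_dV (a_ i) phi) @ \oo --> wd_V a phi + wd_wV A phi.
  rewrite (_ : (fun i => wd_dV (a_ i) phi) = (fun i => wd_V (a_ i) phi + wd_wV (A_ i) phi)).
    exact: cvgD c2 c3.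
  by apply/funext => i; exact: E.
by rewrite -[LHS](cvg_lim (@Rhausdorff R) c1) -[RHS](cvg_lim (@Rhausdorff R) c4).
Qed.

End weak_derivative_calculus.

(** * The derivative of a Lipschitzian function and the product rule *)

Section weak_derivative_product.
Variables (R : realType) (n m : nat) (U : set 'rV[R]_n).
Variable V : {outer_measure set ('rV[R]_n * subsp R n) -> \bar R}.
Variable dV : {outer_measure set 'rV[R]_n -> \bar R}.
Hypotheses (oU : open U) (vV : varifold m U V) (radon_dV : radon_over U dV).
Variables (k : 'I_n) (eta : 'rV[R]_n -> R).
Hypotheses (meta : omeas dV eta) (leta : locally_bounded U eta).
Hypothesis fvar_eta : forall phi, test_fun U phi ->
  fvar V k phi = oI dV (fun x => phi x * eta x).
Local Notation wV := (wgt m V).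
Let radon_wV : radon_over U wV := radon_wgt oU vV.
Implicit Types (a b g A G : 'rV[R]_n -> R).
Local Notation adm := (admissible m U V dV).
Local Notation lint := (locally_integrable m U V).
Local Notation wD := (wd m U V dV k eta).
Local Notation I1 := (wd_dV dV eta).
Local Notation I2 := (wd_V V k).
Local Notation I3 := (wd_wV m V).

Lemma admissible_smooth (p : 'rV[R]_n -> R^o) : smooth p -> adm p.
Proof.
move=> /smooth_continuous cp; split.
- exact: (radon_continuous radon_dV cp).
- exact: (radon_continuous radon_wV cp).
- by move=> K cK _; have [B _ HB] := bounded_on_compact cp cK; exists B.
Qed.

(** Integration by parts: phi a grad p = a grad (p phi) - p a grad phi, and the identity for [a] is
    applied to the test function p phi. Replacing [p] by [g] in the outcome costs [e] times a
    constant that depends on [phi], [a] and [A] alone. The integral of phi a grad p thus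
    approximates the defect of the identity for g a. *)
Lemma wd_smooth_approx a A phi : wD a A -> adm a -> lint A -> test_fun U phi ->
  exists2 C : R, 0 <= C & forall g (p : 'rV[R]_n -> R^o) (e : R), adm g -> smooth p -> 0 <= e ->
    (forall x, supp phi x -> `|p x - g x| <= e) ->
    ointeg V (fun z => phi z.1 * a z.1 * tgrad p k z) /\
    `|oI V (fun z => phi z.1 * a z.1 * tgrad p k z) -
      (I1 (fun x => g x * a x) phi - I2 (fun x => g x * a x) phi -
       I3 (fun x => g x * A x) phi)| <= e * C.
Proof.
move=> wa aa lA tphi; have sphi := test_fun_smooth tphi.
exists (oI dV (fun x => `|phi x * (a x * eta x)|) + oI V (fun z => `|a z.1 * tgrad phi k z|) +
  oI wV (fun x => `|phi x * A x|)).
  by rewrite !addr_ge0 ?oI_ge0.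
move=> g p e ag sp e0 Hp.
have ap := admissible_smooth sp.
have tpp := test_funM sp tphi.
have apa := admissibleM ap aa; have aga := admissibleM ag aa.
have lpA := locally_integrableM oU vV ap lA; have lgA := locally_integrableM oU vV ag lA.
have E z : phi z.1 * a z.1 * tgrad p k z =
    a z.1 * tgrad (fun x => p x * phi x) k z - p z.1 * a z.1 * tgrad phi k z.
  by rewrite (tgrad_mul k z sp sphi); ring.
have i2 := ointeg_V oU vV k aa tpp.
have i2' := ointeg_V oU vV k apa tphi.
split.
  by move: (ointegB i2 i2'); congr (ointeg V _); apply/funext => z; rewrite E.
have E2 : oI V (fun z => phi z.1 * a z.1 * tgrad p k z) =
    I2 a (fun x => p x * phi x) - I2 (fun x => p x * a x) phi.
  transitivity (oI V (fun z => a z.1 * tgrad (fun x => p x * phi x) k z - p z.1 * a z.1 * tgrad phi k z)).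
    exact: eq_oI.
  exact: (oIB i2 i2').
have E1 : I1 a (fun x => p x * phi x) = I1 (fun x => p x * a x) phi.
  by apply: eq_oI => x; rewrite -mulrA mulrCA -[p x * a x * _]mulrA.
have E3 : I3 A (fun x => p x * phi x) = I3 (fun x => p x * A x) phi.
  by apply: eq_oI => x; rewrite -mulrA mulrCA.
have -> : oI V (fun z => phi z.1 * a z.1 * tgrad p k z) =
    I1 (fun x => p x * a x) phi - I2 (fun x => p x * a x) phi - I3 (fun x => p x * A x) phi.
  rewrite E2; have := wa _ tpp; rewrite E1 E3.
  move: (I1 _ _) (I2 _ _) (I2 _ _) (I3 _ _) => x1 x2 x3 x4 ->.
  by rewrite addrAC addrK.
have dist : forall x, phi x != 0 -> `|p x - g x| <= e.
  by move=> x px; apply: Hp; exact: subset_closure.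
have d1 : `|I1 (fun x => p x * a x) phi - I1 (fun x => g x * a x) phi| <=
    e * oI dV (fun x => `|phi x * (a x * eta x)|).
  have j := ointeg_dV radon_dV meta leta aa tphi.
  have j1 := ointeg_dV radon_dV meta leta apa tphi.
  have j2 := ointeg_dV radon_dV meta leta aga tphi.
  rewrite /wd_dV -oIB// -oIZ; last exact: ointeg_norm.
  apply: norm_oI_le; [exact: (ointeg_meas (ointegB j1 j2))|exact/ointegZ/ointeg_norm|].
  move=> x; rewrite (_ : _ - _ = (p x - g x) * (phi x * (a x * eta x))); last by ring.
  rewrite normrM; have [->|px] := eqVneq (phi x) 0; first by rewrite mul0r normr0 !mulr0.
  by rewrite ler_wpM2r// dist.
have d2 : `|I2 (fun x => p x * a x) phi - I2 (fun x => g x * a x) phi| <=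
    e * oI V (fun z => `|a z.1 * tgrad phi k z|).
  have j := ointeg_V oU vV k aa tphi.
  have j1 := ointeg_V oU vV k apa tphi.
  have j2 := ointeg_V oU vV k aga tphi.
  rewrite /wd_V -oIB// -oIZ; last exact: ointeg_norm.
  apply: norm_oI_le; [exact: (ointeg_meas (ointegB j1 j2))|exact/ointegZ/ointeg_norm|].
  move=> z; rewrite (_ : _ - _ = (p z.1 - g z.1) * (a z.1 * tgrad phi k z)); last by ring.
  rewrite normrM; have [Sz|Sz] := pselect (supp phi z.1).
    by rewrite ler_wpM2r// Hp.
  by rewrite (tgrad_out k tphi Sz) mulr0 normr0 !mulr0.
have d3 : `|I3 (fun x => p x * A x) phi - I3 (fun x => g x * A x) phi| <=
    e * oI wV (fun x => `|phi x * A x|).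
  have j := ointeg_wV oU vV lA tphi.
  have j1 := ointeg_wV oU vV lpA tphi.
  have j2 := ointeg_wV oU vV lgA tphi.
  rewrite /wd_wV -oIB// -oIZ; last exact: ointeg_norm.
  apply: norm_oI_le; [exact: (ointeg_meas (ointegB j1 j2))|exact/ointegZ/ointeg_norm|].
  move=> x; rewrite (_ : _ - _ = (p x - g x) * (phi x * A x)); last by ring.
  rewrite normrM; have [->|px] := eqVneq (phi x) 0; first by rewrite mul0r normr0 !mulr0.
  by rewrite ler_wpM2r// dist.
move: d1 d2 d3; set x1 := I1 _ _; set y1 := I1 _ _; set x2 := I2 _ _; set y2 := I2 _ _.
set x3 := I3 _ _; set y3 := I3 _ _ => d1 d2 d3.
rewrite (_ : _ - _ = (x1 - y1) - (x2 - y2) - (x3 - y3)); last by ring.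
apply: (le_trans (ler_normB _ _)); rewrite !mulrDr; apply: lerD d3.
by apply: (le_trans (ler_normB _ _)); exact: lerD.
Qed.

Lemma smooth_tgrad_le (b : 'rV[R]_n -> R) (p : 'rV[R]_n -> R^o) (L : R) K : 0 <= L ->
  ointeg wV b -> (forall x, ~ K x -> b x = 0) -> smooth p ->
  (forall x i, K x -> `|'d p x (delta_mx 0 i)| <= L) ->
  `|oI V (fun z => b z.1 * tgrad p k z)| <= n%:R * L * oI wV (fun x => `|b x|).
Proof.
move=> L0 ib b0 sp Hp.
have nL0 : 0 <= n%:R * L by rewrite mulr_ge0.
have mt : omeas V (tgrad p k) by apply: (radon_continuous_over vV); exact: tgrad_continuous.
have mc := omeasM (omeas_over oU vV (ointeg_meas ib)) mt.
have [|_] := norm_oI_over oU vV mc (ointegZ (n%:R * L) ib).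
  move=> z; rewrite !normrM mulrC; have [Kz|/b0 ->] := pselect (K z.1); last by rewrite normr0 !mulr0.
  apply: ler_wpM2r => //; apply: (le_trans (tgrad_le _ _ _)).
  rewrite -[`|n%:R| * _]normrM ger0_norm// mulr_natl -[X in _ *+ X]card_ord -sumr_const.
  by apply: ler_sum => i _; exact: Hp.
move=> /le_trans; apply; rewrite -oIZ; last exact: ointeg_norm.
by rewrite le_eqVlt; apply/orP; left; apply/eqP/eq_oI => x; rewrite normrM ger0_norm.
Qed.

Let mul1 g : (fun x => g x * 1) = g.
Proof. by apply/funext => x; rewrite mulr1. Qed.

Let I3_0 (h phi : 'rV[R]_n -> R) : I3 (fun x => h x * 0) phi = 0.
Proof.
rewrite /wd_wV (_ : (fun x => _) = fun=> 0); first exact: oI0.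
by apply/funext => x; rewrite !mulr0.
Qed.

Let lint0 : lint (fun=> 0).
Proof.
apply: (locally_integrable_bounded oU vV); first exact: omeas_cst.
by move=> K _ _; exists `|0 : R|.
Qed.

Let wd1 : wD (fun=> 1) (fun=> 0) := wd_cst oU vV radon_dV meta leta fvar_eta 1.

Let supp_sub K (phi : 'rV[R]_n -> R) : compact K -> (forall x, ~ K x -> phi x = 0) -> supp phi `<=` K.
Proof. by move=> cK; apply: supp_subset; apply: compact_closed => //; exact: norm_hausdorff. Qed.

Let defect1 g (phi : 'rV[R]_n -> R) :
  I1 (fun x => g x * 1) phi - I2 (fun x => g x * 1) phi - I3 (fun x => g x * 0) phi =
  I1 g phi - I2 g phi.
Proof. by rewrite I3_0 subr0 mul1. Qed.

(** With a = 1, the defect of [g] at [phi] is a limit of integrals of phi grad p with uniformly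
    bounded grad p. It is therefore dominated by the weight integral of |phi| and has a locally
    bounded density. *)
Lemma lipschitz_weak_derivative g : locally_lipschitz U (g : _ -> R^o) ->
  exists G, [/\ omeas wV G, locally_bounded U G & wD g G].
Proof.
move=> lg; have ag := admissible_lipschitz oU vV radon_dV lg.
have [|||G [mG lG HG]] := @test_functional_local_density R n U wV oU radon_wV
  (fun phi => I1 g phi - I2 g phi).
- move=> phi psi tp tq; have sp := test_fun_smooth tp; have sq := test_fun_smooth tq.
  have -> : I1 g (fun x => phi x + psi x) = I1 g phi + I1 g psi.
    rewrite /wd_dV -oID; last 2 first.
    - exact: (ointeg_dV radon_dV meta leta ag tp).
    - exact: (ointeg_dV radon_dV meta leta ag tq).
    by apply: eq_oI => x; rewrite mulrDl.
  have -> : I2 g (fun x => phi x + psi x) = I2 g phi + I2 g psi.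
    rewrite /wd_V -oID; last 2 first.
    - exact: (ointeg_V oU vV k ag tp).
    - exact: (ointeg_V oU vV k ag tq).
    by apply: eq_oI => z; rewrite (tgradD k z sp sq) mulrDr.
  by rewrite opprD addrACA.
- move=> c phi tp; have sp := test_fun_smooth tp.
  have -> : I1 g (fun x => c * phi x) = c * I1 g phi.
    rewrite /wd_dV -oIZ; last exact: (ointeg_dV radon_dV meta leta ag tp).
    by apply: eq_oI => x; rewrite -mulrA.
  have -> : I2 g (fun x => c * phi x) = c * I2 g phi.
    rewrite /wd_V -oIZ; last exact: (ointeg_V oU vV k ag tp).
    by apply: eq_oI => z; rewrite (tgradZ c k z sp) mulrCA.
  by rewrite mulrBr.
- move=> K cK KU; have [L L0 HL] := locally_lipschitz_smooth_approx lg cK KU.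
  exists (n%:R * L) => phi tphi phi0.
  have [C C0 HC] := wd_smooth_approx wd1 (admissible_cst _ _ _ _ 1) lint0 tphi.
  have C1 : 0 < C + 1 by lra.
  apply/ler_addgt0Pr => e e0.
  have d0 : 0 < e / (C + 1) by exact: divr_gt0.
  have [p [sp pg dp]] := HL _ d0.
  have [|_] := HC g p _ ag sp (ltW d0).
    by move=> x /(supp_sub cK phi0); exact: pg.
  rewrite defect1; under [X in oI V X]eq_fun do rewrite mulr1.
  have := smooth_tgrad_le L0 (test_fun_ointeg radon_wV tphi) phi0 sp dp.
  set s := I1 g phi - I2 g phi; set t := oI V _; set u := n%:R * L * _ => H1 H2.
  have H3 : e / (C + 1) * C <= e.
    by rewrite mulrAC ler_pdivrMr// ler_wpM2l ?(ltW e0)// lerDl.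
  rewrite -[s](subKr t); apply: (le_trans (ler_normB _ _)); lra.
by exists G; split=> // phi tphi; rewrite -[I3 G phi](HG phi tphi) addrC subrK.
Qed.

(** The defect of g a is a limit of integrals of phi a grad p, where grad p is bounded but need not
    converge. For a test function [psi] in place of [a] the limit is known: it is the integral of
    psi phi G, because [G] is the derivative of [g]. The replacement costs at most the gradient
    bound times the integral of |phi (psi - a)|. *)
Lemma wd_mul a A g G : adm a -> lint A -> wD a A ->
    locally_lipschitz U (g : _ -> R^o) -> omeas wV G -> locally_bounded U G -> wD g G ->
  wD (fun x => g x * a x) (fun x => g x * A x + a x * G x).
Proof.
move=> aa lA wa lg mG lG wg phi tphi; have ag := admissible_lipschitz oU vV radon_dV lg.
have [sphi cK KU] := tphi; set K := supp phi in cK KU.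
have lGi : lint G by exact: (locally_integrable_bounded oU vV).
have -> : I3 (fun x => g x * A x + a x * G x) phi =
    I3 (fun x => g x * A x) phi + I3 (fun x => a x * G x) phi.
  rewrite /wd_wV -oID; last 2 first.
  - exact: (ointeg_wV oU vV (locally_integrableM oU vV ag lA) tphi).
  - exact: (ointeg_wV oU vV (locally_integrableM oU vV aa lGi) tphi).
  by apply: eq_oI => x; rewrite mulrDr.
suff : (I1 (fun x => g x * a x) phi - I2 (fun x => g x * a x) phi - I3 (fun x => g x * A x) phi)
    - I3 (fun x => a x * G x) phi = 0 by lra.
have [L L0 HL] := locally_lipschitz_smooth_approx lg cK KU.
have [Bf Bf0 HBf] := test_fun_bounded tphi.
have [BG HBG] := lG K cK KU; have [_ mwa la] := aa; have [Ba HBa] := la K cK KU.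
pose D := n%:R * L * Bf + Bf * `|BG|.
have D0 : 0 <= D by rewrite addr_ge0// ?mulr_ge0.
have mK := cpt_caratheodory radon_wV cK.
set S' := I3 (fun x => a x * G x) phi; set S := (X in X - S').
(* [D] is fixed before the L_1 distance [d] between [psi] and [a], so [d] may tend to 0. *)
suff H d : 0 < d -> `|S - S'| <= D * d.
  apply/eqP; rewrite -normr_le0; apply/ler_addgt0Pr => e e0; rewrite add0r.
  have D1 : 0 < D + 1 by lra.
  apply: (le_trans (H _ (divr_gt0 e0 D1))).
  by rewrite mulrCA ler_piMr ?(ltW e0)// ler_pdivrMr// mul1r lerDl.
move=> d0.
have [||||psi tpsi Hpsi] := @radon_L1_approx R n U wV oU radon_wV K (fun x => \1_K x * a x) `|Ba| d cK KU.
- by apply: omeasM => //; exact: omeas_indic.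
- move=> x; rewrite indicE; case: (asboolP (K x)) => Kx; last by rewrite memNset// mul0r normr0.
  by rewrite mem_set// mul1r; apply: le_trans (ler_norm Ba); exact: HBa.
- by move=> x Kx; rewrite indicE memNset// mul0r.
- by [].
have tpf := test_funM (test_fun_smooth tpsi) tphi.
have iKa : ointeg wV (fun x => \1_K x * a x).
  by have [_ H] := locally_integrable_bounded oU vV mwa la; exact: H.
have ipsi := test_fun_ointeg radon_wV tpsi.
have idf : ointeg wV (fun x => `|psi x - \1_K x * a x|) by exact/ointeg_norm/ointegB.
set del := oI wV _ in Hpsi.
have [C1 C10 HC1] := wd_smooth_approx wa aa lA tphi.
have [C2 C20 HC2] := wd_smooth_approx wd1 (admissible_cst _ _ _ _ 1) lint0 tpf.
have C3 : 0 < C1 + C2 + 1 by lra.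
apply/ler_addgt0Pr => e e0.
have [p [sp pg dp]] := HL _ (divr_gt0 e0 C3).
have [i1 H1] := HC1 g p _ ag sp (ltW (divr_gt0 e0 C3)) pg.
have pfK x : ~ K x -> psi x * phi x = 0 by move=> /supp_out ->; rewrite mulr0.
have [|i2 H2] := HC2 g p _ ag sp (ltW (divr_gt0 e0 C3)).
  by move=> x /(supp_sub cK pfK); exact: pg.
have defG : I1 g (fun x => psi x * phi x) - I2 g (fun x => psi x * phi x) = I3 G (fun x => psi x * phi x).
  by have := wg _ tpf; move: (I1 _ _) (I2 _ _) (I3 _ _) => x1 x2 x3 ->; rewrite addrAC addrN add0r.
rewrite defect1 defG in H2.
have HK x : psi x * phi x - phi x * a x = phi x * (psi x - \1_K x * a x).
  rewrite indicE; case: (asboolP (K x)) => Kx; first by rewrite mem_set// mul1r; ring.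
  by rewrite memNset// (supp_out Kx); ring.
have ipa : ointeg wV (fun x => phi x * a x).
  have [ma' ia'] := locally_integrable_bounded oU vV mwa la.
  by apply: (ointeg_wV oU vV).
have ib : ointeg wV (fun x => psi x * phi x - phi x * a x).
  by apply: ointegB ipa; exact: (test_fun_ointeg radon_wV tpf).
have le1 : oI wV (fun x => `|psi x * phi x - phi x * a x|) <= Bf * del.
  rewrite /del -oIZ//; apply: le_oI; [exact: ointeg_norm|exact: ointegZ|].
  by move=> x; rewrite HK normrM ler_wpM2r.
have H3 : `|oI V (fun z => psi z.1 * phi z.1 * 1 * tgrad p k z) -
    oI V (fun z => phi z.1 * a z.1 * tgrad p k z)| <= n%:R * L * Bf * del.
  rewrite -oIB// -[leRHS]mulrA.
  apply: le_trans (ler_wpM2l (mulr_ge0 (ler0n _ _) L0) le1).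
  rewrite (@eq_oI _ _ V _ (fun z => (psi z.1 * phi z.1 - phi z.1 * a z.1) * tgrad p k z)).
    apply: (smooth_tgrad_le L0 ib _ sp dp) => x Kx.
    by rewrite HK (supp_out Kx) mul0r.
  by move=> z; rewrite mulr1 mulrBl.
have H4 : `|I3 G (fun x => psi x * phi x) - S'| <= Bf * `|BG| * del.
  have j1 := ointeg_wV oU vV lGi tpf.
  have j2 := ointeg_wV oU vV (locally_integrableM oU vV aa lGi) tphi.
  rewrite /S' /wd_wV -oIB// /del -oIZ//; apply: norm_oI_le.
  - exact: (ointeg_meas (ointegB j1 j2)).
  - exact: ointegZ.
  - move=> x; rewrite mulrA -mulrBl HK [leLHS]normrM [`|phi x * _|]normrM.
    have [Kx|/supp_out ->] := pselect (K x).
      rewrite mulrAC; apply: ler_wpM2r => //; apply: ler_pM => //.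
      by apply: le_trans (ler_norm BG); exact: HBG.
    by rewrite normr0 !mul0r !mulr_ge0.
have del0 : 0 <= del by exact: oI_ge0.
have He : e / (C1 + C2 + 1) * C1 + e / (C1 + C2 + 1) * C2 <= e.
  by rewrite -mulrDr mulrAC ler_pdivrMr// ler_wpM2l ?(ltW e0)// lerDl.
have Hd : n%:R * L * Bf * del + Bf * `|BG| * del <= D * d.
  by rewrite -mulrDl ler_wpM2l ?(ltW Hpsi).
move: H1 H2 H3 H4; set t1 := oI V _; set t2 := oI V _; set t3 := I3 G _ => H1 H2 H3 H4.
(* The four errors: smoothing [g] in the defect of g a, exchanging [a] for [psi], smoothing [g] in
   its own defect, and exchanging [psi] for [a] in the integral against [G]. *)
have -> : S - S' = - (t1 - S) - (t2 - t1) + (t2 - t3) + (t3 - S') by ring.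
apply: (le_trans (ler_normD _ _)); apply: (le_trans (lerD (ler_normD _ _) (lexx _))).
apply: (le_trans (lerD (lerD (ler_normB _ _) (lexx _)) (lexx _))).
rewrite normrN; lra.
Qed.

End weak_derivative_product.

(** * Uniqueness of weak derivatives *)

Section weak_derivative_uniqueness.
Variables (R : realType) (n : nat) (U : set 'rV[R]_n).
Variable mu : {outer_measure set 'rV[R]_n -> \bar R}.
Hypotheses (oU : open U) (radon_mu : radon_over U mu).

(** Borel-Cantelli: the tail from index M on has measure at most 2^-M. *)
Lemma limsup_null (E : nat -> set 'rV[R]_n) :
  (forall i, (mu (E i) < (2 ^- i.+1)%:E)%E) ->
  mu (\bigcap_M \bigcup_i E (M + i)%N) = 0%E.
Proof.
move=> HE; apply/eqP; rewrite eq_le outer_measure_ge0 andbT; apply/lee_addgt0Pr => e e0.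
rewrite add0e; have [M HM] := archi_inv e0.
apply: (@le_trans _ _ (mu (\bigcup_i E (M + i)%N))).
  by apply: le_outer_measure => x; apply.
apply: (le_trans (outer_measure_sigma_subadditive mu _)).
apply: (@le_trans _ _ (\sum_(i <oo | xpredT i) ((2 ^- M : R) / (2 ^ i.+1)%:R)%:E)%E).
  apply: lee_nneseries => i _ *; first exact: outer_measure_ge0.
  apply: ltW; apply: (lt_le_trans (HE _)); rewrite lee_fin -addnS exprD invfM.
  by rewrite natrX.
apply: (le_trans (epsilon_trick0 _ _)); first by rewrite invr_ge0 exprn_ge0.
rewrite lee_fin; apply: le_trans (ltW HM).
rewrite lef_pV2 ?posrE ?exprn_gt0//; first by rewrite -natrX ler_nat ltn_expl.
Qed.

(** Fundamental lemma of the calculus of variations. On a compact set, the indicator of the part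
    where [A] has a given sign is an almost everywhere limit of test functions by [limsup_null]; the
    cut-off [chi] provides the dominating function. *)
Lemma test_orthogonal_null A :
  omeas mu A -> (forall K, compact K -> K `<=` U -> ointeg mu (fun x => \1_K x * A x)) ->
  (forall phi, test_fun U phi -> oI mu (fun x => phi x * A x) = 0) ->
  mu [set x | A x <> 0] = 0%E.
Proof.
move=> mA iA A0.
have [muU _ _ _ _] := radon_mu.
have key j (s : R) : `|s| = 1 -> mu (cpt_exh U j `&` [set x | 0 < s * A x]) = 0%E.
  move=> s1; set K := cpt_exh U j; set B := K `&` _.
  have cK : compact K by exact: compact_cpt_exh.
  have KU : K `<=` U by exact: cpt_exh_sub.
  have mK := cpt_caratheodory radon_mu cK.
  have mB : mu.-caratheodory B.
    apply: caratheodory_measurable_setI => //.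
    have /omeasP H : omeas mu (fun x => s * A x) by apply: omeasM => //; exact: omeas_cst.
    exact: (H _ (@open_gt R 0)).
  have BK : B `<=` K by exact: subIsetl.
  have [chi [tchi chi01 chi1]] := smooth_urysohn cK oU KU.
  have [_ cS SU] := tchi.
  have Hi i : exists pE : ('rV[R]_n -> R) * set 'rV[R]_n, [/\ test_fun U pE.1,
      forall x, 0 <= pE.1 x <= 1, (mu pE.2 < (2 ^- i.+1)%:E)%E & forall x, ~ pE.2 x -> pE.1 x = \1_B x].
    have [|phi [E [h1 h2 h3 h4 h5]]] := radon_indic_approx oU radon_mu cK KU BK mB (e := 2 ^- i.+1).
      by rewrite invr_gt0 exprn_gt0.
    by exists (phi, E).
  have [pE HpE] := choice Hi.
  have N0 := @limsup_null (fun i => (pE i).2) (fun i => let: And4 _ _ h _ := HpE i in h).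
  set N := \bigcap_M _ in N0.
  have ichi : ointeg mu (fun x => `|\1_(supp chi) x * A x|) by exact/ointeg_norm/iA.
  have mphi phi : test_fun U phi -> omeas mu phi.
    by move=> tp; apply: ointeg_meas; exact: (test_fun_ointeg radon_mu).
  have tpsi i : test_fun U (fun x => (pE i).1 x * chi x).
    by have [h _ _ _] := HpE i; exact: (test_funM (test_fun_smooth h) tchi).
  have cvg_psi x : ~ N x ->
      (fun i => (pE i).1 x * chi x * A x) @ \oo --> \1_B x * A x.
    move=> Nx; have [M HM] : exists M, forall i, ~ (pE (M + i)%N).2 x.
      apply: contrapT => /forallNP H; apply: Nx => M _.
      by have /existsNP[i /contrapT Hi'] := H M; exists i.
    apply: cvg_near_cst; exists M => // i /= Mi.
    have [_ _ _ h] := HpE i; rewrite h; last by have := HM (i - M)%N; rewrite subnKC.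
    rewrite indicE; case: (asboolP (B x)) => Bx; last by rewrite memNset// !mul0r.
    by rewrite mem_set// chi1 ?mulr1//; exact: BK.
  have psi_le i x : ~ N x -> `|(pE i).1 x * chi x * A x| <= `|\1_(supp chi) x * A x|.
    move=> _; have [_ /(_ x)/andP[h0 h1] _ _] := HpE i; have /andP[c0 c1] := chi01 x.
    rewrite [leLHS]normrM [leRHS]normrM ler_wpM2r// indicE.
    case: (asboolP (supp chi x)) => Sx; last by rewrite (supp_out Sx) mulr0 normr0 normr_ge0.
    by rewrite mem_set// normr1 normrM !ger0_norm// mulr_ile1.
  have [iB cvB _] := oI_dominated N0 (fun i => omeasM (mphi _ (tpsi i)) mA)
    (omeasM (omeas_indic mB) mA) ichi cvg_psi psi_le.
  have B0 : oI mu (fun x => \1_B x * A x) = 0.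
    rewrite -[LHS](cvg_lim (@Rhausdorff R) cvB).
    rewrite (_ : (fun i => _) = fun=> 0); first exact: lim_cst.
    by apply/funext => i; exact: A0.
  apply: null_sub (oI_norm_eq0 iB _).
    move=> x Bx /=; rewrite indicE mem_set// mul1r => E.
    by have [_ /=] := Bx; rewrite E mulr0 ltxx.
  rewrite -[RHS](mulr0 s) -B0 -oIZ//; apply: eq_oI => x.
  rewrite indicE; case: (asboolP (B x)) => Bx; last by rewrite memNset// mul0r normr0 mulr0.
  rewrite mem_set// mul1r -[LHS]mul1r -s1 -normrM ger0_norm//.
  by have [_ /ltW] := Bx.
apply: (@null_sub _ _ mu _ (\bigcup_j ((cpt_exh U j `&` [set x | 0 < 1 * A x]) `|`
    (cpt_exh U j `&` [set x | 0 < -1 * A x])) `|` ~` U)).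
  move=> x /eqP /= Ax; have [Ux|] := pselect (U x); last by right.
  have [j _ Kx] : (\bigcup_j cpt_exh U j) x by rewrite -(cpt_exh_bigcup oU).
  left; exists j => //; move: Ax; rewrite neq_lt => /orP[Ax|Ax].
    by right; split=> //=; lra.
  by left; split=> //=; lra.
apply: null_setU => //; apply: null_bigcup => j.
by apply: null_setU; apply: key; rewrite ?normrN normr1.
Qed.

End weak_derivative_uniqueness.

Lemma wd_unique (R : realType) (n m : nat) (U : set 'rV[R]_n)
    (V : {outer_measure set ('rV[R]_n * subsp R n) -> \bar R})
    (dV : {outer_measure set 'rV[R]_n -> \bar R}) k eta a A A' :
  open U -> varifold m U V ->
  locally_integrable m U V A -> locally_integrable m U V A' ->
  wd m U V dV k eta a A -> wd m U V dV k eta a A' ->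
  wgt m V [set x | A x <> A' x] = 0%E.
Proof.
move=> oU vV [mA iA] [mA' iA'] wA wA'.
apply: null_sub (@test_orthogonal_null R n U (wgt m V) oU (radon_wgt oU vV) (fun x => A x - A' x) _ _ _).
- by move=> x /= H /eqP; rewrite subr_eq0 => /eqP.
- exact: omeasB.
- move=> K cK KU; under eq_fun do rewrite mulrBr.
  by apply: ointegB; [exact: iA|exact: iA'].
- move=> phi tphi; under eq_fun do rewrite mulrBr.
  have j := ointeg_wV oU vV (conj mA iA) tphi.
  have j' := ointeg_wV oU vV (conj mA' iA') tphi.
  rewrite (oIB j j'); have := wA _ tphi; rewrite (wA' _ tphi) => /addrI.
  by rewrite /wd_wV => ->; rewrite subrr.
Qed.

(** * The chain rule *)

Section caratheodory_functions.
Variables (R : realType) (T : pointedType).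
Variable mu : {outer_measure set T -> \bar R}.

(** Composition with a Caratheodory function: [g] is rounded down to multiples of 1/(i+1), which
    leaves countably many values, and continuity in the second variable gives the limit. *)
Lemma omeas_slices (Psi : T -> R -> R) (g : T -> R) :
  (forall t, omeas mu (Psi ^~ t)) -> (forall x, continuous (Psi x)) -> omeas mu g ->
  omeas mu (fun x => Psi x (g x)).
Proof.
move=> mPsi cPsi mg.
pose gi (i : nat) x : R := (Num.floor (g x * i.+1%:R))%:~R / i.+1%:R.
apply: (@omeas_cvg _ _ mu (fun i x => Psi x (gi i x))) => [i|x].
  apply/omeasP => W oW.
  have -> : (fun x => Psi x (gi i x)) @^-1` W = \bigcup_(z : int)
      ([set x | Num.floor (g x * i.+1%:R) = z] `&` (Psi ^~ (z%:~R / i.+1%:R)) @^-1` W).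
    apply/seteqP; split=> [x Hx|x [z _ [/= Hz]]].
      by exists (Num.floor (g x * i.+1%:R)) => //; split.
    by rewrite /gi Hz.
  apply: (@countable_bigcupT_measurable _ (caratheodory_type mu)) => [|z]; first exact: countableP.
  apply: measurableI; last by move/omeasP: (mPsi (z%:~R / i.+1%:R)); exact.
  have mgi : omeas mu (fun x => g x * i.+1%:R) by apply: omeasM => //; exact: omeas_cst.
  have := mgi measurableT `[z%:~R, (z + 1)%:~R[%classic (measurable_itv _); rewrite setTI.
  congr (mu.-caratheodory _); apply/seteqP; split=> x /=; rewrite in_itv/=.
    by move=> Hx; apply: floor_def.
  by move=> <-; exact: floor_itv.
apply: (@continuous_cvg _ _ _ _ _ (gi ^~ x) (Psi x)); first exact: cPsi.
apply/cvgrPdist_le => e e0; have [N HN] := archi_inv e0.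
near=> i; rewrite /gi; have i0 : 0 < i.+1%:R :> R by [].
have /andP[h1 h2] := floor_itv (g x * i.+1%:R).
set z : R := (Num.floor _)%:~R in h1 *; rewrite intrD -/z mulr1z in h2.
have -> : g x - z / i.+1%:R = (g x * i.+1%:R - z) / i.+1%:R by field; rewrite gt_eqF.
rewrite normrM [`|i.+1%:R^-1|]gtr0_norm ?invr_gt0// ger0_norm ?subr_ge0//.
apply: (@le_trans _ _ i.+1%:R^-1).
  by rewrite ler_piMl ?invr_ge0// lerBlDr addrC ltW.
apply: le_trans (ltW HN); rewrite lef_pV2 ?posrE// ler_nat ltnS.
by near: i; exact: nbhs_infty_ge.
Unshelve. all: by end_near. Qed.

(** The coordinates are switched from constants to functions one at a time, each switch being an
    instance of [omeas_slices]. *)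
Lemma omeas_coords (N : nat) (c : 'I_N -> T -> R) (D : 'rV[R]_N -> R) :
  (forall i, omeas mu (c i)) -> continuous D -> omeas mu (fun x => D (\row_i c i x)).
Proof.
move=> mc cD.
have H j : forall v : 'rV[R]_N, omeas mu (fun x => D (\row_i if (i < j)%N then c i x else v 0 i)).
  elim: j => [|j IH] v.
    have : omeas mu (fun=> D v) by exact: omeas_cst.
    congr (omeas mu _); apply/funext => x; congr D; apply/rowP => i.
    by rewrite mxE.
  have [jN|jN] := ltnP j N; last first.
    have := IH v; congr (omeas mu _); apply/funext => x; congr D; apply/rowP => i.
    by rewrite !mxE (leq_trans (ltn_ord i) jN) (leq_trans (ltn_ord i) (leqW jN)).
  pose w x t : 'rV[R]_N := \row_i if (i < j)%N then c i x else if i == j :> nat then t else v 0 i.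
  have := @omeas_slices (fun x t => D (w x t)) (c (Ordinal jN)).
  have -> : (fun x => D (\row_i (if (i < j.+1)%N then c i x else v 0 i))) =
      (fun x => D (w x (c (Ordinal jN) x))).
    apply/funext => x; congr D; apply/rowP => i; rewrite !mxE ltnS leq_eqVlt.
    have [E|_] := eqVneq (i : nat) j; last by [].
    have -> : i = Ordinal jN by apply: val_inj.
    by rewrite /= ltnn.
  apply=> [t|x|//].
    have := IH (\row_i if i == j :> nat then t else v 0 i).
    congr (omeas mu _); apply/funext => x; congr D; apply/rowP => i.
    by rewrite !mxE.
  move=> t; apply: (@continuous_comp _ _ _ (w x) D); last exact: cD.
  apply/cvgrPdist_le => e e0; near=> s.
  apply: (@le_trans _ _ `|t - s|).
    apply: rV_norm_le => // i; rewrite !mxE.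
    by case: ifP => _; rewrite ?subrr ?normr0//; case: ifP => _; rewrite ?subrr ?normr0.
  by near: s; exact: cvgr_dist_le.
have := H N 0; congr (omeas mu _); apply/funext => x; congr D; apply/rowP => i.
by rewrite !mxE ltn_ord.
Unshelve. all: by end_near. Qed.

End caratheodory_functions.

Section bernstein_derivative.
Variable R : realType.

(** The derivative of [bern] with respect to [s] with the values [psi j] held fixed; the recursion
    is Leibniz' rule. *)
Fixpoint dbern (N : nat) (s : R) (psi : nat -> R) : R :=
  if N is N'.+1 then
    (1 - s) * dbern N' s psi + s * dbern N' s (fun j => psi j.+1) +
    (bern N' s (fun j => psi j.+1) - bern N' s psi)
  else 0.

Lemma dbernE N s psi : dbern N.+1 s psi = N.+1%:R * bern N s (fun j => psi j.+1 - psi j).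
Proof.
elim: N psi => [|N IH] psi; first by rewrite /=; ring.
rewrite [LHS]/= -/(dbern N.+1 s psi) -/(dbern N.+1 s (fun j => psi j.+1)).
rewrite -/(bern N.+1 s psi) -/(bern N.+1 s (fun j => psi j.+1)) !IH -bernB.
rewrite [bern N.+1 s _]/= -!natr1; ring.
Qed.

Variables (M : R) (M0 : 0 < M).

Lemma bern_dist_node N s z d : 0 <= s <= 1 -> z = 2 * M * s - M -> 0 < d ->
  (0 < N)%N -> bern N s (fun j => `|node M N j - z|) <= (d + 4 * M ^+ 2 / N%:R / d) / 2.
Proof.
move=> s01 zE d0 N0; have N0' : 0 < N%:R :> R by rewrite ltr0n.
have := bern_dist N (2 * M / N%:R) (2 * M * s) s01 d0.
have -> : (fun j => `|j%:R * (2 * M / N%:R) - 2 * M * s|) = (fun j => `|node M N j - z|).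
  by apply/funext => j; rewrite /node zE; congr `|_|; ring.
move=> /le_trans; apply; rewrite ler_pM2r ?invr_gt0// lerD2l ler_pM2r ?invr_gt0//.
by rewrite le_eqVlt; apply/orP; left; apply/eqP; field; rewrite gt_eqF.
Qed.

(** The nodes have order N + 1 but the mean has order N, as in the derivative of a Bernstein
    polynomial. The mean position is then off by h s, and N h^2 + (h s)^2 <= (N + 1) h^2 restores
    the bound. *)
Lemma bern_dist_node_pred N s z d : 0 <= s <= 1 -> z = 2 * M * s - M -> 0 < d ->
  bern N s (fun j => `|node M N.+1 j - z|) <= (d + 4 * M ^+ 2 / N.+1%:R / d) / 2.
Proof.
move=> s01 zE d0; have N0' : 0 < N.+1%:R :> R by rewrite ltr0n.
have := bern_dist N (2 * M / N.+1%:R) (2 * M * s) s01 d0.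
have -> : (fun j => `|j%:R * (2 * M / N.+1%:R) - 2 * M * s|) = (fun j => `|node M N.+1 j - z|).
  by apply/funext => j; rewrite /node zE; congr `|_|; ring.
move=> /le_trans; apply; rewrite ler_pM2r ?invr_gt0// lerD2l ler_pM2r ?invr_gt0//.
set h := 2 * M / N.+1%:R.
have -> : N%:R * h * s - 2 * M * s = - (h * s).
  have -> : 2 * M = (N%:R + 1) * h by rewrite natr1 /h; field; rewrite gt_eqF.
  ring.
have -> : 4 * M ^+ 2 / N.+1%:R = N.+1%:R * h ^+ 2 by rewrite /h; field; rewrite gt_eqF.
rewrite -natr1 mulrDl mul1r lerD2l sqrrN exprMn ler_piMr ?sqr_ge0//.
by case/andP: s01 => s0 s1; rewrite expr2 mulr_ile1.
Qed.

Lemma bern_node_approx N s z (q : R -> R) (D d : R) : 0 <= s <= 1 -> z = 2 * M * s - M ->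
  0 < d -> (0 < N)%N -> 0 <= D ->
  (forall t, `|t| <= M -> `|q t - q z| <= D * `|t - z|) ->
  `|bern N s (fun j => q (node M N j)) - q z| <= D * ((d + 4 * M ^+ 2 / N%:R / d) / 2).
Proof.
move=> s01 zE d0 N0 D0 H; rewrite -(bern_cst N s (q z)) -bernB.
apply: (@le_trans _ _ (bern N s (fun j => D * `|node M N j - z|))).
  apply: bern_norm_le => // j jN; apply: H; exact: node_le.
by rewrite bernZ ler_wpM2l// bern_dist_node.
Qed.

(** Difference quotients of [q] at neighbouring nodes are values of q' within one step of the node,
    which adds 2M/(N + 1) to the deviation. The factor 2M stems from the substitution z = 2 M s -
    M. *)
Lemma dbern_node_approx N s z (q q' : R -> R) (D d : R) : 0 <= s <= 1 -> z = 2 * M * s - M ->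
  0 < d -> 0 <= D ->
  (forall t t', t <= t' -> exists2 u, t <= u <= t' & q t' - q t = q' u * (t' - t)) ->
  (forall t, `|t| <= M -> `|q' t - q' z| <= D * `|t - z|) ->
  `|dbern N.+1 s (fun j => q (node M N.+1 j)) - 2 * M * q' z| <=
    2 * M * D * ((d + 4 * M ^+ 2 / N.+1%:R / d) / 2 + 2 * M / N.+1%:R).
Proof.
move=> s01 zE d0 D0 Hq Hq'; have N0 : 0 < N.+1%:R :> R by [].
set h := 2 * M / N.+1%:R; have h0 : 0 < h by rewrite divr_gt0 ?mulr_gt0.
have nodeS j : node M N.+1 j.+1 = node M N.+1 j + h by rewrite /node -/h -natr1; ring.
rewrite dbernE -(bern_cst N s (2 * M * q' z)) -bernZ -bernB.
apply: (@le_trans _ _ (bern N s (fun j => 2 * M * D * (`|node M N.+1 j - z| + h)))).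
  apply: bern_norm_le => // j jN.
  have [|u /andP[u1 u2] ->] := Hq (node M N.+1 j) (node M N.+1 j.+1).
    by rewrite nodeS lerDl ltW.
  have uM : `|u| <= M.
    have /(node_le M0) /(_ (ltn0Sn _)) := leqW jN; have /(node_le M0) /(_ (ltn0Sn _)) := (jN : j.+1 <= N.+1)%N.
    by rewrite !ler_norml => /andP[_ a] /andP[b _]; apply/andP; split; lra.
  have -> : N.+1%:R * (q' u * (node M N.+1 j.+1 - node M N.+1 j)) - 2 * M * q' z =
      2 * M * (q' u - q' z).
    by rewrite nodeS /h; field; rewrite gt_eqF.
  rewrite normrM ger0_norm ?mulr_ge0 ?(ltW M0)// -mulrA ler_wpM2l ?mulr_ge0 ?(ltW M0)//.
  apply: (le_trans (Hq' _ uM)); apply: ler_wpM2l => //.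
  rewrite nodeS in u2; have -> : u - z = (node M N.+1 j - z) + (u - node M N.+1 j) by ring.
  by apply: (le_trans (ler_normD _ _)); rewrite lerD2l ger0_norm ?subr_ge0//; lra.
rewrite bernZ bernD bern_cst ler_wpM2l ?mulr_ge0 ?(ltW M0)// lerD2r.
exact: bern_dist_node_pred.
Qed.

End bernstein_derivative.

Lemma diff_comp_affine (R : realType) (Y W V : normedModType R) (f : V -> W) (L : {linear Y -> V}) (c : V) y v :
  continuous L -> differentiable f (L y + c) ->
  'd (fun x => f (L x + c)) y v = 'd f (L y + c) (L v).
Proof.
move=> cL df; have dL := is_diff_lin y cL.
have H : is_diff y (fun x => L x + c) L.
  have -> : (fun x => L x + c) = (L : Y -> V) + cst c by [].
  by apply: is_diff_eq; rewrite addr0.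
exact: (is_diff_val (is_diff_comp H (differentiableP df))).
Qed.

Section affine_slices.
Variables (R : realType) (Y Z : normedModType R).

Definition pinl (y : Y) : (Y * Z)%type := (y, 0).
Definition pinr (z : Z) : (Y * Z)%type := (0, z).

Fact pinl_linear : linear pinl.
Proof. by move=> a x y; congr (_, _); rewrite /= scaler0 addr0. Qed.

Fact pinr_linear : linear pinr.
Proof. by move=> a x y; congr (_, _); rewrite /= scaler0 addr0. Qed.

HB.instance Definition _ := GRing.isLinear.Build R Y (Y * Z)%type _ pinl pinl_linear.
HB.instance Definition _ := GRing.isLinear.Build R Z (Y * Z)%type _ pinr pinr_linear.

Lemma pinl_continuous : continuous pinl.
Proof. by move=> y; apply: cvg_pair; [exact: cvg_id|exact: cvg_cst]. Qed.

Lemma pinr_continuous : continuous pinr.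
Proof. by move=> z; apply: cvg_pair; [exact: cvg_cst|exact: cvg_id]. Qed.

Variables (W : normedModType R) (Phi : (Y * Z)%type -> W).
Hypothesis sPhi : smooth Phi.

Let slE t : (fun y => Phi (y, t)) = (fun y => Phi (pinl y + (0, t))).
Proof. by apply/funext => y; congr Phi; congr (_, _); rewrite /= ?addr0 ?add0r. Qed.

Let srE t : (fun z => Phi (t, z)) = (fun z => Phi (pinr z + (t, 0))).
Proof. by apply/funext => y; congr Phi; congr (_, _); rewrite /= ?addr0 ?add0r. Qed.

Lemma smooth_slicel t : smooth (fun y => Phi (y, t)).
Proof. by rewrite slE => j; apply: class_C_comp_affine; [exact: pinl_continuous|exact: sPhi]. Qed.

Lemma smooth_slicer t : smooth (fun z => Phi (t, z)).
Proof. by rewrite srE => j; apply: class_C_comp_affine; [exact: pinr_continuous|exact: sPhi]. Qed.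

Lemma diff_slicel y t v : 'd (fun y => Phi (y, t)) y v = 'd Phi (y, t) (v, 0).
Proof.
rewrite slE diff_comp_affine; [|exact: pinl_continuous|exact: smooth_differentiable].
by rewrite (_ : pinl y + (0, t) = (y, t))//; congr (_, _); rewrite /= ?addr0 ?add0r.
Qed.

Lemma diff_slicer y t v : 'd (fun z => Phi (y, z)) t v = 'd Phi (y, t) (0, v).
Proof.
rewrite srE diff_comp_affine; [|exact: pinr_continuous|exact: smooth_differentiable].
by rewrite (_ : pinr t + (y, 0) = (y, t))//; congr (_, _); rewrite /= ?addr0 ?add0r.
Qed.

Lemma diff_pair y t v w : 'd Phi (y, t) (v, w) = 'd Phi (y, t) (v, 0) + 'd Phi (y, t) (0, w).
Proof. by rewrite -linearD; congr ('d Phi _ _); congr (_, _); rewrite /= ?addr0 ?add0r. Qed.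

End affine_slices.

Section real_slices.
Variable R : realType.

Lemma smooth_real_MVT (q : R^o -> R^o) (t t' : R) : smooth q -> t <= t' ->
  exists2 u, t <= u <= t' & q t' - q t = 'd q u 1 * (t' - t).
Proof.
move=> sq tt'; have [c /andP[c0 c1] H] := @MVT_line R R^o q t (t' - t) (fun x => smooth_differentiable x sq).
exists (t + c * (t' - t)).
  rewrite lerDl mulr_ge0 ?(ltW c0) ?subr_ge0//= -lerBrDl ler_piMl ?subr_ge0 ?(ltW c1)//.
have E : t + (t' - t) = t' by ring.
have lin (u v : R^o) : 'd q u v = ('d q u (1 : R^o) : R) * v.
  by rewrite -[v in LHS]mulr1 -[v * 1]/(v *: (1 : R^o)) linearZ/= /GRing.scale/= mulrC.
by rewrite E in H; rewrite H lin.
Qed.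

Lemma smooth_real_lipschitz (q : R^o -> R^o) (M : R) : smooth q ->
  exists2 D : R, 0 <= D & forall t t', `|t| <= M -> `|t'| <= M -> `|q t - q t'| <= D * `|t - t'|.
Proof.
move=> sq; have cM : compact (`[- M, M]%classic : set R) by exact: segment_compact.
have [D D0 HD] := @bounded_on_compact R R R^o (fun u => 'd q u (1 : R^o)) _ (smooth_continuous (smooth_diff (1 : R^o) sq)) cM.
exists D => //.
suff H t t' : t <= t' -> `|t| <= M -> `|t'| <= M -> `|q t - q t'| <= D * `|t - t'|.
  move=> t t' tM t'M; have [tt'|/ltW tt'] := leP t t'; first exact: H.
  by rewrite distrC [`|t - t'|]distrC; exact: H.
move=> tt' tM t'M; have [u /andP[u1 u2] E] := smooth_real_MVT sq tt'.
rewrite distrC [`|t - t'|]distrC E normrM ler_wpM2r//; apply: HD.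
rewrite /= in_itv/=; move: tM t'M; rewrite !ler_norml => /andP[a _] /andP[_ c].
by apply/andP; split; lra.
Qed.

End real_slices.

Lemma compact_norm_le (R : realType) (Y : normedModType R) (b : frame Y) (r : R) :
  compact [set y : Y | `|y| <= r].
Proof.
have [C C0 HC] := fco_le b.
apply: (@subclosed_compact _ _ (fbox b (C * r))); last 2 first.
- exact: compact_fbox.
- by move=> y /= Hy i; apply: (le_trans (HC i y)); rewrite ler_wpM2l// ltW.
apply: (@closed_comp _ _ (fun y : Y => `|y|) [set t : R | t <= r]); last exact: closed_le.
by move=> y _; exact: norm_continuous.
Qed.

Lemma locally_lipschitz_le (R : realType) (V W W' : normedModType R) (U : set V)
    (g : V -> W) (h : V -> W') (c : R) :
  0 <= c -> (forall x y, `|h x - h y| <= c * `|g x - g y|) ->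
  locally_lipschitz U g -> locally_lipschitz U h.
Proof.
move=> c0 H lg x Ux; have [A [D [nA D0 HD]]] := lipschitz_nbhs lg Ux.
exists A => //; exists (c * D); split; first exact: num_real.
move=> M HM [y z] [/= Ay Az]; apply: (le_trans (H y z)).
apply: (@le_trans _ _ (c * (D * `|y - z|))); first by rewrite ler_wpM2l// HD.
by rewrite mulrA ler_wpM2r// ltW.
Qed.

Lemma cvg_rate (R : realType) (u : nat -> R) (l C : R) :
  (forall i, `|u i - l| <= C * i.+1%:R^-1) -> u @ \oo --> l.
Proof.
move=> H; apply/subr_cvg0/norm_cvg0P.
apply: (@squeeze_cvgr _ _ _ _ (fun=> 0) (fun i : nat => C * i.+1%:R^-1)).
- by near=> i; rewrite normr_ge0/= H.
- exact: cvg_cst.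
- rewrite -(mulr0 (C : R)); apply: cvgMr; exact: cvg_harmonic.
Unshelve. all: by end_near. Qed.

(** * Directional weak derivatives of vector valued functions *)

Section vector_weak_derivative.
Variables (R : realType) (n m : nat) (U : set 'rV[R]_n).
Variable V : {outer_measure set ('rV[R]_n * subsp R n) -> \bar R}.
Variable dV : {outer_measure set 'rV[R]_n -> \bar R}.
Hypotheses (oU : open U) (vV : varifold m U V) (radon_dV : radon_over U dV).
Variables (k : 'I_n) (eta : 'rV[R]_n -> R).
Hypotheses (meta : omeas dV eta) (leta : locally_bounded U eta).
Hypothesis fvar_eta : forall phi, test_fun U phi ->
  fvar V k phi = oI dV (fun x => phi x * eta x).
Local Notation wV := (wgt m V).
Let radon_wV : radon_over U wV := radon_wgt oU vV.
Local Notation adm := (admissible m U V dV).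
Local Notation lint := (locally_integrable m U V).
Local Notation wD := (wd m U V dV k eta).

Lemma admissibleB a b : adm a -> adm b -> adm (fun x => a x - b x).
Proof.
move=> Ha Hb; have := admissibleD Ha (admissibleM (admissible_cst m U V dV (-1)) Hb).
by congr (admissible _ _ _ _ _); apply/funext => x; rewrite mulN1r.
Qed.

Lemma locally_integrableZ c A : lint A -> lint (fun x => c * A x).
Proof. by move=> H; apply: (locally_integrableM oU vV (admissible_cst m U V dV c)). Qed.

Lemma locally_integrableB A B : lint A -> lint B -> lint (fun x => A x - B x).
Proof.
move=> Ha Hb; have := locally_integrableD Ha (locally_integrableZ (-1) Hb).
by congr (locally_integrable _ _ _ _); apply/funext => x; rewrite mulN1r.
Qed.

Lemma locally_integrable_norm A : lint A -> lint (fun x => `|A x|).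
Proof.
move=> [mA iA]; split; first exact: omeas_norm.
move=> K cK KU; have := ointeg_norm (iA K cK KU).
congr (ointeg _ _); apply/funext => x; rewrite normrM indicE.
by case: (_ \in _); rewrite ?normr1 ?normr0.
Qed.

Lemma locally_integrable_sum (I : Type) (s : seq I) (A : I -> 'rV[R]_n -> R) :
  (forall i, lint (A i)) -> lint (fun x => \sum_(i <- s) A i x).
Proof.
move=> H; split; first by apply: omeas_sum => i; have [] := H i.
move=> K cK KU; under eq_fun do rewrite mulr_sumr.
by apply: ointeg_sum => i; have [_] := H i; exact.
Qed.

Lemma wdB a A b B : adm a -> lint A -> wD a A -> adm b -> lint B -> wD b B ->
  wD (fun x => a x - b x) (fun x => A x - B x).
Proof.
move=> aa iA wa ab iB wb phi tphi; have := wa _ tphi; have := wb _ tphi.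
have -> : wd_dV dV eta (fun x => a x - b x) phi = wd_dV dV eta a phi - wd_dV dV eta b phi.
  rewrite /wd_dV -(oIB (ointeg_dV radon_dV meta leta aa tphi) (ointeg_dV radon_dV meta leta ab tphi)).
  by apply: eq_oI => x; rewrite mulrBl mulrBr.
have -> : wd_V V k (fun x => a x - b x) phi = wd_V V k a phi - wd_V V k b phi.
  rewrite /wd_V -(oIB (ointeg_V oU vV k aa tphi) (ointeg_V oU vV k ab tphi)).
  by apply: eq_oI => x; rewrite mulrBl.
have -> : wd_wV m V (fun x => A x - B x) phi = wd_wV m V A phi - wd_wV m V B phi.
  rewrite /wd_wV -(oIB (ointeg_wV oU vV iA tphi) (ointeg_wV oU vV iB tphi)).
  by apply: eq_oI => x; rewrite mulrBr.
by move=> -> ->; rewrite opprD addrACA.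
Qed.

Lemma wdZ c a A : adm a -> lint A -> wD a A -> wD (fun x => c * a x) (fun x => c * A x).
Proof.
move=> aa iA wa phi tphi.
have -> : wd_dV dV eta (fun x => c * a x) phi = c * wd_dV dV eta a phi.
  rewrite /wd_dV -(oIZ c (ointeg_dV radon_dV meta leta aa tphi)).
  by apply: eq_oI => x; rewrite -mulrA mulrCA.
have -> : wd_V V k (fun x => c * a x) phi = c * wd_V V k a phi.
  rewrite /wd_V -(oIZ c (ointeg_V oU vV k aa tphi)).
  by apply: eq_oI => x; rewrite -mulrA.
have -> : wd_wV m V (fun x => c * A x) phi = c * wd_wV m V A phi.
  rewrite /wd_wV -(oIZ c (ointeg_wV oU vV iA tphi)).
  by apply: eq_oI => x; rewrite mulrCA.
by rewrite (wa _ tphi) mulrDr.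
Qed.

(** Induction on the order: the recursion reads b0 + s (b1 - b0), and [wd_mul] treats the product.
    The derivative has one part from the coefficients and one, [S] times [dbern], from the
    parameter. *)
Lemma wd_bern (s S : 'rV[R]_n -> R) (a A : nat -> 'rV[R]_n -> R) N :
    locally_lipschitz U (s : _ -> R^o) -> omeas wV S -> locally_bounded U S -> wD s S ->
    (forall j, adm (a j)) -> (forall j, lint (A j)) -> (forall j, wD (a j) (A j)) ->
  let aN x := bern N (s x) (fun j => a j x) in
  let AN x := bern N (s x) (fun j => A j x) + S x * dbern N (s x) (fun j => a j x) in
  [/\ adm aN, lint AN & wD aN AN].
Proof.
move=> ls mS lS ws; have as_ := admissible_lipschitz oU vV radon_dV ls.
have iS := locally_integrable_bounded oU vV mS lS.
elim: N a A => [|N IH] a A Ha HA Hw aN AN.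
  have -> : AN = A 0%N by apply/funext => x; rewrite /AN/= mulr0 addr0.
  by split; [exact: Ha|exact: HA|exact: Hw].
have [a0 A0 w0] := IH a A Ha HA Hw.
have [a1 A1 w1] := IH (fun j => a j.+1) (fun j => A j.+1) (fun j => Ha _) (fun j => HA _) (fun j => Hw _).
set b0 := fun x => bern N (s x) (fun j => a j x) in a0 w0.
set b1 := fun x => bern N (s x) (fun j => a j.+1 x) in a1 w1.
set B0 := fun x => _ in A0 w0; set B1 := fun x => _ in A1 w1.
have da := admissibleB a1 a0; have dA := locally_integrableB A1 A0.
have dw := wdB a1 A1 w1 a0 A0 w0.
have sda := admissibleM as_ da.
have sdA := locally_integrableD (locally_integrableM oU vV as_ dA) (locally_integrableM oU vV da iS).
have sdw := wd_mul oU vV radon_dV meta leta fvar_eta da dA dw ls mS lS ws.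
have -> : aN = (fun x => b0 x + s x * (b1 x - b0 x)).
  by apply/funext => x; rewrite /aN/= /b0 /b1; ring.
have -> : AN = (fun x => B0 x + (s x * (B1 x - B0 x) + (b1 x - b0 x) * S x)).
  by apply/funext => x; rewrite /AN/= /B0 /B1 /b0 /b1; ring.
split; [exact: admissibleD|exact: locally_integrableD|].
exact: (wdD oU vV radon_dV meta leta).
Qed.

Variable Y : normedModType R.

(* [F] is the [k]-th partial derivative of [f] in the sense of T(V, Y) *)
Definition weak_partial (f F : 'rV[R]_n -> Y) : Prop :=
  [/\ forall h : Y -> R, continuous h -> omeas dV (fun x => h (f x)) /\ omeas wV (fun x => h (f x)),
      forall l : {linear Y -> R^o}, continuous l -> omeas wV (fun x => l (F x)),
      forall (l : {linear Y -> R^o}) (s : R), continuous l ->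
        lint (fun x => if `|f x| <= s then l (F x) else 0)
    & forall gamma, @test_scalar R Y gamma ->
        wD (fun x => gamma (f x)) (fun x => 'd gamma (f x) (F x)) ].

Variables (b : frame Y) (f F : 'rV[R]_n -> Y).
Hypothesis wf : weak_partial f F.

Lemma linear_frame (W : lmodType R) (l : {linear Y -> W}) y : l y = \sum_i (fco b i y : R) *: l (fvec b i).
Proof. by rewrite {1}(fcoE b y) linear_sum; apply: eq_bigr => i _; rewrite linearZ. Qed.

(** The differential of a test scalar at f x vanishes when |f x| > s, so it is controlled by [F] on
    the set where |f| <= s, and there integrability of [F] is known. *)
Lemma covector_le (c : 'I_(frk b) -> R) (C s : R) x : 0 <= C ->
  (forall i, `|c i| <= C) -> (s < `|f x| -> forall i, c i = 0) ->
  `|\sum_i fco b i (F x) * c i| <=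
    C * \sum_i `|if `|f x| <= s then fco b i (F x) : R else 0|.
Proof.
move=> C0 cC c0; apply: (le_trans (ler_norm_sum _ _ _)); rewrite mulr_sumr; apply: ler_sum => i _.
rewrite normrM [leLHS]mulrC; case: (leP `|f x| s) => H; first exact: ler_wpM2r.
by rewrite c0// normr0 mul0r mulr_ge0.
Qed.

Lemma truncated_locally_integrable (s : R) :
  lint (fun x => \sum_i `|if `|f x| <= s then fco b i (F x) : R else 0|).
Proof.
apply: locally_integrable_sum => i; apply: locally_integrable_norm.
by have [_ _ H _] := wf; apply: H; exact: fco_continuous.
Qed.

Lemma covector_omeas (c : 'I_(frk b) -> 'rV[R]_n -> R) : (forall i, omeas wV (c i)) ->
  omeas wV (fun x => \sum_i fco b i (F x) * c i x).
Proof.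
move=> mc; apply: omeas_sum => i; apply: omeasM => //.
by have [_ H _ _] := wf; apply: H; exact: fco_continuous.
Qed.

Lemma test_scalar_out gamma : @test_scalar R Y gamma ->
  exists s : R, forall y v, s < `|y| -> 'd gamma y v = 0.
Proof.
move=> [sg cg]; have [B B0 HB] := @bounded_on_compact R Y Y id _ (fun x => cvg_id) cg.
exists B => y v By; apply/eqP/negP => /negP H.
have : `|y| <= B by apply: HB; apply: subset_closure; exists v.
by rewrite leNgt By.
Qed.

Lemma test_scalar_covector gamma : @test_scalar R Y gamma ->
  exists C s : R, [/\ 0 <= C, forall y i, `|'d gamma y (fvec b i)| <= C &
    forall y v, s < `|y| -> 'd gamma y v = 0].
Proof.
move=> tg; have [s Hs] := test_scalar_out tg; have [sg _] := tg.
have H i : exists C : R, 0 <= C /\ forall y, `|'d gamma y (fvec b i)| <= C.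
  have [C C0 HC] := bounded_on_compact (smooth_continuous (smooth_diff (fvec b i) sg)) (@compact_norm_le R Y b s).
  exists C; split=> // y; have [ys|ys] := leP `|y| s; first exact: HC.
  by rewrite Hs// normr0.
have [C HC] := choice H; exists (\sum_i C i), s; split=> // [|y i].
  by apply: sumr_ge0 => i _; have [] := HC i.
apply: (le_trans ((HC i).2 y)); rewrite (bigD1 i)//= lerDl.
by apply: sumr_ge0 => j _; have [] := HC j.
Qed.

Lemma weak_partial_test gamma : @test_scalar R Y gamma ->
  adm (fun x => gamma (f x)) /\ lint (fun x => 'd gamma (f x) (F x)).
Proof.
move=> tg; have [sg _] := tg; have [mf _ _ _] := wf.
have [B B0 HB] := test_scalar_bounded b tg.
split.
  have [h1 h2] := mf _ (smooth_continuous sg).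
  by split=> // K _ _; exists B.
have [C [s [C0 HC Hs]]] := test_scalar_covector tg.
have E x : 'd gamma (f x) (F x) = \sum_i fco b i (F x) * 'd gamma (f x) (fvec b i).
  exact: linear_frame.
apply: (locally_integrable_le oU vV _ (locally_integrableZ C (truncated_locally_integrable s))).
  under eq_fun do rewrite E; apply: covector_omeas => i.
  by have [] := mf _ (smooth_continuous (smooth_diff (fvec b i) sg)).
by move=> x; rewrite E; apply: covector_le => // sx i; exact: Hs.
Qed.

Section chain_rule.
Variables (g G : 'rV[R]_n -> R) (Phi : (Y * R^o)%type -> R^o).
Hypotheses (lg : locally_lipschitz U (g : _ -> R^o)).
Hypotheses (mG : omeas wV G) (lG : locally_bounded U G) (wg : wD g G).
Hypothesis sPhi : smooth Phi.
(** Uniformity over bounded ranges of the second variable: the slices are test scalars whose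
    differentials vanish outside a common ball, with common bounds. This dominates the Bernstein
    approximations of all orders. *)
Hypothesis HPhi : forall M : R, exists s B : R, forall (y : Y) (z : R), `|z| <= M ->
  [/\ `|Phi (y, z)| <= B, `|'d Phi (y, z : R^o) (0, 1 : R^o)| <= B &
    s < `|y| -> forall v, 'd Phi (y, z : R^o) (v, 0) = 0].

Let slice_test (t : R) : @test_scalar R Y (fun y => Phi (y, t : R^o)).
Proof.
split; first exact: smooth_slicel.
have [s [B H]] := HPhi `|t|; have cs := @compact_norm_le R Y b s.
apply: (subclosed_compact _ cs); first exact: closed_closure.
have cl : closed [set y : Y | `|y| <= s] by apply: compact_closed => //; exact: norm_hausdorff.
rewrite closureE => y; apply; split=> // {}y [v]; rewrite diff_slicel// => Hv /=.
rewrite leNgt; apply/negP => sy; move/negP: Hv; apply; apply/eqP.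
by have [_ _ h] := H y t (lexx _); exact: h.
Qed.

Let slice_wd (t : R) :
  [/\ adm (fun x => Phi (f x, t : R^o)), lint (fun x => 'd Phi (f x, t : R^o) (F x, 0)) &
    wD (fun x => Phi (f x, t : R^o)) (fun x => 'd Phi (f x, t : R^o) (F x, 0))].
Proof.
have [h1 h2] := weak_partial_test (slice_test t).
have [_ _ _ h3] := wf; have {}h3 := h3 _ (slice_test t).
have E : (fun x => 'd (fun y => Phi (y, t : R^o)) (f x) (F x)) = (fun x => 'd Phi (f x, t : R^o) (F x, 0)).
  by apply/funext => x; rewrite diff_slicel.
by rewrite -E.
Qed.

Lemma omeas_pair mu (h : (Y * R^o)%type -> R) : (forall q : Y -> R, continuous q -> omeas mu (fun x => q (f x))) ->
  omeas mu g -> continuous h -> omeas mu (fun x => h (f x, g x)).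
Proof.
move=> mf mg ch; apply: (@omeas_slices _ _ mu (fun x t => h (f x, t))) => // [t|x t].
  apply: (mf (fun y => h (y, t))) => y.
  have cp : continuous (fun y : Y => (y, t : R^o)).
    by move=> z; exact: (cvg_pair cvg_id (cvg_cst _)).
  exact: (continuous_comp (cp y) (ch _)).
have cp : continuous (fun t : R^o => (f x, t)).
  by move=> z; exact: (cvg_pair (cvg_cst _) cvg_id).
exact: (continuous_comp (cp t) (ch _)).
Qed.

(* On the support of the test function, with [`|g| <= M] there, [Phi (f, g)] is
   approximated by its Bernstein polynomials in the second variable on [-M, M],
   to which the product rule applies. *)
Lemma wd_chain : wD (fun x => Phi (f x, g x)) (fun x => 'd Phi (f x, g x : R^o) (F x, G x)).
Proof.
move=> phi tphi; have [sphi cK KU] := tphi; set K := supp phi in cK KU.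
have ag := admissible_lipschitz oU vV radon_dV lg; have [mdg mwg lgb] := ag.
have [M0' HM0] := lgb _ cK KU; pose M := `|M0'| + 1; have M0 : 0 < M by rewrite ltr_wpDl.
have gM x : K x -> `|g x| <= M.
  by move=> Kx; apply: (le_trans (HM0 x Kx)); apply: (le_trans (ler_norm _)); rewrite lerDl.
have [s0 [B HB]] := HPhi M.
have B0 : 0 <= B by have [h _ _] := HB 0 0 (ltac:(by rewrite normr0 ltW)); exact: le_trans h.
have M2 : 2 * M != 0 by rewrite mulf_neq0// gt_eqF.
pose s x := (g x + M) / (2 * M); pose S x := (2 * M)^-1 * G x.
have ls : locally_lipschitz U (s : _ -> R^o).
  apply: (@locally_lipschitz_le R _ R^o R^o U g s `|(2 * M)^-1| _ _ lg) => // x y; rewrite /s -mulrBl.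
  have -> : g x + M - (g y + M) = g x - g y by ring.
  by rewrite normrM mulrC.
have gE x : g x = 2 * M * s x - M by rewrite /s; field; rewrite gt_eqF.
have mS : omeas wV S by apply: omeasM => //; exact: omeas_cst.
have lS : locally_bounded U S.
  move=> C cC CU; have [D HD] := lG cC CU; exists (`|(2 * M)^-1| * D) => x Cx.
  by rewrite normrM ler_wpM2l// HD.
have ws : wD s S.
  have iG := locally_integrable_bounded oU vV mG lG.
  have i0 : lint (fun=> 0).
    apply: (locally_integrable_bounded oU vV); first exact: omeas_cst.
    by move=> C _ _; exists `|0 : R|.
  have a1 : adm (fun x => (2 * M)^-1 * g x) by exact: admissibleM (admissible_cst m U V dV _) ag.
  have := wdD oU vV radon_dV meta leta a1 (locally_integrableZ (2 * M)^-1 iG) (wdZ (2 * M)^-1 ag iG wg)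
    (admissible_cst m U V dV (2^-1)) i0 (wd_cst oU vV radon_dV meta leta fvar_eta 2^-1).
  have -> : (fun x => (2 * M)^-1 * g x + 2^-1) = s.
    by apply/funext => x; rewrite /s; field; rewrite gt_eqF.
  by have -> : (fun x => (2 * M)^-1 * G x + 0) = S by apply/funext => x; rewrite addr0.
have s01 x : K x -> 0 <= s x <= 1.
  move=> /gM; rewrite ler_norml => /andP[h1 h2]; rewrite /s.
  by rewrite ler_pdivlMr ?mulr_gt0// ler_pdivrMr ?mulr_gt0// mul0r mul1r; apply/andP; split; lra.
(* Order (i + 1)^2 and d = 1/(i + 1) give the rate 1/(i + 1). The order is written as a successor
   because [dbernE] and [dbern_node_approx] concern orders N + 1. *)
pose N i := (i.+1 ^ 2).-1.+1%N.
have NE i : N i = (i.+1 ^ 2)%N by rewrite /N prednK// expn_gt0.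
pose a i j x : R := Phi (f x, node M (N i) j : R^o).
pose A i j x : R := 'd Phi (f x, node M (N i) j : R^o) (F x, 0).
have Hb i := @wd_bern s S (a i) (A i) (N i) ls mS lS ws
  (fun j => let: And3 h _ _ := slice_wd _ in h) (fun j => let: And3 _ h _ := slice_wd _ in h)
  (fun j => let: And3 _ _ h := slice_wd _ in h).
have Nr i : (N i)%:R = i.+1%:R ^+ 2 :> R by rewrite NE natrX.
have rate (i : nat) : ((i.+1%:R^-1 + 4 * M ^+ 2 / (N i)%:R / i.+1%:R^-1) / 2 : R) =
    (1 + 4 * M ^+ 2) / 2 * i.+1%:R^-1.
  by rewrite Nr; field; rewrite addrC natr1 pnatr_eq0.
have iD0 (i : nat) : 0 < (i.+1%:R^-1 : R) by rewrite invr_gt0.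
have nodeM i j : (j <= N i)%N -> `|node M (N i) j| <= M by move=> /node_le; exact.
have [mf _ _ _] := wf.
have mPhi mu (Psi : (Y * R^o)%type -> R^o) : smooth Psi -> (forall q : Y -> R, continuous q -> omeas mu (fun x => q (f x))) ->
    omeas mu g -> omeas mu (fun x => Psi (f x, g x)).
  by move=> sPsi mq mg; exact: (omeas_pair mq mg (smooth_continuous sPsi)).
have [C [C0 HC]] : exists C : R, 0 <= C /\ forall i y (z : R), `|z| <= M -> `|'d Phi (y, z : R^o) (fvec b i, 0)| <= C.
  have cYM := compact_setX (@compact_norm_le R Y b s0) (@segment_compact R (- M) M).
  have Hi i : exists C : R, 0 <= C /\ forall y (z : R), `|z| <= M -> `|'d Phi (y, z : R^o) (fvec b i, 0)| <= C.
    have [C C0 HC] := bounded_on_compact (smooth_continuous (smooth_diff (fvec b i, 0) sPhi)) cYM.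
    exists C; split=> // y z zM; have [ys|ys] := leP `|y| s0.
      by apply: (HC (y, z)); split=> //=; move: zM; rewrite in_itv/= ler_norml.
    by have [_ _ h] := HB y z zM; rewrite h// normr0.
  have [C HC] := choice Hi; exists (\sum_i C i); split=> [|i y z zM].
    by apply: sumr_ge0 => i _; have [] := HC i.
  apply: (le_trans ((HC i).2 y z zM)); rewrite (bigD1 i)//= lerDl.
  by apply: sumr_ge0 => j _; have [] := HC j.
pose T x : R := \sum_i `|if `|f x| <= s0 then fco b i (F x) : R else 0|.
have dyE y (z : R) v : 'd Phi (y, z : R^o) (v, 0) = \sum_i fco b i v * 'd Phi (y, z : R^o) (fvec b i, 0).
  rewrite -diff_slicel// (linear_frame ('d (fun y => Phi (y, z : R^o)) y)).
  by apply: eq_bigr => i _; rewrite diff_slicel.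
have dzE y (z w : R) : 'd Phi (y, z : R^o) (0, w : R^o) = w * 'd Phi (y, z : R^o) (0, 1 : R^o).
  rewrite -diff_slicer// -[X in 'd _ _ X]mulr1 -[w * 1]/(w *: (1 : R^o)) linearZ/=.
  by rewrite diff_slicer.
have dyle y (z : R) x : y = f x -> `|z| <= M -> `|'d Phi (y, z : R^o) (F x, 0)| <= C * T x.
  move=> -> zM; rewrite dyE; apply: covector_le => // [i|sx i]; first exact: HC.
  by have [_ _ h] := HB (f x) z zM; exact: h.
pose aN i x := bern (N i) (s x) (fun j => a i j x).
pose AN i x := bern (N i) (s x) (fun j => A i j x) + S x * dbern (N i) (s x) (fun j => a i j x).
(* Dominates the derivatives of all orders: the coefficients contribute the truncated [F], and the
   other part is at most B |G|, as S = G/(2M) and |dbern| <= 2 M B. *)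
pose H x := C * T x + B * `|G x|.
have dle i x : K x -> `|dbern (N i) (s x) (fun j => a i j x)| <= 2 * M * B.
  move=> Kx; rewrite /N dbernE -bernZ -(bern_cst (i.+1 ^ 2).-1 (s x) (2 * M * B)).
  apply: bern_norm_le => [|j jN]; first exact: s01.
  have nS : node M (N i) j <= node M (N i) j.+1.
    by rewrite /node lerD2r ler_wpM2r ?ler_nat// divr_ge0 ?mulr_ge0 ?(ltW M0).
  have [u /andP[u1 u2] E] := smooth_real_MVT (smooth_slicer sPhi (f x)) nS.
  rewrite /a E diff_slicer// mulrCA normrM.
  have -> : (N i)%:R * (node M (N i) j.+1 - node M (N i) j) = 2 * M.
    by rewrite /node -natr1; field; rewrite pnatr_eq0.
  rewrite (@ger0_norm _ (2 * M)) ?mulr_ge0 ?(ltW M0)// [leRHS]mulrC ler_wpM2r ?mulr_ge0 ?(ltW M0)//.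
  have uM : `|u| <= M.
    have := nodeM i _ (jN : j.+1 <= N i)%N; have := nodeM i _ (leqW jN).
    by rewrite !ler_norml => /andP[x1 _] /andP[_ x2]; apply/andP; split; lra.
  by have [_ h _] := HB (f x) u uM.
apply: (@wd_lim _ _ _ _ _ _ oU vV radon_dV k eta meta leta aN AN _ _ H B phi tphi).
- by move=> i; have [[]] := Hb i.
- by move=> i; have [[]] := Hb i.
- by apply: mPhi => // q cq; have [] := mf q cq.
- by apply: mPhi => // q cq; have [] := mf q cq.
- by move=> i; have [_ []] := Hb i.
- have -> : (fun x => 'd Phi (f x, g x : R^o) (F x, G x)) = (fun x =>
      \sum_i fco b i (F x) * 'd Phi (f x, g x : R^o) (fvec b i, 0) + G x * 'd Phi (f x, g x : R^o) (0, 1 : R^o)).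
    by apply/funext => x; rewrite diff_pair// dyE dzE.
  have mq q : continuous q -> omeas wV (fun x => q (f x)) by move=> cq; have [] := mf q cq.
  apply: omeasD; last first.
    by apply: omeasM => //; exact: (mPhi wV _ (smooth_diff (0, 1 : R^o) sPhi) mq mwg).
  by apply: covector_omeas => i; exact: (mPhi wV _ (smooth_diff (fvec b i, 0) sPhi) mq mwg).
- move=> i x Kx; rewrite /aN -(bern_cst (N i) (s x) B); apply: bern_norm_le => [|j jN]; first exact: s01.
  by have [h _ _] := HB (f x) _ (nodeM i j jN).
- move=> x Kx; have sq := smooth_slicer sPhi (f x).
  have [D D0 HD] := smooth_real_lipschitz M sq.
  apply: (@cvg_rate _ _ _ (D * ((1 + 4 * M ^+ 2) / 2))) => i.
  rewrite -[leRHS]mulrA -rate.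
  have := @bern_node_approx R M M0 (N i) (s x) (g x) (fun t => Phi (f x, t : R^o)) D _ (s01 x Kx) (gE x) (iD0 i).
  by apply=> // t tM; apply: HD => //; exact: gM.
- apply: locally_integrableD.
    exact: locally_integrableZ (truncated_locally_integrable s0).
  by apply: locally_integrableZ; apply: locally_integrable_norm; exact: (locally_integrable_bounded oU vV).
- move=> i x Kx; apply: (le_trans (ler_normD _ _)); apply: lerD.
    rewrite -(bern_cst (N i) (s x) (C * T x)); apply: bern_norm_le => [|j jN]; first exact: s01.
    by apply: dyle => //; exact: nodeM.
  rewrite normrM; apply: (le_trans (ler_wpM2l (normr_ge0 _) (dle i x Kx))).
  rewrite /S normrM ger0_norm ?invr_ge0 ?mulr_ge0 ?(ltW M0)//.
  by rewrite le_eqVlt; apply/orP; left; apply/eqP; field; rewrite gt_eqF.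
- move=> x Kx; rewrite diff_pair// dzE; apply: cvgD.
    have sq := smooth_slicer (smooth_diff (F x, 0) sPhi) (f x).
    have [D D0 HD] := smooth_real_lipschitz M sq.
    apply: (@cvg_rate _ _ _ (D * ((1 + 4 * M ^+ 2) / 2))) => i.
    rewrite -[leRHS]mulrA -rate.
    have := @bern_node_approx R M M0 (N i) (s x) (g x) (fun t => 'd Phi (f x, t : R^o) (F x, 0)) D _ (s01 x Kx) (gE x) (iD0 i).
    by apply=> // t tM; apply: HD => //; exact: gM.
  have -> : G x * 'd Phi (f x, g x : R^o) (0, 1 : R^o) = S x * (2 * M * 'd Phi (f x, g x : R^o) (0, 1 : R^o)).
    by rewrite /S; field; rewrite gt_eqF.
  apply: cvgMr.
  have sq := smooth_slicer (smooth_diff (0, 1 : R^o) sPhi) (f x).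
  have [D D0 HD] := smooth_real_lipschitz M sq.
  apply: (@cvg_rate _ _ _ (2 * M * D * ((1 + 4 * M ^+ 2) / 2 + 2 * M))) => i.
  have := @dbern_node_approx R M M0 (i.+1 ^ 2).-1 (s x) (g x) (fun t => Phi (f x, t : R^o))
    (fun t => 'd Phi (f x, t : R^o) (0, 1 : R^o)) D _ (s01 x Kx) (gE x) (iD0 i) D0.
  rewrite -/(N i) rate => /(_ _ _)/le_trans; apply.
  + move=> t t' tt'; have [u ut E] := smooth_real_MVT (smooth_slicer sPhi (f x)) tt'.
    by exists u => //; rewrite E diff_slicer.
  + by move=> t tM; apply: HD => //; exact: gM.
  + rewrite -[leRHS]mulrA; apply: ler_wpM2l; first by rewrite !mulr_ge0 ?(ltW M0).
    rewrite [leRHS]mulrDl lerD2l ler_wpM2l ?mulr_ge0 ?(ltW M0)//.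
    rewrite lef_pV2 ?posrE ?ltr0n// ler_nat NE.
    by rewrite -mulnn leq_pmulr.
- by move=> i; have [_ _ h] := Hb i; exact: h.
Qed.

End chain_rule.

End vector_weak_derivative.

(** * Uniqueness for vector valued functions and the derivative on the zero set *)

Section weak_partial_operations.
Variables (R : realType) (n m : nat) (U : set 'rV[R]_n).
Variable V : {outer_measure set ('rV[R]_n * subsp R n) -> \bar R}.
Variable dV : {outer_measure set 'rV[R]_n -> \bar R}.
Hypotheses (oU : open U) (vV : varifold m U V) (radon_dV : radon_over U dV).
Variables (k : 'I_n) (eta : 'rV[R]_n -> R).
Hypotheses (meta : omeas dV eta) (leta : locally_bounded U eta).
Hypothesis fvar_eta : forall phi, test_fun U phi ->
  fvar V k phi = oI dV (fun x => phi x * eta x).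
Local Notation wV := (wgt m V).
Let radon_wV : radon_over U wV := radon_wgt oU vV.
Local Notation adm := (admissible m U V dV).
Local Notation lint := (locally_integrable m U V).
Local Notation wD := (wd m U V dV k eta).
Variables (Y : normedModType R) (b : frame Y).
Local Notation wpartial := (@weak_partial R n m U V dV k eta Y).

Lemma smooth_rescale (q : Y -> R^o) (e c : R) : smooth q ->
  smooth ((fun y => e * q (c *: y)) : Y -> R^o).
Proof.
move=> sq j; apply: (@class_CM R Y j (fun=> e) (fun y => q (c *: y))).
  exact: (@class_C_cst R Y R^o).
apply: (@eq_class_C _ _ _ j (fun y => q (( *:%R c : {linear Y -> Y}) y + 0))).
  by move=> y; rewrite addr0.
by apply: class_C_comp_affine => //; exact: scaler_continuous.
Qed.

Lemma diff_rescale (q : Y -> R^o) (e c : R) y v : smooth q ->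
  'd ((fun y => e * q (c *: y)) : Y -> R^o) y v = e * c * ('d q (c *: y) v : R).
Proof.
move=> sq; have E : (fun y => q (c *: y)) = (fun y => q (( *:%R c : {linear Y -> Y}) y + 0)).
  by apply/funext => z; rewrite addr0.
have sq' : smooth (fun y => q (c *: y)).
  by move=> j; rewrite E; apply: class_C_comp_affine => //; exact: scaler_continuous.
have dq := differentiableP (smooth_differentiable y sq').
have dc : is_diff y (fun=> e : R^o) (fun=> 0 : R^o) by exact: is_diff_cst.
have := is_diff_val (is_diff_scale dc dq) v.
rewrite [in X in _ = X -> _]E diff_comp_affine; [|exact: scaler_continuous|exact: smooth_differentiable].
rewrite addr0 /= linearZ/= scale0r addr0 => ->.
by rewrite /GRing.scale/= mulrA.
Qed.

Lemma test_scalar_of_norm (gamma : Y -> R^o) (s : R) : smooth gamma ->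
  (forall y v, s < `|y| -> 'd gamma y v = 0) -> test_scalar gamma.
Proof.
move=> sg H; split=> //; have cs := @compact_norm_le R Y b s.
apply: (subclosed_compact _ cs); first exact: closed_closure.
have cl : closed [set y : Y | `|y| <= s] by apply: compact_closed => //; exact: norm_hausdorff.
rewrite closureE => y; apply; split=> // {}y [v] Hv /=.
by rewrite leNgt; apply/negP => sy; move/negP: Hv; apply; apply/eqP; exact: H.
Qed.

(** The differential of a nonzero coordinate functional does not have compact support. The cut-off
    turns the functional into a test scalar whose differential is unchanged inside the box of size
    r. *)
Definition tcoord (i : 'I_(frk b)) (r : R) (y : Y) : R := fcut b r y * fco b i y.

Lemma tcoord_diff i r y v : 'd (tcoord i r : Y -> R^o) y v =
  fcut b r y * fco b i v + 'd (fcut b r : Y -> R^o) y v * fco b i y.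
Proof.
have dc := differentiableP (smooth_differentiable y (smooth_fcut b r)).
have df := differentiableP (smooth_differentiable y (smooth_fco i)).
have := is_diff_val (is_diff_scale dc df) v.
rewrite (is_diff_val (is_diff_lin y (@fco_continuous _ _ b i))); exact.
Qed.

Lemma near_fbox_interior r y : (forall i, `|fco b i y| < r) -> \forall z \near y, fbox b r z.
Proof.
move=> H.
have Hi i : \forall z \near y, `|fco b i z| <= r.
  have : (fun z => `|fco b i z : R|) @ y --> `|fco b i y : R|.
    by apply: (@continuous_comp _ _ _ (fco b i) Num.norm); [exact: fco_continuous|exact: norm_continuous].
  by move=> /cvgr_le -/(_ r (H i)).
have := @filter_forall _ _ _ _ _ Hi; apply => //.
Qed.

Lemma fcut_near1 r y v : 0 < r -> (forall i, `|fco b i y| < r) ->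
  fcut b r y = 1 /\ 'd (fcut b r : Y -> R^o) y v = 0.
Proof.
move=> r0 H; have nb := near_fbox_interior H; split.
  by apply: fcut1 => //; exact: nbhs_singleton nb.
apply: (@diff_near_cst _ Y R^o (fcut b r) y 1 (smooth_differentiable y (smooth_fcut b r))).
by apply: filterS nb => z; exact: fcut1.
Qed.

Lemma tcoord_diff1 i r y v : 0 < r -> (forall j, `|fco b j y| < r) ->
  'd (tcoord i r : Y -> R^o) y v = fco b i v.
Proof.
by move=> r0 H; have [h1 h2] := fcut_near1 v r0 H; rewrite tcoord_diff h1 h2 mul1r mul0r addr0.
Qed.

Lemma test_scalar_tcoord i r : 0 < r -> @test_scalar R Y (tcoord i r).
Proof.
move=> r0.
have [C C0 HC] := norm_le_fco b.
apply: (@test_scalar_of_norm _ (C * \sum_(j < frk b) (2 * r))).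
  by move=> j; exact: (@class_CM R Y j (fcut b r) (fco b i) (smooth_fcut b r j) (smooth_fco i j)).
move=> y v Hy; have nb : ~ fbox b (2 * r) y.
  move=> By; move: Hy; rewrite ltNge => /negP; apply; apply: (le_trans (HC y)).
  by rewrite ler_wpM2l//; apply: ler_sum => j _; exact: By.
by rewrite tcoord_diff (fcut0 r0 nb) (diff_fcut_out _ r0 nb) !mul0r addr0.
Qed.

Lemma large_fbox y : \forall j \near \oo, forall i, `|fco b i y| < (j : nat).+1%:R.
Proof.
near=> j => i.
have : `|fco b i y| <= \sum_i `|fco b i y : R| by rewrite (bigD1 i)//= lerDl sumr_ge0.
move=> /le_lt_trans; apply; apply: (@le_lt_trans _ _ j%:R); last by rewrite ltr_nat.
by near: j; exact: nbhs_infty_ger.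
Unshelve. all: by end_near. Qed.

(** Where all coordinates of f x are below j + 1, the differential of the cut-off coordinate reads
    off the i-th coordinate of F x; scalar uniqueness is needed for countably many pairs (i, j)
    only. *)
Lemma weak_partial_unique f F F' : wpartial f F -> wpartial f F' ->
  wV [set x | F x <> F' x] = 0%E.
Proof.
move=> wf wf'.
have H i j : wV [set x | 'd (tcoord i j.+1%:R : Y -> R^o) (f x) (F x) <>
    'd (tcoord i j.+1%:R : Y -> R^o) (f x) (F' x)] = 0%E.
  have tc := @test_scalar_tcoord i j.+1%:R (ltr0Sn _ _).
  have [_ l1] := weak_partial_test oU vV b wf tc.
  have [_ l2] := weak_partial_test oU vV b wf' tc.
  have [_ _ _ /(_ _ tc) w1] := wf; have [_ _ _ /(_ _ tc) w2] := wf'.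
  exact: (wd_unique oU vV l1 l2 w1 w2).
(* The finite index set is embedded into the natural numbers by [insub]; the other indices
   contribute empty sets. *)
apply: null_sub (null_bigcup (fun j => @null_bigcup _ _ wV
  (fun i => if insub i is Some i' then [set x | 'd (tcoord i' j.+1%:R : Y -> R^o) (f x) (F x) <>
    'd (tcoord i' j.+1%:R : Y -> R^o) (f x) (F' x)] else set0) _)); last first.
  by move=> j i; case: (insub i) => [i'|]; [exact: H|exact: outer_measure0].
move=> x /= neq; apply: contrapT => HN; apply: neq.
have [J _ HJ] := large_fbox (f x); have {}HJ := HJ J (leqnn J).
rewrite [LHS](fcoE b) [RHS](fcoE b); apply: eq_bigr => i _; congr (_ *: _).
rewrite -(@tcoord_diff1 i J.+1%:R (f x))// -[RHS](@tcoord_diff1 i J.+1%:R (f x))//.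
apply: contrapT => neq; apply: HN; exists J => //; exists (i : nat) => //.
by rewrite valK.
Qed.

(* [e (q (y / e)) -> 0] as [e -> 0] while its derivative at [0] remains that of [q]. *)
Lemma weak_partial_zero f F : wpartial f F -> wV [set x | f x = 0 /\ F x <> 0] = 0%E.
Proof.
move=> wf; have [mf mF iF wF] := wf.
have key i : wV [set x | (if f x == 0 then fco b i (F x) : R else 0) <> 0] = 0%E.
  pose q := tcoord i 1 : Y -> R^o.
  have tq : test_scalar q by exact: test_scalar_tcoord.
  have [sq _] := tq.
  have [C [s [C0 HC Hs]]] := test_scalar_covector b tq.
  have [Bq Bq0 HBq] := test_scalar_bounded b tq.
  pose e (j : nat) : R := j.+1%:R^-1.
  have e0 j : 0 < e j by rewrite invr_gt0.
  have e1 j : e j <= 1 by rewrite invf_le1// ler1n.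
  pose ga j : Y -> R^o := fun y => (e j : R) * q (j.+1%:R *: y) : R^o.
  have ej j : e j * j.+1%:R = 1 by rewrite mulVf.
  have dga j y v : 'd (ga j) y v = 'd q (j.+1%:R *: y) v :> R by rewrite diff_rescale// ej mul1r.
  have out j y v : s < `|y| -> 'd (ga j) y v = 0.
    move=> sy; rewrite dga Hs// normrZ ger0_norm// (lt_le_trans sy)//.
    by rewrite ler_peMl// ler1n.
  have tga j : test_scalar (ga j).
    by apply: (@test_scalar_of_norm _ s); [exact: smooth_rescale|exact: out].
  pose A j x : R := 'd (ga j) (f x) (F x).
  pose A0 x : R := if f x == 0 then fco b i (F x) : R else 0.
  pose H x := C * \sum_j `|if `|f x| <= s then fco b j (F x) : R else 0|.
  have iH : lint H by exact: (locally_integrableZ dV oU vV C (truncated_locally_integrable b wf s)).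
  have AH j x : `|A j x| <= H x.
    rewrite /A (linear_frame b ('d (ga j) (f x))); apply: (covector_le F) => // [l|sx l].
      by rewrite dga.
    exact: out.
  have AA x : (A ^~ x) @ \oo --> A0 x.
    apply: cvg_near_cst; rewrite /A0; have [fx|fx] := eqVneq (f x) 0.
      near=> j; rewrite /A dga fx scaler0.
      by apply: tcoord_diff1 => // l; rewrite linear0 normr0.
    (* Off the zero set, (j + 1) |f x| eventually exceeds [s], beyond which the differential of [q]
       vanishes. *)
    near=> j; rewrite /A dga Hs// normrZ ger0_norm//.
    rewrite -ltr_pdivrMr ?normr_gt0//; apply: (@lt_trans _ _ j%:R); last by rewrite ltr_nat.
    by near: j; exact: nbhs_infty_gtr.
  have mA j : omeas wV (A j) by have [_ []] := weak_partial_test oU vV b wf (tga j).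
  have mA0 : omeas wV A0 by exact: omeas_cvg mA AA.
  have A0H x : `|A0 x| <= H x.
    have -> : A0 x = if f x == 0 then A 0%N x else 0.
      rewrite /A0; case: eqP => // fx; rewrite /A dga fx scaler0.
      by rewrite tcoord_diff1 // => l; rewrite linear0 normr0.
    by case: ifP => _ //; rewrite normr0 (le_trans _ (AH 0%N x)).
  have iA0 := locally_integrable_le oU vV mA0 iH A0H.
  have i0 : lint (fun=> 0).
    apply: (locally_integrable_bounded oU vV); first exact: omeas_cst.
    by move=> K _ _; exists `|0 : R|.
  have wA0 : wD (fun=> 0) A0.
    move=> phi tphi.
    apply: (@wd_lim _ _ _ _ _ _ oU vV radon_dV k eta meta leta (fun j x => ga j (f x)) A _ _ H Bq phi tphi) => //.
    - by move=> j; have [] := mf _ (smooth_continuous (smooth_rescale (e j) j.+1%:R sq)).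
    - by move=> j; have [] := mf _ (smooth_continuous (smooth_rescale (e j) j.+1%:R sq)).
    - exact: omeas_cst.
    - exact: omeas_cst.
    - by move=> j x _; rewrite normrM gtr0_norm// -[leRHS]mul1r ler_pM// ltW.
    - move=> x _; apply: (@cvg_rate _ _ _ Bq) => j.
      by rewrite subr0 normrM gtr0_norm// mulrC ler_wpM2r// ltW.
    - by move=> j; apply: (wF _ (tga j)).
  exact: (wd_unique oU vV iA0 i0 wA0 (wd_cst oU vV radon_dV meta leta fvar_eta 0)).
apply: null_sub (@null_bigcup _ _ wV (fun j => if insub j is Some i then
    [set x | (if f x == 0 then fco b i (F x) : R else 0) <> 0] else set0) _); last first.
  by move=> j; case: (insub j) => [i|]; [exact: key|exact: outer_measure0].
move=> x [fx Fx]; apply: contrapT => HN; apply: Fx; rewrite (fcoE b (F x)) big1// => i _.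
suff -> : fco b i (F x) = 0 by rewrite scale0r.
apply: contrapT => Fi; apply: HN.
by exists (i : nat) => //; rewrite valK /= fx eqxx.
Unshelve. all: by end_near. Qed.

End weak_partial_operations.

(** * Addition of Lipschitzian functions *)

Section weak_partial_sum.
Variables (R : realType) (n m : nat) (U : set 'rV[R]_n).
Variable V : {outer_measure set ('rV[R]_n * subsp R n) -> \bar R}.
Variable dV : {outer_measure set 'rV[R]_n -> \bar R}.
Hypotheses (oU : open U) (vV : varifold m U V) (radon_dV : radon_over U dV).
Variables (k : 'I_n) (eta : 'rV[R]_n -> R).
Hypotheses (meta : omeas dV eta) (leta : locally_bounded U eta).
Hypothesis fvar_eta : forall phi, test_fun U phi ->
  fvar V k phi = oI dV (fun x => phi x * eta x).
Local Notation wV := (wgt m V).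
Let radon_wV : radon_over U wV := radon_wgt oU vV.
Local Notation adm := (admissible m U V dV).
Local Notation lint := (locally_integrable m U V).
Local Notation wD := (wd m U V dV k eta).
Variables (Y : normedModType R) (b : frame Y).
Local Notation wpartial := (@weak_partial R n m U V dV k eta Y).

Lemma test_scalar_diff_bounded gamma : @test_scalar R Y gamma -> forall v : Y,
  exists2 B : R, 0 <= B & forall y, `|'d gamma y v| <= B.
Proof.
move=> tg v; have [C [s [C0 HC _]]] := test_scalar_covector b tg.
exists (\sum_i `|fco b i v| * C); first by apply: sumr_ge0 => i _; rewrite mulr_ge0.
move=> y; rewrite (linear_frame b ('d gamma y)).
apply: (le_trans (ler_norm_sum _ _ _)); apply: ler_sum => i _.
by rewrite normrM ler_wpM2l.
Qed.

Lemma weak_partial_cst : wpartial (fun=> 0) (fun=> 0).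
Proof.
have i0 : lint (fun=> 0).
  apply: (locally_integrable_bounded oU vV); first exact: omeas_cst.
  by move=> K _ _; exists `|0 : R|.
split.
- by move=> h _; split; exact: omeas_cst.
- by move=> l _; exact: omeas_cst.
- by move=> l s _; rewrite linear0; under eq_fun do rewrite if_same.
- move=> gamma _; rewrite linear0; exact: (wd_cst oU vV radon_dV meta leta fvar_eta).
Qed.

Section add_line.
Variable e : Y.

(** One direction [e] is added at a time, so that the chain rule is needed for a scalar function [g]
    only; a vector valued function is added by iteration over its coordinates. *)
Definition add_line (p : (Y * R^o)%type) : Y := p.1 + (p.2 : R) *: e.

Fact add_line_linear : linear add_line.
Proof.
by move=> a [y z] [y' z']; rewrite /add_line/= scalerDl scalerDr scalerA addrACA.
Qed.

HB.instance Definition _ := GRing.isLinear.Build R (Y * R^o)%type Y _ add_line add_line_linear.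

Lemma add_line_continuous : continuous add_line.
Proof.
apply: (@le_continuous_linear R _ _ add_line (1 + `|e|)) => -[y z] /=.
apply: (le_trans (ler_normD _ _)); rewrite normrZ mulrDl mul1r; apply: lerD.
  by rewrite prod_normE /= le_max lexx.
by rewrite mulrC ler_wpM2l// prod_normE /= le_max lexx orbT.
Qed.

Lemma weak_partial_add f F (g G : 'rV[R]_n -> R) : wpartial f F ->
    locally_lipschitz U (g : _ -> R^o) -> omeas wV G -> locally_bounded U G -> wD g G ->
  wpartial (fun x => f x + g x *: e) (fun x => F x + G x *: e).
Proof.
move=> wf lg mG lG wg; have [mf mF iF wF] := wf.
have [mdg mwg lgb] := admissible_lipschitz oU vV radon_dV lg.
have iG := locally_integrable_bounded oU vV mG lG.
have mh mu (h : Y -> R) : continuous h -> omeas mu g -> (forall q : Y -> R, continuous q -> omeas mu (fun x => q (f x))) ->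
    omeas mu (fun x => h (f x + g x *: e)).
  move=> ch mg mq; apply: (@omeas_pair R n Y f g mu (fun p => h (add_line p))) => // p.
  by apply: (@continuous_comp _ _ _ add_line h); [exact: add_line_continuous|exact: ch].
have ml (l : {linear Y -> R^o}) : continuous l -> omeas wV (fun x => l (F x + G x *: e)).
  move=> cl; have := omeasD (mF l cl) (omeasM mG (@omeas_cst _ _ wV (l e))).
  by congr (omeas _ _); apply/funext => x; rewrite linearD linearZ.
split.
- by move=> h ch; split; apply: mh => // q cq; have [] := mf q cq.
- exact: ml.
- move=> l s cl.
  have mT : omeas wV (fun x => if `|f x + g x *: e| <= s then l (F x + G x *: e) else 0).
    have mn : omeas wV (fun x => `|f x + g x *: e|).
      by apply: (mh wV (fun y : Y => `|y|)) => //; [exact: norm_continuous|move=> q cq; have [] := mf q cq].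
    have mS : wV.-caratheodory [set x | `|f x + g x *: e| <= s].
      have := mn measurableT [set t : R | t <= s]%classic (closed_measurable (@closed_le R s)).
      by rewrite setTI.
    have := omeasM (omeas_indic mS) (ml l cl).
    congr (omeas _ _); apply/funext => x; rewrite indicE.
    case: ifP => H; first by rewrite mem_set// mul1r.
    by rewrite memNset ?mul0r//= H.
  split=> // K cK KU; have mK := cpt_caratheodory radon_wV cK.
  (* On [K], a bound [s] for |f + g e| gives the bound [s'] for |f|, and [F] is integrable on the
     corresponding set. *)
  have [M HM] := lgb K cK KU; set s' := s + `|M| * `|e|.
  have [_ /(_ K cK KU) i1] := locally_integrableD (locally_integrable_norm (iF l s' cl))
    (locally_integrableZ dV oU vV `|l e| (locally_integrable_norm iG)).
  apply: (le_ointeg _ i1); first by apply: omeasM => //; exact: omeas_indic.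
  move=> x; rewrite indicE; case: (asboolP (K x)) => Kx; last by rewrite memNset// !mul0r normr0.
  rewrite mem_set// !mul1r; case: (leP `|f x + g x *: e| s) => H; last by rewrite normr0 addr_ge0 ?mulr_ge0.
  rewrite ifT; last first.
    rewrite -[f x](addrK (g x *: e)); apply: (le_trans (ler_normB _ _)); apply: lerD => //.
    by rewrite normrZ ler_wpM2r// (le_trans (HM x Kx))// ler_norm.
  rewrite linearD linearZ; apply: (le_trans (ler_normD _ _)); rewrite lerD2l.
  by rewrite /GRing.scale/= normrM mulrC.
- move=> gamma tg; have [sg _] := tg.
  pose Phi (p : (Y * R^o)%type) : R^o := gamma (add_line p + 0).
  have sPhi : smooth Phi by move=> j; apply: class_C_comp_affine; [exact: add_line_continuous|exact: sg].
  have dPhi y (z : R) v (w : R) : 'd Phi (y, z : R^o) (v, w : R^o) = 'd gamma (y + z *: e) (v + w *: e).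
    by rewrite diff_comp_affine ?addr0//; [exact: add_line_continuous|exact: smooth_differentiable].
  have [Bg Bg0 HBg] := test_scalar_bounded b tg.
  have [Be Be0 HBe] := test_scalar_diff_bounded tg e.
  have [s Hs] := test_scalar_out tg.
  have HPhi (M : R) : exists s B : R, forall (y : Y) (z : R), `|z| <= M ->
      [/\ `|Phi (y, z)| <= B, `|'d Phi (y, z : R^o) (0, 1 : R^o)| <= B &
        s < `|y| -> forall v : Y, 'd Phi (y, z : R^o) (v, 0) = 0].
    (* For |z| <= M, translation by z e enlarges the radius outside of which the differential of
       [gamma] vanishes by at most M |e|. *)
    exists (s + M * `|e|), (Num.max Bg Be) => y z zM; split.
    + by rewrite le_max HBg.
    + by rewrite dPhi add0r scale1r le_max HBe orbT.
    + move=> sy v; rewrite dPhi scale0r addr0 Hs//; rewrite -ltrBrDr in sy.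
      apply: (lt_le_trans sy); rewrite lerBlDr -{1}[y](addrK (z *: e)).
      apply: (le_trans (ler_normB _ _)); rewrite lerD2l normrZ.
      by rewrite ler_wpM2r.
  have := wd_chain oU vV radon_dV meta leta fvar_eta b wf lg mG lG wg sPhi HPhi.
  have -> : (fun x => Phi (f x, g x)) = (fun x => gamma (f x + g x *: e)).
    by apply/funext => x; rewrite /Phi /add_line addr0.
  by have -> : (fun x => 'd Phi (f x, g x : R^o) (F x, G x : R^o)) =
      (fun x => 'd gamma (f x + g x *: e) (F x + G x *: e)) by apply/funext => x; exact: dPhi.
Qed.

End add_line.

Lemma weak_partial_add_sum f F (I : Type) (s : seq I) (g G : I -> 'rV[R]_n -> R) (e : I -> Y) :
    wpartial f F -> (forall i, locally_lipschitz U (g i : _ -> R^o)) ->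
    (forall i, omeas wV (G i)) -> (forall i, locally_bounded U (G i)) ->
    (forall i, wD (g i) (G i)) ->
  wpartial (fun x => f x + \sum_(i <- s) g i x *: e i) (fun x => F x + \sum_(i <- s) G i x *: e i).
Proof.
move=> wf lg mG lG wg; elim: s => [|i s IH].
  have -> : (fun x => f x + \sum_(i <- [::]) g i x *: e i) = f.
    by apply/funext => x; rewrite big_nil addr0.
  by have -> : (fun x => F x + \sum_(i <- [::]) G i x *: e i) = F
    by apply/funext => x; rewrite big_nil addr0.
have := weak_partial_add (e i) IH (lg i) (mG i) (lG i) (wg i).
have -> : (fun x => f x + \sum_(i <- i :: s) g i x *: e i) =
    (fun x => f x + \sum_(i <- s) g i x *: e i + g i x *: e i).
  by apply/funext => x; rewrite big_cons addrCA addrC.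
by have -> : (fun x => F x + \sum_(i <- i :: s) G i x *: e i) =
    (fun x => F x + \sum_(i <- s) G i x *: e i + G i x *: e i)
  by apply/funext => x; rewrite big_cons addrCA addrC.
Qed.

(** Prepares (2): the pair (f, g) is the sum of (f, 0) and the Lipschitzian function (0, g). *)
Lemma weak_partial_pinl (Z : normedModType R) f F : wpartial f F ->
  @weak_partial R n m U V dV k eta (Y * Z)%type (fun x => (f x, 0)) (fun x => (F x, 0)).
Proof.
move=> [mf mF iF wF].
have nl y : `|(y, 0) : (Y * Z)%type| = `|y|.
  by rewrite prod_normE /= normr0; apply/max_idPl.
split.
- move=> h ch; apply: (mf (fun y => h (pinl Z y))) => y.
  by apply: (@continuous_comp _ _ _ (@pinl R Y Z) h); [exact: pinl_continuous|exact: ch].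
- move=> l cl; apply: (mF (l \o @pinl R Y Z)) => y.
  by apply: (@continuous_comp _ _ _ (@pinl R Y Z) l); [exact: pinl_continuous|exact: cl].
- move=> l s cl; under eq_fun do rewrite nl; apply: (iF (l \o @pinl R Y Z)) => y.
  by apply: (@continuous_comp _ _ _ (@pinl R Y Z) l); [exact: pinl_continuous|exact: cl].
- move=> gamma tg; have [sg _] := tg; have [s Hs] := test_scalar_out tg.
  have tg' : @test_scalar R Y (fun y => gamma (y, 0)).
    apply: (@test_scalar_of_norm R Y b _ s); first exact: smooth_slicel.
    by move=> y v sy; rewrite diff_slicel// Hs// nl.
  have := wF _ tg'; congr (wd _ _ _ _ _ _ _ _); apply/funext => x.
  by rewrite diff_slicel.
Qed.

End weak_partial_sum.

(** * Multiplication by a Lipschitzian function *)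

Section scale_map.
Variables (R : realType) (Y : normedModType R).

Definition pfst (p : (Y * R^o)%type) : Y := p.1.
Definition psnd (p : (Y * R^o)%type) : R^o := p.2.

Fact pfst_linear : linear pfst. Proof. by []. Qed.
Fact psnd_linear : linear psnd. Proof. by []. Qed.

HB.instance Definition _ := GRing.isLinear.Build R (Y * R^o)%type Y _ pfst pfst_linear.
HB.instance Definition _ := GRing.isLinear.Build R (Y * R^o)%type R^o _ psnd psnd_linear.

Lemma pfst_continuous : continuous pfst. Proof. by move=> p; exact: cvg_fst. Qed.
Lemma psnd_continuous : continuous psnd. Proof. by move=> p; exact: cvg_snd. Qed.

Definition scale_map (p : (Y * R^o)%type) : Y := (p.2 : R) *: p.1.

Lemma is_diff_scale_map p :
  is_diff p scale_map (fun q => (p.2 : R) *: q.1 + (q.2 : R) *: p.1).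
Proof. exact: (is_diff_scale (is_diff_lin p psnd_continuous) (is_diff_lin p pfst_continuous)). Qed.

Lemma scale_map_continuous : continuous scale_map.
Proof. by move=> p; apply: differentiable_continuous; have [] := is_diff_scale_map p. Qed.

Variables (b : frame Y) (gamma : Y -> R^o).
Hypothesis sg : smooth gamma.

Lemma diff_comp_scale_map p q :
  'd (fun p => gamma (scale_map p)) p q = 'd gamma (scale_map p) ((p.2 : R) *: q.1 + (q.2 : R) *: p.1).
Proof.
have dg := differentiableP (smooth_differentiable (scale_map p) sg).
by rewrite (is_diff_val (is_diff_comp (is_diff_scale_map p) dg)).
Qed.

End scale_map.

(** The derivative involves ['d gamma] in the varying direction p.1. Expanding p.1 in coordinates
    leaves the fixed directions [fvec b i], to which the induction hypothesis applies. *)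
Lemma smooth_comp_scale_map (R : realType) (Y : normedModType R) (b : frame Y) (gamma : Y -> R^o) :
  smooth gamma -> smooth (fun p : (Y * R^o)%type => gamma (scale_map p)).
Proof.
move=> sg j; elim: j gamma sg => [|j IH] gamma sg.
  move=> p; apply: (@continuous_comp _ _ _ (@scale_map R Y) gamma); first exact: scale_map_continuous.
  exact: (smooth_continuous sg).
apply: (@class_CS _ _ _ j _ (fun p q => (p.2 : R) * 'd gamma (scale_map p) q.1 +
    (q.2 : R) * \sum_i fco b i p.1 * 'd gamma (scale_map p) (fvec b i) : R^o)).
  move=> p; have dg := differentiableP (smooth_differentiable (scale_map p) sg).
  have -> : (fun p => gamma (scale_map p)) = gamma \o @scale_map R Y by [].
  apply: (is_diff_eq (is_diff_comp (is_diff_scale_map p) dg)).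
  apply/funext => q /=; rewrite linearD !linearZ/=; congr (_ + _ *: _).
  exact: linear_frame.
move=> v; apply: class_CD.
  apply: class_CM; first exact: (class_C_lin j (@psnd_continuous R Y)).
  exact: (IH (fun y => 'd gamma y v.1) (smooth_diff v.1 sg)).
apply: class_CM; first exact: class_C_cst.
apply: class_C_sum => i; apply: class_CM; last exact: (IH (fun y => 'd gamma y (fvec b i)) (smooth_diff _ sg)).
apply: (class_C_lin j (L := fco b i \o @pfst R Y)) => p.
apply: (@continuous_comp _ _ _ (@pfst R Y) (fco b i)); first exact: pfst_continuous.
exact: fco_continuous.
Qed.

Section weak_partial_scale.
Variables (R : realType) (n m : nat) (U : set 'rV[R]_n).
Variable V : {outer_measure set ('rV[R]_n * subsp R n) -> \bar R}.
Variable dV : {outer_measure set 'rV[R]_n -> \bar R}.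
Hypotheses (oU : open U) (vV : varifold m U V) (radon_dV : radon_over U dV).
Variables (k : 'I_n) (eta : 'rV[R]_n -> R).
Hypotheses (meta : omeas dV eta) (leta : locally_bounded U eta).
Hypothesis fvar_eta : forall phi, test_fun U phi ->
  fvar V k phi = oI dV (fun x => phi x * eta x).
Local Notation wV := (wgt m V).
Let radon_wV : radon_over U wV := radon_wgt oU vV.
Local Notation adm := (admissible m U V dV).
Local Notation lint := (locally_integrable m U V).
Local Notation wD := (wd m U V dV k eta).
Variables (Y : normedModType R) (b : frame Y).
Local Notation wpartial := (@weak_partial R n m U V dV k eta Y).

(** Over |z| <= M only the compact ball |y| <= s matters, so [Phi] and its derivative in the second
    variable are bounded there, as [wd_chain] demands. *)
Lemma compact_support_chain (Phi : (Y * R^o)%type -> R^o) (s : R) : smooth Phi ->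
    (forall (y : Y) (z : R), s < `|y| -> Phi (y, z) = 0) ->
  forall M : R, exists s B : R, forall (y : Y) (z : R), `|z| <= M ->
    [/\ `|Phi (y, z)| <= B, `|'d Phi (y, z : R^o) (0, 1 : R^o)| <= B &
      s < `|y| -> forall v, 'd Phi (y, z : R^o) (v, 0) = 0].
Proof.
move=> sPhi P0 M.
have out (y : Y) (z : R) q : s < `|y| -> 'd Phi (y, z : R^o) q = 0.
  move=> sy; apply: (@diff_near_cst _ _ _ Phi (y, z) 0); first exact: smooth_differentiable.
  have : \forall y' \near y, s < `|y'|.
    by have := @norm_continuous _ Y y => /cvgr_gt -/(_ s sy).
  move=> ny; exists ([set y' | s < `|y'|], setT) => /=; first by split=> //; exact: filterT.
  by move=> [y' z'] [/= sy' _]; exact: P0.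
have cYM := compact_setX (@compact_norm_le R Y b s) (@segment_compact R (- M) M).
have [B1 B10 H1] := bounded_on_compact (smooth_continuous sPhi) cYM.
have [B2 B20 H2] := bounded_on_compact (smooth_continuous (smooth_diff (0, 1 : R^o) sPhi)) cYM.
have Min (y : Y) (z : R) : `|y| <= s -> `|z| <= M -> ([set y : Y | `|y| <= s] `*` [set` `[- M, M]]) (y, z).
  by move=> ys zM; split=> //=; rewrite in_itv/= -ler_norml.
exists s, (Num.max B1 B2) => y z zM; split.
- have [ys|ys] := leP `|y| s; first by rewrite le_max (H1 (y, z) (Min y z ys zM)).
  by rewrite P0// normr0 le_max B10.
- have [ys|ys] := leP `|y| s; first by rewrite le_max (H2 (y, z) (Min y z ys zM)) orbT.
  by rewrite out// normr0 le_max B10.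
- by move=> sy v; exact: out.
Qed.

(** For small z the differential of y |-> gamma (z y) lives far out, so gamma (z y) need not satisfy
    the hypothesis of [wd_chain]. The factor [fcut b (r j)] repairs this. It is removed as j grows,
    the derivatives being dominated through local integrability of [f] and [F]. *)
Lemma weak_partial_scale f F (g G : 'rV[R]_n -> R) : wpartial f F ->
    (forall i, lint (fun x => fco b i (f x))) -> (forall i, lint (fun x => fco b i (F x))) ->
    locally_lipschitz U (g : _ -> R^o) -> omeas wV G -> locally_bounded U G -> wD g G ->
  wpartial (fun x => g x *: f x) (fun x => G x *: f x + g x *: F x).
Proof.
move=> wf if_ iF_ lg mG lG wg; have [mf mF iF wF] := wf.
have ag := admissible_lipschitz oU vV radon_dV lg; have [mdg mwg lgb] := ag.
have iG := locally_integrable_bounded oU vV mG lG.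
have mh mu (h : Y -> R) : continuous h -> omeas mu g -> (forall q : Y -> R, continuous q -> omeas mu (fun x => q (f x))) ->
    omeas mu (fun x => h (g x *: f x)).
  move=> ch mg mq; apply: (@omeas_pair R n Y f g mu (fun p => h (scale_map p))) => // p.
  by apply: (@continuous_comp _ _ _ (@scale_map R Y) h); [exact: scale_map_continuous|exact: ch].
pose E x := G x *: f x + g x *: F x.
have mwf q : continuous q -> omeas wV (fun x => q (f x)) by move=> cq; have [] := mf q cq.
have llf (l : {linear Y -> R^o}) : lint (fun x => l (f x)).
  under eq_fun do rewrite (linear_frame b l).
  apply: locally_integrable_sum => i; under eq_fun do rewrite /GRing.scale/= mulrC.
  exact: (locally_integrableZ dV oU vV _ (if_ i)).
have llF (l : {linear Y -> R^o}) : lint (fun x => l (F x)).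
  under eq_fun do rewrite (linear_frame b l).
  apply: locally_integrable_sum => i; under eq_fun do rewrite /GRing.scale/= mulrC.
  exact: (locally_integrableZ dV oU vV _ (iF_ i)).
have ll (l : {linear Y -> R^o}) : lint (fun x => l (E x)).
  have := locally_integrableD (locally_integrable_mul_bounded oU vV mG lG (llf l))
    (locally_integrableM oU vV ag (llF l)).
  by congr (locally_integrable _ _ _ _); apply/funext => x; rewrite /E linearD !linearZ.
split.
- by move=> h ch; split; apply: mh => // q cq; have [] := mf q cq.
- by move=> l _; have [] := ll l.
- move=> l s cl; apply: (locally_integrable_le oU vV _ (locally_integrable_norm (ll l))); last first.
    by move=> x; case: ifP => _ //; rewrite normr0.
  have mn : omeas wV (fun x => `|g x *: f x|).
    by apply: (mh wV (fun y : Y => `|y|)) => //; exact: norm_continuous.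
  have mS : wV.-caratheodory [set x | `|g x *: f x| <= s].
    have := mn measurableT [set t : R | t <= s]%classic (closed_measurable (@closed_le R s)).
    by rewrite setTI.
  have [mlE _] := ll l.
  have := omeasM (omeas_indic mS) mlE.
  congr (omeas _ _); apply/funext => x; rewrite indicE.
  case: ifP => H; first by rewrite mem_set// mul1r.
  by rewrite memNset ?mul0r//= H.
move=> gamma tg; have [sg _] := tg.
pose r (j : nat) : R := j.+1%:R.
have r0 j : 0 < r j by rewrite ltr0n.
have r1 j : 1 <= r j by rewrite ler1n.
pose Phi j (p : (Y * R^o)%type) : R^o := (fcut b (r j) (pfst p) : R) * gamma (scale_map p).
have sfc j : smooth (fun p : (Y * R^o)%type => fcut b (r j) (pfst p) : R^o).
  move=> i; apply: (@eq_class_C _ _ _ i (fun p => fcut b (r j) (@pfst R Y p + 0))).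
    by move=> p; rewrite addr0.
  by apply: class_C_comp_affine; [exact: pfst_continuous|exact: smooth_fcut].
have sgs := smooth_comp_scale_map b sg.
have sPhi j : smooth (Phi j) by move=> i; apply: class_CM; [exact: sfc|exact: sgs].
have dPhi j y (z : R) v (w : R) : 'd (Phi j) (y, z : R^o) (v, w : R^o) =
    fcut b (r j) y * 'd gamma (z *: y) (z *: v + w *: y) + 'd (fcut b (r j) : Y -> R^o) y v * gamma (z *: y) :> R.
  have h1 := differentiableP (smooth_differentiable (y, z : R^o) (sfc j)).
  have h2 := differentiableP (smooth_differentiable (y, z : R^o) sgs).
  have := is_diff_val (is_diff_scale h1 h2) (v, w); rewrite diff_comp_scale_map// => H.
  have {}H : 'd (Phi j) (y, z : R^o) (v, w : R^o) = fcut b (r j) y * 'd gamma (z *: y) (z *: v + w *: y) +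
      'd (fun p : (Y * R^o)%type => fcut b (r j) (pfst p) : R^o) (y, z : R^o) (v, w : R^o) * gamma (z *: y) :> R by exact: H.
  rewrite H; congr (_ + _ * _).
  have df := differentiableP (smooth_differentiable y (smooth_fcut b (r j))).
  exact: (is_diff_val (is_diff_comp (is_diff_lin (y, z : R^o) (@pfst_continuous R Y)) df)).
have [C0 C00 HC0] := norm_le_fco b.
pose sj j : R := C0 * \sum_(i < frk b) (2 * r j).
have P0 j (y : Y) (z : R) : sj j < `|y| -> Phi j (y, z) = 0.
  move=> sy; rewrite /Phi /= fcut0 ?mul0r// => By; move: sy; rewrite ltNge => /negP; apply.
  by apply: (le_trans (HC0 y)); rewrite ler_wpM2l//; apply: ler_sum => i _; exact: By.
have wPhi j := wd_chain oU vV radon_dV meta leta fvar_eta b wf lg mG lG wg (sPhi j)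
  (compact_support_chain (sPhi j) (P0 j)).
have [Bg Bg0 HBg] := test_scalar_bounded b tg.
have [Cg [sgm [Cg0 HCg _]]] := test_scalar_covector b tg.
have tc1 : @test_scalar R Y (fcut b 1).
  apply: (@test_scalar_of_norm R Y b _ (C0 * \sum_(i < frk b) 2)); first exact: smooth_fcut.
  move=> y v sy; apply: diff_fcut_out => // By; move: sy; rewrite ltNge => /negP; apply.
  apply: (le_trans (HC0 y)); rewrite ler_wpM2l//; apply: ler_sum => i _.
  by have := By i; rewrite mulr1.
have [C1 [_ [C10 HC1 _]]] := test_scalar_covector b tc1.
have cov_le (q : Y -> R^o) C y v : (forall y i, `|'d q y (fvec b i)| <= C) ->
    `|'d q y v| <= C * \sum_i `|fco b i v : R|.
  move=> HC; rewrite (linear_frame b ('d q y)) mulr_sumr.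
  apply: (le_trans (ler_norm_sum _ _ _)); apply: ler_sum => i _.
  by rewrite normrM mulrC ler_wpM2r.
(* The cut-off of radius r j is a rescaled [fcut b 1]; since 1/(r j) <= 1, its differential is
   bounded independently of j. *)
have dfc j y v : `|'d (fcut b (r j) : Y -> R^o) y v| <= C1 * \sum_i `|fco b i v : R|.
  have -> : fcut b (r j) = (fun y => 1 * fcut b 1 ((r j)^-1 *: y)).
    apply/funext => y'; rewrite mul1r /fcut; apply: eq_bigr => i _.
    by rewrite linearZ invr1 mul1r.
  rewrite diff_rescale; last exact: smooth_fcut.
  rewrite normrM mul1r ger0_norm ?invr_ge0 ?(ltW (r0 j))//.
  apply: le_trans (cov_le _ _ ((r j)^-1 *: y) _ HC1).
  by rewrite ler_piMl// invf_le1.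
(* The first term dominates the differential of [gamma] applied to [E], the second the differential
   of the cut-off applied to [F] and multiplied by [gamma]. *)
pose H x := Cg * (\sum_i `|fco b i (E x) : R|) + (Bg * C1) * \sum_i `|fco b i (F x) : R|.
have iH : lint H.
  apply: locally_integrableD; apply: (locally_integrableZ dV oU vV);
    apply: locally_integrable_sum => i; apply: locally_integrable_norm => //.
move=> phi tphi.
have mq mu (q : (Y * R^o)%type -> R^o) : smooth q -> omeas mu g ->
    (forall h : Y -> R, continuous h -> omeas mu (fun x => h (f x))) -> omeas mu (fun x => q (f x, g x)).
  move=> sq mg mh'; exact: (@omeas_pair R n Y f g mu q mh' mg (smooth_continuous sq)).
have mdf h : continuous h -> omeas dV (fun x => h (f x)) by move=> ch; have [] := mf h ch.
have AE j x : 'd (Phi j) (f x, g x : R^o) (F x, G x : R^o) = fcut b (r j) (f x) * 'd gamma (g x *: f x) (E x) +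
    'd (fcut b (r j) : Y -> R^o) (f x) (F x) * gamma (g x *: f x) :> R.
  by rewrite dPhi /E [G x *: _ + _]addrC.
apply: (@wd_lim _ _ _ _ _ _ oU vV radon_dV k eta meta leta (fun j x => Phi j (f x, g x : R^o))
  (fun j x => 'd (Phi j) (f x, g x : R^o) (F x, G x : R^o)) _ _ H Bg phi tphi).
- by move=> j; exact: mq.
- by move=> j; exact: mq.
- by apply: (mh dV gamma _ mdg mdf); exact: smooth_continuous.
- by apply: (mh wV gamma _ mwg mwf); exact: smooth_continuous.
- move=> j; under eq_fun do rewrite AE (linear_frame b ('d gamma _)) (linear_frame b ('d (fcut b (r j) : Y -> R^o) _)).
  have mfc := mwf _ (smooth_continuous (smooth_fcut b (r j))).
  have mgam := mh wV gamma (smooth_continuous sg) mwg mwf.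
  apply: omeasD; apply: omeasM => //; apply: omeas_sum => i; apply: omeasM.
  + by have [] := ll (fco b i).
  + by apply: (mh wV (fun y => 'd gamma y (fvec b i)) _ mwg mwf); exact: (smooth_continuous (smooth_diff _ sg)).
  + by have [] := llF (fco b i).
  + exact: (mwf _ (smooth_continuous (smooth_diff (fvec b i) (smooth_fcut b (r j))))).
- under eq_fun do rewrite (linear_frame b ('d gamma _)).
  apply: omeas_sum => i; apply: omeasM; first by have [] := ll (fco b i).
  by apply: (mh wV (fun y => 'd gamma y (fvec b i)) _ mwg mwf); exact: (smooth_continuous (smooth_diff _ sg)).
- move=> j x _; rewrite /Phi normrM (ger0_norm (fcut_ge0 _ _ _)) -[leRHS]mul1r ler_pM ?fcut_ge0 ?fcut_le1//.
- move=> x _; apply: cvg_near_cst; apply: filterS (large_fbox b (f x)) => j Hj.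
  by rewrite /Phi; have [-> _] := fcut_near1 0 (r0 j) Hj; rewrite mul1r.
- exact: iH.
- move=> j x _; rewrite AE; apply: (le_trans (ler_normD _ _)); apply: lerD.
    rewrite normrM (ger0_norm (fcut_ge0 _ _ _)); apply: le_trans (cov_le _ _ (g x *: f x) _ HCg).
    by rewrite ler_piMl// fcut_le1.
  by rewrite normrM mulrC -mulrA ler_pM// dfc.
- move=> x _; apply: cvg_near_cst; apply: filterS (large_fbox b (f x)) => j Hj.
  by rewrite AE; have [-> ->] := fcut_near1 (F x) (r0 j) Hj; rewrite mul1r mul0r addr0.
- by move=> j; exact: wPhi.
Qed.

End weak_partial_scale.

(** * Derivatives as homomorphisms *)

Section outer_measure_sum.
Variables (R : realType) (n : nat) (U : set 'rV[R]_n).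
Variables mu nu : {outer_measure set 'rV[R]_n -> \bar R}.
Local Notation munu := (outer_add mu nu : {outer_measure set 'rV[R]_n -> \bar R}).

Lemma outer_add_eq0 N : munu N = 0%E <-> mu N = 0%E /\ nu N = 0%E.
Proof.
rewrite -[_ N]/(mu N + nu N)%E; split=> [H|[-> ->]]; last by rewrite adde0.
have := outer_measure_ge0 mu N; have := outer_measure_ge0 nu N => h1 h2.
by split; apply/eqP; rewrite eq_le ?h1 ?h2 andbT -H; [exact: leeDl|exact: leeDr].
Qed.

Lemma outer_add_caratheodory A : mu.-caratheodory A -> nu.-caratheodory A ->
  munu.-caratheodory A.
Proof. by move=> mA nA X; rewrite -[munu X]/(mu X + nu X)%E mA nA addeACA. Qed.

Hypotheses (oU : open U) (rmu : radon_over U mu) (rnu : radon_over U nu).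

(** Inside a compact set both measures are finite, so additivity of the sum together with
    subadditivity of each summand forces additivity of each. Exhaustion of [U] and nullity of its
    complement do the rest. *)
Lemma caratheodory_outer_add A : munu.-caratheodory A -> mu.-caratheodory A.
Proof.
move=> mA.
have key K : compact K -> K `<=` U -> mu.-caratheodory (A `&` K).
  move=> cK KU; apply: le_caratheodory_measurable => X.
  have mK := cpt_caratheodory rmu cK.
  have fin (m' : {outer_measure set 'rV[R]_n -> \bar R}) : radon_over U m' ->
      forall S, S `<=` K -> m' S \is a fin_num.
    move=> r S SK; rewrite ge0_fin_numE ?outer_measure_ge0//.
    by apply: le_lt_trans (radon_compact r cK KU); exact: le_outer_measure.
  have E : mu (X `&` K) = (mu (X `&` (A `&` K)) + mu (X `&` K `&` ~` A))%E.
    have := mA (X `&` K).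
    rewrite -[munu (X `&` K)]/(mu (X `&` K) + nu (X `&` K))%E.
    rewrite -[munu (X `&` K `&` A)]/(mu (X `&` K `&` A) + nu (X `&` K `&` A))%E.
    rewrite -[munu (X `&` K `&` ~` A)]/(mu (X `&` K `&` ~` A) + nu (X `&` K `&` ~` A))%E.
    have h1 := outer_measureU2 mu (X `&` K `&` A) (X `&` K `&` ~` A).
    have h2 := outer_measureU2 nu (X `&` K `&` A) (X `&` K `&` ~` A).
    rewrite -setIUr setUv setIT in h1 h2.
    have -> : X `&` (A `&` K) = X `&` K `&` A by rewrite setIA setIAC.
    have SK B : X `&` K `&` B `<=` K by move=> x [[]].
    have SK' : X `&` K `<=` K by exact: subIsetr.
    move: h1 h2 (fin mu rmu _ SK') (fin nu rnu _ SK') (fin mu rmu _ (SK A)) (fin nu rnu _ (SK A))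
      (fin mu rmu _ (SK (~` A))) (fin nu rnu _ (SK (~` A))).
    case: (mu (X `&` K)) => [x1||]//; case: (nu (X `&` K)) => [x2||]//.
    case: (mu (X `&` K `&` A)) => [x3||]//; case: (nu (X `&` K `&` A)) => [x4||]//.
    case: (mu (X `&` K `&` ~` A)) => [x5||]//; case: (nu (X `&` K `&` ~` A)) => [x6||]//.
    rewrite -!EFinD !lee_fin => h1 h2 _ _ _ _ _ _ [h3]; congr EFin.
    by apply/eqP; rewrite eq_le; apply/andP; split; lra.
  rewrite (mK X) E -addeA leeD2l//.
  have -> : X `&` ~` (A `&` K) = (X `&` K `&` ~` A) `|` (X `&` ~` K).
    apply/seteqP; split=> [x [Xx H]|x [[[Xx Kx] nA]|[Xx nK]]].
    - by have [Kx|Kx] := pselect (K x); [left; split=> // Ax; apply: H|right].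
    - by split=> // -[].
    - by split=> // -[].
  exact: outer_measureU2.
have [mu0 _ _ _ _] := rmu.
apply: (@caratheodory_null_eq _ _ mu (\bigcup_j (A `&` cpt_exh U j)) _ (~` U)) => //.
  apply/seteqP; split=> x [H nU]; split=> //; first by case: H => j _ [].
  move: nU => /contrapT; rewrite {1}(cpt_exh_bigcup oU) => -[j _ Kx].
  by exists j.
apply: caratheodory_measurable_bigcup => j; apply: key; first exact: compact_cpt_exh.
exact: cpt_exh_sub.
Qed.

End outer_measure_sum.

Lemma outer_addC (R : realType) (n : nat) (mu nu : {outer_measure set 'rV[R]_n -> \bar R}) A :
  (outer_add mu nu : {outer_measure set 'rV[R]_n -> \bar R}).-caratheodory A ->
  (outer_add nu mu : {outer_measure set 'rV[R]_n -> \bar R}).-caratheodory A.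
Proof.
move=> H X; have := H X; rewrite /= /outer_add => E.
by rewrite [LHS]addeC E; congr adde; rewrite addeC.
Qed.

Section distance_to_complement.
Variables (R : realType) (S : Type) (d : S -> S -> R) (W : set S).
Hypotheses (d0 : forall x, d x x = 0) (dge0 : forall x y, 0 <= d x y).
Hypotheses (dC : forall x y, d x y = d y x) (dT : forall x y z, d x z <= d x y + d y z).
Hypothesis oW : forall x, W x -> exists2 e : R, 0 < e & forall y, d x y < e -> W y.

(** The distance to the complement of [W] reduces measurability of preimages of open sets to that of
    real functions. A bare pseudo-distance is enough, which covers both [Y] and the linear maps with
    [homdist]. *)
Lemma positivity_function : exists h : S -> R,
  (forall x y, `|h x - h y| <= d x y) /\ (forall x, W x <-> 0 < h x).
Proof.
have [WT|/existsNP[w0 nw0]] := pselect (forall x, W x).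
  by exists (fun=> 1); split=> [x y|x]; [rewrite subrr normr0|split=> // _; exact: ltr01].
pose E x := [set d x w | w in ~` W].
have E0 x : E x !=set0 by exists (d x w0); exists w0.
have lE x : lbound (E x) 0 by move=> _ [w _ <-].
have hE x : has_inf (E x) by split; [exact: E0|exists 0; exact: lE].
have H x y : inf (E x) - inf (E y) <= d x y.
  rewrite lerBlDl -lerBlDr; apply: lb_le_inf => // _ [w nw <-].
  rewrite lerBlDr addrC; apply: (le_trans _ (dT x y w)).
  by apply: ge_inf; [exists 0; exact: lE|exists w].
exists (fun x => inf (E x)); split.
  by move=> x y; rewrite ler_norml H andbT lerNl opprB dC H.
move=> x; split=> [Wx|].
  have [e e0 He] := oW Wx; apply: (lt_le_trans e0); apply: lb_le_inf => // _ [w nw <-].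
  by rewrite leNgt; apply/negP => /He.
move=> h0; apply: contrapT => nW; move: h0; rewrite ltNge => /negP; apply.
by rewrite -(d0 x); apply: ge_inf; [exists 0; exact: lE|exists x].
Qed.

End distance_to_complement.

Section operator_norm.
Variables (R : realType) (n : nat) (Y : normedModType R).
Implicit Types A B C : HomRn n Y.
Local Notation e_ k := (delta_mx 0 k : 'rV[R]_n).

Lemma hom_row A u : A u = \sum_k u 0 k *: A (e_ k).
Proof. by rewrite {1}(row_sum_delta u) linear_sum; apply: eq_bigr => k _; rewrite linearZ. Qed.

Lemma hom_le A u : enorm u <= 1 -> `|A u| <= \sum_k `|A (e_ k)|.
Proof.
move=> u1; rewrite hom_row; apply: (le_trans (ler_norm_sum _ _ _)); apply: ler_sum => k _.
by rewrite normrZ ler_piMl// (le_trans (coord_le_enorm u k)).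
Qed.

Let opset A := [set `|A u| | u in [set u : 'rV[R]_n | enorm u <= 1]].

Let opset_ubound A : has_ubound (opset A).
Proof. by exists (\sum_k `|A (e_ k)|) => _ [u u1 <-]; exact: hom_le. Qed.

Let opset0 A : opset A !=set0.
Proof.
exists `|A 0|; exists 0 => //=.
by rewrite enormE big1 ?sqrtr0// => i _; rewrite mxE expr0n.
Qed.

Lemma le_opnorm A u : enorm u <= 1 -> `|A u| <= opnorm A.
Proof. by move=> u1; apply: ub_le_sup; [exact: opset_ubound|exists u]. Qed.

Lemma opnorm_le A (r : R) : (forall u, enorm u <= 1 -> `|A u| <= r) -> opnorm A <= r.
Proof. by move=> H; apply: ge_sup; [exact: opset0|move=> _ [u u1 <-]; exact: H]. Qed.

Lemma opnorm_ge0 A : 0 <= opnorm A.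
Proof. by have [_ [u u1 _]] := opset0 A; apply: le_trans (le_opnorm A u1). Qed.

Lemma opnorm_le_sum A : opnorm A <= \sum_k `|A (e_ k)|.
Proof. by apply: opnorm_le => u; exact: hom_le. Qed.

Lemma enorm_delta k : enorm (e_ k) = 1.
Proof. by rewrite -[e_ k]scale1r enorm_scale_delta normr1. Qed.

Definition homdist A B : R := opnorm (fun u => B u - A u).

Lemma homdistxx A : homdist A A = 0.
Proof.
apply/eqP; rewrite eq_le; apply/andP; split; last exact: (opnorm_ge0 (A \- A)).
by apply: (@opnorm_le (A \- A)) => u _ /=; rewrite subrr normr0.
Qed.

Lemma homdist_ge0 A B : 0 <= homdist A B.
Proof. exact: (opnorm_ge0 (B \- A)). Qed.

Lemma homdistC A B : homdist A B = homdist B A.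
Proof. by rewrite /homdist /opnorm; congr sup; apply: eq_imagel => u _; rewrite distrC. Qed.

Lemma homdist_triangle A B C : homdist A C <= homdist A B + homdist B C.
Proof.
apply: (@opnorm_le (C \- A)) => u u1 /=.
rewrite -(subrKA (B u)) addrC; apply: (le_trans (ler_normD _ _)).
by apply: lerD; [exact: (le_opnorm (B \- A) u1)|exact: (le_opnorm (C \- B) u1)].
Qed.

Lemma homdist_le A B : homdist A B <= \sum_k `|B (e_ k) - A (e_ k)|.
Proof. exact: (opnorm_le_sum (B \- A)). Qed.

Lemma opnorm_dist A B : `|opnorm A - opnorm B| <= homdist A B.
Proof.
suff H (A' B' : HomRn n Y) : opnorm A' - opnorm B' <= homdist A' B'.
  by rewrite ler_norml H andbT lerNl opprB homdistC H.
rewrite lerBlDr; apply: opnorm_le => u u1.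
rewrite -(subrK (B' u) (A' u)); apply: (le_trans (ler_normD _ _)); apply: lerD.
  by rewrite distrC; exact: (le_opnorm (B' \- A') u1).
exact: le_opnorm.
Qed.

Definition hom_of_fun (F : 'I_n -> Y) (u : 'rV[R]_n) : Y := \sum_k u 0 k *: F k.

Fact hom_of_linear F : linear (hom_of_fun F).
Proof.
move=> a u v; rewrite /hom_of_fun scaler_sumr -big_split; apply: eq_bigr => k _.
by rewrite !mxE scalerDl scalerA.
Qed.

HB.instance Definition _ F := GRing.isLinear.Build R 'rV[R]_n Y _ (hom_of_fun F) (hom_of_linear F).

Definition hom_of (F : 'I_n -> Y) : HomRn n Y := hom_of_fun F.

Lemma hom_of_delta F k : hom_of F (e_ k) = F k.
Proof.
rewrite /hom_of /= /hom_of_fun (bigD1 k)//= big1 ?addr0 => [|i ik].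
  by rewrite mxE !eqxx scale1r.
by rewrite mxE (negbTE ik) scale0r.
Qed.

Variables (mu : {outer_measure set 'rV[R]_n -> \bar R}) (b : frame Y).

(* Hom(R^n, Y) is identified with R^N by means of a frame. *)
Lemma hom_measurableP (F : 'rV[R]_n -> HomRn n Y) :
  measurable_on mu (@Hom_open R n Y) setT F <->
  forall k i, omeas mu (fun x => fco b i (F x (e_ k)) : R).
Proof.
split=> [mF k i|mF].
  apply/omeasP => W oW.
  have := mF [set A | W (fco b i (A (e_ k)))] _; rewrite setTI; apply.
  move=> A WA; have [C C0 HC] := fco_le b.
  have /nbhs_ballP[e /= e0 He] : nbhs (fco b i (A (e_ k)) : R) W by apply: open_nbhs_nbhs.
  exists (e / C); first exact: divr_gt0.
  move=> B HB; apply: He; rewrite /ball/= distrC -linearB.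
  apply: (le_lt_trans (HC i _)); rewrite -ltr_pdivlMl// mulrC.
  by apply: le_lt_trans HB; apply: (le_opnorm (B \- A)); rewrite enorm_delta.
move=> W oW; rewrite setTI.
have [h [hd hW]] := positivity_function homdistxx homdist_ge0 homdistC homdist_triangle oW.
pose I := ('I_n * 'I_(frk b))%type.
pose T (c : 'rV[R]_#|{: I}|) : HomRn n Y :=
  hom_of (fun k => \sum_i c 0 (enum_rank (k, i)) *: fvec b i).
pose c x : 'rV[R]_#|{: I}| := \row_j fco b (enum_val j).2 (F x (e_ (enum_val j).1)).
have TE x k : T (c x) (e_ k) = F x (e_ k).
  rewrite hom_of_delta [RHS](fcoE b); apply: eq_bigr => i _.
  by rewrite mxE enum_rankK.
have hE x : h (F x) = h (T (c x)).
  apply/eqP; rewrite -subr_eq0 -normr_le0; apply: (le_trans (hd _ _)); apply: (le_trans (homdist_le _ _)).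
  by rewrite big1// => k _; rewrite TE subrr normr0.
have ch : continuous (fun c => h (T c)).
  pose L : R := \sum_(k < n) \sum_i `|fvec b i|.
  have hL c0 c1 : `|h (T c0) - h (T c1)| <= L * `|c0 - c1|.
    apply: (le_trans (hd _ _)); apply: (le_trans (homdist_le _ _)).
    rewrite /L mulr_suml; apply: ler_sum => k _; rewrite !hom_of_delta -sumrB.
    apply: (le_trans (ler_norm_sum _ _ _)); rewrite mulr_suml; apply: ler_sum => i _.
    rewrite -scalerBl normrZ mulrC ler_wpM2l// distrC.
    by have := rV_coord_le (c0 - c1) (enum_rank (k, i)); rewrite !mxE.
  move=> c0; apply: (@locally_lipschitz_continuous R _ R^o setT (fun c => h (T c))) => //.
  move=> x _; exists setT; first exact: filterT.
  exists L; split; first exact: num_real.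
  move=> M LM [c1 c2] _ /=; apply: (le_trans (hL c1 c2)).
  by apply: ler_wpM2r => //; exact: ltW.
have mc : omeas mu (fun x => h (T (c x))).
  apply: (@omeas_coords _ _ mu #|{: I}| (fun j x => fco b (enum_val j).2 (F x (e_ (enum_val j).1))) _ _ ch).
  by move=> j; exact: mF.
have /omeasP := mc => /(_ _ (@open_gt R 0)); congr (mu.-caratheodory _).
by apply/seteqP; split=> x; rewrite /= -hE => /hW.
Qed.

Lemma opnorm_omeas (F : 'rV[R]_n -> HomRn n Y) :
  measurable_on mu (@Hom_open R n Y) setT F -> omeas mu (fun x => opnorm (F x)).
Proof.
move=> mF; apply/omeasP => W oW.
have := mF [set A | W (opnorm A)] _; rewrite setTI; apply.
move=> A WA; have /nbhs_ballP[e /= e0 He] : nbhs (opnorm A) W by apply: open_nbhs_nbhs.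
exists e => // B HB; apply: He; rewrite /ball/=.
exact: le_lt_trans (opnorm_dist A B) HB.
Qed.

End operator_norm.

Section hom_of_operations.
Variables (R : realType) (n : nat).
Local Notation e_ k := (delta_mx 0 k : 'rV[R]_n).

Lemma hom_of_add (Y : normedModType R) (A : HomRn n Y) (G : 'I_n -> Y) u :
  hom_of (fun k => A (e_ k) + G k) u = A u + hom_of G u.
Proof.
rewrite (hom_row A) /hom_of /= /hom_of_fun -big_split.
by apply: eq_bigr => k _; rewrite /= scalerDr.
Qed.

Lemma hom_of_pair (Y Z : normedModType R) (A : HomRn n Y) (G : 'I_n -> Z) u :
  hom_of (fun k => (A (e_ k), 0) + @pinr R Y Z (G k)) u = (A u, hom_of G u).
Proof.
rewrite (hom_row A) /hom_of /= /hom_of_fun -sum_pair.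
by apply: eq_bigr => k _; congr (_, _); rewrite /= ?addr0 ?add0r.
Qed.

Lemma hom_of_scale (Y : normedModType R) (A : HomRn n Y) (G : 'I_n -> R^o) (y : Y) (t : R) u :
  hom_of (fun k => (G k : R) *: y + t *: A (e_ k)) u = (hom_of G u : R) *: y + t *: A u.
Proof.
rewrite (hom_row A) /hom_of /= /hom_of_fun scaler_suml scaler_sumr -big_split.
apply: eq_bigr => k _ /=; rewrite scalerDr; congr (_ + _); first by rewrite scalerA.
by rewrite !scalerA mulrC.
Qed.

End hom_of_operations.

Lemma oint_restrict (R : realType) (T : pointedType) (mu : {outer_measure set T -> \bar R})
    (D : set T) (o : T -> R) : mu.-caratheodory D -> omeas mu o -> (forall x, 0 <= o x) ->
  (oint mu D (fun x => (o x)%:E) < +oo)%E <-> ointeg mu (fun x => \1_D x * o x).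
Proof.
move=> mD mo o0.
have E : oint mu D (fun x => (o x)%:E) = oint mu setT (fun x => `|\1_D x * o x|%:E).
  rewrite /oint integral_mkcond; apply: eq_integral => x _; rewrite patchE indicE.
  by case: ifP => _; rewrite ?mul1r ?mul0r ?normr0// ger0_norm.
rewrite E; split=> [H|/ointegP[]//]; apply/ointegP; split=> //.
by apply: omeasM => //; exact: omeas_indic.
Qed.

(** * The definition of T(V, Y) in components *)

Section bridge.
Variables (R : realType) (n m : nat) (U : set 'rV[R]_n).
Variable V : {outer_measure set ('rV[R]_n * subsp R n) -> \bar R}.
Variable dV : {outer_measure set 'rV[R]_n -> \bar R}.
Hypotheses (n_gt0 : (0 < n)%N) (oU : open U) (vV : varifold m U V).
Hypotheses (dVm : matches_variation U V dV) (radon_dV : radon_over U dV).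
Variable eta : 'I_n -> 'rV[R]_n -> R.
Hypotheses (meta : forall k, omeas dV (eta k)) (leta : forall k, locally_bounded U (eta k)).
Hypothesis fvar_eta : forall k phi, test_fun U phi ->
  fvar V k phi = oI dV (fun x => phi x * eta k x).
Local Notation wV := (wgt m V).
Let radon_wV : radon_over U wV := radon_wgt oU vV.
Variables (Y : normedModType R) (b : frame Y).
Local Notation wpartial k := (@weak_partial R n m U V dV k (eta k) Y).
Local Notation e_ k := (delta_mx 0 k : 'rV[R]_n).
Implicit Types (f : partial_map 'rV[R]_n Y) (F : 'rV[R]_n -> HomRn n Y).
Local Notation wVdV := (outer_add wV dV : {outer_measure set 'rV[R]_n -> \bar R}).

Section given.
Variables (f : partial_map 'rV[R]_n Y) (F : 'rV[R]_n -> HomRn n Y).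
Hypotheses (dU : dmn f `<=` U) (d0 : wVdV (~` dmn f) = 0%E).

Let dw0 : wV (~` dmn f) = 0%E. Proof. by have [/(_ d0)[]] := outer_add_eq0 wV dV (~` dmn f). Qed.
Let dd0 : dV (~` dmn f) = 0%E. Proof. by have [/(_ d0)[]] := outer_add_eq0 wV dV (~` dmn f). Qed.

Let dV0 : V (~` (dmn f `*` [set: subsp R n])) = 0%E.
Proof.
apply: null_sub (null_over vV dw0) => -[x P] /= H; split=> // dx.
by apply: H.
Qed.

(** The test field is expanded in its coordinates, and integrals over the conull domain of [f] are
    replaced by integrals over the whole space; both sides of the defining identity become sums over
    the directions. *)
Lemma weak_derivative_identity theta gamma : test_field U theta ->
    admissible m U V dV (fun x => gamma (f x)) ->
    (exists B : R, forall x, `|gamma (f x)| <= B) ->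
    (forall k, locally_integrable m U V (fun x => 'd (gamma : Y -> R^o) (f x) (F x (e_ k)))) ->
  first_variation_ext U V dV (fun x => gamma (f x) *: theta x) =
    \sum_k wd_dV dV (eta k) (fun x => gamma (f x)) (fun x => theta x 0 k) /\
  oRint V (dmn f `*` setT) (fun z => gamma (f z.1) * divergence theta z) +
  oRint wV (dmn f) (fun x => 'd (gamma : Y -> R^o) (f x) (F x (theta x))) =
    \sum_k (wd_V V k (fun x => gamma (f x)) (fun x => theta x 0 k) +
      wd_wV m V (fun x => 'd (gamma : Y -> R^o) (f x) (F x (e_ k))) (fun x => theta x 0 k)).
Proof.
move=> tt ag [B HB] ld; have [st cs sU] := tt.
have tk k := test_field_coord k tt.
have [mda mwa la] := ag.
split.
  have mtk k : omeas dV (fun x => theta x 0 k) by apply: ointeg_meas; exact: (test_fun_ointeg radon_dV).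
  have [Bt HBt] : exists Bt : R, forall k x, `|theta x 0 k| <= Bt.
    have H k : exists C : R, 0 <= C /\ forall x, `|theta x 0 k| <= C.
      by have [C C0 HC] := test_fun_bounded (tk k); exists C.
    have [C HC] := choice H; exists (\sum_k C k) => k x.
    apply: (le_trans ((HC k).2 x)); rewrite (bigD1 k)//= lerDl.
    by apply: sumr_ge0 => j _; have [] := HC j.
  have := @first_variation_extE R n m U V dV oU vV dVm radon_dV eta meta leta fvar_eta _ cs sU
    (fun k x => gamma (f x) * theta x 0 k) (B * Bt) (fun k => omeasM mda (mtk k)).
  have -> : (fun x => \row_k (gamma (f x) * theta x 0 k)) = (fun x => gamma (f x) *: theta x).
    by apply/funext => x; apply/rowP => k; rewrite !mxE.
  move=> ->.
  - by apply: eq_bigr => k _; apply: eq_oI => x; rewrite mulrCA mulrA.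
  - by move=> k x; rewrite normrM; apply: ler_pM.
  - by move=> k x /supp_out ->; rewrite mxE mulr0.
rewrite big_split /=; congr (_ + _).
  have iV k := ointeg_V oU vV k ag (tk k).
  have E : (fun z => gamma (f z.1) * divergence theta z) =
      (fun z => \sum_k gamma (f z.1) * tgrad (fun x => theta x 0 k) k z).
    by apply/funext => z; rewrite divergenceE// mulr_sumr.
  rewrite oRint_null//; rewrite E; last by apply: omeas_sum => k; exact: (ointeg_meas (iV k)).
  by rewrite oI_sum.
have iW k := ointeg_wV oU vV (ld k) (tk k).
have E : (fun x => 'd (gamma : Y -> R^o) (f x) (F x (theta x))) =
    (fun x => \sum_k theta x 0 k * 'd (gamma : Y -> R^o) (f x) (F x (e_ k))).
  by apply/funext => x; rewrite [F x _]hom_row linear_sum; apply: eq_bigr => k _; rewrite linearZ.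
rewrite oRint_null//; rewrite E; last by apply: omeas_sum => k; exact: (ointeg_meas (iW k)).
by rewrite oI_sum.
Qed.

Lemma level_caratheodory (K : set 'rV[R]_n) (s : R) : compact K ->
  (forall h : Y -> R, continuous h -> omeas wV (fun x => h (f x))) ->
  wV.-caratheodory (K `&` [set x | dmn f x /\ (`|f x| <= s)%R]).
Proof.
move=> cK mf.
have mn : omeas wV (fun x => `|f x|) by exact: mf (@norm_continuous _ Y).
have mS : wV.-caratheodory [set x | `|f x| <= s].
  have := mn measurableT [set t : R | t <= s]%classic (closed_measurable (@closed_le R s)).
  by rewrite setTI.
apply: (@caratheodory_null_eq _ _ wV (K `&` [set x | `|f x| <= s]) _ (~` dmn f)) => //.
  apply/seteqP; split=> x [] [Kx] => [H /contrapT dx|[dx H] nd]; first by split=> //; case.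
  by [].
by apply: caratheodory_measurable_setI => //; exact: (cpt_caratheodory radon_wV cK).
Qed.

Lemma weak_derivative_of_partial : (forall k, wpartial k f (fun x => F x (e_ k))) ->
  is_weak_derivative m U V dV f F.
Proof.
(* Measurability of [f] is contained in each directional statement, so that one direction has to
   exist. *)
move=> wf; have [mf _ _ _] := wf (Ordinal n_gt0).
have mwf h : continuous h -> omeas wV (fun x => h (f x)) by move=> ch; have [] := mf h ch.
have mF : measurable_on wV (@Hom_open R n Y) setT F.
  by apply/(hom_measurableP wV b) => k i; have [_ + _ _] := wf k; apply; exact: fco_continuous.
split; [split=> //| exact: mF| |].
- move=> W oW.
  have [||||x Wx|h [hd hW]] := @positivity_function R Y (fun x y => `|x - y|) W.
  + by move=> x; rewrite subrr normr0.
  + by [].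
  + by move=> x y; exact: distrC.
  + by move=> x y z; exact: ler_distD.
  + have /nbhs_ballP[e /= e0 He] : nbhs x W by apply: open_nbhs_nbhs.
    by exists e => // y xy; apply: He; rewrite -ball_normE.
  have ch : continuous h.
    move=> y; apply: (@locally_lipschitz_continuous R _ R^o setT h) => // x _.
    exists setT; first exact: filterT.
    exists 1; split; first exact: num_real.
    move=> M LM [c1 c2] _ /=; apply: (le_trans (hd c1 c2)).
    by rewrite ler_peMl// ltW.
  have mW (mu : {outer_measure set 'rV[R]_n -> \bar R}) : mu (~` dmn f) = 0%E -> omeas mu (fun x => h (f x)) ->
      mu.-caratheodory (dmn f `&` f @^-1` W).
    move=> mu0 /omeasP /(_ _ (@open_gt R 0)) mh.
    apply: (@caratheodory_null_eq _ _ mu ((fun x => h (f x)) @^-1` [set t | 0 < t]) _ (~` dmn f)) => //.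
    apply/seteqP; split=> x []; first by move=> /= /hW Wx /contrapT dx; split=> //; case.
    by move=> [dx /= /hW Wx] nd.
  have [m1 m2] := mf h ch.
  by apply: outer_add_caratheodory; exact: mW.
- move=> K s cK KU s0.
  have mD := @level_caratheodory K s cK mwf.
  have mo := opnorm_omeas mF.
  apply/(oint_restrict mD mo) => [x|]; first exact: opnorm_ge0.
  have [C C0 HC] := norm_le_fco b.
  pose T x := \sum_(k < n) C * \sum_i `|if `|f x| <= s then fco b i (F x (e_ k)) : R else 0|.
  have [_ /(_ K cK KU) iT] : locally_integrable m U V T.
    apply: locally_integrable_sum => k; apply: (locally_integrableZ dV oU vV).
    exact: (truncated_locally_integrable b (wf k)).
  apply: (le_ointeg _ iT); first by apply: omeasM => //; exact: omeas_indic.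
  move=> x; rewrite !indicE; case: (asboolP ((K `&` [set x | dmn f x /\ `|f x| <= s]) x)) => [H|H].
    have [Kx [dx fs]] := H; rewrite [x \in _ `&` _]mem_set// mem_set// !mul1r ger0_norm ?opnorm_ge0//.
    apply: (le_trans (opnorm_le_sum _)); apply: ler_sum => k _; rewrite fs.
    exact: HC.
  rewrite memNset// mul0r normr0 mulr_ge0//.
  by apply: sumr_ge0 => k _; rewrite mulr_ge0// sumr_ge0.
- move=> theta gamma tt tg.
  have [B _ HB] := test_scalar_bounded b tg.
  have wt k := weak_partial_test oU vV b (wf k) tg.
  have [|||-> ->] := @weak_derivative_identity theta gamma tt.
  + by have [] := wt (Ordinal n_gt0).
  + by exists B.
  + by move=> k; have [] := wt k.
  apply: eq_bigr => k _; have [_ _ _ wk] := wf k.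
  exact: (wk gamma tg _ (test_field_coord k tt)).
Qed.

End given.

Let partial_integrability f F k : is_weak_derivative m U V dV f F ->
  (forall h : Y -> R, continuous h -> omeas dV (fun x => h (f x)) /\ omeas wV (fun x => h (f x))) /\
  (forall l : {linear Y -> R^o}, continuous l -> omeas wV (fun x => l (F x (e_ k)))) /\
  (forall (l : {linear Y -> R^o}) (s : R), continuous l ->
    locally_integrable m U V (fun x => if `|f x| <= s then l (F x (e_ k)) else 0)).
Proof.
move=> [[dU d0 mf] mF iF wF].
have [dw0 dd0] : wV (~` dmn f) = 0%E /\ dV (~` dmn f) = 0%E by apply/outer_add_eq0.
have mh h : continuous h -> omeas dV (fun x => h (f x)) /\ omeas wV (fun x => h (f x)).
  move=> ch.
  have H (mu : {outer_measure set 'rV[R]_n -> \bar R}) : mu (~` dmn f) = 0%E ->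
      (forall A, wVdV.-caratheodory A -> mu.-caratheodory A) -> omeas mu (fun x => h (f x)).
    move=> mu0 cmu; apply/omeasP => W oW.
    apply: (@caratheodory_null_eq _ _ mu (dmn f `&` f @^-1` (h @^-1` W)) _ (~` dmn f)) => //.
      by apply/seteqP; split=> x [] => [[dx Wx] nd|Wx /contrapT dx]; split=> //; case.
    by apply: cmu; apply: mf; apply: open_comp => // y _; exact: ch.
  split; apply: H => // A cA.
    exact: (caratheodory_outer_add oU radon_dV radon_wV (outer_addC cA)).
  exact: (caratheodory_outer_add oU radon_wV radon_dV cA).
have mcF i : omeas wV (fun x => fco b i (F x (e_ k)) : R) by exact: ((hom_measurableP wV b F).1 mF k i).
have mlF (l : {linear Y -> R^o}) : omeas wV (fun x => l (F x (e_ k))).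
  under eq_fun do rewrite (linear_frame b l).
  by apply: omeas_sum => i; apply: omeasM => //; exact: omeas_cst.
have mwf h : continuous h -> omeas wV (fun x => h (f x)) by move=> ch; have [] := mh h ch.
have iA (l : {linear Y -> R^o}) (s : R) : continuous l ->
    locally_integrable m U V (fun x => if `|f x| <= s then l (F x (e_ k)) else 0).
  move=> cl.
  have mn : omeas wV (fun x => `|f x|) by exact: mwf (@norm_continuous _ Y).
  have mS : wV.-caratheodory [set x | `|f x| <= s].
    have := mn measurableT [set t : R | t <= s]%classic (closed_measurable (@closed_le R s)).
    by rewrite setTI.
  have mA : omeas wV (fun x => if `|f x| <= s then l (F x (e_ k)) else 0).
    have := omeasM (omeas_indic mS) (mlF l).
    congr (omeas _ _); apply/funext => x; rewrite indicE.
    case: ifP => H; first by rewrite mem_set// mul1r.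
    by rewrite memNset ?mul0r//= H.
  (* The integrability condition of the definition concerns s >= 0; for negative [s] the truncated
     function is identically 0. *)
  split=> // K cK KU; have [s0|s0] := leP 0 s; last first.
    rewrite (_ : (fun x => _) = fun=> 0); first exact: ointeg0.
    by apply/funext => x; rewrite ifF ?mulr0//; apply/negbTE; rewrite -ltNge (lt_le_trans s0).
  have mD := level_caratheodory d0 s cK mwf.
  have /(oint_restrict mD (opnorm_omeas mF) (fun x => opnorm_ge0 (F x))) io := iF K s cK KU s0.
  have [C C0 HC] := continuous_linear_le cl.
  set D := K `&` _ in mD io.
  have iu : ointeg wV (fun x => \1_D x * l (F x (e_ k))).
    apply: (le_ointeg _ (ointegZ C io)); first by apply: omeasM (mlF l); exact: omeas_indic.
    move=> x; rewrite normrM mulrCA indicE ger0_norm//; apply: ler_wpM2l => //.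
    apply: (le_trans (HC _)); apply: ler_wpM2l => //.
    by apply: le_opnorm; rewrite enorm_delta.
  apply: (ointeg_null dw0 _ iu) => x /contrapT dx; rewrite !indicE.
  case: (asboolP (K x)) => Kx; last by rewrite [x \in K]memNset// memNset ?mul0r// => -[].
  rewrite [x \in K]mem_set// mul1r; case: ifP => fs; first by rewrite mem_set ?mul1r.
  by rewrite memNset ?mul0r// => -[_ []]; rewrite fs.
exact: (conj mh (conj (fun l _ => mlF l) (fun l s cl => iA l s cl))).
Qed.

Let wd_dV0 k a : wd_dV dV (eta k) a (fun=> 0) = 0.
Proof. by rewrite /wd_dV -[RHS](oI0 dV); apply: eq_oI => x; rewrite mul0r. Qed.

Let wd_V0 k a : wd_V V k a (fun=> 0) = 0.
Proof. by rewrite /wd_V -[RHS](oI0 V); apply: eq_oI => z; rewrite tgrad_cst mulr0. Qed.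

Let wd_wV0 A : wd_wV m V A (fun=> 0) = 0.
Proof. by rewrite /wd_wV -[RHS](oI0 wV); apply: eq_oI => x; rewrite mul0r. Qed.

(** Test fields [phi e_k] leave only the terms of direction [k] in [weak_derivative_identity]. *)
Lemma partial_of_weak_derivative f F : is_weak_derivative m U V dV f F ->
  forall k, wpartial k f (fun x => F x (e_ k)).
Proof.
move=> wfF k; have [mh [mlF iA]] := partial_integrability k wfF.
have [[dU d0 _] _ _ wF] := wfF.
split=> // gamma tg phi tphi; have [sg _] := tg.
have [B B0 HB] := test_scalar_bounded b tg.
have ag : admissible m U V dV (fun x => gamma (f x)).
  have [h1 h2] := mh _ (smooth_continuous sg).
  by split=> // K _ _; exists B.
have ld l : locally_integrable m U V (fun x => 'd gamma (f x) (F x (e_ l))).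
  have [_ [mlF' iA']] := partial_integrability l wfF.
  have [C [s [C0 HC Hs]]] := test_scalar_covector b tg.
  have E x : 'd gamma (f x) (F x (e_ l)) = \sum_i fco b i (F x (e_ l)) * 'd gamma (f x) (fvec b i).
    exact: linear_frame.
  have iT : locally_integrable m U V (fun x => C * \sum_i `|if `|f x| <= s then fco b i (F x (e_ l)) : R else 0|).
    apply: (locally_integrableZ dV oU vV); apply: locally_integrable_sum => i.
    by apply: locally_integrable_norm; apply: iA'; exact: fco_continuous.
  apply: (locally_integrable_le oU vV _ iT).
    under eq_fun do rewrite E; apply: omeas_sum => i; apply: omeasM.
      by apply: mlF'; exact: fco_continuous.
    by have [] := mh _ (smooth_continuous (smooth_diff (fvec b i) sg)).
  move=> x; rewrite E; apply: (covector_le (fun x => F x (e_ l))) => // sx i; exact: Hs.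
have tt := test_field_vfield k tphi.
have Hb : exists B' : R, forall x, `|gamma (f x)| <= B' by exists B.
have [E1 E2] := weak_derivative_identity d0 tt ag Hb ld.
have Ek : (fun x => vfield phi k x 0 k) = phi.
  by apply/funext => x; rewrite vfield_coord eqxx.
have El l : l != k -> (fun x => vfield phi k x 0 l) = (fun=> 0).
  by move=> lk; apply/funext => x; rewrite vfield_coord (negbTE lk).
have := wF _ gamma tt tg; rewrite E1 E2 (bigD1 k)//= big1 ?addr0 => [|l lk]; last first.
  by rewrite (El l lk) wd_dV0.
rewrite (bigD1 k)//= [X in _ + X]big1 ?addr0 => [|l lk]; last first.
  by rewrite (El l lk) wd_V0 wd_wV0 addr0.
by rewrite Ek.
Qed.

End bridge.

(** * The calculus rules for the chosen derivatives *)

Section main.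
Variables (R : realType) (n m : nat) (U : set 'rV[R]_n).
Variable V : {outer_measure set ('rV[R]_n * subsp R n) -> \bar R}.
Variable dV : {outer_measure set 'rV[R]_n -> \bar R}.
Hypotheses (n_gt0 : (0 < n)%N) (oU : open U) (vV : varifold m U V).
Hypotheses (dVm : matches_variation U V dV) (radon_dV : radon_over U dV).
Variable eta : 'I_n -> 'rV[R]_n -> R.
Hypotheses (meta : forall k, omeas dV (eta k)) (leta : forall k, locally_bounded U (eta k)).
Hypothesis fvar_eta : forall k phi, test_fun U phi ->
  fvar V k phi = oI dV (fun x => phi x * eta k x).
Local Notation wV := (wgt m V).
Let radon_wV : radon_over U wV := radon_wgt oU vV.
Local Notation wpartial k := (weak_partial m U V dV k (eta k)).
Local Notation e_ k := (delta_mx 0 k : 'rV[R]_n).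
Local Notation wVdV := (outer_add wV dV : {outer_measure set 'rV[R]_n -> \bar R}).

Lemma weak_derivative_unique (Y : normedModType R) (b : frame Y) (f : partial_map 'rV[R]_n Y) F F' :
  is_weak_derivative m U V dV f F -> is_weak_derivative m U V dV f F' ->
  oae wV (fun x => forall u, F x u = F' x u).
Proof.
move=> wF wF'.
have wk k : wV [set x | F x (e_ k) <> F' x (e_ k)] = 0%E.
  apply: (weak_partial_unique oU vV b (f := f) (dV := dV) (k := k) (eta := eta k)).
    exact: (partial_of_weak_derivative oU vV dVm radon_dV meta leta fvar_eta b wF k).
  exact: (partial_of_weak_derivative oU vV dVm radon_dV meta leta fvar_eta b wF' k).
apply: null_sub (@null_bigcup _ _ wV (fun j => if insub j is Some k then
    [set x | F x (e_ k) <> F' x (e_ k)] else set0) _); last first.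
  by move=> j; case: (insub j) => [k|]; [exact: wk|exact: outer_measure0].
move=> x /existsNP[u neq]; apply: contrapT => HN; apply: neq.
rewrite (hom_row (F x)) (hom_row (F' x)); apply: eq_bigr => k _; congr (_ *: _).
apply: contrapT => Fk; apply: HN; exists (k : nat) => //; by rewrite valK.
Qed.

(** [VD] is a choice of representative, so each formula is first proved for an explicit derivative
    and then transferred by uniqueness. *)
Lemma VD_ae (Y : normedModType R) (b : frame Y) (f : partial_map 'rV[R]_n Y) F :
  is_weak_derivative m U V dV f F ->
  is_weak_derivative m U V dV f (VD m U V dV f) /\
  oae wV (fun x => forall u, VD m U V dV f x u = F x u).
Proof.
move=> wF.
have wVD : is_weak_derivative m U V dV f (VD m U V dV f).
  exact: (@getPex _ (is_weak_derivative m U V dV f) (ex_intro _ F wF)).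
by split=> //; exact: (weak_derivative_unique b wVD wF).
Qed.

Lemma conull_domain : wVdV (~` U) = 0%E.
Proof. by apply/outer_add_eq0; have [-> _ _ _ _] := radon_wV; have [-> _ _ _ _] := radon_dV. Qed.

Lemma lipschitz_weak_derivatives (I : Type) (g : I -> 'rV[R]_n -> R) :
  (forall i, locally_lipschitz U (g i : _ -> R^o)) ->
  exists G : 'I_n -> I -> 'rV[R]_n -> R, forall k i,
    [/\ omeas wV (G k i), locally_bounded U (G k i) & wd m U V dV k (eta k) (g i) (G k i)].
Proof.
move=> lg.
have H (ki : 'I_n * I) := lipschitz_weak_derivative oU vV radon_dV (meta ki.1) (@leta ki.1) (@fvar_eta ki.1) (lg ki.2).
have [G HG] := choice H; exists (fun k i => G (k, i)) => k i.
exact: (HG (k, i)).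
Qed.

(** The map [T] is the identity for sums and [pinr] for pairs, [f] being replaced by (f, 0) in the
    latter case. The same [G] serves [g] alone and the combination, which makes the two derivatives
    comparable. *)
Lemma weak_partial_add_lipschitz (Y Z : normedModType R) (b : frame Y) (c : frame Z)
    (T : {linear Z -> Y}) (f : 'rV[R]_n -> Y) (F : 'I_n -> 'rV[R]_n -> Y) (g : 'rV[R]_n -> Z) :
    (forall k, wpartial k f (F k)) -> locally_lipschitz U g ->
  exists G : 'I_n -> 'rV[R]_n -> Z, (forall k, wpartial k g (G k)) /\
    forall k, wpartial k (fun x => f x + T (g x)) (fun x => F k x + T (G k x)).
Proof.
move=> wf lg; have [C C0 HC] := fco_le c.
have lgj j : locally_lipschitz U ((fun x => fco c j (g x)) : 'rV[R]_n -> R^o).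
  apply: (locally_lipschitz_le (c := C) (ltW C0) _ lg) => x y.
  by rewrite -linearB; exact: HC.
have [G HG] := lipschitz_weak_derivatives lgj.
exists (fun k x => \sum_j G k j x *: fvec c j); split=> k.
  have := weak_partial_add_sum oU vV radon_dV (meta k) (@leta k) (@fvar_eta k) c
    (index_enum 'I_(frk c)) (fvec c)
    (weak_partial_cst oU vV radon_dV (meta k) (@leta k) (@fvar_eta k) Z) lgj
    (fun j => let: And3 h _ _ := HG k j in h) (fun j => let: And3 _ h _ := HG k j in h)
    (fun j => let: And3 _ _ h := HG k j in h).
  congr (weak_partial _ _ _ _ _ _ _ _); apply/funext => x; rewrite add0r//.
  by rewrite -fcoE.
have := weak_partial_add_sum oU vV radon_dV (meta k) (@leta k) (@fvar_eta k) b
    (index_enum 'I_(frk c)) (fun j => T (fvec c j)) (wf k) lgj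
    (fun j => let: And3 h _ _ := HG k j in h) (fun j => let: And3 _ h _ := HG k j in h)
    (fun j => let: And3 _ _ h := HG k j in h).
congr (weak_partial _ _ _ _ _ _ _ _); apply/funext => x; congr (_ + _).
  by rewrite [in RHS](fcoE c (g x)) linear_sum; apply: eq_bigr => j _; rewrite linearZ.
by rewrite linear_sum; apply: eq_bigr => j _; rewrite linearZ.
Qed.

Lemma weak_derivative_lipschitz (Z : normedModType R) (c : frame Z) (g : 'rV[R]_n -> Z) G :
  (forall k, wpartial k g (G k)) ->
  is_weak_derivative m U V dV (PartialMap U g) (fun x => hom_of (G ^~ x)).
Proof.
move=> wg; apply: (weak_derivative_of_partial n_gt0 oU vV dVm radon_dV meta leta fvar_eta c) => //.
  exact: conull_domain.
move=> k; have := wg k; congr (weak_partial _ _ _ _ _ _ _ _); apply/funext => x.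
by rewrite hom_of_delta.
Qed.

Section one_function.
Variables (Y : normedModType R) (finY : finite_dim Y) (f : partial_map 'rV[R]_n Y).
Hypothesis Tf : weakly_diff m U V dV f.

Let wVD : is_weak_derivative m U V dV f (VD m U V dV f).
Proof. by have [F wF] := Tf; have [b _] := finite_dim_frame finY; have [] := VD_ae b wF. Qed.

Let wf k : wpartial k f (fun x => VD m U V dV f x (e_ k)).
Proof.
have [b _] := finite_dim_frame finY.
exact: (partial_of_weak_derivative oU vV dVm radon_dV meta leta fvar_eta b wVD k).
Qed.

Lemma VD_zero_set : oae wV (fun x => dmn f x -> f x = 0 -> forall u, VD m U V dV f x u = 0).
Proof.
have [b _] := finite_dim_frame finY.
have wk k := weak_partial_zero oU vV radon_dV (meta k) (@leta k) (@fvar_eta k) b (wf k).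
apply: null_sub (@null_bigcup _ _ wV (fun j => if insub j is Some k then
    [set x | f x = 0 /\ VD m U V dV f x (e_ k) <> 0] else set0) _); last first.
  by move=> j; case: (insub j) => [k|]; [exact: wk|exact: outer_measure0].
move=> x /not_implyP[_ /not_implyP[fx /existsNP[u neq]]]; apply: contrapT => HN; apply: neq.
rewrite hom_row big1// => k _; suff -> : VD m U V dV f x (e_ k) = 0 by rewrite scaler0.
by apply: contrapT => Fk; apply: HN; exists (k : nat) => //; rewrite valK.
Qed.

(** The new function keeps the domain of [f], so that nullity of the complement is inherited and the
    directional statements alone determine the derivative. *)
Lemma VD_transfer (Z : normedModType R) (c : frame Z) (h : 'rV[R]_n -> Z) (H : 'I_n -> 'rV[R]_n -> Z) :
  (forall k, wpartial k h (H k)) ->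
  weakly_diff m U V dV (PartialMap (dmn f) h) /\
  oae wV (fun x => forall u, VD m U V dV (PartialMap (dmn f) h) x u = hom_of (H ^~ x) u).
Proof.
move=> wh; have [[dU d0 _] _ _ _] := wVD.
have wH : is_weak_derivative m U V dV (PartialMap (dmn f) h) (fun x => hom_of (H ^~ x)).
  apply: (weak_derivative_of_partial n_gt0 oU vV dVm radon_dV meta leta fvar_eta c) => //.
  move=> k; have := wh k; congr (weak_partial _ _ _ _ _ _ _ _); apply/funext => x.
  by rewrite hom_of_delta.
by split; [exists (fun x => hom_of (H ^~ x))|have [] := VD_ae c wH].
Qed.

Lemma VD_pair (Z : normedModType R) (finZ : finite_dim Z) (g : 'rV[R]_n -> Z) :
  locally_lipschitz U g ->
  weakly_diff m U V dV (PartialMap (dmn f) (fun x => (f x, g x))) /\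
  oae wV (fun x => forall u, VD m U V dV (PartialMap (dmn f) (fun x => (f x, g x))) x u =
    (VD m U V dV f x u, VD m U V dV (PartialMap U g) x u)).
Proof.
move=> lg; have [b _] := finite_dim_frame finY; have [c _] := finite_dim_frame finZ.
have [bc _] := finite_dim_frame (finite_dim_pair finY finZ).
have [G [wg wG]] := weak_partial_add_lipschitz bc c (@pinr R Y Z)
  (fun k => weak_partial_pinl b Z (wf k)) lg.
have [wh ae1] := VD_transfer bc wG.
have [_ ae2] := VD_ae c (weak_derivative_lipschitz c wg).
have hE : (fun x => (f x, g x)) = (fun x => (f x, 0) + @pinr R Y Z (g x)).
  by apply/funext => x; congr (_, _); rewrite /= ?addr0 ?add0r.
rewrite hE; split=> //; apply: null_sub (null_setU ae1 ae2) => x /= HN.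
apply: contrapT => /not_orP[/contrapT H1 /contrapT H2]; apply: HN => u.
by rewrite (H2 u); apply: (etrans (H1 u)); exact: hom_of_pair.
Qed.

Lemma VD_add (g : 'rV[R]_n -> Y) : locally_lipschitz U g ->
  weakly_diff m U V dV (PartialMap (dmn f) (fun x => f x + g x)) /\
  oae wV (fun x => forall u, VD m U V dV (PartialMap (dmn f) (fun x => f x + g x)) x u =
    VD m U V dV f x u + VD m U V dV (PartialMap U g) x u).
Proof.
move=> lg; have [b _] := finite_dim_frame finY.
have [G [wg wG]] := weak_partial_add_lipschitz b b idfun wf lg.
have [wh ae1] := VD_transfer b wG.
have [_ ae2] := VD_ae b (weak_derivative_lipschitz b wg).
split=> //; apply: null_sub (null_setU ae1 ae2) => x /= HN.
apply: contrapT => /not_orP[/contrapT H1 /contrapT H2]; apply: HN => u.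
apply: (etrans (H1 u)); apply: (etrans (hom_of_add (VD m U V dV f x) (G ^~ x) u)).
exact: (congr1 (fun t => VD m U V dV f x u + t) (esym (H2 u))).
Qed.

Lemma VD_scale (g : 'rV[R]_n -> R^o) :
  L1loc_on U wV open (fun y : Y => `|y|) (dmn f) f ->
  L1loc_on U wV (@Hom_open R n Y) (fun A : HomRn n Y => opnorm A) setT (VD m U V dV f) ->
  locally_lipschitz U g ->
  weakly_diff m U V dV (PartialMap (dmn f) (fun x => g x *: f x)) /\
  oae wV (fun x => forall u, VD m U V dV (PartialMap (dmn f) (fun x => g x *: f x)) x u =
    VD m U V dV (PartialMap U g) x u *: f x + g x *: VD m U V dV f x u).
Proof.
move=> [d0 mf if_] [_ mF iF] lg; have [b _] := finite_dim_frame finY.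
(* The derivative of the factor [g] is taken in T(V, R), so R needs a frame as well. *)
have finR : finite_dim R^o.
  by exists 1%N, (fun=> 1) => y; exists (fun=> y); rewrite big_ord1 /GRing.scale/= mulr1.
have [c _] := finite_dim_frame finR.
have [G HG] := @lipschitz_weak_derivatives unit (fun=> g) (fun=> lg).
have [C C0 HC] := fco_le b.
have [mwf _ _ _] := wf (Ordinal n_gt0).
have mfc i : omeas wV (fun x => fco b i (f x) : R).
  by have [] := mwf _ (@fco_continuous _ _ b i).
have lf i : locally_integrable m U V (fun x => fco b i (f x)).
  split=> // K cK KU; have mK := cpt_caratheodory radon_wV cK.
  have mn : omeas wV (fun x => `|f x|) by have [] := mwf _ (@norm_continuous _ Y).
  have mKd : wV.-caratheodory (K `&` dmn f).
    by apply: caratheodory_measurable_setI => //; rewrite -(setCK (dmn f));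
      apply: caratheodory_measurable_setC; exact: null_caratheodory.
  have /(oint_restrict mKd mn (fun x => normr_ge0 (f x))) io := if_ K cK KU.
  apply: (@ointeg_null _ _ wV (fun x => \1_(K `&` dmn f) x * (fco b i (f x) : R)) _ (~` dmn f)) => //.
    move=> x /contrapT dx; rewrite !indicE; congr (_%:R * _); congr nat_of_bool.
    by apply/idP/idP; rewrite !inE => // -[].
  apply: (le_ointeg _ (ointegZ C io)); first by apply: omeasM => //; exact: omeas_indic.
  move=> x; rewrite normrM mulrCA indicE ger0_norm//; apply: ler_wpM2l => //; exact: HC.
have lF k i : locally_integrable m U V (fun x => fco b i (VD m U V dV f x (e_ k))).
  have mc : omeas wV (fun x => fco b i (VD m U V dV f x (e_ k)) : R).
    exact: ((hom_measurableP wV b _).1 mF k i).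
  split=> // K cK KU; have mK := cpt_caratheodory radon_wV cK.
  have := iF K cK KU; rewrite setIT.
  move=> /(oint_restrict mK (opnorm_omeas mF) (fun x => opnorm_ge0 _)) io.
  apply: (le_ointeg _ (ointegZ C io)); first by apply: omeasM => //; exact: omeas_indic.
  move=> x; rewrite normrM mulrCA indicE ger0_norm//; apply: ler_wpM2l => //.
  apply: (le_trans (HC i _)); apply: ler_wpM2l; first exact: ltW.
  by apply: le_opnorm; rewrite enorm_delta.
have wG k := weak_partial_scale oU vV radon_dV (meta k) (@leta k) (@fvar_eta k) (wf k) lf (lF k) lg
  (let: And3 h _ _ := HG k tt in h) (let: And3 _ h _ := HG k tt in h) (let: And3 _ _ h := HG k tt in h).
(* Here [g] is regarded as 0 + g 1, so that [weak_partial_add] upgrades the scalar identity for [g]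
   to the full directional statement with values in R. *)
have wg k : wpartial k g (G k tt).
  have := weak_partial_add oU vV radon_dV (meta k) (@leta k) (@fvar_eta k) c (1 : R^o)
    (weak_partial_cst oU vV radon_dV (meta k) (@leta k) (@fvar_eta k) R^o) lg
    (let: And3 h _ _ := HG k tt in h) (let: And3 _ h _ := HG k tt in h) (let: And3 _ _ h := HG k tt in h).
  by congr (weak_partial _ _ _ _ _ _ _ _); apply/funext => x; rewrite add0r /GRing.scale/= mulr1.
have [wh ae1] := VD_transfer b wG.
have [_ ae2] := VD_ae c (weak_derivative_lipschitz c wg).
split=> //; apply: null_sub (null_setU ae1 ae2) => x /= HN.
apply: contrapT => /not_orP[/contrapT H1 /contrapT H2]; apply: HN => u.
by rewrite (H2 u); apply: (etrans (H1 u)); exact: hom_of_scale.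
Qed.

End one_function.

End main.

Theorem mainTheorem16 (R : realType) (m n : nat) (m_gt0 : (0 < m)%N)
  (n_gt0 : (0 < n)%N) (le_mn : (m <= n)%N)
  (U : set 'rV[R]_n) (openU : open U)
  (V : {outer_measure set ('rV[R]_n * subsp R n) -> \bar R})
  (rectV : rectifiable_varifold m U V)
  (dV : {outer_measure set 'rV[R]_n -> \bar R})
  (dVE : is_variation_measure U V dV)
  (radon_dV : radon_over U dV)
  (Y : normedModType R) (finY : finite_dim Y)
  (f : partial_map 'rV[R]_n Y) (Tf : weakly_diff m U V dV f) :
  [/\
      oae (weight_measure m V) (fun x => dmn f x -> f x = 0 ->
        forall u, VD m U V dV f x u = 0),
      forall (Z : normedModType R), finite_dim Z ->
      forall g : 'rV[R]_n -> Z, locally_lipschitz U g ->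
      let h := PartialMap (dmn f) (fun x => (f x, g x)) in
      weakly_diff m U V dV h /\
      oae (weight_measure m V) (fun x => forall u,
        VD m U V dV h x u =
        (VD m U V dV f x u, VD m U V dV (PartialMap U g) x u)),
      forall g : 'rV[R]_n -> Y, locally_lipschitz U g ->
      let h := PartialMap (dmn f) (fun x => f x + g x) in
      weakly_diff m U V dV h /\
      oae (weight_measure m V) (fun x => forall u,
        VD m U V dV h x u =
        VD m U V dV f x u + VD m U V dV (PartialMap U g) x u)
    &
      L1loc_on U (weight_measure m V) open (fun y : Y => `|y|) (dmn f) f ->
      L1loc_on U (weight_measure m V) (@Hom_open R n Y)
        (fun A : HomRn n Y => opnorm A) setT (VD m U V dV f) ->
      forall g : 'rV[R]_n -> R^o, locally_lipschitz U g ->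
      let h := PartialMap (dmn f) (fun x => g x *: f x) in
      weakly_diff m U V dV h /\
      oae (weight_measure m V) (fun x => forall u,
        VD m U V dV h x u =
        VD m U V dV (PartialMap U g) x u *: f x + g x *: VD m U V dV f x u) ].
Proof.
have [vV _] := rectV; have [dVm _] := dVE.
have [eta Heta] := choice (variation_density openU vV dVm radon_dV).
have meta k : omeas dV (eta k) by have [] := Heta k.
have leta k : locally_bounded U (eta k) by have [] := Heta k.
have fvar_eta k phi : test_fun U phi -> fvar V k phi = oI dV (fun x => phi x * eta k x).
  by have [_ _] := Heta k; exact.
split.
- exact: (VD_zero_set openU vV dVm radon_dV meta leta fvar_eta finY Tf).
- move=> Z finZ g lg.
  exact: (VD_pair n_gt0 openU vV dVm radon_dV meta leta fvar_eta finY Tf finZ lg).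
- move=> g lg.
  exact: (VD_add n_gt0 openU vV dVm radon_dV meta leta fvar_eta finY Tf lg).
- move=> If IF g lg.
  exact: (VD_scale n_gt0 openU vV dVm radon_dV meta leta fvar_eta finY Tf If IF lg).
Qed.
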